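(* Let $p\in(1,\infty)$ and let $Q\subset\mathbb{R}^d$ be open. Let $(u_{\varepsilon})$ be a bounded sequence in $L^p(\Omega)\otimes W^{1,p}(Q)$. Then there exist $u\in L^p_{\mathsf{inv}}(\Omega)\otimes W^{1,p}(Q)$ and $\chi\in L^p_{\mathsf{pot}}(\Omega)\otimes L^p(Q)$ such that, up to a subsequence, $$u_{\varepsilon}\overset{2s}{\rightharpoonup}u\ \text{ in }L^p(\Omega\times Q),\qquad \nabla u_{\varepsilon}\overset{2s}{\rightharpoonup}\nabla u+\chi\ \text{ in }L^p(\Omega\times Q)^d .$$ If, additionally, $\langle\cdot\rangle$ is ergodic, then $u=P_{\mathsf{inv}}u=\langle u\rangle\in W^{1,p}(Q)$ and (along the subsequence) $\langle u_{\varepsilon}\rangle\rightharpoonup u$ weakly in $W^{1,p}(Q)$.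
   Context: Standing assumption: $(\Omega,\mathcal{F},P)$ is a probability space with countably generated $\sigma$-algebra, and $\tau=\{\tau_x\}_{x\in\mathbb{R}^d}$ is a group of measurable bijections of $\Omega$ with $\tau_0=\mathrm{Id}$, $\tau_{x+y}=\tau_x\circ\tau_y$, $P(\tau_xA)=P(A)$ for $A\in\mathcal{F}$, and $(\omega,x)\mapsto\tau_x\omega$ is $\mathcal{F}\otimes\mathcal{L}$-measurable ($\mathcal{L}$ the Lebesgue $\sigma$-algebra on $\mathbb{R}^d$). $\langle\cdot\rangle:=\int_\Omega\cdot\,dP$. $\langle\cdot\rangle$ is called ergodic if every $A\in\mathcal{F}$ with $\tau_xA=A$ for all $x\in\mathbb{R}^d$ satisfies $P(A)\in\{0,1\}$. Tensor spaces: for closed subspaces $X\subset L^p(\Omega)$ (or of $L^p(\Omega)^d$) and $Y\subset L^p(Q)$ (resp. $Y\subset W^{1,p}(Q)$), $X\otimes Y$ is the closure of the algebraic tensor product in $L^p(\Omega;L^p(Q))$ (resp. $L^p(\Omega;W^{1,p}(Q))$), with vector values where appropriate; $L^p(\Omega)\otimes L^p(Q)=L^p(\Omega\times Q)$. $\nabla$ is the gradient in $x\in Q$. Unfolding: for $\varepsilon>0$, $\mathcal{T}_\varepsilon:L^p(\Omega\times Q)\to L^p(\Omega\times Q)$ is the unique linear isometric isomorphism with $(\mathcal{T}_\varepsilon u)(\omega,x)=u(\tau_{-x/\varepsilon}\omega,x)$ a.e. for $u$ in the algebraic tensor product of $L^p(\Omega)$ and $L^p(Q)$ (applied componentwise to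 vector fields). $u_\varepsilon\overset{2s}{\rightharpoonup}u$ means $\mathcal{T}_\varepsilon u_\varepsilon\rightharpoonup u$ weakly in $L^p(\Omega\times Q)$ as $\varepsilon\to0$. Horizontal derivatives: $U_x\varphi(\omega)=\varphi(\tau_x\omega)$ on $L^p(\Omega)$; $D_i$ is the infinitesimal generator of $\{U_{he_i}\}_{h\in\mathbb{R}}$, i.e. $D_i\varphi=\lim_{h\to0}(U_{he_i}\varphi-\varphi)/h$ in $L^p(\Omega)$ with domain $\mathcal{D}_i$; $W^{1,p}(\Omega)=\bigcap_{i=1}^d\mathcal{D}_i$, $D\varphi=(D_1\varphi,\dots,D_d\varphi)$; $L^p_{\mathsf{pot}}(\Omega)$ is the closure in $L^p(\Omega)^d$ of $\{D\varphi:\varphi\in W^{1,p}(\Omega)\}$. $L^p_{\mathsf{inv}}(\Omega)=\{\varphi\in L^p(\Omega):U_x\varphi=\varphi\ \forall x\in\mathbb{R}^d\}$, and $P_{\mathsf{inv}}:L^p(\Omega)\to L^p_{\mathsf{inv}}(\Omega)$ is the conditional expectation with respect to $\{A\in\mathcal{F}:\tau_xA=A\ \forall x\in\mathbb{R}^d\}$ (acting in the variable $\omega$). *)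

(* Defs.v *)
From HB Require Import structures.
From mathcomp Require Import all_boot all_order all_algebra.
From mathcomp Require Import all_classical all_reals all_analysis.

Set Implicit Arguments.
Unset Strict Implicit.
Unset Printing Implicit Defensive.

Import Order.TTheory GRing.Theory Num.Theory.
Import numFieldNormedType.Exports.

Local Open Scope classical_set_scope.
Local Open Scope ring_scope.

(* Type alias: R^d carries the Borel sigma-algebra here, the Lebesgue one in
   euclid below. *)
Definition borel_rV (R : realType) (d : nat) : Type := 'rV[R]_d.

Definition borel_rV_display : measure_display.
Proof. exact: default_measure_display. Qed.

Section borel_rV.
Variables (R : realType) (d : nat).

HB.instance Definition _ := Pointed.copy (borel_rV R d) 'rV[R]_d.

Definition rV_coord (i : 'I_d) (x : borel_rV R d) : measurableTypeR R :=
  (x : 'rV[R]_d) ord0 i.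

Let borel0 : g_sigma_preimage rV_coord set0.
Proof. exact: sigma_algebra0. Qed.

Let borelC A : g_sigma_preimage rV_coord A -> g_sigma_preimage rV_coord (~` A).
Proof. exact: sigma_algebraC. Qed.

Let borel_bigcup (F : _^nat) : (forall i, g_sigma_preimage rV_coord (F i)) ->
  g_sigma_preimage rV_coord (\bigcup_i (F i)).
Proof. exact: sigma_algebra_bigcup. Qed.

HB.instance Definition _ := @isMeasurable.Build borel_rV_display
  (borel_rV R d) (g_sigma_preimage rV_coord) borel0 borelC borel_bigcup.

Lemma measurable_rV_coord i : measurable_fun setT (rV_coord i).
Proof.
move=> _ B mB; rewrite setTI; apply: sub_sigma_algebra => /=.
rewrite -bigcup_seq/=; exists i => /=; first by rewrite mem_index_enum.
by exists B => //; rewrite setTI.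
Qed.

Lemma measurable_fun_rV d' (T : measurableType d') (f : T -> borel_rV R d) :
  (forall i, measurable_fun setT (rV_coord i \o f)) -> measurable_fun setT f.
Proof.
move=> mf; apply: (@measurability _ _ _ _ _ _
  (\big[setU/set0]_(i < d) preimage_set_system setT (rV_coord i) measurable)) => //.
move=> _ [B + <-]; rewrite -bigcup_seq/= => -[i _ [C mC <-]].
by rewrite !setTI; have := mf i measurableT _ mC; rewrite setTI.
Qed.

End borel_rV.

Definition rV_cons (R : realType) (d : nat) (z : measurableTypeR R * borel_rV R d) :
  borel_rV R d.+1 := row_mx (const_mx z.1 : 'rV[R]_1) (z.2 : 'rV[R]_d).

Lemma rV_cons0 (R : realType) d z : rV_coord ord0 (@rV_cons R d z) = z.1.
Proof. by rewrite /rV_coord !mxE; case: splitP => // j _; rewrite mxE. Qed.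

Lemma rV_consS (R : realType) d z i :
  rV_coord (lift ord0 i) (@rV_cons R d z) = rV_coord i z.2.
Proof.
rewrite /rV_coord !mxE; case: splitP => [[[]]//|j].
by rewrite lift0 => -[/val_inj ->].
Qed.

Lemma measurable_rV_cons (R : realType) d : measurable_fun setT (@rV_cons R d).
Proof.
apply: measurable_fun_rV => i; case: (unliftP ord0 i) => [j|] ->.
  rewrite (_ : _ \o _ = rV_coord j \o snd).
    by apply: measurableT_comp => //; exact: measurable_rV_coord.
  by apply/funext => z /=; rewrite rV_consS.
rewrite (_ : _ \o _ = fst); first exact: measurable_fst.
by apply/funext => z /=; rewrite rV_cons0.
Qed.

Fixpoint borel_lebesgue (R : realType) (d : nat) : set (borel_rV R d) -> \bar R :=
  match d with
  | 0 => \d_((0 : 'rV[R]_0) : borel_rV R 0)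
  | n.+1 => pushforward (@lebesgue_measure R \x @borel_lebesgue R n)%E
              (@rV_cons R n)
  end.

Section borel_lebesgue_measure.
Variable R : realType.

Let rV_uncons (d : nat) (x : borel_rV R d.+1) :
    measurableTypeR R * borel_rV R d :=
  (rV_coord ord0 x, \row_(i < d) rV_coord (lift ord0 i) x).

Let rV_consK d : cancel (@rV_cons R d) (@rV_uncons d).
Proof.
move=> [t y]; rewrite /rV_uncons rV_cons0; congr pair.
by apply/rowP => i; rewrite mxE rV_consS.
Qed.

Let rV_unconsK d : cancel (@rV_uncons d) (@rV_cons R d).
Proof.
move=> x; apply/rowP => i.
rewrite -[LHS]/(rV_coord i _) -[RHS]/(rV_coord i x).
by case: (unliftP ord0 i) => [j|] ->; rewrite ?rV_cons0// rV_consS/=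
  {1}/rV_coord mxE.
Qed.

Let measurable_rV_uncons d : measurable_fun setT (@rV_uncons d).
Proof.
apply/measurable_fun_pairP; split; first exact: measurable_rV_coord.
apply: measurable_fun_rV => i.
rewrite (_ : _ \o _ = rV_coord (lift ord0 i)); first exact: measurable_rV_coord.
by apply/funext => x; rewrite /= {1}/rV_coord mxE.
Qed.

Lemma borel_lebesgue_spec d :
  exists mu : {sigma_finite_measure set (borel_rV R d) -> \bar R},
    @borel_lebesgue R d = mu.
Proof.
elim: d => [|d [mu muE]]/=; first by exists \d_((0 : 'rV[R]_0) : borel_rV R 0).
rewrite muE.
pose nu : {measure set (borel_rV R d.+1) -> \bar R} :=
  measure_function_pushforward__canonical__measure_function_Measure
    (@lebesgue_measure R \x mu)%E (@measurable_rV_cons R d).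
have nufin : sigma_finite setT nu.
  have [F FT mF] : sigma_finite setT (@lebesgue_measure R \x mu)%E.
    have /sigma_finiteP[F [TF ndF Foo]] := sigma_finiteT (@lebesgue_measure R).
    have /sigma_finiteP[G [TG ndG Goo]] := sigma_finiteT mu.
    exists (fun n => F n `*` G n) => [|k].
      rewrite -setXTT TF TG predeqE => -[x y]; split => [[/= [n _ Fn] [k _ Gk]]|].
        exists (maxn n k) => //; split.
        - by move: x Fn; exact/subsetPset/ndF/leq_maxl.
        - by move: y Gk; exact/subsetPset/ndG/leq_maxr.
      by move=> [n _ []/= ? ?]; split; exists n.
    have [? ?] := Foo k; have [? ?] := Goo k.
    split; first exact: measurableX.
    by rewrite product_measure1E// lte_mul_pinfty// ge0_fin_numE.
  exists (fun k => @rV_uncons d @^-1` F k) => [|k].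
    by rewrite -preimage_bigcup -FT preimage_setT.
  split.
    by rewrite -[X in measurable X]setTI; apply: measurable_rV_uncons => //;
      exact: (mF k).1.
  rewrite /nu/= /pushforward -comp_preimage.
  rewrite (_ : _ \o _ = id); first exact: (mF k).2.
  by apply/funext => z /=; rewrite rV_consK.
pose B := @Measure_isSigmaFinite.Build _ _ _ nu nufin.
pose nu' : {sigma_finite_measure set (borel_rV R d.+1) -> \bar R} :=
  HB.pack (nu : set _ -> \bar R) (Measure.class nu) B.
by exists nu'.
Qed.

Variable d : nat.
Let mu : {sigma_finite_measure set (borel_rV R d) -> \bar R} :=
  projT1 (cid (borel_lebesgue_spec d)).
Let muE : @borel_lebesgue R d = mu := projT2 (cid (borel_lebesgue_spec d)).

Let bl0 : @borel_lebesgue R d set0 = 0%E.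
Proof. by rewrite muE measure0. Qed.

Let bl_ge0 A : (0 <= @borel_lebesgue R d A)%E.
Proof. by rewrite muE measure_ge0. Qed.

Let bl_sigma_additive : semi_sigma_additive (@borel_lebesgue R d).
Proof. by rewrite muE; exact: measure_semi_sigma_additive. Qed.

HB.instance Definition _ := isMeasure.Build _ _ _ (@borel_lebesgue R d)
  bl0 bl_ge0 bl_sigma_additive.

Let bl_sigma_finite : sigma_finite setT (@borel_lebesgue R d).
Proof. by rewrite muE; exact: sigma_finiteT. Qed.

HB.instance Definition _ := @Measure_isSigmaFinite.Build _ _ _
  (@borel_lebesgue R d) bl_sigma_finite.

End borel_lebesgue_measure.

(* R^d as a normed space, with the Lebesgue sigma-algebra, i.e., the completion
   of the Borel sigma-algebra, as its measurable sets *)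
Definition euclid (R : realType) (d : nat) : Type := 'rV[R]_d.

HB.instance Definition _ (R : realType) (d : nat) :=
  NormedModule.copy (euclid R d) 'rV[R]_d.
HB.instance Definition _ (R : realType) (d : nat) :=
  Pointed.copy (euclid R d) 'rV[R]_d.
HB.instance Definition _ (R : realType) (d : nat) :=
  Measurable.copy (euclid R d)
    (caratheodory_type (mu_ext (@borel_lebesgue R d))).

Definition lebesgue_rV (R : realType) (d : nat) : set (euclid R d) -> \bar R :=
  @completed_measure_extension _ (borel_rV R d) R (@borel_lebesgue R d).

HB.instance Definition _ (R : realType) (d : nat) :=
  Measure.on (@lebesgue_rV R d).
HB.instance Definition _ (R : realType) (d : nat) :=
  @Measure_isSigmaFinite.Build _ _ _ (@lebesgue_rV R d)
    (completed_measure_extension_sigma_finite (@sigma_finiteT _ _ _ _)).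

Lemma open_measurable_euclid (R : realType) (d : nat) (Q : set (euclid R d)) :
  open Q -> measurable Q.
Proof.
move=> oQ.
pose box (c : 'rV[rat]_d * nat) : set (borel_rV R d) :=
  [set y | forall i, `|rV_coord i y - ratr (c.1 ord0 i)| < c.2.+1%:R^-1].
have mbox c : measurable (box c).
  rewrite (_ : box c = \big[setI/setT]_(i < d) (rV_coord i @^-1`
      [set t | `|t - ratr (c.1 ord0 i)| < c.2.+1%:R^-1])).
    apply: bigsetI_measurable => i _; rewrite -[X in measurable X]setTI.
    apply: measurable_rV_coord => //.
    rewrite (_ : mkset _ = ball (ratr (c.1 ord0 i) : R) (c.2.+1%:R^-1)).
      exact: measurable_realfun.measurable_ball.
    by apply/seteqP; split => t; rewrite /ball/= distrC.
  apply/seteqP; split => [y yc|y].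
    by rewrite -bigcap_seq => i _; exact: yc.
  by rewrite -bigcap_seq => yc i; apply: (yc i); rewrite /= mem_index_enum.
have QE : Q = \bigcup_(c in [set c | box c `<=` (Q : set 'rV[R]_d)]) box c.
  apply/seteqP; split => [x Qx|x [c cQ cx]]; last exact: cQ.
  have /nbhs_ballP[e /= e0 xeQ] : nbhs x Q by exact: open_nbhs_nbhs.
  have [n ne] : exists n, n.+1%:R^-1 < e / 2.
    have e20 : 0 < e / 2 by rewrite divr_gt0.
    by have [n] := ltr_add_invr e20; rewrite add0r => ne; exists n.
  have /choice[q qx] (i : 'I_d) : exists q : rat,
      `|rV_coord i x - ratr q| < n.+1%:R^-1.
    have [||t [tx [r _ rt]]] := @dense_rat R (ball (rV_coord i x : R) n.+1%:R^-1).
    - by exists (rV_coord i x); apply: ballxx; rewrite invr_gt0.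
    - exact: ball_open.
    - by exists r; rewrite rt.
  exists (\row_i q i, n) => [y yq|i/=]; last by rewrite mxE.
  apply: xeQ; split => // i j; rewrite (ord1 i) /ball/=.
  rewrite (le_lt_trans (ler_distD (ratr (q j)) _ _))// [ltRHS]splitr ltrD//.
    by rewrite (lt_trans _ ne)//; exact: qx.
  by rewrite (lt_trans _ ne)// distrC; have := yq j; rewrite /= mxE.
rewrite QE bigcup_mkcond; apply: countable_bigcupT_measurable => [|c].
  exact: countableP.
case: ifP => // _; apply: caratheodory_measurable_mu_ext; exact: mbox.
Qed.


(* Lebesgue measure on an open set Q. A function on Q is represented by a
   function on R^d, whose values outside Q are irrelevant. *)
Definition lebesgue_on (R : realType) (d : nat) (Q : set (euclid R d))
    (oQ : open Q) : set (euclid R d) -> \bar R :=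
  mrestr (@lebesgue_rV R d) (open_measurable_euclid oQ).

Section lebesgue_on.
Variables (R : realType) (d : nat) (Q : set (euclid R d)) (oQ : open Q).

HB.instance Definition _ := Measure.on (lebesgue_on oQ).

Let lebesgue_on_sigma_finite : sigma_finite setT (lebesgue_on oQ).
Proof.
have [F FT mF] := sigma_finiteT (@lebesgue_rV R d).
exists F => // k; split; first exact: (mF k).1.
apply: le_lt_trans (mF k).2; rewrite /lebesgue_on /mrestr/=.
have mQ := open_measurable_euclid oQ.
by apply: le_measure => //; rewrite inE; [apply: measurableI|]; move: (mF k).1.
Qed.

HB.instance Definition _ := @Measure_isSigmaFinite.Build _ _ _
  (lebesgue_on oQ) lebesgue_on_sigma_finite.

End lebesgue_on.

Section function_spaces.
Context {R : realType}.

(* The elements of L^p(mu) are represented by functions, not by classes of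
   functions modulo a.e. equality. *)
Definition Lp d (T : measurableType d) (mu : {measure set T -> \bar R}) (p : R) :
    set (T -> R) :=
  [set f | f \in Lfun mu p%:E].

Definition Lp_norm d (T : measurableType d) (mu : {measure set T -> \bar R})
    (p : R) (f : T -> R) : \bar R :=
  'N[mu]_p%:E[EFin \o f]%E.

Definition LpV d (T : measurableType d) (mu : {measure set T -> \bar R}) (p : R)
    n : set ('I_n -> T -> R) :=
  [set F | forall i, Lp mu p (F i)].

(* equivalent to every other product norm on L^p(mu)^n *)
Definition LpV_norm d (T : measurableType d) (mu : {measure set T -> \bar R})
    (p : R) n (F : 'I_n -> T -> R) : \bar R :=
  (\sum_(i < n) Lp_norm mu p (F i))%E.

(* In norm_closure and weak_cvg, E is a space of functions with seminorm N;
   functions at distance 0 represent the same element. *)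

Definition norm_closure (V : lmodType R) (E : set V) (N : V -> \bar R)
    (A : set V) : set V :=
  [set f | E f /\ forall e : R, 0 < e -> exists2 g, A g & (N (f - g)%R < e%:E)%E].

Definition weak_cvg (V : lmodType R) (E : set V) (N : V -> \bar R)
    (u_ : nat -> V) (u : V) : Prop :=
  [/\ forall n, E (u_ n),
      E u &
      forall l : V -> R,
        (forall (a : R) f g, E f -> E g -> l (a *: f + g) = a * l f + l g) ->
        (exists C : R, forall f, E f -> (`|l f|%:E <= C%:E * N f)%E) ->
        (l \o u_) n @[n --> \oo] --> l u].

Definition tensor_alg (S T : Type) (X : set (S -> R)) (Y : set (T -> R)) :
    set (S * T -> R) :=
  [set t | exists n (f : 'I_n -> S -> R) (g : 'I_n -> T -> R),
    [/\ forall k, X (f k), forall k, Y (g k) &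
        t = (fun z => \sum_(k < n) f k z.1 * g k z.2)]].

Definition tensor_algV (S T : Type) m (X : set ('I_m -> S -> R))
    (Y : set (T -> R)) : set ('I_m -> S * T -> R) :=
  [set t | exists n (F : 'I_n -> 'I_m -> S -> R) (g : 'I_n -> T -> R),
    [/\ forall k, X (F k), forall k, Y (g k) &
        t = (fun i z => \sum_(k < n) F k i z.1 * g k z.2)]].

End function_spaces.

Section sobolev.
Context {R : realType} {d : nat}.
Implicit Types phi : euclid R d -> R.

Definition basis_vec (i : 'I_d) : euclid R d := delta_mx ord0 i.

Definition partial (i : 'I_d) phi : euclid R d -> R :=
  fun x => 'D_(basis_vec i) phi x.

Definition smooth phi : Prop :=
  forall s : seq 'I_d, let psi := foldr partial phi s in
    continuous psi /\ forall i x, derivable psi x (basis_vec i).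

Definition test_function (Q : set (euclid R d)) phi : Prop :=
  smooth phi /\
  exists K : set (euclid R d),
    [/\ compact K, K `<=` Q & forall x, ~ K x -> phi x = 0].

Variables (Q : set (euclid R d)) (oQ : open Q) (p : R).
Local Notation leb := (lebesgue_on oQ).

Definition weak_gradient (v : euclid R d -> R) (g : 'I_d -> euclid R d -> R) :
    Prop :=
  [/\ Lp leb p v, LpV leb p g &
      forall phi, test_function Q phi -> forall i,
        \int[leb]_x (v x * partial i phi x) = - \int[leb]_x (g i x * phi x)].

Definition W1p : set (euclid R d -> R) :=
  [set v | exists g, weak_gradient v g].

(* the weak gradient is unique up to a.e. equality; likewise for nabla *)
Definition grad (v : euclid R d -> R) : 'I_d -> euclid R d -> R :=
  xget (fun _ _ => 0) [set g | weak_gradient v g].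

Definition W1p_norm (v : euclid R d -> R) : \bar R :=
  (Lp_norm leb p v + LpV_norm leb p (grad v))%E.

Context {dO : measure_display} {Omega : measurableType dO}.
Variable P : probability Omega R.
Local Notation mu := (P \x leb)%E.

Definition weak_gradient_Q (u : Omega * euclid R d -> R)
    (G : 'I_d -> Omega * euclid R d -> R) : Prop :=
  [/\ Lp mu p u, LpV mu p G &
      {ae P, forall w, weak_gradient (fun x => u (w, x))
                                     (fun i x => G i (w, x))}].

(* L^p(Omega; W^{1,p}(Q)): Bochner measurability amounts to the joint
   measurability of u and of its gradient, W^{1,p}(Q) being separable. *)
Definition LpW1p : set (Omega * euclid R d -> R) :=
  [set u | exists G, weak_gradient_Q u G].

Definition nabla (u : Omega * euclid R d -> R) :
    'I_d -> Omega * euclid R d -> R :=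
  xget (fun _ _ => 0) [set G | weak_gradient_Q u G].

(* By Fubini, this is equivalent to the norm
   u |-> ( \int_Omega |u(w, .)|_{W^{1,p}(Q)}^p dP(w) )^{1/p} *)
Definition LpW1p_norm (u : Omega * euclid R d -> R) : \bar R :=
  (Lp_norm mu p u + LpV_norm mu p (nabla u))%E.

(* X (x) W^{1,p}(Q) for X a subspace of L^p(Omega) *)
Definition tensor_W1p (X : set (Omega -> R)) : set (Omega * euclid R d -> R) :=
  norm_closure LpW1p LpW1p_norm (tensor_alg X W1p).

(* X (x) L^p(Q) for X a subspace of L^p(Omega)^d *)
Definition tensor_LpV (X : set ('I_d -> Omega -> R)) :
    set ('I_d -> Omega * euclid R d -> R) :=
  norm_closure (@LpV _ _ _ mu p d) (@LpV_norm _ _ _ mu p d)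
    (tensor_algV X (Lp leb p)).

End sobolev.

Definition countably_generated d (T : measurableType d) : Prop :=
  exists2 G : set (set T), countable G & @measurable d T = <<s G >>.

Record dynamical_system (R : realType) (d : nat) dO (Omega : measurableType dO)
    (P : probability Omega R) (tau : euclid R d -> Omega -> Omega) : Prop := {
  flow0 : tau 0 = id ;
  flowD : forall x y, tau (x + y) = tau x \o tau y ;
  flow_bij : forall x, bijective (tau x) ;
  flow_measurable : forall x, measurable_fun setT (tau x) ;
  flow_preserving : forall x A, measurable A -> P (tau x @` A) = P A ;
  flow_jointly_measurable :
    measurable_fun setT (fun z : Omega * euclid R d => tau z.2 z.1) }.

Section stochastic.
Context {R : realType} {d : nat} {dO : measure_display}
  {Omega : measurableType dO}.
Variables (P : probability Omega R) (tau : euclid R d -> Omega -> Omega) (p : R).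

Definition invariant_set : set (set Omega) :=
  [set A | measurable A /\ forall x, tau x @` A = A].

Definition ergodic : Prop :=
  forall A, invariant_set A -> P A = 0%E \/ P A = 1%E.

Definition Linv : set (Omega -> R) :=
  [set f | Lp P p f /\ forall x, (f \o tau x) = f %[ae P]].

(* g = D_i f, for D_i the infinitesimal generator of (U_{h e_i})_h *)
Definition is_generator (i : 'I_d) (f g : Omega -> R) : Prop :=
  [/\ Lp P p f, Lp P p g &
      Lp_norm P p (h^-1 *: (f \o tau (h *: basis_vec i) - f) - g)
        @[h --> 0^'] --> 0%E].

(* { D f : f in W^{1,p}(Omega) } *)
Definition horizontal_gradients : set ('I_d -> Omega -> R) :=
  [set F | exists f, forall i, is_generator i f (F i)].

Definition Lpot : set ('I_d -> Omega -> R) :=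
  norm_closure (@LpV _ _ _ P p d) (@LpV_norm _ _ _ P p d) horizontal_gradients.

(* g is (a version of) the conditional expectation of f with respect to the
   sigma-algebra of invariant sets *)
Definition is_cond_exp_inv (f g : Omega -> R) : Prop :=
  [/\ Lp P p g,
      exists2 g', (forall B : set (measurableTypeR R), measurable B ->
                     invariant_set (g' @^-1` B)) & g = g' %[ae P] &
      forall A, invariant_set A ->
        \int[P]_(w in A) g w = \int[P]_(w in A) f w].

Variables (Q : set (euclid R d)) (oQ : open Q).
Local Notation leb := (lebesgue_on oQ).
Local Notation mu := (P \x leb)%E.
Local Notation field := (Omega * euclid R d -> R).

(* P_inv on L^p(Omega x Q), acting in the variable w *)
Definition is_Pinv (u v : field) : Prop :=
  Lp mu p v /\
  {ae leb, forall x, is_cond_exp_inv (fun w => u (w, x)) (fun w => v (w, x))}.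

Definition Pinv (u : field) : field := xget (fun=> 0) [set v | is_Pinv u v].

Definition mean (u : field) : euclid R d -> R := fun x => \int[P]_w u (w, x).

(* T is a linear isometric isomorphism of L^p(Omega x Q), given on the
   algebraic tensor product of L^p(Omega) and L^p(Q) by the shift *)
Definition is_unfolding (eps : R) (T : field -> field) : Prop :=
  [/\ [/\ forall u, Lp mu p u -> Lp mu p (T u),
          forall (a : R) u v, Lp mu p u -> Lp mu p v ->
            T (a *: u + v) = (a *: T u + T v) %[ae mu],
          forall u, Lp mu p u -> Lp_norm mu p (T u) = Lp_norm mu p u &
          forall v, Lp mu p v -> exists2 u, Lp mu p u & T u = v %[ae mu]] &
      forall u, tensor_alg (Lp P p) (Lp leb p) u ->
        T u = (fun z => u (tau (- (eps^-1 *: z.2)) z.1, z.2)) %[ae mu]].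

Definition unfolding (eps : R) : field -> field :=
  xget (fun u : field => u) [set T | is_unfolding eps T].

Definition two_scale_cvg (eps_ : nat -> R) (u_ : nat -> field) (u : field) :=
  weak_cvg (Lp mu p) (Lp_norm mu p) (fun n => unfolding (eps_ n) (u_ n)) u.

Definition two_scale_cvgV (eps_ : nat -> R) (u_ : nat -> 'I_d -> field)
    (u : 'I_d -> field) :=
  weak_cvg (@LpV _ _ _ mu p d) (@LpV_norm _ _ _ mu p d)
    (fun n i => unfolding (eps_ n) (u_ n i)) u.

End stochastic.

(* Main.v *)
(* Write S_eps for the unfolding; up to a.e. equality, S_eps F (w, x) =
   F (tau_{-x/eps} w, x). By weak compactness, S_eps u_eps and S_eps nabla u_eps
   converge weakly along a subsequence, to v and U say. Let I_phi F (w) be the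
   integral of F(w, .) phi over Q. For every test function phi,
     D_i (I_phi S_eps u) = eps (I_phi S_eps d_i u + I_{d_i phi} S_eps u).
   This is proved for u = h_eta (x) f, where h_eta is h mollified along the orbits,
   and extended by density, the graph of D being closed.
   Letting eps tend to 0, I_phi v has a vanishing horizontal gradient, hence is
   invariant, and (I_phi U_i + I_{d_i phi} v)_i lies in Lpot. Ergodic averages in
   direction i annihilate the i-th component of Lpot and fix invariant functions,
   so a weak limit G_i of the averages of U_i satisfies I_phi G_i = - I_{d_i phi} v:
   G is the gradient of v, and averaging over invariant sets approximates (v, G)
   by tensors of invariant functions with graphs of gradients. Finally
   I_phi (U - G) lies in Lpot for all phi, so that chi = U - G belongs to Lpot (x) L^p.

   Under ergodicity invariant functions are constant, and the mean over Omega does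
   not see the unfolding: the means of the pairs (u_eps, nabla u_eps) are pairs
   (f, nabla f) which converge weakly in L^p, hence in W^{1,p} by extending
   functionals from the graph of the gradient by Hahn-Banach. *)

(* Elements of L^p are functions, not classes, and [unfolding], [nabla] and [Pinv] are chosen
   objects known only up to null sets. Everything therefore takes place in seminormed spaces, with
   operators that are linear modulo elements of norm 0. One pattern extends a property from simple
   elements to all: the elements that have it form a closed subspace, and this subspace contains a
   total family (indicator functions of generating sets, rectangles, test functions, mollified
   functions). Closed subspaces are weakly closed, so the pattern also serves for weak limits. Weak
   and horizontal gradients are unbounded operators; what is transported is their graph, a set of
   vectors with d + 1 components on which all norms are plain L^p norms. The obstacle is that x |->
   f (tau_x w) is merely measurable for f in L^p(Omega), so that its product with a Sobolev function
   of x, as it arises in S_eps, has in general no weak gradient in x. Mollification along the orbits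
   supplies a dense set of f for which the chain rule becomes an exchange of integrals. *)
Require Import Defs.
From HB Require Import structures.
From mathcomp Require Import all_boot all_order all_algebra.
From mathcomp Require Import all_classical all_reals all_analysis.
From mathcomp Require Import measurable_realfun ring lra.

Set Implicit Arguments.
Unset Strict Implicit.
Unset Printing Implicit Defensive.

Import Order.TTheory GRing.Theory Num.Theory.
Import numFieldNormedType.Exports.

Local Open Scope classical_set_scope.
Local Open Scope ring_scope.

(** * Seminormed spaces *)

Section linear_sets.
Context {R : realType} {V : lmodType R}.
Implicit Types (E W X : set V) (l : V -> R) (q : V -> R).

Definition subspace W := W 0 /\ forall a f g, W f -> W g -> W (a *: f + g).

Definition linear_on E l :=
  forall a f g, E f -> E g -> l (a *: f + g) = a * l f + l g.

Definition seminorm_on E q :=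
  (forall f g, E f -> E g -> q (f + g) <= q f + q g) /\
  (forall a f, E f -> q (a *: f) = `|a| * q f).

Lemma subspaceD W f g : subspace W -> W f -> W g -> W (f + g).
Proof. by move=> [_ sW] Wf Wg; rewrite -[f]scale1r; exact: sW. Qed.

Lemma subspaceZ W a f : subspace W -> W f -> W (a *: f).
Proof. by move=> [W0 sW] Wf; rewrite -[_ *: _]addr0; exact: sW. Qed.

Lemma subspaceN W f : subspace W -> W f -> W (- f).
Proof. by move=> sW Wf; rewrite -scaleN1r; exact: subspaceZ. Qed.

Lemma subspaceB W f g : subspace W -> W f -> W g -> W (f - g).
Proof. by move=> sW Wf Wg; apply: subspaceD => //; exact: subspaceN. Qed.

Lemma subspace_sum W I (r : seq I) (P : pred I) (F : I -> V) : subspace W ->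
  (forall i, P i -> W (F i)) -> W (\sum_(i <- r | P i) F i).
Proof.
move=> sW WF; apply: (big_ind W) => //; first exact: sW.1.
by move=> f g; exact: subspaceD.
Qed.

Lemma linear_on0 E l : subspace E -> linear_on E l -> l 0 = 0.
Proof.
move=> [E0 _] /(_ 1 0 0 E0 E0).
by rewrite scale1r addr0 mul1r; lra.
Qed.

Lemma linear_onD E l f g : linear_on E l -> E f -> E g ->
  l (f + g) = l f + l g.
Proof. by move=> lE Ef Eg; rewrite -{1}[f]scale1r lE// mul1r. Qed.

Lemma linear_onZ E l a f : subspace E -> linear_on E l -> E f ->
  l (a *: f) = a * l f.
Proof.
by move=> sE lE Ef; rewrite -[a *: f]addr0 lE ?(linear_on0 sE lE) ?addr0//;
  exact: sE.1.
Qed.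

Lemma linear_onB E l f g : subspace E -> linear_on E l -> E f -> E g ->
  l (f - g) = l f - l g.
Proof.
by move=> sE lE Ef Eg; rewrite addrC -scaleN1r lE// mulN1r addrC.
Qed.

Lemma seminorm_on0 E q : subspace E -> seminorm_on E q -> q 0 = 0.
Proof. by move=> [E0 _] [_ /(_ 0 0 E0)]; rewrite scale0r normr0 mul0r. Qed.

Lemma seminorm_onN E q f : seminorm_on E q -> E f -> q (- f) = q f.
Proof. by move=> [_ qZ] Ef; rewrite -scaleN1r qZ// normrN1 mul1r. Qed.

(** * Extension of dominated linear functionals *)

Section hahn_banach.
Variables (E W : set V) (q l : V -> R).
Hypotheses (sE : subspace E) (sW : subspace W) (WE : W `<=` E).
Hypotheses (sq : seminorm_on E q) (lW : linear_on W l).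
Hypothesis lq : forall f, W f -> `|l f| <= q f.

(* Partial extensions of l are represented by their graphs; domination by q
   makes such a relation functional. *)
Let dominated_graph (G : set (V * R)) :=
  [/\ forall z, G z -> E z.1,
      forall c y z, G y -> G z -> G (c *: y.1 + z.1, c * y.2 + z.2) &
      forall z, G z -> `|z.2| <= q z.1].

Let graph0 : set (V * R) := [set z | W z.1 /\ z.2 = l z.1].

Let dominated_graph0 : dominated_graph graph0.
Proof.
split => [z [/WE]//|c y z [Wy y2] [Wz z2]|z [Wz ->]]; last exact: lq.
by split => /=; [exact: sW.2|rewrite lW// y2 z2].
Qed.

(** A value c at [f0] is admissible when z.2 - q (z.1 - f0) <= c <= q (z.1 + f0) - z.2 for all z in
    G. By subadditivity every lower bound is at most every upper bound, so the supremum of the lower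
    bounds will do. *)
Let extend G f0 : dominated_graph G -> graph0 `<=` G -> E f0 ->
  exists c, dominated_graph
    [set z | exists t y, G y /\ z = (y.1 + t *: f0, y.2 + t * c)].
Proof.
move=> [GE GL Gq] G0 Ef0.
have G00 : G (0, 0).
  by apply: G0; split => /=; [exact: sW.1|rewrite (linear_on0 sW lW)].
have GD y z : G y -> G z -> G (y.1 + z.1, y.2 + z.2).
  by move=> Gy Gz; have := GL 1 _ _ Gy Gz; rewrite scale1r mul1r.
have GZ a y : G y -> G (a *: y.1, a * y.2).
  by move=> Gy; have := GL a _ _ Gy G00; rewrite /= !addr0.
have EGf y (t : R) : G y -> E (y.1 + t *: f0).
  by move=> Gy; apply: subspaceD => //; [exact: GE|exact: subspaceZ].
pose L := [set z.2 - q (z.1 - f0) | z in G].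
have GEB y : G y -> E (y.1 - f0).
  by move=> Gy; have := EGf _ (-1) Gy; rewrite scaleN1r.
have GED y : G y -> E (y.1 + f0).
  by move=> Gy; have := EGf _ 1 Gy; rewrite scale1r.
have Lub z : G z -> ubound L (q (z.1 + f0) - z.2).
  move=> Gz _ [y Gy <-]; have Gyz := GD _ _ Gy Gz.
  have := Gq _ Gyz; rewrite /= => /(le_trans (ler_norm _)).
  have -> : y.1 + z.1 = (y.1 - f0) + (z.1 + f0) by rewrite addrACA addNr addr0.
  by move=> /le_trans/(_ (sq.1 _ _ (GEB _ Gy) (GED _ Gz))); lra.
have L0 : L !=set0 by exists (0 - q (0 - f0)); exists (0, 0).
have Lsup : has_sup L by split => //; exists (q (0 + f0) - 0); exact: (Lub (0, 0)).
exists (sup L); set c := sup L.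
have up z : G z -> z.2 + c <= q (z.1 + f0).
  move=> Gz; have : c <= q (z.1 + f0) - z.2 by apply: ge_sup => //; exact: Lub.
  by lra.
have dn z : G z -> z.2 - c <= q (z.1 - f0).
  move=> Gz; have : z.2 - q (z.1 - f0) <= c.
    by apply: ub_le_sup; [exact: Lsup.2|exists z].
  by lra.
(* Homogeneity reduces the multiple t of [f0] to the cases 1 and -1, that is, to [up] and [dn]. *)
have onesided y t : G y -> y.2 + t * c <= q (y.1 + t *: f0).
  move=> Gy; have [t0|t0|->] := ltgtP t 0; last first.
  - rewrite mul0r scale0r !addr0.
    exact: le_trans (ler_norm _) (Gq _ Gy).
  - have := up _ (GZ t^-1 _ Gy); rewrite /= => h.
    have -> : y.1 + t *: f0 = t *: (t^-1 *: y.1 + f0).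
      by rewrite scalerDr scalerA divff ?scale1r ?gt_eqF.
    rewrite sq.2; last exact: (GED (_, _) (GZ t^-1 _ Gy)).
    rewrite gtr0_norm//.
    have -> : y.2 + t * c = t * (t^-1 * y.2 + c).
      by rewrite mulrDr mulrA divff ?mul1r ?gt_eqF.
    by rewrite ler_pM2l.
  - pose s := - t; have s0 : 0 < s by rewrite oppr_gt0.
    have := dn _ (GZ s^-1 _ Gy); rewrite /= => h.
    have -> : y.1 + t *: f0 = s *: (s^-1 *: y.1 - f0).
      by rewrite scalerDr scalerA divff ?scale1r ?gt_eqF// scalerN scaleNr opprK.
    rewrite sq.2; last exact: (GEB (_, _) (GZ s^-1 _ Gy)).
    rewrite gtr0_norm//.
    have -> : y.2 + t * c = s * (s^-1 * y.2 - c).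
      by rewrite mulrDr mulrA divff ?mul1r ?gt_eqF// mulrN mulNr opprK.
    by rewrite ler_pM2l.
split.
- by move=> _ [t [y [Gy ->]]] /=; exact: EGf.
- move=> a _ _ [t [y [Gy ->]]] [s [z [Gz ->]]] /=.
  exists (a * t + s), (a *: y.1 + z.1, a * y.2 + z.2); split; first exact: GL.
  congr pair => /=.
    by rewrite scalerDr scalerDl scalerA -!addrA; congr (_ + _); rewrite addrCA.
  by ring.
- move=> _ [t [y [Gy ->]]] /=; rewrite ler_norml onesided// andbT.
  have := onesided _ (- t) (GZ (-1) _ Gy); rewrite /= scaleN1r mulN1r scaleNr.
  have -> : - y.1 - t *: f0 = - (y.1 + t *: f0) by rewrite opprD.
  by rewrite (seminorm_onN sq (EGf _ _ Gy)); lra.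
Qed.

Theorem hahn_banach : exists l', [/\ linear_on E l',
  forall f, W f -> l' f = l f & forall f, E f -> `|l' f| <= q f].
Proof.
(* Joining [graph0] puts the union of the empty chain into [T] as well, and makes a maximal element
   extend l. *)
pose T := [set G | dominated_graph (G `|` graph0)].
have [F FT Ftot|A [TA Amax]] := @Zorn_bigcup _ T.
  have [->|/set0P[G0 FG0]] := eqVneq F set0.
    by rewrite /T/= bigcup_set0 set0U.
  have inF z : (\bigcup_(X in F) X `|` graph0) z ->
      exists2 G, F G & (G `|` graph0) z.
    by move=> [[G FG Gz]|z0]; [exists G => //; left|exists G0 => //; right].
  have outF G z : F G -> (G `|` graph0) z -> (\bigcup_(X in F) X `|` graph0) z.
    by move=> FG [Gz|]; [left; exists G|right].
  split => [z /inF[G /FT[GE _ _] /GE//]|c y z|z /inF[G /FT[_ _ Gq] /Gq//]].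
  move=> /inF[G FG Gy] /inF[H FH Hz].
  have [GH|HG] := Ftot _ _ FG FH.
    apply: (outF _ _ FH); have [_ + _] := FT _ FH; apply => //.
    by move: Gy => [/GH|]; [left|right].
  apply: (outF _ _ FG); have [_ + _] := FT _ FG; apply => //.
  by move: Hz => [/HG|]; [left|right].
set G := A `|` graph0 in TA.
have [GE GL Gq] := TA.
have G00 : G (0, 0).
  by right; split => /=; [exact: sW.1|rewrite (linear_on0 sW lW)].
have Gtot f : E f -> exists c, G (f, c).
  move=> Ef; have G0 : graph0 `<=` G by move=> z; right.
  have [c goodB] := extend TA G0 Ef.
  set B := (X in dominated_graph X) in goodB.
  have GB : G `<=` B.
    by move=> z Gz; exists 0, z; split => //; rewrite scale0r mul0r !addr0; case: z Gz.
  exists c; apply: contrapT => nG; apply: (Amax B); last first.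
    rewrite /T/= (_ : B `|` graph0 = B)//.
    by apply/setUidPl; apply: subset_trans GB.
  split; first by move=> z Az; apply: GB; left.
  move=> BA; apply: nG; left; apply: BA; exists 1, (0, 0); split => //=.
  by rewrite scale1r mul1r !add0r.
have Gfun f a b : G (f, a) -> G (f, b) -> a = b.
  move=> Ga Gb; have := Gq _ (GL (-1) _ _ Ga Gb).
  rewrite /= scaleN1r addNr (seminorm_on0 sE sq) normr_le0 mulN1r.
  by rewrite addrC subr_eq0 => /eqP.
have /choice[l' l'P] (f : V) : exists c, E f -> G (f, c).
  by have [/Gtot[c ?]|] := pselect (E f); [exists c|exists 0].
exists l'; split.
- move=> a f g Ef Eg; apply: (Gfun (a *: f + g)).
    by apply: l'P; exact: sE.2.
  exact: (GL a _ _ (l'P _ Ef) (l'P _ Eg)).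
- by move=> f Wf; apply: (Gfun f); [exact/l'P/WE|right].
- by move=> f Ef; exact: (Gq _ (l'P _ Ef)).
Qed.

End hahn_banach.
End linear_sets.

Section seminormed_spaces.
Context {R : realType}.

Record seminormed (V : lmodType R) (E : set V) (N : V -> \bar R) : Prop := {
  sn_sub : subspace E ;
  sn_fin : forall f, E f -> N f \is a fin_num ;
  sn_ge0 : forall f, (0 <= N f)%E ;
  snD : forall f g, E f -> E g -> (N (f + g)%R <= N f + N g)%E ;
  snZ : forall a f, E f -> (N (a *: f)%R = `|a|%:E * N f)%E }.

Section one_space.
Variables (V : lmodType R) (E : set V) (N : V -> \bar R).
Hypothesis sn : seminormed E N.
Let sE := sn_sub sn.
Let n f := fine (N f).

Lemma sn_fineE f : E f -> N f = (n f)%:E.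
Proof. by move=> Ef; rewrite fineK// (sn_fin sn). Qed.

Lemma sn_seminorm_on : seminorm_on E n.
Proof.
split => [f g Ef Eg|a f Ef].
  rewrite -lee_fin EFinD -!sn_fineE//; [exact: (snD sn)|exact: subspaceD].
by apply: EFin_inj; rewrite EFinM -!sn_fineE//; [exact: (snZ sn)|exact: subspaceZ].
Qed.

Lemma sn0 : N 0 = 0%E.
Proof.
by rewrite sn_fineE; [rewrite (seminorm_on0 sE sn_seminorm_on)|exact: sE.1].
Qed.

Lemma snN f : E f -> N (- f) = N f.
Proof. by move=> Ef; rewrite -scaleN1r (snZ sn)// normrN1 mul1e. Qed.

Lemma snB f g : E f -> E g -> (N (f - g)%R <= N f + N g)%E.
Proof. by move=> Ef Eg; rewrite -(snN Eg); apply: (snD sn) => //; exact: subspaceN. Qed.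

Lemma snBC f g : E f -> E g -> N (f - g) = N (g - f).
Proof. by move=> Ef Eg; rewrite -(opprB g) snN//; exact: subspaceB. Qed.

Lemma sn_triangle f g h : E f -> E g -> E h ->
  (N (f - h)%R <= N (f - g)%R + N (g - h)%R)%E.
Proof.
move=> Ef Eg Eh; have -> : f - h = (f - g) + (g - h) by rewrite addrA subrK.
by apply: (snD sn); exact: subspaceB.
Qed.

Lemma sn_eqN f g : E f -> E g -> N (f - g) = 0%E -> N f = N g.
Proof.
move=> Ef Eg fg0; apply/eqP; rewrite eq_le; apply/andP; split.
  have := snD sn (subspaceB sE Ef Eg) Eg; by rewrite subrK fg0 add0e.
have := snD sn (subspaceB sE Eg Ef) Ef; by rewrite subrK snBC// fg0 add0e.
Qed.

Lemma sn_sum I (r : seq I) (P : pred I) (F : I -> V) :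
  (forall i, P i -> E (F i)) ->
  (N (\sum_(i <- r | P i) F i)%R <= \sum_(i <- r | P i) N (F i))%E.
Proof.
move=> EF; suff [] : E (\sum_(i <- r | P i) F i) /\
  (N (\sum_(i <- r | P i) F i)%R <= \sum_(i <- r | P i) N (F i))%E by [].
apply: (big_ind2 (fun f a => E f /\ (N f <= a)%E)) => //.
- by split; [exact: sE.1|rewrite sn0].
- move=> f a g b [Ef fa] [Eg gb]; split; first exact: subspaceD.
  by apply: le_trans (leeD fa gb); exact: (snD sn).
- by move=> i /EF.
Qed.

Definition bounded_functional (l : V -> R) : Prop :=
  linear_on E l /\
  exists C : R, forall f, E f -> (`|l f|%:E <= C%:E * N f)%E.

Lemma bounded_functional_eq l f g : bounded_functional l -> E f -> E g ->
  N (f - g) = 0%E -> l f = l g.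
Proof.
move=> [lE [C lC]] Ef Eg fg0; have := lC _ (subspaceB sE Ef Eg).
rewrite fg0 mule0 (linear_onB sE lE Ef Eg) lee_fin normr_le0 subr_eq0.
by move/eqP.
Qed.

Lemma linear_on_sum l I (r : seq I) (P : pred I) (F : I -> V) : linear_on E l ->
  (forall i, P i -> E (F i)) ->
  l (\sum_(i <- r | P i) F i) = \sum_(i <- r | P i) l (F i).
Proof.
move=> lE EF; suff [] : E (\sum_(i <- r | P i) F i) /\
  l (\sum_(i <- r | P i) F i) = \sum_(i <- r | P i) l (F i) by [].
apply: (big_ind2 (fun f a => E f /\ l f = a)) => //.
- by split; [exact: sE.1|exact: (linear_on0 sE lE)].
- move=> f a g b [Ef <-] [Eg <-]; split; first exact: subspaceD.
  exact: (linear_onD lE).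
- by move=> i /EF.
Qed.

Definition closed_subspace (X : set V) : Prop :=
  [/\ X `<=` E, subspace X & norm_closure E N X `<=` X].

Lemma closed_subspace_eq X f g : closed_subspace X -> E f -> X g ->
  N (f - g) = 0%E -> X f.
Proof.
move=> [_ _ Xc] Ef Xg fg0; apply: Xc; split => // e e0.
by exists g; rewrite ?fg0 ?lte_fin.
Qed.

Lemma sub_norm_closure W : W `<=` E -> W `<=` norm_closure E N W.
Proof.
move=> WE f Wf; split; first exact: WE.
by move=> e e0; exists f => //; rewrite subrr sn0 lte_fin.
Qed.

Lemma norm_closure_subspace W : W `<=` E -> subspace W ->
  closed_subspace (norm_closure E N W).
Proof.
move=> WE sW; split => [f []//||f [Ef Wf]].
- split; first by apply: sub_norm_closure => //; exact: sW.1.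
  move=> a f g [Ef Wf] [Eg Wg]; split; first exact: sE.2.
  move=> e e0; have a0 : 0 < `|a| + 1 by rewrite ltr_wpDl.
  have [f' Wf' ff'] := Wf (e / 2 / (`|a| + 1)) ltac:(by rewrite !divr_gt0).
  have [g' Wg' gg'] := Wg (e / 2) ltac:(by rewrite divr_gt0).
  exists (a *: f' + g'); first exact: sW.2.
  have -> : a *: f + g - (a *: f' + g') = a *: (f - f') + (g - g').
    by rewrite scalerBr opprD addrACA.
  have Eff' : E (f - f') by apply: subspaceB => //; exact: WE.
  have Egg' : E (g - g') by apply: subspaceB => //; exact: WE.
  apply: (le_lt_trans (snD sn (subspaceZ a sE Eff') Egg')).
  rewrite (snZ sn)// !sn_fineE// -EFinM -EFinD lte_fin.
  move: ff' gg'; rewrite !sn_fineE// !lte_fin => ff' gg'.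
  have n0 : 0 <= n (f - f') by exact: fine_ge0 (sn_ge0 sn _).
  apply: (@le_lt_trans _ _ ((`|a| + 1) * n (f - f') + n (g - g'))).
    by rewrite lerD2r ler_wpM2r// lerDl.
  have : (`|a| + 1) * n (f - f') < e / 2 by rewrite mulrC -ltr_pdivlMr.
  by move: gg'; lra.
- split => // e e0; have e20 : 0 < e / 2 by rewrite divr_gt0.
  have [g [Eg Wg] fg] := Wf _ e20; have [h Wh gh] := Wg _ e20.
  exists h => //; apply: (le_lt_trans (sn_triangle Ef Eg (WE _ Wh))).
  by rewrite [e]splitr EFinD lteD.
Qed.

Lemma norm_closure_min W X : W `<=` X -> closed_subspace X ->
  norm_closure E N W `<=` X.
Proof.
move=> WX [XE _ Xc] f [Ef Wf]; apply: Xc; split => // e /Wf[g Wg fg].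
by exists g => //; exact: WX.
Qed.

(* the distance to a closed subspace is a seminorm, and so Hahn-Banach yields a
   functional which vanishes on the subspace but not at f *)
Lemma separating_functional X f : closed_subspace X -> E f -> ~ X f ->
  exists l, [/\ bounded_functional l, forall g, X g -> l g = 0 & l f != 0].
Proof.
move=> [XE sX Xc] Ef Xf.
pose D g := [set n (g - h) | h in X].
have XB g h : E g -> X h -> E (g - h).
  by move=> Eg Xh; apply: subspaceB => //; exact: XE.
have n_ge0 g : 0 <= n g by exact: fine_ge0 (sn_ge0 sn _).
have Dlb g : lbound (D g) 0 by move=> _ [h _ <-].
have D0 g : D g !=set0 by exists (n (g - 0)), 0 => //; exact: sX.1.
have Dinf g : has_inf (D g) by split => //; exists 0.
pose q g := inf (D g).
have q0 g : 0 <= q g by exact: lb_le_inf.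
have qle g h : X h -> q g <= n (g - h).
  by move=> Xh; apply: ge_inf; [exact: (Dinf g).2|exists h].
have qn g : q g <= n g by have := qle g 0 sX.1; rewrite subr0.
have [nD nZ] := sn_seminorm_on.
have qD g h : E g -> E h -> q (g + h) <= q g + q h.
  move=> Eg Eh; apply/ler_addgt0Pr => e e0.
  have e20 : 0 < e / 2 by rewrite divr_gt0.
  have [_ [g' Xg' <-] gg'] := inf_adherent e20 (Dinf g).
  have [_ [h' Xh' <-] hh'] := inf_adherent e20 (Dinf h).
  have := qle (g + h) _ (subspaceD sX Xg' Xh').
  have -> : g + h - (g' + h') = (g - g') + (h - h') by rewrite opprD addrACA.
  move=> /le_trans/(_ (nD _ _ (XB _ _ Eg Xg') (XB _ _ Eh Xh'))).
  by move: gg' hh'; rewrite -/(q g) -/(q h); lra.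
have qZle a g : E g -> a != 0 -> q (a *: g) <= `|a| * q g.
  move=> Eg a0; have a0' : 0 < `|a| by rewrite normr_gt0.
  rewrite -ler_pdivrMl//; apply: lb_le_inf => // _ [h Xh <-].
  rewrite ler_pdivrMl// -nZ; last exact: XB.
  by rewrite scalerBr; apply: qle; exact: subspaceZ.
have qZ a g : E g -> q (a *: g) = `|a| * q g.
  move=> Eg; have [->|a0] := eqVneq a 0.
    rewrite scale0r normr0 mul0r; apply: le_anti; rewrite q0 andbT.
    by rewrite (le_trans (qn _))// /n sn0.
  apply: le_anti; rewrite qZle//=.
  have := qZle a^-1 _ (subspaceZ a sE Eg) (invr_neq0 a0).
  by rewrite scalerA mulVf// scale1r normfV ler_pdivlMl ?normr_gt0.
have qX g : X g -> q g = 0.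
  by move=> Xg; apply: le_anti; rewrite q0 andbT (le_trans (qle g g Xg))// subrr /n sn0.
have qf : 0 < q f.
  rewrite lt_neqAle q0 andbT; apply/eqP => qf0; apply: Xf; apply: Xc; split => // e e0.
  have [_ [h Xh <-] fh] := inf_adherent e0 (Dinf f).
  exists h => //; rewrite sn_fineE; last exact: XB.
  by rewrite lte_fin; move: fh; rewrite -/(q f) -qf0 add0r.
pose W := [set t *: f | t in [set: R]].
have sW : subspace W.
  split; first by exists 0 => //; rewrite scale0r.
  by move=> a _ _ [s _ <-] [t _ <-]; exists (a * s + t) => //; rewrite scalerDl scalerA.
have WE : W `<=` E by move=> _ [t _ <-]; exact: subspaceZ.
have f0 : f != 0 by apply: contra_notN Xf => /eqP->; exact: sX.1.
have Winj s t : s *: f = t *: f -> s = t.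
  move=> /eqP; rewrite -subr_eq0 -scalerBl => /eqP st0; apply/eqP.
  rewrite -subr_eq0; apply/negPn/negP => st.
  have : q ((s - t) *: f) = 0 by rewrite st0 (qX _ sX.1).
  by rewrite qZ// => /eqP; rewrite mulf_eq0 normr_eq0 (negbTE st) gt_eqF.
(* This is t f |-> t (q f) on the line through f; the coefficient t is unique because q f > 0. *)
pose l g := xget 0 [set t | g = t *: f] * q f.
have lE t : l (t *: f) = t * q f.
  by rewrite /l; case: xgetP => [s _ /Winj->//|/(_ t)]; case.
have [||l' [l'E l'l l'q]] := @hahn_banach _ _ E W q l sE sW WE (conj qD qZ).
- by move=> a _ _ [s _ <-] [t _ <-]; rewrite scalerA -scalerDl !lE; ring.
- by move=> _ [t _ <-]; rewrite lE qZ// normrM (ger0_norm (q0 f)).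
exists l'; split.
- split => //; exists 1 => g Eg; rewrite mul1e sn_fineE// lee_fin.
  exact: le_trans (l'q _ Eg) (qn _).
- by move=> g Xg; apply/eqP; rewrite -normr_le0 -(qX _ Xg) l'q//; exact: XE.
- by rewrite l'l; [rewrite -[f]scale1r lE mul1r gt_eqF|exists 1 => //; rewrite scale1r].
Qed.

(** Mazur's theorem for subspaces: a functional that vanishes on X but not at u would contradict the
    weak convergence. *)
Lemma closed_subspace_weak X (u_ : nat -> V) u : closed_subspace X ->
  (forall k, X (u_ k)) -> weak_cvg E N u_ u -> X u.
Proof.
move=> Xc Xu [_ Eu ucvg]; apply: contrapT => /(separating_functional Xc Eu)[l].
move=> [[lE lC] lX]; apply/negP; rewrite negbK; have := ucvg l lE lC.
have -> : l \o u_ = cst 0 by apply/funext => k /=; exact: lX.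
by move=> l0; apply/eqP; exact: (cvg_unique (@norm_hausdorff _ _) l0 (cvg_cst _)).
Qed.

(** Two bounded operators agree modulo null elements exactly on the preimage of this subspace under
    their difference. That preimage is closed, so the agreement need only be checked on a total
    family. *)
Lemma null_closed_subspace : closed_subspace [set f | E f /\ N f = 0%E].
Proof.
split => [f []//||f [Ef h]].
- split; first by split; [exact: sE.1|exact: sn0].
  move=> a f g [Ef f0] [Eg g0]; split; first exact: sE.2.
  apply/eqP; rewrite eq_le (sn_ge0 sn) andbT.
  apply: (le_trans (snD sn (subspaceZ a sE Ef) Eg)).
  by rewrite (snZ sn)// f0 g0 mule0 adde0.
- split => //; apply/eqP; rewrite eq_le (sn_ge0 sn) andbT.
  apply/lee_addgt0Pr => e e0; rewrite add0e.
  have [g [Eg g0] fg] := h _ e0.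
  have := snD sn (subspaceB sE Ef Eg) Eg; rewrite subrK g0 adde0.
  by move=> /le_trans; apply; exact: ltW.
Qed.

Lemma weak_cvg_eq (u_ v_ : nat -> V) u v : weak_cvg E N u_ u ->
  (forall k, E (v_ k)) -> E v ->
  (forall k, N (u_ k - v_ k) = 0%E) -> N (u - v) = 0%E -> weak_cvg E N v_ v.
Proof.
move=> [Eu_ Eu ucvg] Ev_ Ev uv_ uv; split => // l lE lC.
have lb : bounded_functional l by [].
rewrite -(bounded_functional_eq lb Eu Ev uv).
rewrite (_ : l \o v_ = l \o u_); first exact: ucvg.
by apply/funext => k /=; rewrite (bounded_functional_eq lb _ _ (uv_ k)).
Qed.

(** A functional that separates u from the null elements tends to l u by weak convergence and to 0
    by boundedness. *)
Lemma weak_cvg_norm0 (u_ : nat -> V) u : weak_cvg E N u_ u ->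
  N (u_ k) @[k --> \oo] --> 0%E -> N u = 0%E.
Proof.
move=> [Eu_ Eu ucvg] u0; apply: contrapT => Nu.
have nX : ~ [set f | E f /\ N f = 0%E] u by case.
have [l [[lE [C lC]] _]] := separating_functional null_closed_subspace Eu nX.
apply/negP; rewrite negbK; have lu := ucvg l lE (ex_intro _ _ lC).
apply/eqP; apply: (cvg_unique (@norm_hausdorff _ _) lu).
apply/cvgrPdist_le => e e0.
have C1 : 0 < `|C| + 1 by rewrite ltr_wpDl.
have e'0 : 0 < e / (`|C| + 1) by rewrite divr_gt0.
move/fine_cvgP : u0 => [_ /cvgrPdist_le/(_ _ e'0)].
apply: filterS => k; rewrite !sub0r !normrN /= => uk.
rewrite -lee_fin; apply: (le_trans (lC _ (Eu_ k))).
rewrite sn_fineE// -EFinM !lee_fin.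
apply: (@le_trans _ _ ((`|C| + 1) * n (u_ k))).
  apply: ler_wpM2r; first exact: fine_ge0 (sn_ge0 sn _).
  by rewrite (le_trans (ler_norm _))// lerDl.
by rewrite mulrC -ler_pdivlMr// (le_trans (ler_norm _)).
Qed.

End one_space.

(* linear maps between seminormed spaces are only required to be linear modulo
   elements of norm 0 *)
Definition bounded_operator (V W : lmodType R) (E : set V) (N : V -> \bar R)
    (F : set W) (M : W -> \bar R) (A : V -> W) : Prop :=
  [/\ forall f, E f -> F (A f),
      forall a f g, E f -> E g -> M (A (a *: f + g) - (a *: A f + A g)) = 0%E &
      exists C : R, forall f, E f -> (M (A f) <= C%:E * N f)%E].

Section two_spaces.
Variables (V W : lmodType R) (E : set V) (N : V -> \bar R).
Variables (F : set W) (M : W -> \bar R) (A : V -> W).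
Hypotheses (sn : seminormed E N) (sm : seminormed F M).
Hypothesis bA : bounded_operator E N F M A.
Let sE := sn_sub sn.
Let sF := sn_sub sm.

Lemma bounded_operator_ge0 :
  exists2 C : R, 0 <= C & forall f, E f -> (M (A f) <= C%:E * N f)%E.
Proof.
have [AF _ [C AC]] := bA; exists `|C| => // f Ef.
apply: (le_trans (AC _ Ef)); apply: lee_wpmul2r; first exact: (sn_ge0 sn).
by rewrite lee_fin ler_norm.
Qed.

Lemma bounded_operatorB f g : E f -> E g -> M (A (f - g) - (A f - A g)) = 0%E.
Proof.
have [AF AL _] := bA => Ef Eg.
by have := AL (-1) _ _ Eg Ef; rewrite !scaleN1r [- g + f]addrC [- A g + _]addrC.
Qed.

Lemma bounded_functional_comp l :
  bounded_functional F M l -> bounded_functional E N (l \o A).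
Proof.
have [AF AL _] := bA => lb; have [lF [C lC]] := lb; split.
  move=> a f g Ef Eg /=; rewrite -lF; [|exact: AF..].
  apply: (bounded_functional_eq sm lb); last exact: AL.
    by apply: AF; exact: sE.2.
  by apply: sF.2; exact: AF.
have [K K0 AK] := bounded_operator_ge0; exists (`|C| * K) => f Ef /=.
apply: (le_trans (lC _ (AF _ Ef))); rewrite EFinM -muleA.
apply: (@le_trans _ _ (`|C|%:E * M (A f))%E).
  by apply: lee_wpmul2r; [exact: (sn_ge0 sm)|rewrite lee_fin ler_norm].
by apply: lee_wpmul2l => //; exact: AK.
Qed.

Lemma weak_cvg_operator (u_ : nat -> V) u :
  weak_cvg E N u_ u -> weak_cvg F M (A \o u_) (A u).
Proof.
have [AF AL _] := bA => -[Eu_ Eu ucvg]; split; [by move=> n; exact: AF|exact: AF|].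
move=> l lF lC; have [lAE lAC] := bounded_functional_comp (conj lF lC).
exact: ucvg lAE lAC.
Qed.

(** The vehicle of all density arguments. The operator is additive only modulo null elements, which
    X absorbs: a closed subspace contains every element at distance 0 from it. *)
Lemma closed_subspace_preimage X : closed_subspace F M X ->
  closed_subspace E N [set f | E f /\ X (A f)].
Proof.
have [AF AL _] := bA => Xc; have [XF sX Xcl] := Xc.
split => [f []//||f [Ef h]].
- split; first split; first exact: sE.1.
    apply: (closed_subspace_eq Xc (AF _ sE.1) sX.1); rewrite subr0.
    have [K K0 AK] := bounded_operator_ge0; apply/eqP; rewrite eq_le (sn_ge0 sm) andbT.
    by apply: (le_trans (AK _ sE.1)); rewrite (sn0 sn) mule0.
  move=> a f g [Ef Xf] [Eg Xg]; split; first exact: sE.2.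
  apply: (closed_subspace_eq Xc _ _ (AL a _ _ Ef Eg)); last exact: sX.2.
  by apply: AF; exact: sE.2.
- split => //; apply: Xcl; split; first exact: AF.
  move=> e e0; have [K K0 AK] := bounded_operator_ge0.
  have K1 : 0 < K + 1 by rewrite ltr_wpDl.
  have [g [Eg Xg] fg] := h (e / (K + 1)) ltac:(by rewrite divr_gt0).
  exists (A g) => //.
  have EB := subspaceB sE Ef Eg.
  have <- : M (A (f - g)) = M (A f - A g).
    apply: (sn_eqN sm _ _ (bounded_operatorB Ef Eg)); first exact: AF.
    by apply: subspaceB => //; exact: AF.
  apply: (le_lt_trans (AK _ EB)).
  move: fg; rewrite (sn_fineE sn EB) -EFinM !lte_fin => fg.
  apply: (@le_lt_trans _ _ ((K + 1) * fine (N (f - g)))).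
    by apply: ler_wpM2r; [exact: fine_ge0 (sn_ge0 sn _)|rewrite lerDl].
  by rewrite mulrC -ltr_pdivlMr.
Qed.

End two_spaces.

Section operator_algebra.
Variables (V W : lmodType R) (E : set V) (N : V -> \bar R).
Variables (F : set W) (M : W -> \bar R).
Hypotheses (sn : seminormed E N) (sm : seminormed F M).
Implicit Types A B : V -> W.
Local Notation bounded_operator A := (bounded_operator E N F M A).

Lemma bounded_operator0 : bounded_operator (fun=> 0).
Proof.
split; first by move=> f _; exact: (sn_sub sm).1.
- by move=> a f g _ _; rewrite scaler0 addr0 subrr (sn0 sm).
- by exists 0 => f _; rewrite (sn0 sm) mul0e.
Qed.

Lemma bounded_operatorD A B : bounded_operator A -> bounded_operator B ->
  bounded_operator (fun f => A f + B f).
Proof.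
move=> bA bB; have [AF AL _] := bA; have [BF BL _] := bB.
have sE := sn_sub sn; have sF := sn_sub sm.
split; first by move=> f Ef; apply: subspaceD => //; [exact: AF|exact: BF].
- move=> a f g Ef Eg; have Eh := sE.2 a _ _ Ef Eg.
  have h (C : V -> W) : (forall f, E f -> F (C f)) ->
      F (C (a *: f + g) - (a *: C f + C g)).
    by move=> CF; apply: subspaceB => //; [exact: CF|apply: sF.2; exact: CF].
  have -> : A (a *: f + g) + B (a *: f + g) - (a *: (A f + B f) + (A g + B g)) =
      (A (a *: f + g) - (a *: A f + A g)) + (B (a *: f + g) - (a *: B f + B g)).
    by rewrite scalerDr addrACA opprD addrACA.
  apply/eqP; rewrite eq_le (sn_ge0 sm) andbT.
  by rewrite (le_trans (snD sm (h _ AF) (h _ BF)))// AL// BL// adde0.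
- have [C C0 AC] := bounded_operator_ge0 sn bA.
  have [K K0 BK] := bounded_operator_ge0 sn bB.
  exists (C + K) => f Ef; apply: (le_trans (snD sm (AF _ Ef) (BF _ Ef))).
  by rewrite EFinD ge0_muleDl ?lee_fin// leeD ?AC ?BK.
Qed.

Lemma bounded_operatorZ b A : bounded_operator A ->
  bounded_operator (fun f => b *: A f).
Proof.
move=> bA; have [AF AL _] := bA.
have sE := sn_sub sn; have sF := sn_sub sm.
split; first by move=> f Ef; apply: subspaceZ => //; exact: AF.
- move=> a f g Ef Eg.
  have -> : b *: A (a *: f + g) - (a *: (b *: A f) + b *: A g) =
      b *: (A (a *: f + g) - (a *: A f + A g)).
    by rewrite scalerBr scalerDr !scalerA [a * b]mulrC.
  rewrite (snZ sm) ?AL ?mule0//; apply: subspaceB => //.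
    by apply: AF; exact: sE.2.
  by apply: sF.2; exact: AF.
- have [C C0 AC] := bounded_operator_ge0 sn bA.
  exists (`|b| * C) => f Ef; rewrite (snZ sm) ?EFinM -?muleA; last exact: AF.
  by apply: lee_wpmul2l => //; exact: AC.
Qed.

Lemma bounded_operator_sum I (r : seq I) (A : I -> V -> W) :
  (forall i, bounded_operator (A i)) ->
  bounded_operator (fun f => \sum_(i <- r) A i f).
Proof.
move=> bA; elim: r => [|i r IH].
  by under eq_fun do rewrite big_nil; exact: bounded_operator0.
by under eq_fun do rewrite big_cons; exact: bounded_operatorD.
Qed.

End operator_algebra.

Lemma bounded_operator_id (V : lmodType R) (E : set V) (N : V -> \bar R) :
  seminormed E N -> bounded_operator E N E N id.
Proof.
move=> sn; split => //; first by move=> a f g _ _; rewrite subrr (sn0 sn).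
by exists 1 => f _; rewrite mul1e.
Qed.

Lemma bounded_operatorBid (V : lmodType R) (E : set V) (N : V -> \bar R) A :
  seminormed E N -> bounded_operator E N E N A ->
  bounded_operator E N E N (fun f => A f - f).
Proof.
move=> sn bA; under eq_fun do rewrite -scaleN1r.
by apply: (bounded_operatorD sn sn bA); apply: (bounded_operatorZ sn sn);
  exact: bounded_operator_id.
Qed.

Lemma bounded_operator_comp (U V W : lmodType R) (D : set U) (L : U -> \bar R)
    (E : set V) (N : V -> \bar R) (F : set W) (M : W -> \bar R) A B :
  seminormed D L -> seminormed E N -> seminormed F M ->
  bounded_operator D L E N A -> bounded_operator E N F M B ->
  bounded_operator D L F M (B \o A).
Proof.
move=> sd sn sm bA bB; have [AE AL _] := bA; have [BF BL _] := bB.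
have sD := sn_sub sd; have sE := sn_sub sn; have sF := sn_sub sm.
have [C C0 AC] := bounded_operator_ge0 sd bA.
have [K K0 BK] := bounded_operator_ge0 sn bB.
split; first by move=> f Df /=; exact/BF/AE.
- move=> a f g Df Dg /=; set h := A _; set k := a *: A f + A g.
  have Eh : E h by apply: AE; exact: sD.2.
  have Ek : E k by apply: sE.2; exact: AE.
  have F1 : F (B h - B k) by apply: subspaceB => //; exact: BF.
  have F2 : F (B k - (a *: B (A f) + B (A g))).
    apply: subspaceB => //; first exact: BF.
    by apply: sF.2; apply: BF; exact: AE.
  apply/eqP; rewrite eq_le (sn_ge0 sm) andbT.
  (* Passing through [B k] separates the two defects of linearity: h - k is null and B, being
     bounded, keeps it null, while the second difference is the defect of B itself. *)
  have -> : B h - (a *: B (A f) + B (A g)) =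
      (B h - B k) + (B k - (a *: B (A f) + B (A g))) by rewrite addrA subrK.
  apply: (le_trans (snD sm F1 F2)).
  rewrite (BL a _ _ (AE _ Df) (AE _ Dg)) adde0.
  have <- : M (B (h - k)) = M (B h - B k).
    apply: (sn_eqN sm _ F1 (bounded_operatorB bB Eh Ek)).
    by apply: BF; exact: subspaceB.
  apply: (le_trans (BK _ (subspaceB sE Eh Ek))).
  by rewrite AL// mule0.
- exists (K * C) => f Df /=; apply: (le_trans (BK _ (AE _ Df))).
  by rewrite EFinM -muleA; apply: lee_wpmul2l => //; exact: AC.
Qed.

End seminormed_spaces.

(** * Lebesgue spaces *)

Section Lp_space.
Context {R : realType} {d} {T : measurableType d}.
Variables (mu : {measure set T -> \bar R}) (p : R).
Hypothesis p1 : 1 <= p.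
Let p0 : 0 < p. Proof. exact: lt_le_trans p1. Qed.
Let pn0 : p != 0. Proof. exact: lt0r_neq0. Qed.
Implicit Types f g : T -> R.

(** The p-th power of the norm: unlike the norm, it is additive over disjoint supports and obeys
    Tonelli's theorem. *)
Definition powint f : \bar R := (\int[mu]_x (`|f x| `^ p)%:E)%E.

Lemma powint_ge0 f : (0 <= powint f)%E.
Proof. by apply: integral_ge0 => x _; rewrite lee_fin powR_ge0. Qed.

Lemma Lp_normE f : Lp_norm mu p f = (powint f `^ p^-1)%E.
Proof. by rewrite /Lp_norm unlock. Qed.

Lemma Lp_norm_powint f : (Lp_norm mu p f `^ p)%E = powint f.
Proof. by rewrite Lp_normE -poweRrM mulVf// poweRe1// powint_ge0. Qed.

Lemma Lp_norm_ge0 f : (0 <= Lp_norm mu p f)%E.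
Proof. exact: Lnorm_ge0. Qed.

Lemma LpP f : Lp mu p f <-> measurable_fun setT f /\ (Lp_norm mu p f < +oo)%E.
Proof.
rewrite /Lp/= unfold_in/=; split.
  by move=> /andP[]; rewrite !inE.
by move=> [mf fp]; apply/andP; rewrite !inE.
Qed.

Lemma measurable_powR_norm f : measurable_fun setT f ->
  measurable_fun setT (fun x => (`|f x| `^ p)%:E : \bar R).
Proof.
move=> mf; apply/measurable_EFinP.
apply: (measurableT_comp (measurable_powR p)).
exact: measurableT_comp.
Qed.

Lemma Lp_powint f :
  Lp mu p f <-> measurable_fun setT f /\ (powint f < +oo)%E.
Proof.
rewrite LpP; split => -[mf fp]; split => //.
  by rewrite -Lp_norm_powint poweR_lty.
by rewrite Lp_normE poweR_lty.
Qed.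

Lemma Lp_measurable f : Lp mu p f -> measurable_fun setT f.
Proof. by move=> /LpP[]. Qed.

Lemma Lp_integrable_powR f : Lp mu p f ->
  mu.-integrable setT (fun x => (`|f x| `^ p)%:E).
Proof.
move=> /Lp_powint[mf fp]; apply/integrableP; split; first exact: measurable_powR_norm.
by under eq_integral do rewrite gee0_abs ?lee_fin ?powR_ge0//.
Qed.

Lemma Lp_norm_fin f : Lp mu p f -> Lp_norm mu p f \is a fin_num.
Proof. by move=> /LpP[_ fp]; rewrite ge0_fin_numE// Lp_norm_ge0. Qed.

Lemma subspace_Lp : subspace (Lp mu p).
Proof.
split; first by rewrite /Lp/=; exact: rpred0.
move=> a f g; rewrite /Lp/= => Lf Lg.
have [_ h] := Lfun_submod_closed mu (p1 : (1 <= p%:E)%E).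
exact: h.
Qed.

Lemma seminormed_Lp : seminormed (Lp mu p) (Lp_norm mu p).
Proof.
split.
- exact: subspace_Lp.
- exact: Lp_norm_fin.
- exact: Lp_norm_ge0.
- move=> f g /Lp_measurable mf /Lp_measurable mg.
  exact: minkowski_EFin.
- move=> a f Lf; rewrite /Lp_norm.
  exact: (LnormZ (Lfun_Sub (p1 : (1 <= p%:E)%E) Lf) a).
Qed.

Lemma powint_ae f g : measurable_fun setT f -> measurable_fun setT g ->
  f = g %[ae mu] -> powint f = powint g.
Proof.
move=> mf mg fg; apply: ge0_ae_eq_integral => //.
- exact: measurable_powR_norm.
- exact: measurable_powR_norm.
- by move: fg; apply: filterS => x /= + _ => /(_ I) ->.
Qed.

Lemma Lp_ae f g : Lp mu p f -> measurable_fun setT g -> f = g %[ae mu] ->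
  Lp mu p g.
Proof.
move=> /Lp_powint[mf fp] mg fg; apply/Lp_powint; split => //.
by rewrite -(powint_ae mf mg fg).
Qed.

Lemma Lp_norm_ae f g : measurable_fun setT f -> measurable_fun setT g ->
  f = g %[ae mu] -> Lp_norm mu p f = Lp_norm mu p g.
Proof. by move=> mf mg fg; rewrite !Lp_normE (powint_ae mf mg fg). Qed.

Lemma Lp_norm0_ae f : measurable_fun setT f -> Lp_norm mu p f = 0%E ->
  f = (cst 0) %[ae mu].
Proof.
move=> mf f0; have /measurable_EFinP mf' := mf.
have := Lnorm_eq0_eq0 mf' (_ : 0 < p%:E)%E f0; rewrite lte_fin => /(_ p0).
by apply: filterS => x /(_ I)[].
Qed.

Lemma Lp_norm_cst0 : Lp_norm mu p (cst 0) = 0%E.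
Proof. exact: (sn0 seminormed_Lp). Qed.

Lemma Lp_normB_ae f g : measurable_fun setT f -> measurable_fun setT g ->
  Lp_norm mu p (f - g) = 0%E <-> f = g %[ae mu].
Proof.
move=> mf mg; split => [/Lp_norm0_ae h|fg].
  have := h (measurable_funB mf mg); apply: filterS => x /(_ I) /=.
  by move=> /eqP; rewrite subr_eq0 => /eqP.
rewrite (@Lp_norm_ae _ (cst 0)) ?Lp_norm_cst0//.
  exact: measurable_funB.
by move: fg; apply: filterS => x /(_ I)/= + _; rewrite !fctE => ->; rewrite subrr.
Qed.

Lemma powint_le f g : measurable_fun setT f -> measurable_fun setT g ->
  {ae mu, forall x, `|f x| <= `|g x|} -> (powint f <= powint g)%E.
Proof.
move=> mf mg fg; apply: ae_ge0_le_integral => //.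
- exact: measurable_powR_norm.
- exact: measurable_powR_norm.
- by move: fg; apply: filterS => x fgx _; rewrite lee_fin ge0_ler_powR ?nnegrE// ltW.
Qed.

Lemma Lp_norm_pow f (c : R) : 0 <= c ->
  (Lp_norm mu p f <= c%:E)%E <-> (powint f <= (c `^ p)%:E)%E.
Proof.
move=> c0; rewrite -Lp_norm_powint -poweR_EFin; split => [fc|].
  by apply: gt0_ler_poweR; rewrite ?in_itv/= ?leey ?andbT ?Lp_norm_ge0 ?lee_fin// ltW.
move=> /(@gt0_ler_poweR R p^-1 (ltW _)); rewrite invr_gt0 => /(_ p0).
rewrite !in_itv/= !leey !andbT !poweR_ge0 lee_fin powR_ge0 => /(_ isT isT).
by rewrite -poweRrM -powRrM mulfV// poweRe1 ?Lp_norm_ge0// powRr1.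
Qed.

Lemma Lp_norm_le f g : measurable_fun setT f -> measurable_fun setT g ->
  {ae mu, forall x, `|f x| <= `|g x|} -> (Lp_norm mu p f <= Lp_norm mu p g)%E.
Proof.
move=> mf mg /(powint_le mf mg) fg; rewrite !Lp_normE.
apply: gt0_ler_poweR; rewrite ?in_itv/= ?leey ?andbT ?powint_ge0//.
by rewrite invr_ge0 ltW.
Qed.

Lemma Lp_le f g : measurable_fun setT f -> Lp mu p g ->
  {ae mu, forall x, `|f x| <= `|g x|} -> Lp mu p f.
Proof.
move=> mf Lg fg; apply/LpP; split => //.
have /LpP[mg] := Lg; exact/le_lt_trans/Lp_norm_le.
Qed.

Lemma Lp_Mbounded f g (c : R) : Lp mu p f -> measurable_fun setT g ->
  (forall x, `|g x| <= c) -> Lp mu p (fun x => f x * g x).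
Proof.
move=> Lf mg gc; apply: (@Lp_le _ (`|c| *: f)).
- by apply: measurable_funM => //; exact: Lp_measurable.
- exact: (subspaceZ _ subspace_Lp).
- apply: aeW => x; rewrite /= !normrM normr_id mulrC ler_wpM2r//.
  exact: le_trans (gc x) (ler_norm _).
Qed.

Lemma powint_indic A : measurable A -> powint (\1_A) = mu A.
Proof.
move=> mA; rewrite -[A in RHS]setIT -integral_indic//.
apply: eq_integral => x _; congr EFin; rewrite indicE.
by case: (_ \in _); rewrite ?normr1 ?powR1 ?normr0 ?powR0.
Qed.

Lemma Lp_indic A : measurable A -> (mu A < +oo)%E -> Lp mu p (\1_A).
Proof. by move=> mA Aoo; apply/Lp_powint; rewrite powint_indic. Qed.

(** Dominated convergence for the integrals of |f_k - f|^p, which |2 g|^p dominates. *)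
Lemma Lp_dominated_cvg (f_ : nat -> T -> R) f g :
  (forall k, measurable_fun setT (f_ k)) -> Lp mu p g ->
  (forall k x, `|f_ k x| <= `|g x|) -> (forall x, f_ k x @[k --> \oo] --> f x) ->
  [/\ forall k, Lp mu p (f_ k), Lp mu p f &
     Lp_norm mu p (f_ k - f) @[k --> \oo] --> 0%E].
Proof.
move=> mf_ Lg f_g f_f.
have mf : measurable_fun setT f by apply: (measurable_fun_cvg mf_) => x _; exact: f_f.
have fg x : `|f x| <= `|g x|.
  apply: (@ler_cvg_to _ \oo _ _ (fun k => `|f_ k x|) (cst `|g x|)).
  - by apply: cvg_norm; exact: f_f.
  - exact: cvg_cst.
  - by apply: nearW => k; exact: f_g.
have Lf_ k : Lp mu p (f_ k) by apply: (Lp_le (mf_ k) Lg); apply: aeW => x.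
have Lf : Lp mu p f by apply: (Lp_le mf Lg); apply: aeW => x.
split => //.
have mB k : measurable_fun setT (f_ k - f) by exact: measurable_funB.
have L2g : Lp mu p (2 *: g) by exact: (subspaceZ _ subspace_Lp).
have B2g k x : `|(f_ k - f) x| <= `|(2 *: g) x|.
  rewrite !fctE (le_trans (ler_normB _ _))// [in leRHS]/GRing.scale/= normrM.
  by rewrite ger0_norm// mulrDl mul1r lerD.
have pointwise x : (`|(f_ k - f) x| `^ p)%:E @[k --> \oo] --> (0%E : \bar R).
  apply/fine_cvgP; split; first exact: nearW.
  apply/cvgrPdist_le => e e0.
  have e'0 : 0 < e `^ p^-1 by exact: powR_gt0.
  have /cvgrPdist_le/(_ _ e'0) := f_f x; apply: filterS => k; rewrite distrC => h.
  rewrite sub0r normrN /= ger0_norm ?powR_ge0//.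
  have -> : e = (e `^ p^-1) `^ p by rewrite -powRrM mulVf// powRr1// ltW.
  by apply: ge0_ler_powR; rewrite ?nnegrE// ltW// .
have := @dominated_cvg _ T R mu setT measurableT
  (fun k x => (`|(f_ k - f) x| `^ p)%:E) (cst 0%E) (fun x => (`|(2 *: g) x| `^ p)%:E)
  (fun k => measurable_powR_norm (mB k)) (fun x _ => pointwise x) _
  (Lp_integrable_powR L2g) _.
rewrite integral0 => /(_ (fun _ _ => isT)) h.
have {}h : powint (f_ k - f) @[k --> \oo] --> 0%E.
  apply: h => k x _; rewrite gee0_abs ?lee_fin ?powR_ge0//.
  by apply: ge0_ler_powR; rewrite ?nnegrE// ltW.
have LB k : Lp mu p (f_ k - f) by exact: (subspaceB subspace_Lp).
apply/fine_cvgP; split; first by apply: nearW => k; exact: Lp_norm_fin.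
apply/cvgrPdist_le => e e0.
have e'0 : 0 < e `^ p by exact: powR_gt0.
move/fine_cvgP : h => [_ /cvgrPdist_le/(_ _ e'0)].
apply: filterS => k; rewrite !sub0r !normrN /= !ger0_norm ?fine_ge0 ?powint_ge0 ?Lp_norm_ge0//.
rewrite -lee_fin fineK; last by rewrite ge0_fin_numE ?powint_ge0//; have /Lp_powint[] := LB k.
by move=> /(Lp_norm_pow _ (ltW e0)); rewrite -lee_fin fineK// Lp_norm_fin.
Qed.

End Lp_space.

(** * Approximation by indicator functions of level sets *)

Section staircase.
Context {R : realType}.
Implicit Types (h t : R) (N : nat).

(** For t >= 0 this is min (floor (t / h), N) h, written as a combination of indicator functions of
    half-lines, so that composing with f yields indicator functions of level sets of f. *)
Definition layer h N t : R := \sum_(k < N) h * (k.+1%:R * h <= t)%R%:R.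

Lemma layer_le0 h N t : 0 < h -> t <= 0 -> layer h N t = 0.
Proof.
move=> h0 t0; apply: big1 => k _; rewrite leNgt (le_lt_trans t0) ?mulr0//.
by rewrite mulr_gt0.
Qed.

Lemma layer_ge0 h N t : 0 < h -> 0 <= layer h N t.
Proof. by move=> h0; apply: sumr_ge0 => k _; rewrite mulr_ge0// ltW. Qed.

Lemma layer_full h N t : 0 < h -> N%:R * h <= t -> layer h N t = N%:R * h.
Proof.
move=> h0 Nt; rewrite /layer (eq_bigr (fun=> h)) => [|k _].
  by rewrite sumr_const card_ord mulr_natl.
rewrite (le_trans _ Nt) ?mulr1//.
by rewrite ler_wpM2r ?(ltW h0)// ler_nat.
Qed.

Lemma layer_bounds h N t : 0 < h -> 0 <= t ->
  layer h N t <= t /\ (t <= N%:R * h -> t - layer h N t <= h).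
Proof.
move=> h0 t0; elim: N => [|N [IH1 IH2]].
  rewrite /layer big_ord0; split => //; rewrite mul0r => t0'.
  by rewrite subr0 (le_trans t0')// ltW.
have [Nt|tN] := leP (N.+1%:R * h) t.
  rewrite layer_full//; split => // tN; rewrite (@le_trans _ _ 0) ?(ltW h0)//.
  by rewrite subr_le0.
have -> : layer h N.+1 t = layer h N t.
  by rewrite /layer big_ord_recr/= leNgt tN mulr0 addr0.
split => // _; have [/IH2//|Nt] := leP t (N%:R * h).
rewrite layer_full ?(ltW Nt)// lerBlDr ltW//.
by move: tN; rewrite -natr1 mulrDl mul1r addrC.
Qed.

Definition staircase h N t : R := layer h N t - layer h N (- t).

Lemma staircase_le h N t : 0 < h -> `|staircase h N t| <= `|t|.
Proof.
move=> h0; rewrite /staircase; have [t0|/ltW t0] := leP 0 t.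
  rewrite (layer_le0 N h0 (_ : - t <= 0)) ?oppr_le0// subr0.
  by rewrite !ger0_norm ?layer_ge0//; exact: (layer_bounds N h0 t0).1.
rewrite (layer_le0 N h0 t0) sub0r normrN ger0_norm ?layer_ge0// ler0_norm//.
have nt0 : 0 <= - t by rewrite oppr_ge0.
exact: (layer_bounds N h0 nt0).1.
Qed.

Lemma staircase_dist h N t : 0 < h -> `|t| <= N%:R * h ->
  `|t - staircase h N t| <= h.
Proof.
move=> h0; rewrite /staircase; have [t0|/ltW t0] := leP 0 t => tN.
  rewrite (layer_le0 N h0 (_ : - t <= 0)) ?oppr_le0// subr0.
  have [h1 h2] := layer_bounds N h0 t0.
  by rewrite ger0_norm ?subr_ge0//; apply: h2; rewrite -(ger0_norm t0).
have nt0 : 0 <= - t by rewrite oppr_ge0.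
rewrite (layer_le0 N h0 t0) sub0r opprK -normrN opprD.
have [h1 h2] := layer_bounds N h0 nt0.
by rewrite ger0_norm ?subr_ge0//; apply: h2; rewrite -(ler0_norm t0).
Qed.

(** Rounding towards 0 to multiples of 1 / (n + 1). The (n + 1)^2 layers cover the range up to n +
    1, so that mesh and truncation improve together. *)
Definition stair (n : nat) : R -> R := staircase n.+1%:R^-1 (n.+1 ^ 2)%N.

Lemma stair_le n t : `|stair n t| <= `|t|.
Proof. by apply: staircase_le; rewrite invr_gt0. Qed.

Lemma stair_cvg t : stair n t @[n --> \oo] --> t.
Proof.
apply/cvgrPdist_le => e e0; near=> n.
have n1 : (n.+1%:R : R) != 0 by rewrite pnatr_eq0.
apply: (@le_trans _ _ n.+1%:R^-1).
  apply: staircase_dist; first by rewrite invr_gt0.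
  rewrite natrX expr2 -mulrA divff// mulr1.
  by near: n; exists `|Num.ceil `|t| |%N => // n /=;
    move=> tn; rewrite (le_trans (ceil_ge _))// -[Num.ceil _]gez0_abs ?ceil_ge0 ?(lt_le_trans (ltrN10 R))//
      -pmulrn ler_nat leqW.
by near: n; have := near_infty_natSinv_lt (PosNum e0); apply: filterS => n /ltW.
Unshelve. all: by end_near. Qed.

End staircase.

Section level_sets.
Context {R : realType} {d} {T : measurableType d}.
Variables (mu : {measure set T -> \bar R}) (p : R).
Hypothesis p1 : 1 <= p.
Implicit Types f : T -> R.

Let sL := subspace_Lp mu p1.
Let snL := seminormed_Lp mu p1.

Lemma stair_comp_sum n f : stair n \o f =
  \sum_(k < n.+1 ^ 2) (n.+1%:R^-1 *: (\1_[set x | k.+1%:R / n.+1%:R <= f x] : T -> R)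
    - n.+1%:R^-1 *: (\1_[set x | k.+1%:R / n.+1%:R <= - f x] : T -> R)).
Proof.
apply/funext => x; rewrite fct_sumE/= /stair /staircase /layer -sumrB.
by apply: eq_bigr => k _; rewrite !fctE /GRing.scale/= !indicE !mem_setE.
Qed.

Lemma measurable_level f (a : R) : measurable_fun setT f ->
  measurable [set x | a <= f x].
Proof.
move=> mf; rewrite -[X in measurable X]setTI.
have -> : [set x | a <= f x] = f @^-1` `[a, +oo[.
  by apply/seteqP; split => x; rewrite /= in_itv/= andbT.
exact: mf.
Qed.

(** Chebyshev's inequality: |f / a| >= 1 on the level set. *)
Lemma measure_level_lty f (a : R) : Lp mu p f -> 0 < a ->
  (mu [set x | (a <= f x)%R] < +oo)%E.
Proof.
move=> Lf a0; have /(Lp_powint _ p1)[mf fp] := Lf.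
have mA := measurable_level a mf.
rewrite -(powint_indic mu p1 mA).
have Laf : Lp mu p (a^-1 *: f) by exact: subspaceZ.
have /(Lp_powint _ p1)[maf] := Laf; apply: le_lt_trans.
apply: (powint_le p1) => //.
apply: aeW => x; rewrite indicE; case: (boolP (x \in _)) => [|_].
  rewrite inE/= => afx; rewrite !fctE/= /GRing.scale/=.
  by rewrite normr1 ger0_norm ?mulr_ge0 ?invr_ge0 ?(ltW a0) ?(le_trans (ltW a0))//
    mulrC ler_pdivlMr// mul1r.
by rewrite normr0.
Qed.

(** [stair n \o f] is a combination of level sets of f and of - f and converges to f under the bound
    |f|. Only positive levels occur, for which the level sets have finite measure. *)
Lemma closed_subspace_level_sets X f : closed_subspace (Lp mu p) (Lp_norm mu p) X ->
  Lp mu p f ->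
  (forall a : R, 0 < a -> X (\1_[set x | a <= f x]) /\ X (\1_[set x | a <= - f x])) ->
  X f.
Proof.
move=> [XL sX Xc] Lf Xlev; apply: Xc; split => // e e0.
have mf := Lp_measurable Lf.
have Xs n : X (stair n \o f).
  rewrite stair_comp_sum; apply: subspace_sum => // k _.
  have [? ?] := Xlev _ (divr_gt0 (ltr0Sn R k) (ltr0Sn R n)).
  by apply: subspaceB => //; exact: subspaceZ.
have := @Lp_dominated_cvg _ _ _ mu _ p1 (fun n => stair n \o f) f f
  (fun n => Lp_measurable (XL _ (Xs n))) Lf (fun n x => stair_le n (f x))
  (fun x => @stair_cvg R (f x)).
move=> [Ls _ /fine_cvgP[_ /cvgrPdist_lt/(_ _ e0)[n _ /(_ n (leqnn n))/=]]].
rewrite sub0r normrN ger0_norm ?fine_ge0 ?Lp_norm_ge0// => h.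
exists (stair n \o f) => //; rewrite (snBC snL)// (sn_fineE snL) ?lte_fin//.
exact: subspaceB.
Qed.

Lemma closed_subspace_indic X : closed_subspace (Lp mu p) (Lp_norm mu p) X ->
  (forall A, measurable A -> (mu A < +oo)%E -> X (\1_A)) -> X = Lp mu p.
Proof.
move=> Xc XA; apply/seteqP; split; first by case: Xc.
move=> f Lf; apply: closed_subspace_level_sets => // a a0.
have Lnf : Lp mu p (- f) by exact: subspaceN.
split; apply: XA.
- exact/measurable_level/(Lp_measurable Lf).
- exact: measure_level_lty.
- exact/(measurable_level a)/(Lp_measurable Lnf).
- exact: (measure_level_lty Lnf a0).
Qed.

End level_sets.

Lemma cvg_sumr {R : realType} I (r : seq I) (f : I -> nat -> R) (l : I -> R) :
  (forall i, f i n @[n --> \oo] --> l i) ->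
  \sum_(i <- r) f i n @[n --> \oo] --> \sum_(i <- r) l i.
Proof.
move=> fl; elim: r => [|i r IH].
  by rewrite big_nil; under eq_fun do rewrite big_nil; exact: cvg_cst.
rewrite big_cons; under eq_fun do rewrite big_cons.
by apply: cvgD => //; exact: fl.
Qed.

Lemma indic_bigcup_cvg {R : realType} T (F : (set T)^nat) (x : T) :
  nondecreasing_seq F ->
  (\1_(F k) x : R) @[k --> \oo] --> (\1_(\bigcup_k F k) x : R).
Proof.
move=> ndF; apply: cvg_near_cst.
have [[n _ Fnx]|nFx] := pselect ((\bigcup_k F k) x).
  exists n => // k /= nk; have /subsetPset/(_ _ Fnx) Fkx := ndF _ _ nk.
  by rewrite !indicE !mem_set//; exists n.
apply: nearW => k; rewrite !indicE !memNset// => Fkx; by apply: nFx; exists k.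
Qed.

(** * Monotone classes inside closed subspaces *)

Section dynkin_subspace.
Context {R : realType} {d} {T : measurableType d}.
Variables (mu : {measure set T -> \bar R}) (p : R).
Hypothesis p1 : 1 <= p.
Variable X : set (T -> R).
Hypothesis Xc : closed_subspace (Lp mu p) (Lp_norm mu p) X.
Let sL := subspace_Lp mu p1.
Let snL := seminormed_Lp mu p1.

Lemma closed_subspace_dominated (f_ : nat -> T -> R) f g :
  (forall k, X (f_ k)) -> Lp mu p g -> (forall k x, `|f_ k x| <= `|g x|) ->
  (forall x, f_ k x @[k --> \oo] --> f x) -> X f.
Proof.
move=> Xf Lg f_g f_f; have [XL sX Xcl] := Xc.
have [Lf_ Lf] := @Lp_dominated_cvg _ _ _ mu _ p1 f_ f g
  (fun n => Lp_measurable (XL _ (Xf n))) Lg f_g f_f.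
move=> /fine_cvgP[_ /cvgrPdist_lt h]; apply: Xcl; split => // e e0.
have [n _ /(_ n (leqnn n))/=] := h _ e0.
rewrite sub0r normrN ger0_norm ?fine_ge0 ?Lp_norm_ge0// => {}h.
exists (f_ n) => //; rewrite (snBC snL)// (sn_fineE snL) ?lte_fin//.
exact: subspaceB.
Qed.

Lemma closed_subspace_ae f g : X f -> measurable_fun setT g ->
  f = g %[ae mu] -> X g.
Proof.
move=> Xf mg fg; have [XL _ _] := Xc; have Lf := XL _ Xf.
apply: (closed_subspace_eq Xc _ Xf); first exact: (Lp_ae p1 Lf).
apply/(Lp_normB_ae mu p1 mg (Lp_measurable Lf)).
by move: fg; apply: filterS => x /= + _ => /(_ I).
Qed.

(** The sets A for which the indicator function of A [&] D lies in X form a Dynkin class: proper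
    differences stay by linearity, increasing unions by dominated convergence, for which D must have
    finite measure. *)
Lemma closed_subspace_dynkin (G : set (set T)) (D : set T) :
  setI_closed G -> G `<=` measurable -> measurable D -> (mu D < +oo)%E ->
  X (\1_D) -> (forall B, G B -> X (\1_(B `&` D))) ->
  forall A, <<s G >> A -> X (\1_(A `&` D)).
Proof.
move=> GI mG mD Doo XD XG; have [XL sX _] := Xc.
suff: <<s G >> `<=` [set A | measurable A /\ X (\1_(A `&` D))].
  by move=> h A /h[].
apply: lambda_system_subset => //.
  split => [//||A B BA [mA XA] [mB XB]|F ndF XF].
  - by split => //; rewrite setTI.
  - split; first exact: measurableD.
    suff -> : \1_((A `\` B) `&` D) = (\1_(A `&` D) : T -> R) - \1_(B `&` D).
      exact: subspaceB.
    apply/funext => x; rewrite !fctE !indicE in_setI in_setD !in_setI.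
    have [xB|xB] := boolP (x \in B); last by rewrite andbT subr0.
    have -> : x \in A by rewrite inE; apply: BA; rewrite inE in xB.
    by rewrite subrr.
  - split; first by apply: bigcup_measurable => k _; exact: (XF k).1.
    apply: (@closed_subspace_dominated (fun k => \1_(F k `&` D)) _ (\1_D)).
    + by move=> k; exact: (XF k).2.
    + exact: Lp_indic.
    + move=> k x; rewrite !indicE in_setI.
      by case: (x \in F k); case: (x \in D); rewrite ?normr0.
    + move=> x; rewrite setI_bigcupl; apply: indic_bigcup_cvg => m n mn.
      by apply/subsetPset; apply: setSI; apply/subsetPset; exact: ndF.
by move=> B GB; split; [exact: mG|exact: XG].
Qed.

(** Generation is required only up to null sets, which is what holds for Lebesgue-measurable sets.
    The exhaustion D brings sets of infinite measure within reach of [closed_subspace_dynkin]. *)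
Lemma closed_subspace_generated (G : set (set T)) (D : (set T)^nat) :
  setI_closed G -> G `<=` measurable ->
  (forall A, measurable A ->
    exists2 B, <<s G >> B & (\1_A : T -> R) = \1_B %[ae mu]) ->
  \bigcup_k D k = setT -> nondecreasing_seq D ->
  (forall k, measurable (D k) /\ (mu (D k) < +oo)%E) ->
  (forall k, X (\1_(D k))) -> (forall B k, G B -> X (\1_(B `&` D k))) ->
  X = Lp mu p.
Proof.
move=> GI mG GE DT ndD Doo XD XG; apply: closed_subspace_indic => // A mA Aoo.
have [B GB AB] := GE _ mA.
apply: (@closed_subspace_dominated (fun k => \1_(A `&` D k)) _ (\1_A)).
- move=> k; have [mD Dk] := Doo k.
  apply: closed_subspace_ae (closed_subspace_dynkin GI mG mD Dk (XD k) (XG^~ k) GB) _ _.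
    by apply: measurable_indic; exact: measurableI.
  move: AB; apply: filterS => x /= /(_ I); rewrite !indicE !in_setI => /eqP.
  by rewrite eqr_nat; case: (x \in A); case: (x \in B).
- exact: Lp_indic.
- move=> k x; rewrite !indicE in_setI.
  by case: (x \in A); case: (x \in D k); rewrite ?normr0.
- move=> x; rewrite -[A in X in _ --> X]setIT -DT setI_bigcupr.
  apply: indic_bigcup_cvg => m n mn.
  by apply/subsetPset; apply: setIS; apply/subsetPset; exact: ndD.
Qed.

End dynkin_subspace.

Section LpV_space.
Context {R : realType} {d} {T : measurableType d}.
Variables (mu : {measure set T -> \bar R}) (p : R).
Hypothesis p1 : 1 <= p.
Variable n : nat.
Local Notation E := (@LpV _ _ _ mu p n).
Local Notation N := (@LpV_norm _ _ _ mu p n).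
Let sL := subspace_Lp mu p1.
Let snL := seminormed_Lp mu p1.

Lemma seminormed_LpV : seminormed E N.
Proof.
split.
- split; first by move=> i; exact: sL.1.
  by move=> a f g Ef Eg i; apply: sL.2.
- by move=> f Ef; apply/sum_fin_numP => i _ _; exact: (sn_fin snL).
- by move=> f; apply: sume_ge0 => i _; exact: Lp_norm_ge0.
- move=> f g Ef Eg; rewrite /LpV_norm -big_split/=; apply: lee_sum => i _.
  exact: (snD snL).
- move=> a f Ef; rewrite /LpV_norm ge0_sume_distrr//; last first.
    by move=> i _; exact: Lp_norm_ge0.
  by apply: eq_bigr => i _; exact: (snZ snL).
Qed.

Lemma Lp_norm_le_LpV (F : 'I_n -> T -> R) i : (Lp_norm mu p (F i) <= N F)%E.
Proof.
rewrite /LpV_norm (bigD1 i)//= leeDl//.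
by apply: sume_ge0 => j _; exact: Lp_norm_ge0.
Qed.

Lemma LpV_norm0P (F : 'I_n -> T -> R) :
  N F = 0%E <-> forall i, Lp_norm mu p (F i) = 0%E.
Proof.
split => [F0 i|F0]; last by rewrite /LpV_norm big1.
by apply/eqP; rewrite eq_le Lp_norm_ge0 andbT -F0 Lp_norm_le_LpV.
Qed.

Lemma LpV_normB_ae (F G : 'I_n -> T -> R) :
  (forall i, measurable_fun setT (F i)) -> (forall i, measurable_fun setT (G i)) ->
  N (F - G) = 0%E <-> forall i, F i = G i %[ae mu].
Proof.
by move=> mF mG; rewrite LpV_norm0P; split => h i; have := h i;
  move/(Lp_normB_ae mu p1 (mF i) (mG i)).
Qed.

Lemma LpV_proj_operator i :
  bounded_operator E N (Lp mu p) (Lp_norm mu p) (fun F => F i).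
Proof.
split => [F /(_ i)//|a F G _ _|].
  by rewrite subrr; exact: (sn0 snL).
by exists 1 => F _; rewrite mul1e Lp_norm_le_LpV.
Qed.

Definition LpV_inj (i : 'I_n) (f : T -> R) : 'I_n -> T -> R :=
  fun j => if j == i then f else 0.

Lemma LpV_inj_norm i f : N (LpV_inj i f) = Lp_norm mu p f.
Proof.
rewrite /LpV_norm (bigD1 i)//= /LpV_inj eqxx big1 ?adde0// => j /negbTE ->.
exact: (sn0 snL).
Qed.

Lemma LpV_inj_LpV i f : Lp mu p f -> E (LpV_inj i f).
Proof. by move=> Lf j; rewrite /LpV_inj; case: ifP => // _; exact: sL.1. Qed.

Lemma LpV_sum_inj (F : 'I_n -> T -> R) : F = \sum_i LpV_inj i (F i).
Proof.
apply/funext => j; rewrite fct_sumE (bigD1 j)//= /LpV_inj eqxx big1 ?addr0//.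
by move=> i ij; rewrite eq_sym (negbTE ij).
Qed.

Lemma LpV_inj_operator i :
  bounded_operator (Lp mu p) (Lp_norm mu p) E N (LpV_inj i).
Proof.
split => [f|a f g _ _|]; first exact: LpV_inj_LpV.
  rewrite (_ : _ - _ = 0); first exact: (sn0 seminormed_LpV).
  apply/funext => j.
  change (LpV_inj i (a *: f + g) j - (a *: LpV_inj i f j + LpV_inj i g j) = 0).
  by rewrite /LpV_inj; case: ifP => _; rewrite ?scaler0 ?addr0 subrr.
by exists 1 => f Lf; rewrite mul1e LpV_inj_norm.
Qed.

(** A bounded functional on the product is the sum of its restrictions to the coordinate
    subspaces. *)
Lemma weak_cvgV (u_ : nat -> 'I_n -> T -> R) u :
  (forall i, weak_cvg (Lp mu p) (Lp_norm mu p) (u_ ^~ i) (u i)) ->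
  weak_cvg E N u_ u.
Proof.
move=> uu; split; first by move=> k i; have [+ _ _] := uu i; exact.
  by move=> i; have [_ + _] := uu i.
move=> l lE lC.
have lF F : E F -> l F = \sum_i (l \o LpV_inj i) (F i).
  move=> EF; rewrite {1}[F]LpV_sum_inj (linear_on_sum seminormed_LpV _ lE)//.
  by move=> i _; apply: LpV_inj_LpV; exact: EF.
have Eu_ k : E (u_ k) by move=> i; have [+ _ _] := uu i; exact.
have Eu : E u by move=> i; have [_ + _] := uu i.
rewrite lF// (_ : l \o u_ = fun k => \sum_i (l \o LpV_inj i) (u_ k i)); last first.
  by apply/funext => k /=; rewrite lF.
apply: cvg_sumr => i; have [_ _ h] := uu i.
have [lL lLC] := bounded_functional_comp snL seminormed_LpV (LpV_inj_operator i)
  (conj lE lC).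
exact: h _ lL lLC.
Qed.

Lemma weak_cvgV_proj (u_ : nat -> 'I_n -> T -> R) u i : weak_cvg E N u_ u ->
  weak_cvg (Lp mu p) (Lp_norm mu p) (u_ ^~ i) (u i).
Proof. exact: (weak_cvg_operator seminormed_LpV snL (LpV_proj_operator i)). Qed.

Lemma LpV_operator (V : lmodType R) (D : set V) (L : V -> \bar R)
    (A : 'I_n -> V -> T -> R) : seminormed D L ->
  (forall i, bounded_operator D L (Lp mu p) (Lp_norm mu p) (A i)) ->
  bounded_operator D L E N (fun f i => A i f).
Proof.
move=> sD bA; split.
- by move=> f Df i; have [+ _ _] := bA i; exact.
- move=> a f g Df Dg; apply/LpV_norm0P => i; have [_ + _] := bA i; exact.
- have /choice[C CA] (i : 'I_n) : exists C : R,
      0 <= C /\ forall f, D f -> (Lp_norm mu p (A i f) <= C%:E * L f)%E.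
    by have [C ? ?] := bounded_operator_ge0 sD (bA i); exists C.
  exists (\sum_i C i) => f Df; rewrite -sumEFin ge0_sume_distrl//.
    by apply: lee_sum => i _; exact: (CA i).2.
  by move=> i _; rewrite lee_fin; exact: (CA i).1.
Qed.

End LpV_space.

Lemma bounded_functional_cvg {R : realType} (V : lmodType R) (E : set V)
    (N : V -> \bar R) (l : V -> R) (f_ : nat -> V) f :
  seminormed E N -> bounded_functional E N l -> (forall k, E (f_ k)) -> E f ->
  N (f_ k - f) @[k --> \oo] --> 0%E -> l (f_ k) @[k --> \oo] --> l f.
Proof.
move=> sn [lE [C lC]] Ef_ Ef f0; have sE := sn_sub sn.
have C1 : 0 < `|C| + 1 by rewrite ltr_wpDl.
apply/cvgrPdist_le => e e0.
have e'0 : 0 < e / (`|C| + 1) by rewrite divr_gt0.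
move/fine_cvgP : f0 => [_ /cvgrPdist_le/(_ _ e'0)].
apply: filterS => k; rewrite !sub0r !normrN /= => fk.
have EB := subspaceB sE (Ef_ k) Ef.
rewrite distrC -(linear_onB sE lE)// -lee_fin; apply: (le_trans (lC _ EB)).
rewrite (sn_fineE sn)// -EFinM !lee_fin.
apply: (@le_trans _ _ ((`|C| + 1) * fine (N (f_ k - f)))).
  apply: ler_wpM2r; first exact: fine_ge0 (sn_ge0 sn _).
  by rewrite (le_trans (ler_norm _))// lerDl.
by rewrite mulrC -ler_pdivlMr// (le_trans (ler_norm _)).
Qed.

Lemma bounded_functional_kernel {R : realType} (V : lmodType R) (E : set V)
    (N : V -> \bar R) (l : V -> R) : seminormed E N ->
  bounded_functional E N l -> closed_subspace E N [set f | E f /\ l f = 0].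
Proof.
move=> sn lb; have [lE [C lC]] := lb; have sE := sn_sub sn.
split => [f []//||f [Ef h]].
- split; first by split; [exact: sE.1|exact: (linear_on0 sE lE)].
  move=> a f g [Ef f0] [Eg g0]; split; first exact: sE.2.
  by rewrite lE// f0 g0 mulr0 addr0.
- split => //; apply/eqP; rewrite -normr_le0; apply/ler_addgt0Pr => e e0.
  have C1 : 0 < `|C| + 1 by rewrite ltr_wpDl.
  have [g [Eg g0] fg] := h _ (divr_gt0 e0 C1).
  have EB := subspaceB sE Ef Eg; have := lC _ EB.
  rewrite (linear_onB sE lE)// g0 subr0 add0r => lf.
  rewrite -lee_fin (le_trans lf)//.
  move: fg; rewrite (sn_fineE sn)// -EFinM lee_fin lte_fin => fg.
  apply: (@le_trans _ _ ((`|C| + 1) * fine (N (f - g)))).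
    apply: ler_wpM2r; first exact: fine_ge0 (sn_ge0 sn _).
    by rewrite (le_trans (ler_norm _))// lerDl.
  by rewrite mulrC -ler_pdivlMr// ltW.
Qed.

Lemma bounded_functionalB {R : realType} (V : lmodType R) (E : set V)
    (N : V -> \bar R) (l m : V -> R) : seminormed E N ->
  bounded_functional E N l -> bounded_functional E N m ->
  bounded_functional E N (fun f => l f - m f).
Proof.
move=> sn [lE [C lC]] [mE [K mK]]; split.
  by move=> a f g Ef Eg; rewrite lE// mE//; ring.
exists (C + K) => f Ef; have := lC _ Ef; have := mK _ Ef.
rewrite (sn_fineE sn Ef) -!EFinM !lee_fin mulrDl => h1 h2.
by rewrite (le_trans (ler_normB _ _))// lerD.
Qed.

Lemma bounded_functionalD {R : realType} (V : lmodType R) (E : set V)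
    (N : V -> \bar R) (l m : V -> R) : seminormed E N ->
  bounded_functional E N l -> bounded_functional E N m ->
  bounded_functional E N (fun f => l f + m f).
Proof.
move=> sn bl bm.
have := bounded_functionalB sn bl (bounded_functionalB sn (bounded_functionalB sn bm bm) bm).
by congr bounded_functional; apply/funext => f; rewrite subrr sub0r opprK.
Qed.

(** * Conjugate exponents and positive weights *)

Section hoelder.
Context {R : realType} {d} {T : measurableType d}.
Variables (mu : {measure set T -> \bar R}) (p q : R).
Hypothesis p1 : 1 < p.
Hypothesis pq : p^-1 + q^-1 = 1.

Let p0 : 0 < p. Proof. exact: lt_trans p1. Qed.

Lemma conjugate_gt1 : 1 < q.
Proof.
have ip0 : 0 < p^-1 by rewrite invr_gt0.
have ip1 : p^-1 < 1 by rewrite invf_lt1.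
have q0 : 0 < q^-1 by move: pq; lra.
have q1 : q^-1 < 1 by move: pq; lra.
by rewrite -invf_lt1 -1?invr_gt0.
Qed.

Let q0 : 0 < q. Proof. exact: lt_trans conjugate_gt1. Qed.

Lemma conjugate_mul : (q - 1) * p = q.
Proof.
have := pq; have pn0 : p != 0 by rewrite gt_eqF.
have qn0 : q != 0 by rewrite gt_eqF.
move=> /(congr1 (fun x => x * (p * q))).
have -> : (p^-1 + q^-1) * (p * q) = q + p by field; rewrite ?pn0 ?qn0.
by rewrite mul1r => h; rewrite mulrBl mul1r mulrC -h; ring.
Qed.

Lemma hoelder_norm1 (f g : T -> R) : Lp mu p f -> Lp mu q g ->
  (\int[mu]_x `|f x * g x|%:E <= Lp_norm mu p f * Lp_norm mu q g)%E.
Proof.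
move=> Lf Lg; have := hoelder mu (Lp_measurable Lf) (Lp_measurable Lg) p0 q0 pq.
by rewrite Lnorm1.
Qed.

Lemma hoelder_integrable (f g : T -> R) : Lp mu p f -> Lp mu q g ->
  mu.-integrable setT (EFin \o (fun x => f x * g x)).
Proof.
move=> Lf Lg; apply/integrableP; split.
  apply/measurable_EFinP; exact: measurable_funM (Lp_measurable Lf) (Lp_measurable Lg).
apply: (le_lt_trans (hoelder_norm1 Lf Lg)).
by rewrite -ge0_fin_numE ?mule_ge0 ?Lp_norm_ge0// fin_numM// Lp_norm_fin.
Qed.

Lemma hoelder_le (f g : T -> R) : Lp mu p f -> Lp mu q g ->
  (`|\int[mu]_x (f x * g x)|%:E <= Lp_norm mu p f * Lp_norm mu q g)%E.
Proof.
move=> Lf Lg; apply: le_trans (hoelder_norm1 Lf Lg).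
have ifg := hoelder_integrable Lf Lg.
rewrite EFin_normr_Rintegral//.
exact: (le_abse_integral mu measurableT (measurable_int mu ifg)).
Qed.

Lemma pairing_functional (g : T -> R) : Lp mu q g ->
  bounded_functional (Lp mu p) (Lp_norm mu p) (fun f => \int[mu]_x (f x * g x)).
Proof.
move=> Lg; split.
  move=> a f h Lf Lh.
  have If := hoelder_integrable Lf Lg; have Ih := hoelder_integrable Lh Lg.
  rewrite (_ : (fun x => (a *: f + h) x * g x) =
      (fun x => a * (f x * g x) + h x * g x)); last first.
    by apply/funext => x; rewrite !fctE mulrDl -mulrA.
  rewrite RintegralD//; first by rewrite RintegralZl.
  by have := integrableZl measurableT a If.
exists (fine (Lp_norm mu q g)) => f Lf.
by rewrite fineK ?Lp_norm_fin// muleC hoelder_le.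
Qed.

End hoelder.

Section positive_weight.
Context {R : realType} {d} {T : measurableType d}.
Variables (mu : {sigma_finite_measure set T -> \bar R}) (p : R).
Hypothesis p1 : 1 <= p.

Lemma positive_integrable_function : exists w : T -> R,
  [/\ measurable_fun setT w, forall x, 0 < w x &
      (\int[mu]_x (w x)%:E < +oo)%E].
Proof.
have /sigma_finiteP[F [TF ndF Foo]] := sigma_finiteT mu.
(* With these weights the k-th term of the integral is at most 2^-(k+1), and these bounds add up to
   1. *)
pose a k : R := (2 ^ k.+1)%:R^-1 / (1 + fine (mu (F k))).
have muF0 k : 0 <= fine (mu (F k)) by exact: fine_ge0.
have a0 k : 0 < a k by rewrite divr_gt0 ?invr_gt0 ?ltr0n ?expn_gt0// ltr_wpDr.
pose W x := (\sum_(k <oo) (a k * \1_(F k) x)%:E)%E.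
have mterm k : measurable_fun setT (fun x : T => (a k * \1_(F k) x)%:E).
  apply/measurable_EFinP; apply: measurable_funM => //.
  by apply: measurable_indic; exact: (Foo k).1.
have term0 k x : (0 <= (a k * \1_(F k) x)%:E)%E.
  by rewrite lee_fin mulr_ge0// ltW.
have W0 x : (0 < W x)%E.
  have [k _ Fkx] : (\bigcup_k F k) x by rewrite -TF.
  apply: (@lt_le_trans _ _ (a k * \1_(F k) x)%:E).
    by rewrite lte_fin indicE mem_set// mulr1.
  rewrite /W (@nneseriesD1 _ _ k xpredT)//.
  by apply: leeDl; apply: nneseries_ge0 => n _ _; exact: term0.
have mW : measurable_fun setT W.
  by apply: (@ge0_emeasurable_sum _ _ _ _ _ xpredT).
have IW : (\int[mu]_x W x < +oo)%E.
  rewrite integral_nneseries//.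
  apply: (@le_lt_trans _ _ (\sum_(k <oo) (1 / (2 ^ k.+1)%:R)%:E)%E).
    apply: lee_nneseries => [k _ _|k _]; first by apply: integral_ge0 => x _; exact: term0.
    under eq_integral do rewrite EFinM.
    rewrite ge0_integralZl//; last 2 first.
    - by apply/measurable_EFinP; apply: measurable_indic; exact: (Foo k).1.
    - by rewrite lee_fin ltW.
    have fF : mu (F k) \is a fin_num by rewrite ge0_fin_numE//; exact: (Foo k).2.
    have -> : (\int[mu]_x (\1_(F k) x)%:E = (fine (mu (F k)))%:E)%E.
      by rewrite fineK// integral_indic ?setIT//; exact: (Foo k).1.
    rewrite -EFinM lee_fin /a div1r -[leRHS]mulr1 -mulrA.
    rewrite ler_wpM2l ?invr_ge0 ?ler0n//.
    by rewrite mulrC ler_pdivrMr ?ltr_wpDr// mul1r lerDr.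
  by apply: le_lt_trans (@epsilon_trick0 R 1 xpredT ler01) _; rewrite ltry.
(* The minimum with 1 makes the weight finite at every point, and hence real-valued. *)
pose V x := Order.min (W x) 1%E.
have V0 x : (0 < V x)%E by rewrite lt_min W0 lte01.
have Vfin x : V x \is a fin_num.
  by rewrite ge0_fin_numE ?(ltW (V0 x))// (le_lt_trans _ (ltry 1))// ge_min lexx orbT.
exists (fun x => fine (V x)); split.
- by apply: (measurableT_comp (fine_measurable measurableT)) => //;
    apply: measurable_mine.
- by move=> x; rewrite fine_gt0// V0/= -ge0_fin_numE// ltW.
- apply: le_lt_trans IW; apply: ge0_le_integral => //.
  + by move=> x _; rewrite fineK// ltW.
  + by under eq_fun do rewrite fineK//; exact: measurable_mine.
  + by move=> x _; rewrite fineK// ge_min lexx.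
Qed.

Lemma positive_Lp_function : exists2 h, Lp mu p h & forall x, 0 < h x.
Proof.
have [w [mw w0 Iw]] := positive_integrable_function.
have p0 : 0 < p by exact: lt_le_trans p1.
exists (fun x => w x `^ p^-1); last by move=> x; exact: powR_gt0.
apply/(Lp_powint _ p1); split.
  exact: (measurableT_comp (measurable_powR _)).
rewrite /powint; under eq_integral.
  move=> x _; rewrite (ger0_norm (powR_ge0 _ _)) -powRrM mulVf ?gt_eqF//.
  rewrite powRr1 ?(ltW (w0 x))//; over.
exact: Iw.
Qed.

End positive_weight.

Lemma limn_einf_le {R : realType} (u : (\bar R)^nat) (c : \bar R) :
  (forall n, u n <= c)%E -> (limn_einf u <= c)%E.
Proof.
move=> uc; rewrite limn_einf_lim; apply: lime_le; first exact: is_cvg_einfs.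
apply: nearW => n; apply: (@le_trans _ _ (u n)) => //.
by apply: ereal_inf_lbound; exists n => /=.
Qed.

(** Fatou's lemma, the lower limit of the integrals being at most c. *)
Lemma ge0_integral_le_cvg {R : realType} {d} {T : measurableType d}
    (mu : {measure set T -> \bar R}) (f_ : nat -> T -> \bar R) (f : T -> \bar R)
    (c : \bar R) :
  (forall n, measurable_fun setT (f_ n)) -> (forall n x, 0 <= f_ n x)%E ->
  (forall x, f_ n x @[n --> \oo] --> f x) -> (forall n, \int[mu]_x f_ n x <= c)%E ->
  (\int[mu]_x f x <= c)%E.
Proof.
move=> mf f0 ff fc.
apply: le_trans (limn_einf_le fc); apply: le_trans (fatou mu measurableT mf _) => //.
by under [leRHS]eq_integral => x _ do rewrite (cvg_limn_einf_sup (ff x)).1.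
Qed.

(** * Duality and weak compactness *)

Section riesz.
Context {R : realType} {d} {T : measurableType d}.
Variables (mu : {sigma_finite_measure set T -> \bar R}) (p q : R).
Hypothesis p1 : 1 < p.
Hypothesis pq : p^-1 + q^-1 = 1.
Variable l : (T -> R) -> R.
Hypothesis lb : bounded_functional (Lp mu p) (Lp_norm mu p) l.

Let p1' : 1 <= p. Proof. exact: ltW. Qed.
Let q1' : 1 <= q. Proof. exact: ltW (conjugate_gt1 p1 pq). Qed.
Let p0 : 0 < p. Proof. exact: lt_trans p1. Qed.
Let q0 : 0 < q. Proof. exact: lt_le_trans q1'. Qed.
Let snL := seminormed_Lp mu p1'.
Let sL := subspace_Lp mu p1'.
Let lE : linear_on (Lp mu p) l := lb.1.

Section weighted_charge.
Variables (h : T -> R).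
Hypothesis Lh : Lp mu p h.
Let mh : measurable_fun setT h := Lp_measurable Lh.

Let indic_h A : measurable A -> Lp mu p (fun x => \1_A x * h x).
Proof.
move=> mA; apply: (Lp_le p1' _ Lh).
  by apply: measurable_funM => //; exact: measurable_indic.
apply: aeW => x; rewrite indicE; case: (x \in A); first by rewrite mul1r.
by rewrite mul0r normr0.
Qed.

(** For infinite mu an indicator function need not be in L^p. The weight h in L^p makes this set
    function finite on every measurable set, as Radon-Nikodym requires. *)
Definition weighted_charge (A : set T) : \bar R := (l (fun x => \1_A x * h x))%:E.

Let charge0 : weighted_charge set0 = 0%E.
Proof.
rewrite /weighted_charge (_ : (fun _ => _) = 0) ?(linear_on0 sL lE)//.
by apply/funext => x; rewrite indicE in_set0 mul0r.
Qed.

Let charge_fin A : measurable A -> weighted_charge A \is a fin_num.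
Proof. by []. Qed.

Let charge_sigma_additive : semi_sigma_additive weighted_charge.
Proof.
move=> F mF tF mUF.
have -> : (fun n => \sum_(0 <= i < n) weighted_charge (F i))%E =
    (fun n => weighted_charge (\bigcup_(i in `I_n) F i)).
  apply/funext => n; elim: n => [|n IH].
    by rewrite big_geq// II0 bigcup_set0 charge0.
  rewrite big_nat_recr//= IH /weighted_charge -EFinD -(linear_onD lE).
  - congr EFin; congr l; apply/funext => x; rewrite !fctE IIS bigcup_setU bigcup_set1.
    rewrite -mulrDl; congr (_ * _).
    have dis : (F n `&` \bigcup_(i in `I_n) F i) = set0.
      rewrite setI_bigcupr; apply: bigcup0 => i /= ni.
      move/trivIsetP : tF => /(_ n i I I); apply.
      by rewrite gt_eqF.
    rewrite !indicE in_setU.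
    have [xF|] := boolP (x \in F n); last by rewrite orbF addr0.
    have [xU|] := boolP (x \in _); last by rewrite add0r.
    have : x \in F n `&` \bigcup_(i in `I_n) F i by rewrite in_setI xF.
    by rewrite dis in_set0.
  - by apply: indic_h; exact: bigcup_measurable.
  - exact: indic_h.
rewrite /weighted_charge; apply: cvg_EFin; first exact: nearW.
pose f_ n x : R := \1_(\bigcup_(i in `I_n) F i) x * h x.
pose f x : R := \1_(\bigcup_i F i) x * h x.
have cvg_f x : f_ n x @[n --> \oo] --> f x.
  apply: cvgMr_tmp; rewrite (_ : \bigcup_i F i = \bigcup_n \bigcup_(i in `I_n) F i).
    apply: (@indic_bigcup_cvg R T (fun n => \bigcup_(i in `I_n) F i)) => m n mn.
    by apply/subsetPset; apply: bigcup_sub => i /= im; apply: bigcup_sup => /=; exact: leq_trans mn.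
  apply/seteqP; split => [y [i _ Fiy]|y [n _ [i /= _ Fiy]]].
    by exists i.+1 => //; exists i => /=.
  by exists i.
have mf_ n : measurable_fun setT (f_ n).
  apply: Lp_measurable; apply: indic_h; exact: bigcup_measurable.
have bf n x : `|f_ n x| <= `|h x|.
  rewrite /f_ indicE; case: (x \in _); first by rewrite mul1r.
  by rewrite mul0r normr0.
have [Lf_ Lf f0] := Lp_dominated_cvg p1' mf_ Lh bf cvg_f.
exact: (bounded_functional_cvg snL lb Lf_ Lf f0).
Qed.

Let weighted_charge_density0 : exists g : T -> R,
  [/\ mu.-integrable setT (EFin \o g) &
    forall A, measurable A -> l (fun x => \1_A x * h x) = \int[mu]_(x in A) g x].
Proof.
pose C := @isCharge.Build _ T R weighted_charge charge0 charge_fin charge_sigma_additive.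
pose nu : {charge set T -> \bar R} := HB.pack weighted_charge C.
have numu : nu `<< mu.
  apply/null_content_dominatesP => A mA A0; rewrite /nu/= /weighted_charge.
  congr EFin; rewrite -(linear_on0 sL lE).
  apply: (bounded_functional_eq snL lb (indic_h mA) sL.1).
  apply/(Lp_normB_ae mu p1'); [exact: Lp_measurable (indic_h mA)|exact: measurable_cst|].
  exists A; split => // x /=; apply: contra_notP => nAx _.
  by rewrite indicE memNset// mul0r.
exists (fine \o Radon_Nikodym nu mu); split.
  apply: eq_integrable (Radon_Nikodym_integrable numu) => // x _ /=.
  by rewrite fineK//; exact: Radon_Nikodym_fin_num.
move=> A mA; rewrite /Rintegral.
under eq_integral do rewrite /= fineK ?Radon_Nikodym_fin_num//.
by rewrite -(Radon_Nikodym_integral numu mA).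
Qed.

(** The density represents l on indicator functions times h; [stair] carries this over to all
    bounded multiples k h, by dominated convergence on both sides. *)
Lemma weighted_charge_density : exists g : T -> R,
  [/\ mu.-integrable setT (EFin \o g), measurable_fun setT g &
    forall (k : T -> R) (M : R), measurable_fun setT k -> (forall x, `|k x| <= M) ->
      Lp mu p (fun x => k x * h x) /\
      l (fun x => k x * h x) = \int[mu]_x (k x * g x)].
Proof.
have [g [Ig lg]] := weighted_charge_density0.
have mg : measurable_fun setT g by apply/measurable_EFinP; exact: measurable_int Ig.
have Ikg (k : T -> R) (M : R) : measurable_fun setT k -> (forall x, `|k x| <= M) ->
    mu.-integrable setT (EFin \o (fun x => k x * g x)).
  move=> mk kM; apply: (le_integrable measurableT _ _ (integrableZl measurableT M Ig)).
    by apply/measurable_EFinP; exact: measurable_funM.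
  move=> x _ /=; rewrite lee_fin !normrM ler_wpM2r//.
  exact: le_trans (kM x) (ler_norm _).
have Lkh (k : T -> R) (M : R) : measurable_fun setT k -> (forall x, `|k x| <= M) ->
    Lp mu p (fun x => k x * h x).
  move=> mk kM; rewrite (_ : (fun _ => _) = (fun x => h x * k x)).
    exact: Lp_Mbounded kM.
  by apply/funext => x; rewrite mulrC.
pose K := [set k : T -> R | [/\ measurable_fun setT k,
  exists M, forall x, `|k x| <= M & l (fun x => k x * h x) = \int[mu]_x (k x * g x)]].
have sK : subspace K.
  split.
    split; [exact: measurable_cst|by exists 0 => x; rewrite normr0|].
    rewrite (_ : (fun _ => _) = 0) ?(linear_on0 sL lE).
      by rewrite (_ : (fun _ => _) = cst 0) ?Rintegral_cst ?mul0r//;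
        apply/funext => x; rewrite mul0r.
    by apply/funext => x; rewrite mul0r.
  move=> a k k' [mk [M kM] lk] [mk' [M' kM'] lk']; split.
  - by apply: measurable_funD => //; exact: measurable_funM.
  - exists (`|a| * M + M') => x; rewrite !fctE (le_trans (ler_normD _ _))//.
    by rewrite lerD// normrM ler_wpM2l.
  - rewrite (_ : (fun x => (a *: k + k') x * h x) =
        a *: (fun x => k x * h x) + (fun x => k' x * h x)); last first.
      by apply/funext => x; rewrite !fctE mulrDl -mulrA.
    rewrite lE; [|exact: Lkh kM|exact: Lkh kM'].
    rewrite (_ : (fun x => (a *: k + k') x * g x) =
        (fun x => a * (k x * g x) + k' x * g x)); last first.
      by apply/funext => x; rewrite !fctE mulrDl -mulrA.
    rewrite RintegralD//; [|exact: integrableZl (Ikg _ _ mk kM)|exact: Ikg kM'].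
    by rewrite RintegralZl ?lk ?lk'//; exact: Ikg kM.
have Kindic A : measurable A -> K (\1_A).
  move=> mA; split; first exact: measurable_indic.
    by exists 1 => x; rewrite indicE; case: (x \in A); rewrite ?normr1 ?normr0.
  rewrite lg// Rintegral_mkcond; congr Rintegral; apply/funext => x.
  by rewrite patchE indicE; case: (x \in A); rewrite ?mul1r ?mul0r.
exists g; split => // k M mk kM; split; first exact: Lkh kM.
have Ks n : K (stair n \o k).
  rewrite stair_comp_sum; apply: subspace_sum => // i _.
  apply: subspaceB => //; apply: subspaceZ => //; apply: Kindic;
    by apply: measurable_level => //; exact: measurableT_comp.
pose f_ n x : R := (stair n \o k) x * h x.
have bf n x : `|f_ n x| <= `|k x * h x|.
  by rewrite /f_ !normrM ler_wpM2r// stair_le.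
have cvg_f x : f_ n x @[n --> \oo] --> k x * h x.
  by apply: cvgMr_tmp; exact: stair_cvg.
have mf n : measurable_fun setT (f_ n).
  by apply: measurable_funM => //; case: (Ks n).
have [Lf_ Lf f0] := Lp_dominated_cvg p1' mf (Lkh _ _ mk kM) bf cvg_f.
have lcvg := bounded_functional_cvg snL lb Lf_ Lf f0.
have icvg : \int[mu]_x ((stair n \o k) x * g x) @[n --> \oo] -->
    \int[mu]_x (k x * g x).
  have kg := Ikg _ _ mk kM.
  have := @dominated_cvg _ T R mu setT measurableT
    (fun n x => ((stair n \o k) x * g x)%:E) (EFin \o (fun x => k x * g x))
    (abse \o (EFin \o (fun x => k x * g x))) _ _ _ (integrable_abse kg) _.
  move=> h'; apply: (@fine_cvg _ _ _ _ (fun n => \int[mu]_x ((stair n \o k) x * g x)%:E)%E).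
  rewrite /Rintegral fineK; last exact: integrable_fin_num.
  apply: h' => //.
  - by move=> n; apply/measurable_EFinP; apply: measurable_funM => //; case: (Ks n).
  - by move=> x _; apply: cvg_EFin; [exact: nearW|apply: cvgMr_tmp; exact: stair_cvg].
  - by move=> n x _ /=; rewrite lee_fin !normrM ler_wpM2r// stair_le.
apply: (cvg_unique (@norm_hausdorff _ _) lcvg).
rewrite (_ : (fun n => l (f_ n)) = fun n => \int[mu]_x ((stair n \o k) x * g x))//.
by apply/funext => n; have [_ _ ->] := Ks n.
Qed.

End weighted_charge.

(** If w is the density of the charge weighted by h > 0, the representing function must be g = w /
    h. That g is in L^q follows by testing l with the extremal functions |g|^(q-1) sgn g of
    Hoelder's inequality, cut off so that they are admissible: on them l equals the p-th power of
    their norm. *)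
Theorem riesz_representation : exists2 g, Lp mu q g &
  forall f, Lp mu p f -> l f = \int[mu]_x (f x * g x).
Proof.
have [h Lh h0] := positive_Lp_function mu p1'.
have mh := Lp_measurable Lh.
have [w [Iw mw lw]] := weighted_charge_density Lh.
pose hi x := h x `^ (- 1).
have hiE x : hi x * h x = 1 by rewrite /hi powR_inv1 ?(ltW (h0 x))// mulVf ?gt_eqF.
have hi0 x : 0 < hi x by exact: powR_gt0.
have mhi : measurable_fun setT hi by exact: (measurableT_comp (measurable_powR _)).
pose g x := w x * hi x.
have mg : measurable_fun setT g by exact: measurable_funM.
have gh x : w x = g x * h x by rewrite /g -mulrA hiE mulr1.
clearbody g.
(* On [A n] both |g| and 1 / h are at most n. Hence [f n] below is a bounded multiple of h, the only
   kind of function on which l is known so far. *)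
pose A n := [set x | `|g x| <= n%:R /\ hi x <= n%:R].
have mA n : measurable (A n).
  rewrite (_ : A n = [set x | - n%:R <= - `|g x|] `&` [set x | - n%:R <= - hi x]).
    apply: measurableI; apply: measurable_level; apply: measurableT_comp => //.
    exact: measurableT_comp.
  by apply/seteqP; split => x /=; rewrite !lerN2.
have Acvg x : (\1_(A n) x : R) @[n --> \oo] --> (1 : R).
  rewrite (_ : 1 = \1_(\bigcup_n A n) x); last first.
    rewrite indicE mem_set//.
    have [n n1] : exists n, `|g x| + hi x <= n%:R.
      exists (Num.bound (`|g x| + hi x)); apply/ltW/archi_boundP.
      by rewrite addr_ge0// ltW.
    exists n => //; split; apply: le_trans n1; rewrite ?lerDl ?lerDr//.
    exact: ltW.
  apply: indic_bigcup_cvg => m n mn; apply/subsetPset => y [gm hm].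
  by split; rewrite (le_trans _ (_ : m%:R <= n%:R :> R)) ?ler_nat.
have gq x : g x * (g x * `|g x| `^ (q - 2)) = `|g x| `^ q.
  have [->|gx0] := eqVneq (g x) 0.
    by rewrite normr0 !mul0r powR0// gt_eqF.
  have ngx : 0 < `|g x| by rewrite normr_gt0.
  rewrite mulrA -expr2 -(real_normK (num_real _)) -(powR_mulrn 2 (ltW ngx)).
  rewrite -powRD; last by rewrite (gt_eqF ngx) implybT.
  by congr powR; ring.
pose f n x := g x * `|g x| `^ (q - 2) * \1_(A n) x.
pose k n x := f n x * hi x.
have normf n x : `|f n x| = `|g x| `^ (q - 1) * \1_(A n) x.
  rewrite /f !normrM [`|_ `^ _|]ger0_norm ?powR_ge0// [`|\1__ _|]ger0_norm//.
  congr (_ * _); have [->|gx0] := eqVneq (g x) 0.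
    by rewrite normr0 mul0r powR0// subr_eq0 gt_eqF// (conjugate_gt1 p1 pq).
  have ngx : 0 < `|g x| by rewrite normr_gt0.
  rewrite -{1}[`|g x|]powRr1 ?ltW// -powRD; last by rewrite (gt_eqF ngx) implybT.
  by congr powR; ring.
have mf n : measurable_fun setT (f n).
  apply: measurable_funM; last exact: measurable_indic.
  apply: measurable_funM => //; apply: (measurableT_comp (measurable_powR _)).
  exact: measurableT_comp.
have mk n : measurable_fun setT (k n) by exact: measurable_funM.
have kb n x : `|k n x| <= n%:R `^ (q - 1) * n%:R.
  rewrite /k normrM normf indicE; case: (boolP (x \in A n)); last first.
    by rewrite mulr0 mul0r mulr_ge0 ?powR_ge0.
  rewrite inE => -[gn hn]; rewrite mulr1 (gtr0_norm (hi0 x)).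
  apply: ler_pM => //; first exact: ltW.
  apply: ge0_ler_powR; rewrite ?nnegrE// subr_ge0.
  exact: q1'.
have khE n : (fun x => k n x * h x) = f n.
  by apply/funext => x; rewrite /k -mulrA hiE mulr1.
have fgE n x : f n x * g x = `|g x| `^ q * \1_(A n) x.
  by rewrite /f mulrAC [_ * g x]mulrC gq.
have normfp n x : `|f n x| `^ p = `|g x| `^ q * \1_(A n) x.
  rewrite normf powRM ?powR_ge0// -powRrM (conjugate_mul p1 pq) indicE.
  by case: (x \in A n); rewrite ?powR1// powR0// gt_eqF.
have Lf n : Lp mu p (f n) by rewrite -khE; have [] := lw _ _ (mk n) (kb n).
have lf n : l (f n) = \int[mu]_x (f n x * g x).
  rewrite -{1}khE; have [_ ->] := lw _ _ (mk n) (kb n).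
  congr Rintegral; apply/funext => x; rewrite gh -[in RHS](khE n).
  by rewrite mulrA mulrAC.
have lfE n : (l (f n))%:E = powint mu p (f n).
  rewrite lf /Rintegral fineK.
    by apply: eq_integral => x _; rewrite normfp fgE.
  have /(Lp_powint mu p1')[_ fo] := Lf n.
  rewrite ge0_fin_numE; last first.
    by apply: integral_ge0 => x _; rewrite lee_fin fgE mulr_ge0// powR_ge0.
  apply: le_lt_trans fo; rewrite le_eqVlt; apply/orP; left; apply/eqP.
  by apply: eq_integral => x _; rewrite normfp fgE.
have [C C0 lC] : exists2 C, 0 <= C &
    forall f', Lp mu p f' -> (`|l f'|%:E <= C%:E * Lp_norm mu p f')%E.
  have [_ [C lC]] := lb; exists `|C| => // f' Lf'; apply: (le_trans (lC _ Lf')).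
  by apply: lee_wpmul2r; [exact: Lp_norm_ge0|rewrite lee_fin ler_norm].
(* The number i = l (f n) is the p-th power of the norm of [f n], so that i <= C i^(1/p), that is,
   i^(1/q) <= C. *)
have bound n : (powint mu p (f n) <= (C `^ q)%:E)%E.
  rewrite -lfE lee_fin; set i := l (f n).
  have i0 : 0 <= i by rewrite -lee_fin lfE powint_ge0.
  have := lC _ (Lf n); rewrite Lp_normE -lfE poweR_EFin -EFinM lee_fin ger0_norm// -/i.
  have [->|in0] := eqVneq i 0; first by rewrite powR_ge0.
  have ip : 0 < i by rewrite lt_neqAle eq_sym in0.
  move=> h1; have iC : i `^ q^-1 <= C.
    rewrite -(ler_pM2r (powR_gt0 p^-1 ip)) -powRD; last by rewrite in0 implybT.
    by rewrite addrC pq powRr1.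
  rewrite -[i]powRr1// -(mulVf (lt0r_neq0 q0)) powRrM.
  by apply: ge0_ler_powR => //; rewrite ?nnegrE ?powR_ge0// ltW.
have Lg : Lp mu q g.
  apply/(Lp_powint mu q1'); split => //.
  apply: (@le_lt_trans _ _ (C `^ q)%:E); last by rewrite ltry.
  apply: (ge0_integral_le_cvg (f_ := fun n x => (`|f n x| `^ p)%:E)) => //.
  - by move=> n; exact: measurable_powR_norm.
  - move=> x; apply: cvg_EFin; first exact: nearW.
    rewrite (_ : fine \o _ = fun n => `|g x| `^ q * \1_(A n) x).
      by rewrite -[X in _ --> X]mulr1; exact: cvgMl_tmp.
    by apply: funext => n; rewrite /= normfp.
exists g => // f' Lf'; have mb := pairing_functional p1 pq Lg.
have Kc := bounded_functional_kernel snL (bounded_functionalB snL lb mb).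
suff [_ /eqP] : [set f' | Lp mu p f' /\ l f' - \int[mu]_x (f' x * g x) = 0] f'.
  by rewrite subr_eq0 => /eqP.
(* Where |f'| / h <= n, f' is a bounded multiple of h. The kernel of the difference of the two
   functionals is closed, so dominated convergence removes the truncation. *)
pose B n x : R := \1_[set x | `|f' x| * hi x <= n%:R] x.
have mB n : measurable [set x | `|f' x| * hi x <= n%:R].
  rewrite (_ : mkset _ = [set x | - n%:R <= - (`|f' x| * hi x)]); last first.
    by apply/seteqP; split => x /=; rewrite lerN2.
  apply: measurable_level; apply: measurableT_comp => //.
  by apply: measurable_funM => //; apply: measurableT_comp => //; exact: Lp_measurable Lf'.
apply: (closed_subspace_dominated p1' Kc (f_ := fun n x => f' x * B n x) _ Lf').
- move=> n; pose k' x := f' x * B n x * hi x.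
  have mf' : measurable_fun setT f' := Lp_measurable Lf'.
  have mk' : measurable_fun setT k'.
    by apply: measurable_funM => //; apply: measurable_funM => //; exact: measurable_indic.
  have kb' x : `|k' x| <= n%:R.
    rewrite /k' /B indicE; case: (boolP (x \in _)); last by rewrite mulr0 mul0r normr0.
    by rewrite inE /= mulr1 normrM (gtr0_norm (hi0 x)).
  have [Lk lk] := lw _ _ mk' kb'.
  have k'E : (fun x => k' x * h x) = (fun x => f' x * B n x).
    by apply/funext => x; rewrite /k' -mulrA hiE mulr1.
  rewrite k'E in Lk lk; split => //; rewrite lk; apply/eqP; rewrite subr_eq0; apply/eqP.
  congr Rintegral; apply/funext => x.
  by rewrite gh -(congr1 (fun f => f x) k'E) mulrA mulrAC.
- move=> n x; rewrite /B indicE; case: (x \in _); first by rewrite mulr1.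
  by rewrite mulr0 normr0.
- move=> x; rewrite -[X in _ --> X]mulr1; apply: cvgMl_tmp.
  apply: cvg_near_cst; exists (Num.bound (`|f' x| * hi x)) => // n /= nb.
  rewrite /B indicE mem_set//=; apply: (le_trans (ltW (archi_boundP _))).
    by rewrite mulr_ge0// ltW.
  by rewrite ler_nat.
Qed.

End riesz.

(** Cantor's diagonal argument on top of the Bolzano-Weierstrass theorem. *)
Lemma diagonal_subsequence_nat {R : realType} (a : nat -> nat -> R) (b : nat -> R) :
  (forall j n, `|a j n| <= b j) ->
  exists2 k : nat -> nat, {homo k : m n / (m < n)%N} &
    forall j, cvgn (a j \o k).
Proof.
move=> ab.
have /choice[F FP] (js : nat * (nat -> nat)) : exists f : nat -> nat,
    increasing_seq f /\ cvgn (a js.1 \o js.2 \o f).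
  have [|f incf cf] := @bolzano_weierstrass R (a js.1 \o js.2); last by exists f.
  exists (b js.1); split; first exact: num_real.
  by move=> x bx n _ /=; rewrite (le_trans (ab _ _))// ltW.
(* Nested extractions: along [psi j] the sequences [a 0], ..., [a j] all converge. *)
pose psi := fix psi j := if j is j'.+1 then psi j' \o F (j, psi j') else F (0%N, id).
have Finc js m n : (F js m < F js n)%N = (m < n)%N.
  by rewrite !ltnNge; congr (~~ _); exact: (FP js).1.
have Fge js n : (n <= F js n)%N.
  by elim: n => // n IH; apply: (leq_ltn_trans IH); rewrite Finc.
have psi_inc j m n : (m < n)%N -> (psi j m < psi j n)%N.
  by elim: j m n => [|j IH] m n mn /=; [rewrite Finc|apply: IH; rewrite Finc].
(* To carry a limit from [psi j] over to the diagonal it is enough that theta dominates the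
   identity. *)
have psi_sub j n : (j <= n)%N -> exists theta : nat -> nat,
    (forall i, (i <= theta i)%N) /\ psi n = psi j \o theta.
  elim: n => [|n IH]; first by rewrite leqn0 => /eqP ->; exists id.
  rewrite leq_eqVlt => /predU1P[->|]; first by exists id.
  rewrite ltnS => /IH[th [thge E]]; exists (th \o F (n.+1, psi n)); split.
    by move=> i /=; apply: leq_trans (Fge _ i) (thge _).
  by rewrite /= E.
exists (fun n => psi n n).
  have step n : (psi n n < psi n.+1 n.+1)%N by rewrite /=; apply: psi_inc; exact: Fge.
  move=> m n; elim: n => // n IH; rewrite ltnS leq_eqVlt => /predU1P[->|/IH mn].
    exact: step.
  exact: ltn_trans mn (step n).
move=> j; have [l jl] : exists l : R, (a j \o psi j) n @[n --> \oo] --> l.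
  case: j => [|j]; have [_ /cvg_ex[l jl]] := FP (0%N, id); first by exists l.
  by have [_ /cvg_ex[l' jl']] := FP (j.+1, psi j); exists l'.
apply/cvg_ex; exists l; apply/cvgrPdist_le => e e0.
have /cvgrPdist_le/(_ _ e0)[N _ jN] := jl.
exists (maxn N j) => // n /=; rewrite geq_max => /andP[Nn jn].
have [th [thge E]] := psi_sub _ _ jn.
by rewrite E; apply: (jN (th n)) => /=; exact: leq_trans (thge n).
Qed.

Lemma diagonal_subsequence {R : realType} (I : countType) (a : I -> nat -> R)
    (b : I -> R) : (forall j n, `|a j n| <= b j) ->
  exists2 k : nat -> nat, {homo k : m n / (m < n)%N} &
    forall j, cvgn (a j \o k).
Proof.
move=> ab.
pose a' j := if unpickle j is Some i then a i else fun=> 0.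
pose b' j := if unpickle j is Some i then b i else 0.
have [|k kinc kcvg] := @diagonal_subsequence_nat R a' b'.
  by move=> j n; rewrite /a' /b'; case: unpickle => [i|]; rewrite ?normr0.
by exists k => // j; have := kcvg (pickle j); rewrite /a' pickleK.
Qed.

Lemma leq_homo_lt (k : nat -> nat) : {homo k : m n / (m < n)%N} ->
  forall n, (n <= k n)%N.
Proof.
by move=> kinc; elim=> // n IH; apply: (leq_ltn_trans IH); exact: kinc.
Qed.

(** The linear span of e is dense. The form with closed subspaces is the one in which density is
    both proved and used. *)
Definition total_family {R : realType} {d} {T : measurableType d}
    (mu : {measure set T -> \bar R}) (p : R) (I : Type) (e : I -> T -> R) :=
  (forall i, Lp mu p (e i)) /\
  forall X, closed_subspace (Lp mu p) (Lp_norm mu p) X -> (forall i, X (e i)) ->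
    X = Lp mu p.

Section weak_compactness.
Context {R : realType} {d} {T : measurableType d}.
Variables (mu : {sigma_finite_measure set T -> \bar R}) (p q : R).
Hypothesis p1 : 1 < p.
Hypothesis pq : p^-1 + q^-1 = 1.
Let q1 : 1 < q. Proof. exact: conjugate_gt1 pq. Qed.
Let p1' : 1 <= p. Proof. exact: ltW. Qed.
Let q1' : 1 <= q. Proof. exact: ltW. Qed.
Let sLq := subspace_Lp mu q1'.
Let snLq := seminormed_Lp mu q1'.

Section one_sequence.
Variables (f : nat -> T -> R) (C : R).
Hypothesis Lf : forall n, Lp mu p (f n).
Hypothesis fC : forall n, (Lp_norm mu p (f n) <= C%:E)%E.

Let pair (g : T -> R) n := \int[mu]_x (f n x * g x).

Let C0 : 0 <= C.
Proof. by rewrite -lee_fin (le_trans _ (fC 0))// Lp_norm_ge0. Qed.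

Let pair_le g n : Lp mu q g -> `|pair g n| <= C * fine (Lp_norm mu q g).
Proof.
move=> Lg; rewrite -lee_fin EFinM fineK ?Lp_norm_fin//.
apply: (le_trans (hoelder_le p1 pq (Lf n) Lg)).
by rewrite lee_wpmul2r// Lp_norm_ge0.
Qed.

Let qp : q^-1 + p^-1 = 1. Proof. by rewrite addrC. Qed.

Let pair_lin n : linear_on (Lp mu q) (pair ^~ n).
Proof.
have [h _] := pairing_functional q1 qp (Lf n); move=> a g g' Lg Lg'.
have E g0 : pair g0 n = \int[mu]_x (g0 x * f n x).
  by congr Rintegral; apply/funext => x; rewrite mulrC.
by rewrite !E; exact: h.
Qed.

(** The bound C on the norms of [f n] is uniform, so the pairings with a limit of such g form a
    Cauchy sequence. *)
Lemma closed_subspace_pairing_cvg :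
  closed_subspace (Lp mu q) (Lp_norm mu q) [set g | Lp mu q g /\ cvgn (pair g)].
Proof.
split => [g []//||g [Lg h]].
  split; first split; first exact: sLq.1.
    rewrite (_ : pair 0 = cst 0); first exact: is_cvg_cst.
    by apply/funext => n; rewrite (linear_on0 sLq (pair_lin n)).
  move=> a g g' [Lg cg] [Lg' cg']; split; first exact: sLq.2.
  rewrite (_ : pair _ = (fun n => a * pair g n + pair g' n)).
    by apply: is_cvgD => //; apply: is_cvgMr.
  by apply/funext => n; rewrite pair_lin.
split => //; apply: cauchy_cvg; apply: cauchy_exP => e e0.
pose e' := e / 4 / (C + 1).
have C1 : 0 < C + 1 by rewrite ltr_wpDl.
have e'0 : 0 < e' by rewrite !divr_gt0.
have [g' [Lg' /cvg_ex[l gl]] gg'] := h _ e'0.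
have near_l n : `|pair g n - pair g' n| <= e / 4.
  rewrite -(linear_onB sLq (pair_lin n))//.
  apply: (le_trans (pair_le _ (subspaceB sLq Lg Lg'))).
  move: gg'; rewrite (sn_fineE snLq (subspaceB sLq Lg Lg')) lte_fin => gg'.
  apply: (@le_trans _ _ ((C + 1) * e')).
    apply: ler_pM => //; [exact: fine_ge0 (Lp_norm_ge0 _ _ _)|by rewrite lerDl|exact: ltW].
  by rewrite /e' mulrC divfK// gt_eqF.
have e40 : 0 < e / 2 by rewrite divr_gt0.
exists l; have /cvgrPdist_lt/(_ _ e40) := gl.
apply: filterS => n gln; rewrite /ball/= (le_lt_trans (ler_distD (pair g' n) _ _))//.
have h1 := near_l n; rewrite distrC in h1.
have h2 : `|l - pair g' n| + `|pair g' n - pair g n| < e / 2 + e / 4 by exact: ltr_leD.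
by apply: lt_trans h2 _; move: e0; lra.
Qed.

(** Reflexivity, by Riesz twice: the limit functional on L^q is bounded and hence given by some u in
    L^p, and every functional on L^p is the pairing with some g in L^q, along which convergence is
    assumed. *)
Lemma weak_limit : (forall g, Lp mu q g -> cvgn (pair g)) ->
  exists u, weak_cvg (Lp mu p) (Lp_norm mu p) f u.
Proof.
move=> pc; pose L g := limn (pair g).
have Lcvg g : Lp mu q g -> pair g n @[n --> \oo] --> L g by move=> /pc.
have Lb : bounded_functional (Lp mu q) (Lp_norm mu q) L.
  split.
    move=> a g g' Lg Lg'; apply: (cvg_unique (@norm_hausdorff _ _) (Lcvg _ _)).
      exact: sLq.2.
    rewrite (_ : pair _ = (fun n => a * pair g n + pair g' n)); last first.
      by apply/funext => n; rewrite pair_lin.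
    by apply: cvgD; [apply: cvgMl_tmp; exact: Lcvg|exact: Lcvg].
  exists C => g Lg; rewrite (sn_fineE snLq Lg) -EFinM lee_fin.
  apply: (@ler_cvg_to _ \oo _ _ (fun n => `|pair g n|) (cst (C * fine (Lp_norm mu q g)))).
  - by apply: cvg_norm; exact: Lcvg.
  - exact: cvg_cst.
  - by apply: nearW => n; exact: pair_le.
have [u Lu LE] := riesz_representation q1 qp Lb.
exists u; split => // l lE lC.
have [g Lg lg] := riesz_representation p1 pq (conj lE lC).
rewrite (_ : l \o f = pair g); last by apply/funext => n /=; rewrite lg.
rewrite (_ : l u = L g); first exact: Lcvg.
by rewrite lg// LE//; congr Rintegral; apply/funext => x; rewrite mulrC.
Qed.

End one_sequence.

(** The diagonal sequence is taken over all pairs of a component and a member of the family, which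
    must therefore be countable. It is common to the m sequences. *)
Theorem weak_compactness (I : countType) (e : I -> T -> R) m
    (f : 'I_m -> nat -> T -> R) (C : R) : total_family mu q e ->
  (forall i n, Lp mu p (f i n)) ->
  (forall i n, (Lp_norm mu p (f i n) <= C%:E)%E) ->
  exists (k : nat -> nat) (u : 'I_m -> T -> R), {homo k : m n / (m < n)%N} /\
    forall i, weak_cvg (Lp mu p) (Lp_norm mu p) (f i \o k) (u i).
Proof.
move=> [Le tote] Lf fC.
pose a (j : 'I_m * I) n := \int[mu]_x (f j.1 n x * e j.2 x).
have [|k kinc acvg] := @diagonal_subsequence R _ a
    (fun j => C * fine (Lp_norm mu q (e j.2))).
  move=> [i j] n; rewrite /a/= -lee_fin EFinM fineK ?Lp_norm_fin//.
  apply: (le_trans (hoelder_le p1 pq (Lf i n) (Le j))).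
  by rewrite lee_wpmul2r// Lp_norm_ge0.
have /choice[u uP] (i : 'I_m) : exists u,
    weak_cvg (Lp mu p) (Lp_norm mu p) (f i \o k) u.
  have Lfk n : Lp mu p ((f i \o k) n) by exact: Lf.
  have fkC n : (Lp_norm mu p ((f i \o k) n) <= C%:E)%E by exact: fC.
  apply: (weak_limit Lfk fkC) => g Lg.
  have E := tote _ (closed_subspace_pairing_cvg Lfk fkC).
  suff [] : [set g | Lp mu q g /\
    cvgn (fun n => \int[mu]_x ((f i \o k) n x * g x))] g by [].
  by rewrite E// => j; split; [exact: Le|exact: (acvg (i, j))].
by exists k, u.
Qed.

End weak_compactness.

Lemma ge0_integral_eq0 {R : realType} {d} {T : measurableType d}
    (mu : {measure set T -> \bar R}) (f : T -> \bar R) :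
  measurable_fun setT f -> (forall x, 0 <= f x)%E ->
  (\int[mu]_x f x = 0)%E <-> {ae mu, forall x, f x = 0%E}.
Proof.
move=> mf f0; have := ae_eq_integral_abs mu measurableT mf.
under eq_integral do rewrite gee0_abs//.
move=> [h1 h2]; split => [/h1|ae0].
  by apply: filterS => x /= /(_ I).
by apply: h2; move: ae0; apply: filterS => x /= + _.
Qed.

(** * Product measures, slices and tensors *)

Section product_space.
Context {R : realType} {d1 d2} {T1 : measurableType d1} {T2 : measurableType d2}.
Variables (m1 : {sigma_finite_measure set T1 -> \bar R}).
Variables (m2 : {sigma_finite_measure set T2 -> \bar R}).
Local Notation mu := (m1 \x m2)%E.
Implicit Types F : T1 * T2 -> R.

Lemma measurable_Rintegral_section F : measurable_fun setT F ->
  measurable_fun setT (fun x => \int[m2]_y F (x, y)).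
Proof.
move=> mF; have mF' : measurable_fun setT (EFin \o F) by exact/measurable_EFinP.
apply: (measurableT_comp (fine_measurable measurableT)) => //.
rewrite (_ : (fun x => _) = (fun x => \int[m2]_y (EFin \o F)^\+ (x, y)) \-
    (fun x => \int[m2]_y (EFin \o F)^\- (x, y)))%E.
  apply: emeasurable_funB.
  - by apply: (measurable_fun_fubini_tonelli_F (EFin \o F)^\+%E) => //; exact: measurable_funepos.
  - by apply: (measurable_fun_fubini_tonelli_F (EFin \o F)^\-%E) => //; exact: measurable_funeneg.
apply: funext => x; rewrite /= [LHS]integralE; congr (_ - _)%E;
  by apply: eq_integral => y _; rewrite ?(funeposE, funenegE).
Qed.

Lemma measurable_section F x : measurable_fun setT F ->
  measurable_fun setT (fun y => F (x, y)).
Proof. by move=> mF; exact: measurableT_comp. Qed.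

Lemma measurable_section2 F y : measurable_fun setT F ->
  measurable_fun setT (fun x => F (x, y)).
Proof. by move=> mF; exact: measurableT_comp. Qed.

Let mindicE (N : set (T1 * T2)) : measurable N ->
  measurable_fun setT (fun z => (\1_N z : R)%:E).
Proof. by move=> mN; apply/measurable_EFinP; exact: measurable_indic. Qed.

Let indic0 (N : set (T1 * T2)) z : ((\1_N z : R)%:E = 0)%E <-> ~ N z.
Proof.
rewrite indicE; split => [|nNz]; last by rewrite memNset.
by move=> + Nz; rewrite mem_set// => /eqP; rewrite eqe oner_eq0.
Qed.

Let null_prod1 (N : set (T1 * T2)) : measurable N ->
  mu N = 0%E <-> {ae m1, forall x, {ae m2, forall y, ~ N (x, y)}}.
Proof.
move=> mN; have mi := mindicE mN.
rewrite -[N in mu N]setIT -integral_indic// fubini_tonelli1//.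
rewrite ge0_integral_eq0; first last.
- by move=> x; apply: integral_ge0 => y _.
- exact: measurable_fun_fubini_tonelli_F.
have sec x : (\int[m2]_y (\1_N (x, y))%:E = 0)%E <-> {ae m2, forall y, ~ N (x, y)}.
  rewrite ge0_integral_eq0//; last exact: measurableT_comp mi _.
  by split; apply: filterS => y /indic0.
by split; apply: filterS => x /sec.
Qed.

Let null_prod2 (N : set (T1 * T2)) : measurable N ->
  mu N = 0%E <-> {ae m2, forall y, {ae m1, forall x, ~ N (x, y)}}.
Proof.
move=> mN; have mi := mindicE mN.
rewrite -[N in mu N]setIT -integral_indic// fubini_tonelli2//.
rewrite ge0_integral_eq0; first last.
- by move=> x; apply: integral_ge0 => y _.
- exact: measurable_fun_fubini_tonelli_G.
have sec y : (\int[m1]_x (\1_N (x, y))%:E = 0)%E <-> {ae m1, forall x, ~ N (x, y)}.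
  rewrite ge0_integral_eq0//; last exact: measurableT_comp mi _.
  by split; apply: filterS => x /indic0.
by split; apply: filterS => x /sec.
Qed.

Lemma ae_prod1 (Q : T1 * T2 -> Prop) : {ae mu, forall z, Q z} ->
  {ae m1, forall x, {ae m2, forall y, Q (x, y)}}.
Proof.
move=> [N [mN N0 QN]]; have := (null_prod1 mN).1 N0.
apply: filterS => x; apply: filterS => y nN; apply: contrapT => nQ.
by apply: nN; exact: QN.
Qed.

Lemma ae_prod2 (Q : T1 * T2 -> Prop) : {ae mu, forall z, Q z} ->
  {ae m2, forall y, {ae m1, forall x, Q (x, y)}}.
Proof.
move=> [N [mN N0 QN]]; have := (null_prod2 mN).1 N0.
apply: filterS => x; apply: filterS => y nN; apply: contrapT => nQ.
by apply: nN; exact: QN.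
Qed.

(** In contrast to [ae_prod1], this direction needs Q measurable: a set all of whose sections are
    null can fail to lie in a null set. *)
Lemma prod1_ae (Q : set (T1 * T2)) : measurable Q ->
  {ae m1, forall x, {ae m2, forall y, Q (x, y)}} -> {ae mu, forall z, Q z}.
Proof.
move=> mQ aeQ; have mC := measurableC mQ; exists (~` Q); split => //.
apply/null_prod1 => //; move: aeQ; apply: filterS => x; apply: filterS => y.
by move=> ? [].
Qed.

Lemma prod2_ae (Q : set (T1 * T2)) : measurable Q ->
  {ae m2, forall y, {ae m1, forall x, Q (x, y)}} -> {ae mu, forall z, Q z}.
Proof.
move=> mQ aeQ; have mC := measurableC mQ; exists (~` Q); split => //.
apply/null_prod2 => //; move: aeQ; apply: filterS => x; apply: filterS => y.
by move=> ? [].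
Qed.

Lemma measurable_eq_set F G : measurable_fun setT F -> measurable_fun setT G ->
  measurable [set z | F z = G z].
Proof.
move=> mF mG; rewrite (_ : mkset _ = [set z | 0 <= - `|F z - G z|]).
  apply: measurable_level; apply: measurableT_comp => //.
  by apply: measurableT_comp => //; exact: measurable_funB.
apply/seteqP; split => z /=; first by move->; rewrite subrr normr0 oppr0.
by rewrite oppr_ge0 normr_le0 subr_eq0 => /eqP.
Qed.

Section Lp_product.
Variables (p q : R).
Hypothesis p1 : 1 < p.
Hypothesis pq : p^-1 + q^-1 = 1.
Let q1 : 1 < q. Proof. exact: conjugate_gt1 pq. Qed.
Let qp : q^-1 + p^-1 = 1. Proof. by rewrite addrC. Qed.
Let p1' : 1 <= p. Proof. exact: ltW. Qed.
Let q1' : 1 <= q. Proof. exact: ltW. Qed.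
Let p0 : 0 < p. Proof. exact: lt_trans p1. Qed.
Let snmu := seminormed_Lp mu p1'.
Let sn1 := seminormed_Lp m1 p1'.
Let sn2 := seminormed_Lp m2 p1'.
Let sLmu := subspace_Lp mu p1'.
Let sL1 := subspace_Lp m1 p1'.

Lemma powint_tonelli F : measurable_fun setT F ->
  powint mu p F = (\int[m1]_x powint m2 p (fun y => F (x, y)))%E.
Proof.
move=> mF; rewrite /powint fubini_tonelli1//; exact: measurable_powR_norm.
Qed.

Lemma measurable_powint_section F : measurable_fun setT F ->
  measurable_fun setT (fun x => powint m2 p (fun y => F (x, y))).
Proof.
move=> mF; apply: (measurable_fun_fubini_tonelli_F (fun z => (`|F z| `^ p)%:E)) => //.
exact: measurable_powR_norm.
Qed.

Lemma Lp_section_ae F : Lp mu p F ->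
  {ae m1, forall x, Lp m2 p (fun y => F (x, y))}.
Proof.
move=> /(Lp_powint _ p1')[mF]; rewrite powint_tonelli// => Foo.
have : m1.-integrable setT (fun x => powint m2 p (fun y => F (x, y))).
  apply/integrableP; split; first exact: measurable_powint_section.
  by under eq_integral do rewrite gee0_abs ?powint_ge0//.
move=> /(integrable_ae measurableT); apply: filterS => x /(_ I) Fx.
apply/(Lp_powint _ p1'); split; first exact: measurable_section.
by rewrite -ge0_fin_numE// powint_ge0.
Qed.

(** With [leb] for the second measure, [slice leb phi] is the operator I_phi. *)
Definition slice (k : T2 -> R) F : T1 -> R := fun x => \int[m2]_y (F (x, y) * k y).

Lemma measurable_slice k F : measurable_fun setT k -> measurable_fun setT F ->
  measurable_fun setT (slice k F).
Proof.
move=> mk mF; apply: (@measurable_Rintegral_section (fun z => F z * k z.2)).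
by apply: measurable_funM => //; exact: measurableT_comp.
Qed.

(** Hoelder's inequality in y for almost every x, then integration of the p-th powers over x. *)
Lemma powint_slice k F : Lp m2 q k -> Lp mu p F ->
  (powint m1 p (slice k F) <= (fine (Lp_norm m2 q k) `^ p)%:E * powint mu p F)%E.
Proof.
move=> Lk LF; have mF := Lp_measurable LF; have mk := Lp_measurable Lk.
have c0 : 0 <= fine (Lp_norm m2 q k) by exact: fine_ge0 (Lp_norm_ge0 _ _ _).
rewrite powint_tonelli// -ge0_integralZl//; last first.
- by rewrite lee_fin powR_ge0.
- by move=> x _; exact: powint_ge0.
- exact: measurable_powint_section.
apply: ae_ge0_le_integral => //.
- by apply: measurable_powR_norm; exact: measurable_slice.
- by move=> x _; apply: mule_ge0; [rewrite lee_fin powR_ge0|exact: powint_ge0].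
- exact: (measurable_funeM _ (measurable_powint_section mF)).
have := Lp_section_ae LF; apply: filterS => x LFx _.
have h := hoelder_le p1 pq LFx Lk.
have -> : powint m2 p (fun y => F (x, y)) =
    (fine (Lp_norm m2 p (fun y => F (x, y))) `^ p)%:E.
  by rewrite -poweR_EFin fineK ?Lp_norm_fin// Lp_norm_powint.
rewrite -EFinM lee_fin -powRM//; last exact: fine_ge0 (Lp_norm_ge0 _ _ _).
apply: ge0_ler_powR; rewrite ?nnegrE ?(ltW p0)// ?mulr_ge0//.
  exact: fine_ge0 (Lp_norm_ge0 _ _ _).
by rewrite -lee_fin EFinM !fineK ?Lp_norm_fin// muleC.
Qed.

Lemma Lp_slice k F : Lp m2 q k -> Lp mu p F -> Lp m1 p (slice k F).
Proof.
move=> Lk LF; apply/(Lp_powint _ p1'); split.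
  exact: measurable_slice (Lp_measurable Lk) (Lp_measurable LF).
apply: (le_lt_trans (powint_slice Lk LF)).
have /(Lp_powint _ p1')[_ Foo] := LF.
by rewrite lte_mul_pinfty// lee_fin powR_ge0.
Qed.

Lemma Lp_norm_slice k F : Lp m2 q k -> Lp mu p F ->
  (Lp_norm m1 p (slice k F) <= Lp_norm m2 q k * Lp_norm mu p F)%E.
Proof.
move=> Lk LF; have c0 : 0 <= fine (Lp_norm m2 q k) by exact: fine_ge0 (Lp_norm_ge0 _ _ _).
have F0 : 0 <= fine (Lp_norm mu p F) by exact: fine_ge0 (Lp_norm_ge0 _ _ _).
rewrite -(fineK (Lp_norm_fin Lk)) -(fineK (Lp_norm_fin LF)) -EFinM.
apply/(Lp_norm_pow m1 p1'); first exact: mulr_ge0.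
rewrite powRM// EFinM -[X in (_ * X)%E]poweR_EFin fineK ?Lp_norm_fin//.
by rewrite Lp_norm_powint//; exact: powint_slice.
Qed.

Lemma slice_linear_ae k a F G : Lp m2 q k -> Lp mu p F -> Lp mu p G ->
  slice k (a *: F + G) = a *: slice k F + slice k G %[ae m1].
Proof.
move=> Lk LF LG; have := Lp_section_ae LF; have := Lp_section_ae LG.
apply: filterS2 => x LGx LFx _; rewrite !fctE /slice.
have [h _] := pairing_functional p1 pq Lk.
exact: (h a _ _ LFx LGx).
Qed.

Lemma slice_linear_kernel_ae k k' a F : Lp m2 q k -> Lp m2 q k' -> Lp mu p F ->
  slice (a *: k + k') F = a *: slice k F + slice k' F %[ae m1].
Proof.
move=> Lk Lk' LF; have := Lp_section_ae LF.
apply: filterS => x LFx _; rewrite !fctE /slice.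
have [h _] := pairing_functional q1 qp LFx.
have E (k0 : T2 -> R) : \int[m2]_y (F (x, y) * k0 y) = \int[m2]_y (k0 y * F (x, y)).
  by apply: eq_Rintegral => y _; rewrite mulrC.
by rewrite !E; exact: h.
Qed.

Lemma slice_operator k : Lp m2 q k ->
  bounded_operator (Lp mu p) (Lp_norm mu p) (Lp m1 p) (Lp_norm m1 p) (slice k).
Proof.
move=> Lk; split; first by move=> F LF; exact: Lp_slice.
- move=> a F G LF LG; have LS : Lp mu p (a *: F + G) by exact: sLmu.2.
  apply/(Lp_normB_ae m1 p1').
  + exact: Lp_measurable (Lp_slice Lk LS).
  + by apply: Lp_measurable; apply: sL1.2; exact: Lp_slice.
  + exact: slice_linear_ae.
- exists (fine (Lp_norm m2 q k)) => F LF.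
  by rewrite fineK ?Lp_norm_fin//; exact: Lp_norm_slice.
Qed.

Lemma slice_kernel_operator F : Lp mu p F ->
  bounded_operator (Lp m2 q) (Lp_norm m2 q) (Lp m1 p) (Lp_norm m1 p) (slice ^~ F).
Proof.
move=> LF; split; first by move=> k Lk; exact: Lp_slice.
- move=> a k k' Lk Lk'.
  have LS : Lp m2 q (a *: k + k') by exact: (subspace_Lp m2 q1').2.
  apply/(Lp_normB_ae m1 p1').
  + exact: Lp_measurable (Lp_slice LS LF).
  + by apply: Lp_measurable; apply: sL1.2; exact: Lp_slice.
  + exact: slice_linear_kernel_ae.
- exists (fine (Lp_norm mu p F)) => k Lk.
  by rewrite fineK ?Lp_norm_fin// muleC; exact: Lp_norm_slice.
Qed.

Definition tensor (a : T1 -> R) (b : T2 -> R) : T1 * T2 -> R :=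
  fun z => a z.1 * b z.2.

Lemma measurable_tensor a b : measurable_fun setT a -> measurable_fun setT b ->
  measurable_fun setT (tensor a b).
Proof. by move=> ma mb; apply: measurable_funM; exact: measurableT_comp. Qed.

Lemma powint_tensor a b : measurable_fun setT a -> measurable_fun setT b ->
  powint mu p (tensor a b) = (powint m1 p a * powint m2 p b)%E.
Proof.
move=> ma mb; rewrite powint_tonelli; last exact: measurable_tensor.
under eq_integral => x _.
  rewrite (_ : powint _ _ _ = (`|a x| `^ p)%:E * powint m2 p b)%E; last first.
    rewrite /powint -ge0_integralZl//; last exact: measurable_powR_norm.
    by apply: eq_integral => y _; rewrite /tensor/= normrM powRM// EFinM.
  over.
rewrite -ge0_integralZr//; [exact: measurable_powR_norm|exact: powint_ge0].
Qed.

Lemma Lp_norm_tensor a b : measurable_fun setT a -> measurable_fun setT b ->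
  Lp_norm mu p (tensor a b) = (Lp_norm m1 p a * Lp_norm m2 p b)%E.
Proof.
move=> ma mb; rewrite !Lp_normE powint_tensor// poweRM//; exact: powint_ge0.
Qed.

Lemma Lp_tensor a b : Lp m1 p a -> Lp m2 p b -> Lp mu p (tensor a b).
Proof.
move=> La Lb; apply/LpP; split.
  exact: measurable_tensor (Lp_measurable La) (Lp_measurable Lb).
rewrite Lp_norm_tensor; [|exact: Lp_measurable La|exact: Lp_measurable Lb].
by rewrite -ge0_fin_numE ?mule_ge0 ?Lp_norm_ge0// fin_numM// Lp_norm_fin.
Qed.

Lemma tensor_operator1 b : Lp m2 p b ->
  bounded_operator (Lp m1 p) (Lp_norm m1 p) (Lp mu p) (Lp_norm mu p) (tensor ^~ b).
Proof.
move=> Lb; split; first by move=> a La; exact: Lp_tensor.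
- move=> c a a' _ _; rewrite (_ : _ - _ = 0) ?(sn0 snmu)//.
  apply/funext => z.
  change ((c * a z.1 + a' z.1) * b z.2 - (c * (a z.1 * b z.2) + a' z.1 * b z.2) = 0).
  by ring.
- exists (fine (Lp_norm m2 p b)) => a La.
  by rewrite (Lp_norm_tensor (Lp_measurable La) (Lp_measurable Lb)) fineK ?Lp_norm_fin// muleC.
Qed.

Lemma tensor_operator2 a : Lp m1 p a ->
  bounded_operator (Lp m2 p) (Lp_norm m2 p) (Lp mu p) (Lp_norm mu p) (tensor a).
Proof.
move=> La; split; first by move=> b Lb; exact: Lp_tensor.
- move=> c b b' _ _; rewrite (_ : _ - _ = 0) ?(sn0 snmu)//.
  apply/funext => z.
  change (a z.1 * (c * b z.2 + b' z.2) - (c * (a z.1 * b z.2) + a z.1 * b' z.2) = 0).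
  by ring.
- exists (fine (Lp_norm m1 p a)) => b Lb.
  by rewrite (Lp_norm_tensor (Lp_measurable La) (Lp_measurable Lb)) fineK ?Lp_norm_fin.
Qed.

Lemma rectangles_dense X : closed_subspace (Lp mu p) (Lp_norm mu p) X ->
  (forall A B, measurable A -> (m1 A < +oo)%E -> measurable B -> (m2 B < +oo)%E ->
    X (tensor (\1_A) (\1_B))) -> X = Lp mu p.
Proof.
move=> Xc XAB.
have /sigma_finiteP[F [TF ndF Foo]] := sigma_finiteT m1.
have /sigma_finiteP[G [TG ndG Goo]] := sigma_finiteT m2.
have tensorE A B : tensor (\1_A) (\1_B) = \1_(A `*` B).
    apply/funext => -[x y]; rewrite /tensor !indicE/= in_setX/=.
  by case: (x \in A); rewrite ?mul1r ?mul0r.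
apply: (closed_subspace_generated p1' Xc
    (G := [set C | exists A, measurable A /\ exists B, measurable B /\ C = A `*` B])
    (D := fun k => F k `*` G k)).
- move=> _ _ [A [mA [B [mB ->]]]] [A' [mA' [B' [mB' ->]]]]; rewrite -setXI.
  exists (A `&` A'); split; first exact: measurableI.
  by exists (B `&` B'); split => //; exact: measurableI.
- by move=> _ [A [mA [B [mB ->]]]]; exact: measurableX.
- move=> A mA; exists A; last by apply: aeW => x _.
  move: mA; rewrite measurable_prod_measurableType; apply: sub_sigma_algebra2.
  by move=> _ [B mB [C mC <-]]; exists B; split => //; exists C.
- rewrite -setXTT TF TG predeqE => -[x y]; split.
    by move=> [n _ []/= ? ?]; split; exists n.
  move=> [/= [n _ Fnx] [k _ Gky]]; exists (maxn n k) => //; split.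
  + by move: x Fnx; exact/subsetPset/ndF/leq_maxl.
  + by move: y Gky; exact/subsetPset/ndG/leq_maxr.
- move=> m n mn; have /subsetPset h1 := ndF _ _ mn.
  have /subsetPset h2 := ndG _ _ mn.
  by apply/subsetPset => z [/h1 ? /h2 ?]; split.
- move=> k; have [? ?] := Foo k; have [? ?] := Goo k.
  split; first exact: measurableX.
  have E : (m1 \x m2)%E (F k `*` G k) = (m1 (F k) * m2 (G k))%E.
    exact: product_measure1E.
  by rewrite /= E lte_mul_pinfty// ge0_fin_numE.
- move=> k; have [? ?] := Foo k; have [? ?] := Goo k.
  by rewrite -tensorE; exact: XAB.
- move=> _ k [A [mA [B [mB ->]]]]; have [mF Fk] := Foo k; have [mG Gk] := Goo k.
  rewrite -setXI -tensorE; apply: XAB; try exact: measurableI.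
    by rewrite (le_lt_trans _ Fk)// le_measure ?inE//; exact: measurableI.
  by rewrite (le_lt_trans _ Gk)// le_measure ?inE//; exact: measurableI.
Qed.

(** Totality is used one variable at a time: with [f j] fixed the first factor becomes arbitrary,
    then with this factor fixed the second one does. Rectangles are a special case and suffice. *)
Lemma total_family_product (I J : Type) (e : I -> T1 -> R) (f : J -> T2 -> R) :
  total_family m1 p e -> total_family m2 p f ->
  total_family mu p (fun ij : I * J => tensor (e ij.1) (f ij.2)).
Proof.
move=> [Le tote] [Lf totf]; split; first by move=> [i j]; exact: Lp_tensor.
move=> X Xc Xef.
have step1 j : [set a | Lp m1 p a /\ X (tensor a (f j))] = Lp m1 p.
  apply: tote; first exact: (closed_subspace_preimage sn1 snmu (tensor_operator1 (Lf j)) Xc).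
  by move=> i; split => //; exact: (Xef (i, j)).
have step2 a : Lp m1 p a -> [set b | Lp m2 p b /\ X (tensor a b)] = Lp m2 p.
  move=> La; apply: totf.
    exact: (closed_subspace_preimage sn2 snmu (tensor_operator2 La) Xc).
  by move=> j; split => //; have : Lp m1 p a by []; rewrite -(step1 j) => -[].
apply: rectangles_dense => // A B mA Aoo mB Boo.
have : Lp m2 p (\1_B) by exact: Lp_indic.
by rewrite -(step2 (\1_A)) => [[]//|]; exact: Lp_indic.
Qed.

End Lp_product.
End product_space.

Lemma split_sum {V : zmodType} n n' (F : 'I_n -> V) (G : 'I_n' -> V) :
  \sum_(k < n + n') (match fintype.split k with inl i => F i | inr i => G i end) =
  \sum_(k < n) F k + \sum_(k < n') G k.
Proof.
rewrite big_split_ord/=; congr (_ + _); apply: eq_bigr => i _.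
  by have := unsplitK (inl i : 'I_n + 'I_n') => /= ->.
by have := unsplitK (inr i : 'I_n + 'I_n') => /= ->.
Qed.

Lemma subspace_tensor_algV {R : realType} (S T : Type) m
    (X : set ('I_m -> S -> R)) (Y : set (T -> R)) :
  (forall (a : R) f, X f -> X (a *: f)) -> subspace (tensor_algV X Y).
Proof.
move=> XZ; split.
  exists 0%N, (fun=> fun=> fun=> 0), (fun=> fun=> 0); split; [by case|by case|].
  by apply/funext => i; apply/funext => z; rewrite big_ord0.
move=> a _ _ [n [F [g [XF Yg ->]]]] [n' [F' [g' [XF' Yg' ->]]]].
exists (n + n')%N, (fun k => match fintype.split k with inl i => a *: F i | inr i => F' i end),
  (fun k => match fintype.split k with inl i => g i | inr i => g' i end); split.
- by move=> k; case: (fintype.split _) => i //; exact: XZ.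
- by move=> k; case: (fintype.split _).
apply/funext => i; apply/funext => z.
transitivity (a * (\sum_(k < n) F k i z.1 * g k z.2) + \sum_(k < n') F' k i z.1 * g' k z.2) => //.
rewrite mulr_sumr -split_sum.
by apply: eq_bigr => k _; case: (fintype.split _) => j //=; rewrite mulrA.
Qed.

Lemma subspace_tensor_alg {R : realType} (S T : Type)
    (X : set (S -> R)) (Y : set (T -> R)) :
  (forall (a : R) f, X f -> X (a *: f)) -> subspace (tensor_alg X Y).
Proof.
move=> XZ; split.
  exists 0%N, (fun=> fun=> 0), (fun=> fun=> 0); split; [by case|by case|].
  by apply/funext => z; rewrite big_ord0.
move=> a _ _ [n [F [g [XF Yg ->]]]] [n' [F' [g' [XF' Yg' ->]]]].
exists (n + n')%N, (fun k => match fintype.split k with inl i => a *: F i | inr i => F' i end),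
  (fun k => match fintype.split k with inl i => g i | inr i => g' i end); split.
- by move=> k; case: (fintype.split _) => i //; exact: XZ.
- by move=> k; case: (fintype.split _).
apply/funext => z.
transitivity (a * (\sum_(k < n) F k z.1 * g k z.2) + \sum_(k < n') F' k z.1 * g' k z.2) => //.
rewrite mulr_sumr -split_sum.
by apply: eq_bigr => k _; case: (fintype.split _) => j //=; rewrite mulrA.
Qed.

Lemma tensor_alg1 {R : realType} (S T : Type)
    (X : set (S -> R)) (Y : set (T -> R)) a b : X a -> Y b ->
  tensor_alg X Y (fun z => a z.1 * b z.2).
Proof.
move=> Xa Yb; exists 1%N, (fun=> a), (fun=> b); split => //.
by apply/funext => z; rewrite big_ord1.
Qed.

Lemma tensor_algV1 {R : realType} (S T : Type) m
    (X : set ('I_m -> S -> R)) (Y : set (T -> R)) a b : X a -> Y b ->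
  tensor_algV X Y (fun i z => a i z.1 * b z.2).
Proof.
move=> Xa Yb; exists 1%N, (fun=> a), (fun=> b); split => //.
by apply/funext => i; apply/funext => z; rewrite big_ord1.
Qed.

(** * Averaging over finitely many sets in one variable *)

Section averaging.
Context {R : realType} {d1 d2} {T1 : measurableType d1} {T2 : measurableType d2}.
Variables (m1 : {sigma_finite_measure set T1 -> \bar R}).
Variables (m2 : {sigma_finite_measure set T2 -> \bar R}).
Local Notation mu := (m1 \x m2)%E.
Variables (p q : R).
Hypothesis p1 : 1 < p.
Hypothesis pq : p^-1 + q^-1 = 1.
Let q1 : 1 < q. Proof. exact: conjugate_gt1 pq. Qed.
Let p1' : 1 <= p. Proof. exact: ltW. Qed.
Let q1' : 1 <= q. Proof. exact: ltW. Qed.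
Let p0 : 0 < p. Proof. exact: lt_trans p1. Qed.
Let q0 : 0 < q. Proof. exact: lt_trans q1. Qed.
Let snmu := seminormed_Lp mu p1'.
Let sLmu := subspace_Lp mu p1'.

Definition finite_measurable (B : set T2) := measurable B /\ (m2 B < +oo)%E.

Definition average B (F : T1 * T2 -> R) : T1 -> R :=
  (fine (m2 B))^-1 *: slice m2 (\1_B) F.

(** For disjoint sets B the sum of these operators is the conditional expectation in the second
    variable given the partition, set to 0 off the union. A null set B contributes 0, the inverse of
    0 being 0. *)
Definition averaging B F : T1 * T2 -> R := tensor (average B F) (\1_B).

Lemma average_operator B : finite_measurable B ->
  bounded_operator (Lp mu p) (Lp_norm mu p) (Lp m1 p) (Lp_norm m1 p) (average B).
Proof.
move=> [mB Boo]; have LB : Lp m2 q (\1_B) by exact: Lp_indic.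
have sn1 := seminormed_Lp m1 p1'.
apply: (bounded_operator_comp snmu sn1 sn1 (slice_operator m1 p1 pq LB)).
split; first by move=> f; exact: (subspaceZ _ (sn_sub sn1)).
- move=> a f g _ _; rewrite (_ : _ - _ = 0) ?(sn0 sn1)//.
  by rewrite scalerDr !scalerA [_ * a]mulrC subrr.
- by exists `|(fine (m2 B))^-1| => f Lf; rewrite (snZ sn1).
Qed.

Lemma averaging_operator B : finite_measurable B ->
  bounded_operator (Lp mu p) (Lp_norm mu p) (Lp mu p) (Lp_norm mu p) (averaging B).
Proof.
move=> fB; have LB : Lp m2 p (\1_B) by apply: Lp_indic => //; case: fB.
exact: (bounded_operator_comp snmu (seminormed_Lp m1 p1') snmu
  (average_operator fB) (tensor_operator1 m1 p1 LB)).
Qed.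

(* Jensen's inequality for the normalized measure on B, in product form *)
Lemma powint_averaging B F : finite_measurable B -> Lp mu p F ->
  (powint mu p (averaging B F) <= powint mu p (fun z => F z * \1_B z.2)%R)%E.
Proof.
move=> [mB Boo] LF; have LB : Lp m2 q (\1_B) by exact: Lp_indic.
have mF := Lp_measurable LF.
have LFB : Lp mu p (fun z => F z * \1_B z.2).
  apply: (Lp_Mbounded p1' LF (c := 1)).
    by apply: measurableT_comp => //; exact: measurable_indic.
  by move=> z; rewrite indicE; case: (_ \in _); rewrite ?normr1 ?normr0.
have mS := measurable_slice m2 (Lp_measurable LB) mF.
rewrite powint_tensor//; last first.
  exact: (@measurable_funM _ _ _ _ (cst (fine (m2 B))^-1)).
have sliceE : slice m2 (\1_B) F = slice m2 (\1_B) (fun z => F z * \1_B z.2).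
  apply/funext => x; apply: eq_Rintegral => y _; rewrite -mulrA; congr (_ * _).
  by rewrite indicE; case: (_ \in _); rewrite ?mulr1 ?mulr0.
have := powint_slice p1 pq LB LFB; rewrite -sliceE.
have [b bE b0] : exists2 b : R, m2 B = b%:E & 0 <= b.
  by exists (fine (m2 B)); rewrite ?fineK ?ge0_fin_numE// fine_ge0.
have bI r : 1 < r -> powint m2 r (\1_B) = b%:E.
  by move=> r1; rewrite (powint_indic m2 (ltW r1))//= bE.
rewrite Lp_normE !bI// poweR_EFin/= -powRrM => h.
have -> : powint m1 p (average B F) = (((b^-1) `^ p)%:E * powint m1 p (slice m2 (\1_B) F))%E.
  rewrite /average bE/= /powint -ge0_integralZl//; last 2 first.
  - exact: measurable_powR_norm.
  - by rewrite lee_fin powR_ge0.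
  apply: eq_integral => x _; rewrite -EFinM; congr EFin.
  by rewrite normrM powRM// ger0_norm// invr_ge0.
have [b00|bn0] := eqVneq b 0; first by rewrite b00 mule0 powint_ge0.
have bp : 0 < b by rewrite lt_neqAle eq_sym bn0.
rewrite muleC muleA -EFinM.
apply: (@le_trans _ _ ((b * b^-1 `^ p)%:E * ((b `^ (q^-1 * p))%:E *
  powint mu p (fun z => (F z * \1_B z.2)%R)))%E).
  by rewrite lee_wpmul2l// lee_fin mulr_ge0// powR_ge0.
(* The exponents of the measure b of B add up to 1 - p + p / q = 0. *)
rewrite muleA -EFinM (_ : _ * _ = 1) ?mul1e//.
rewrite -powR_inv1 ?ltW// -powRrM -{1}(powRr1 (ltW bp)) -!powRD; last 2 first.
- by rewrite bn0 implybT.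
- by rewrite bn0 implybT.
rewrite (_ : _ + _ = 0) ?powRr0//.
have -> : q^-1 = 1 - p^-1 by move: pq; lra.
by rewrite mulrBl mulVf ?gt_eqF//; ring.
Qed.

Section disjoint_family.
Variables (K : finType) (C : K -> set T2).
Hypothesis fC : forall s, finite_measurable (C s).
Hypothesis tC : forall s t y, C s y -> C t y -> s = t.

Let sum_averaging F : T1 * T2 -> R := \sum_s averaging (C s) F.

Let powR_disjoint (a : K -> R) y :
  `|\sum_s a s * \1_(C s) y| `^ p = \sum_s `|a s * \1_(C s) y| `^ p.
Proof.
have [[s Csy]|nC] := pselect (exists s, C s y).
  rewrite (bigD1 s)//= [RHS](bigD1 s)//= !big1 ?addr0// => t ts;
    rewrite indicE memNset ?mulr0 ?normr0 ?powR0 ?gt_eqF// => Cty;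
    by rewrite (tC Csy Cty) eqxx in ts.
rewrite !big1 ?normr0 ?powR0 ?gt_eqF// => s _;
  by rewrite indicE memNset ?mulr0 ?normr0 ?powR0 ?gt_eqF// => Csy; apply: nC; exists s.
Qed.

(** At each point at most one summand is nonzero, so p-th powers add up on both sides and
    [powint_averaging] applies to each set. *)
Lemma averaging_contraction F : Lp mu p F ->
  (Lp_norm mu p (sum_averaging F) <= Lp_norm mu p F)%E.
Proof.
move=> LF; have mF := Lp_measurable LF.
have LA s : Lp mu p (averaging (C s) F) by have [+ _ _] := averaging_operator (fC s); exact.
have LS : Lp mu p (sum_averaging F) by apply: subspace_sum.
rewrite !Lp_normE; apply: gt0_ler_poweR; rewrite ?in_itv/= ?leey ?powint_ge0//.
  by rewrite invr_ge0 ltW.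
have mterm s : measurable_fun setT (fun z => (`|F z * \1_(C s) z.2| `^ p)%:E).
  apply: measurable_powR_norm; apply: measurable_funM => //.
  by apply: measurableT_comp => //; apply: measurable_indic; case: (fC s).
apply: (@le_trans _ _ (\sum_s powint mu p (fun z => F z * \1_(C s) z.2)%R)%E).
  rewrite (_ : powint _ _ _ = \sum_s powint mu p (averaging (C s) F))%E.
    by apply: lee_sum => s _; exact: powint_averaging.
  rewrite /powint -ge0_integral_sum//; last first.
    by move=> s; apply: measurable_powR_norm; exact: Lp_measurable (LA s).
  apply: eq_integral => z _; rewrite sumEFin /sum_averaging fct_sumE; congr EFin.
  exact: powR_disjoint.
rewrite /powint -ge0_integral_sum//; apply: ge0_le_integral => //.
- by move=> z _; apply: sume_ge0 => s _; rewrite lee_fin powR_ge0.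
- by apply: emeasurable_sum => s.
- exact: measurable_powR_norm.
- move=> z _; rewrite sumEFin lee_fin -powR_disjoint.
  apply: ge0_ler_powR; rewrite ?nnegrE ?(ltW p0)//.
  rewrite -mulr_sumr normrM ler_piMr//.
  have [[s Csz]|nC] := pselect (exists s, C s z.2).
    rewrite (bigD1 s)//= indicE mem_set// big1 ?addr0 ?normr1// => t ts.
    by rewrite indicE memNset// => Ctz; rewrite (tC Csz Ctz) eqxx in ts.
  by rewrite big1 ?normr0// => s _; rewrite indicE memNset// => Csz; apply: nC; exists s.
Qed.

Lemma averaging_tensor s f : Lp m1 p f ->
  Lp_norm mu p (sum_averaging (tensor f (\1_(C s))) - tensor f (\1_(C s))) = 0%E.
Proof.
move=> Lf; have [mC Coo] := fC s; set t := tensor f _.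
have Lt : Lp mu p t by apply: Lp_tensor => //; exact: Lp_indic.
have LA r : Lp mu p (averaging (C r) t) by have [+ _ _] := averaging_operator (fC r); exact.
have [b bE b0] : exists2 b : R, m2 (C s) = b%:E & 0 <= b.
  by exists (fine (m2 (C s))); rewrite ?fineK ?ge0_fin_numE// fine_ge0.
have slice_t r x : slice m2 (\1_(C r)) t x = f x * ((s == r)%:R * b).
  rewrite /slice (_ : (fun y => _) = (fun y => f x * \1_(C s `&` C r) y)); last first.
    by apply/funext => y; rewrite /t /tensor/= -mulrA indicI.
  have mI : measurable (C s `&` C r) by apply: measurableI => //; case: (fC r).
  have Ioo : (m2 (C s `&` C r) < +oo)%E.
    by rewrite (le_lt_trans _ Coo)// le_measure ?inE//; exact: subIsetl.
  rewrite RintegralZl//; last first.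
    apply/integrableP; split; first exact/measurable_EFinP.
    under eq_integral do rewrite /= ger0_norm//.
    by rewrite integral_indic// setIT.
  congr (_ * _); rewrite /Rintegral integral_indic// setIT.
  have [<-|sr] := eqVneq s r; first by rewrite setIid /= bE mul1r.
  rewrite (_ : _ `&` _ = set0) ?measure0 ?mul0r//.
  by apply/seteqP; split => // y [/tC h /h]; apply/eqP.
(* On a null set [C s] averaging does not reproduce the tensor, but then the tensor itself has norm
   0. *)
have [b00|bn0] := eqVneq b 0.
  have Nt : Lp_norm mu p t = 0%E.
    rewrite (Lp_norm_tensor m1 m2 p (Lp_measurable Lf) (measurable_indic mC)).
    rewrite [X in (_ * X)%E]Lp_normE powint_indic//= bE b00 poweR_EFin powR0 ?mule0//.
    by rewrite invr_eq0 gt_eqF.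
  apply/eqP; rewrite eq_le (sn_ge0 snmu) andbT.
  have LS : Lp mu p (sum_averaging t) by apply: subspace_sum.
  by rewrite (le_trans (snB snmu LS Lt))// Nt adde0 -Nt averaging_contraction.
rewrite (_ : _ - _ = 0) ?(sn0 snmu)//; apply/funext => z.
rewrite !fctE /sum_averaging fct_sumE (bigD1 s)//= big1 => [|r rs].
  rewrite /averaging /average bE /tensor/= fctE slice_t eqxx mul1r addr0.
  by rewrite /GRing.scale/= mulrCA mulVf// mulr1 subrr.
by rewrite /averaging /average /tensor/= fctE slice_t eq_sym (negbTE rs)
  mul0r mulr0 scaler0 mul0r.
Qed.

End disjoint_family.

Section atoms.
Variables (L : finType) (B : L -> set T2) (S : set (set T2)).
Hypothesis SI : setI_closed S.
Hypothesis SC : forall A, S A -> S (~` A).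
Hypothesis S0 : S set0.
Hypothesis SB : forall k, S (B k).
Hypothesis mS : S `<=` measurable.
Hypothesis Boo : forall k, (m2 (B k) < +oo)%E.

(* the atom on which no B k holds may have infinite measure *)
Definition atom (s : {ffun L -> bool}) : set T2 :=
  if [exists k, s k] then [set y | forall k, s k = (y \in B k)] else set0.

Lemma atom_bigsetI s : atom s =
  if [exists k, s k] then \big[setI/setT]_(k : L) (if s k then B k else ~` B k)
  else set0.
Proof.
rewrite /atom; case: ifP => // _; apply/seteqP; split => y /=.
  move=> sy; rewrite -bigcap_seq => k _ /=; rewrite sy.
  by case: ifP; rewrite ?inE// => /negbT; rewrite notin_setE.
rewrite -bigcap_seq => sy k; have /= := sy k (mem_index_enum k).
by case: (s k) => h; apply/esym; [exact/mem_set|exact/memNset].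
Qed.

Lemma atom_closed s : S (atom s).
Proof.
rewrite atom_bigsetI; case: ifP => // _.
have ST : S setT by rewrite -setC0; exact: SC.
by elim/big_ind: _ => [//|A A'|k _]; [exact: SI|case: ifP => _; [exact: SB|exact/SC]].
Qed.

Lemma atom_finite s : finite_measurable (atom s).
Proof.
split; first exact/mS/atom_closed.
rewrite /atom; case: ifP => [/existsP[k sk]|_]; last by rewrite measure0.
apply: (le_lt_trans _ (Boo k)); apply: le_measure; rewrite ?inE; last first.
- by move=> y /= /(_ k); rewrite sk => /esym /set_mem.
- exact/mS/SB.
- have := mS (atom_closed s); rewrite /atom; case: ifP => // /negbT/negP; case.
  by apply/existsP; exists k.
Qed.

Lemma atom_inj s t y : atom s y -> atom t y -> s = t.
Proof.
rewrite /atom; case: ifP => // _; case: ifP => // _ /= sy ty.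
by apply/ffunP => k; rewrite sy ty.
Qed.

(** [B k] is the disjoint union of the atoms whose k-th bit is set; the excluded pattern, with no
    bit set, is never among them. *)
Lemma indic_atoms k : \1_(B k) = \sum_(s : {ffun L -> bool} | s k) (\1_(atom s) : T2 -> R).
Proof.
apply/funext => y; rewrite fct_sumE.
pose sy := [ffun k => y \in B k].
have [yB|yB] := boolP (y \in B k).
  rewrite indicE yB (bigD1 sy)/=; last by rewrite ffunE.
  rewrite indicE mem_set; last first.
    rewrite /atom ifT; first by move=> j; rewrite ffunE.
    by apply/existsP; exists k; rewrite ffunE.
  rewrite big1 ?addr0// => s /andP[sk ssy]; rewrite indicE memNset// /atom ifT.
    by move=> /= h; case/eqP: ssy; apply/ffunP => j; rewrite ffunE.
  by apply/existsP; exists k.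
rewrite indicE (negbTE yB) big1// => s sk; rewrite indicE memNset// /atom ifT.
  by move=> /= /(_ k); rewrite sk (negbTE yB).
by apply/existsP; exists k.
Qed.

Lemma averaging_fixed k f : Lp m1 p f ->
  Lp_norm mu p (\sum_s averaging (atom s) (tensor f (\1_(B k))) -
    tensor f (\1_(B k))) = 0%E.
Proof.
move=> Lf; have Latom s : Lp mu p (tensor f (\1_(atom s))).
  by apply: Lp_tensor => //; have [? ?] := atom_finite s; exact: Lp_indic.
have bA : bounded_operator (Lp mu p) (Lp_norm mu p) (Lp mu p) (Lp_norm mu p)
    (fun F => \sum_s averaging (atom s) F - F).
  apply: (bounded_operatorBid snmu); apply: (bounded_operator_sum snmu snmu) => s.
  exact/averaging_operator/atom_finite.
have Kc := closed_subspace_preimage snmu snmu bA (null_closed_subspace snmu).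
suff [_ []] : [set F | Lp mu p F /\ [set G | Lp mu p G /\ Lp_norm mu p G = 0%E]
  (\sum_s averaging (atom s) F - F)] (tensor f (\1_(B k))) by [].
have -> : tensor f (\1_(B k)) = \sum_(s : {ffun L -> bool} | s k) tensor f (\1_(atom s)).
  apply/funext => z; rewrite indic_atoms /tensor !fct_sumE mulr_sumr.
  by apply: eq_bigr.
have [_ sK _] := Kc; apply: subspace_sum => // s _; split => //; split.
  apply: (subspaceB sLmu) => //; apply: subspace_sum => // t _.
  by have [+ _ _] := averaging_operator (atom_finite t); exact.
exact: (averaging_tensor atom_finite atom_inj).
Qed.

End atoms.

(* The contraction E averaging over the atoms generated by the sets B fixes an
   approximant t of F, so that |F - E F| <= |F - t| + |E (t - F)|. *)
Lemma averaging_approximation m (S : set (set T2)) (F : 'I_m -> T1 * T2 -> R) (e : R) :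
  setI_closed S -> (forall A, S A -> S (~` A)) -> S set0 -> S `<=` measurable ->
  (forall i, norm_closure (Lp mu p) (Lp_norm mu p)
    (tensor_alg (Lp m1 p) [set b | exists2 B, S B /\ (m2 B < +oo)%E & b = \1_B]) (F i)) ->
  0 < e ->
  exists (K : finType) (C : K -> set T2), (forall s, S (C s) /\ finite_measurable (C s)) /\
    forall i, (Lp_norm mu p (F i - \sum_s averaging (C s) (F i))%R < e%:E)%E.
Proof.
move=> SI SC S0 mS FA e0; have e20 : 0 < e / 2 by rewrite divr_gt0.
have LF i : Lp mu p (F i) by case: (FA i).
have /choice[t tF] i : exists t : {n & (('I_n -> T1 -> R) * ('I_n -> set T2))%type},
    [/\ forall k, Lp m1 p ((projT2 t).1 k),
        forall k, S ((projT2 t).2 k) /\ (m2 ((projT2 t).2 k) < +oo)%E &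
        (Lp_norm mu p (F i - \sum_k tensor ((projT2 t).1 k) (\1_((projT2 t).2 k)))%R
          < (e / 2)%:E)%E].
  have [_ /(_ _ e20)[_ [n [f [g [Lf Lg ->]]]] Ft]] := FA i.
  have /choice[B gB] k : exists B, [/\ S B, (m2 B < +oo)%E & g k = \1_B].
    by have [B [? ?] ?] := Lg k; exists B.
  exists (existT _ n (f, B)); split => //= [k|]; first by have [? ? _] := gB k.
  congr (_ < _)%E: Ft; congr (Lp_norm _ _ (_ - _)); apply/funext => z.
  by rewrite fct_sumE; apply: eq_bigr => k _; have [_ _ ->] := gB k.
(* All sets of all m approximants are put into one family, so that a single partition serves every
   component. *)
pose L := {i : 'I_m & 'I_(projT1 (t i))}.
pose B (l : L) := (projT2 (t (tag l))).2 (tagged l).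
have SB l : S (B l) by have [_ /(_ (tagged l))[]] := tF (tag l).
have Boo l : (m2 (B l) < +oo)%E by have [_ /(_ (tagged l))[]] := tF (tag l).
have fC := atom_finite SI SC S0 SB mS Boo.
exists {ffun L -> bool}, (atom B); split => [s|i].
  by split; [exact: (atom_closed SI SC S0 SB)|exact: fC].
pose E F := \sum_s averaging (atom B s) F.
have bE : bounded_operator (Lp mu p) (Lp_norm mu p) (Lp mu p) (Lp_norm mu p) E.
  by apply: (bounded_operator_sum snmu snmu) => s; exact: averaging_operator.
have LE G : Lp mu p G -> Lp mu p (E G) by have [+ _ _] := bE; exact.
have [Lf _ Ft] := tF i; set u := \sum_k _ in Ft.
have Lterm k : Lp mu p (tensor ((projT2 (t i)).1 k) (\1_((projT2 (t i)).2 k))).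
  apply: Lp_tensor => //; apply: Lp_indic => //; last exact: (Boo (Tagged _ k)).
  exact/mS/(SB (Tagged _ k)).
have Lu : Lp mu p u by apply: subspace_sum.
have uE : Lp_norm mu p (E u - u) = 0%E.
  have Kc := closed_subspace_preimage snmu snmu (bounded_operatorBid snmu bE)
    (null_closed_subspace snmu).
  suff [_ []] : [set F | Lp mu p F /\ [set G | Lp mu p G /\ Lp_norm mu p G = 0%E]
    (E F - F)] u by [].
  have [_ sK _] := Kc; apply: subspace_sum => // k _; split; first exact: Lterm.
  split; first by apply: (subspaceB sLmu) => //; exact: LE.
  exact: (averaging_fixed SI SC S0 SB mS Boo
    (Tagged (fun i => 'I_(projT1 (t i))) k) (Lf k)).
have -> : e = e / 2 + e / 2 by rewrite -splitr.
rewrite EFinD; apply: (le_lt_trans (sn_triangle snmu (LF i) Lu (LE _ (LF i)))).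
apply: lteD => //; apply: (le_lt_trans (sn_triangle snmu Lu (LE _ Lu) (LE _ (LF i)))).
rewrite (snBC snmu Lu (LE _ Lu)) uE add0e; apply: (le_lt_trans _ Ft).
have LuF := subspaceB sLmu Lu (LF i).
rewrite (snBC snmu (LF i) Lu) (sn_eqN snmu (g := E (u - F i))).
- exact: (averaging_contraction fC (@atom_inj _ _)).
- by apply: (subspaceB sLmu); exact: LE.
- exact: LE.
- rewrite (snBC snmu); [exact: (bounded_operatorB bE)|..|exact: LE].
  by apply: (subspaceB sLmu); exact: LE.
Qed.

(** Averages are slices against indicator functions, so the vector of averages of the components of
    F over one set lies in X. Averaging over a partition thus produces elements of the algebraic
    tensor product. The partition must be the same for all components, as X is a space of
    vectors. *)
Lemma tensor_closure_slices m (X : set ('I_m -> T1 -> R)) (I : Type) (k : I -> T2 -> R)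
    (F : 'I_m -> T1 * T2 -> R) :
  closed_subspace (@LpV _ _ _ m1 p m) (@LpV_norm _ _ _ m1 p m) X ->
  total_family m2 q k -> LpV mu p F ->
  (forall j, X (fun i => slice m2 (k j) (F i))) ->
  norm_closure (@LpV _ _ _ mu p m) (@LpV_norm _ _ _ mu p m)
    (tensor_algV X (Lp m2 p)) F.
Proof.
move=> Xc [Lk tk] LF XF; split => // e e0.
have {tk}XF g : Lp m2 q g -> X (fun i => slice m2 g (F i)).
  have bF : bounded_operator (Lp m2 q) (Lp_norm m2 q) (@LpV _ _ _ m1 p m)
      (@LpV_norm _ _ _ m1 p m) (fun g i => slice m2 g (F i)).
    apply: (LpV_operator (seminormed_Lp m2 q1')) => i.
    exact: (slice_kernel_operator p1 pq (LF i)).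
  have Kc := closed_subspace_preimage (seminormed_Lp m2 q1')
    (seminormed_LpV m1 p1' m) bF Xc.
  by rewrite -(tk _ Kc) => [[]//|j]; split; [exact: Lk|exact: XF].
have [XE sX _] := Xc.
have em0 : 0 < e / m.+1%:R by rewrite divr_gt0.
have dense i : norm_closure (Lp mu p) (Lp_norm mu p) (tensor_alg (Lp m1 p)
    [set b | exists2 B, measurable B /\ (m2 B < +oo)%E & b = \1_B]) (F i).
  set Y := tensor_alg _ _.
  have YL : Y `<=` Lp mu p.
    move=> _ [n [f [g [Lf Lg ->]]]].
    rewrite (_ : (fun z => _) = \sum_k tensor (f k) (g k)); last first.
      by apply/funext => z; rewrite fct_sumE.
    apply: subspace_sum => // j _; apply: Lp_tensor => //.
    by have [B [mB Boo] ->] := Lg j; exact: Lp_indic.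
  have Yc : closed_subspace (Lp mu p) (Lp_norm mu p) (norm_closure (Lp mu p) (Lp_norm mu p) Y).
    apply: (norm_closure_subspace snmu) => //; apply: subspace_tensor_alg.
    by move=> a f; exact: (subspaceZ _ (subspace_Lp m1 p1')).
  rewrite (rectangles_dense p1 Yc) => [|A B mA Aoo mB Boo]; first exact: LF.
  apply: (sub_norm_closure snmu YL); apply: tensor_alg1; first exact: Lp_indic.
  by exists B.
have [K [C [mC FC]]] := averaging_approximation (@measurableI _ _) (@measurableC _ _)
  measurable0 (@subset_refl _ _) dense em0.
pose t i := \sum_s averaging (C s) (F i).
exists t.
  have sT : subspace (tensor_algV X (Lp m2 p)).
    by apply: subspace_tensor_algV => a f; exact: (subspaceZ _ sX).
  rewrite (_ : t = \sum_s (fun i => averaging (C s) (F i))); last first.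
    by apply/funext => i; rewrite fct_sumE.
  apply: subspace_sum => // s _; have [_ [mCs Csoo]] := mC s.
  apply: (tensor_algV1 (a := fun i => average (C s) (F i))); last exact: Lp_indic.
  by apply: (subspaceZ _ sX); apply: XF; exact: Lp_indic.
(* The m bounds e / (m + 1) add up to less than e, also for m = 0. *)
rewrite /LpV_norm; apply: (@le_lt_trans _ _ (\sum_(i < m) (e / m.+1%:R)%:E)%E).
  by apply: lee_sum => i _; exact/ltW/FC.
rewrite sumEFin sumr_const card_ord lte_fin -(mulr_natr (e / _)) -mulrA gtr_pMr//.
by rewrite mulrC ltr_pdivrMr// mul1r ltr_nat.
Qed.

End averaging.

(** * Lebesgue measure *)

Section product_scaling.
Context {R : realType} {d1 d2} {T1 : measurableType d1} {T2 : measurableType d2}.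
Variables (m1 : {measure set T1 -> \bar R}) (m2 : {sigma_finite_measure set T2 -> \bar R}).
Variables (f1 : T1 -> T1) (f2 : T2 -> T2) (c1 c2 : R).
Hypotheses (c10 : 0 <= c1) (c20 : 0 <= c2).
Hypotheses (mf1 : measurable_fun setT f1) (mf2 : measurable_fun setT f2).
Hypothesis f1E : forall A, measurable A -> m1 (f1 @^-1` A) = (c1%:E * m1 A)%E.
Hypothesis f2E : forall A, measurable A -> m2 (f2 @^-1` A) = (c2%:E * m2 A)%E.

Lemma product_measure_scaling B : measurable B ->
  (m1 \x m2)%E ((fun w => (f1 w.1, f2 w.2)) @^-1` B) = ((c1 * c2)%:E * (m1 \x m2) B)%E.
Proof.
move=> mB; rewrite /product_measure1.
have mphi : measurable_fun setT (m2 \o xsection B) by exact: measurable_fun_xsection.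
transitivity (\int[m1]_x (c2%:E * ((m2 \o xsection B) \o f1) x))%E.
  apply: eq_integral => x _ /=.
  have -> : xsection ((fun w => (f1 w.1, f2 w.2)) @^-1` B) x = f2 @^-1` xsection B (f1 x).
    by apply/seteqP; split => y; rewrite /xsection/= !inE.
  by rewrite f2E//; exact: measurable_xsection.
rewrite ge0_integralZl_EFin//; last exact: measurableT_comp.
rewrite mulrC EFinM -muleA; congr (_ * _)%E.
rewrite -[X in (\int[m1]_(x in X) _)%E](preimage_setT f1) -ge0_integral_pushforward//.
rewrite -[RHS](ge0_integral_mscale _ _ (NngNum c10))//.
by apply: eq_measure_integral => A mA _; rewrite /= /pushforward f1E.
Qed.

End product_scaling.

(** The pushforward scaled by |a| has the values of Lebesgue measure on the intervals ]x, y], which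
    determine it. For a < 0 the preimages are closed at the other end, which does not change their
    length. *)
Lemma lebesgue_measure_affine {R : realType} (a z : R) : a != 0 ->
  forall A, measurable A ->
  lebesgue_measure ((fun t => a * t + z) @^-1` A) = ((`|a|^-1)%:E * lebesgue_measure A)%E.
Proof.
move=> a0 A mA; pose f (t : measurableTypeR R) : measurableTypeR R := a * t + z.
rewrite -/f.
have mf : measurable_fun setT f by apply: measurable_funD => //; exact: measurable_funM.
have na0 : 0 <= `|a| by [].
pose nu : {measure set (measurableTypeR R) -> \bar R} :=
  mscale (NngNum na0) (measure_function_pushforward__canonical__measure_function_Measure
    (@lebesgue_measure R) mf).
have -> : lebesgue_measure A = nu A.
  apply: lebesgue_measure_unique => // _ [[x y] _ <-].
  rewrite /nu/= /mscale/= /pushforward.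
  have [an|ap|] := ltrgtP a 0; last by move/eqP: a0.
  - rewrite (_ : f @^-1` _ = `[(y - z) / a, (x - z) / a[%classic); last first.
      apply/seteqP; split => t /=; rewrite !in_itv/= /f.
        by rewrite ler_ndivrMr// ltr_ndivlMr// lerBrDr ltrBlDr !(mulrC t) andbC.
      by rewrite ler_ndivrMr// ltr_ndivlMr// lerBrDr ltrBlDr !(mulrC t) andbC.
    rewrite !lebesgue_measure_itv/= !lte_fin ltr_ndivrMr// divfK ?lt_eqF// ltrD2r.
    case: ifP => _; rewrite ?mule0// -!EFinB -EFinM ltr0_norm//; congr EFin.
    by field; rewrite lt_eqF.
  - rewrite (_ : f @^-1` _ = `](x - z) / a, (y - z) / a]%classic); last first.
      apply/seteqP; split => t /=; rewrite !in_itv/= /f.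
        by rewrite ler_pdivlMr// ltr_pdivrMr// lerBrDr ltrBlDr !(mulrC t).
      by rewrite ler_pdivlMr// ltr_pdivrMr// lerBrDr ltrBlDr !(mulrC t).
    rewrite !lebesgue_measure_itv/= !lte_fin ltr_pdivrMr// divfK ?gt_eqF// ltrD2r.
    case: ifP => _; rewrite ?mule0// -!EFinB -EFinM gtr0_norm//; congr EFin.
    by field; rewrite gt_eqF.
rewrite /nu/= /mscale/= /pushforward muleA -EFinM mulVf ?mul1e//.
by rewrite normr_eq0.
Qed.

Section borel_affine.
Variable R : realType.

Lemma rV_coord_inj d (x y : borel_rV R d) :
  (forall i, rV_coord i x = rV_coord i y) -> x = y.
Proof. by move=> xy; apply/rowP => i; exact: xy. Qed.

Definition affine_rV d (a : R) (z : 'rV[R]_d) : borel_rV R d -> borel_rV R d :=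
  fun x => a *: (x : 'rV[R]_d) + z.

Lemma rV_coord_affine d a z i (x : borel_rV R d) :
  rV_coord i (affine_rV a z x) = a * rV_coord i x + (z : 'rV[R]_d) ord0 i.
Proof. by rewrite /affine_rV /rV_coord !mxE. Qed.

Lemma measurable_affine_rV d (a : R) (z : 'rV[R]_d) : measurable_fun setT (affine_rV a z).
Proof.
apply: measurable_fun_rV => i.
rewrite (_ : _ \o _ = fun x => a * rV_coord i x + (z : 'rV[R]_d) ord0 i); last first.
  by apply/funext => x /=; rewrite rV_coord_affine.
by apply: measurable_funD => //; apply: measurable_funM => //; exact: measurable_rV_coord.
Qed.

(** Induction on d: through [rV_cons] the map acts separately on the first coordinate and on the
    others. *)
Lemma borel_lebesgue_affine d (a : R) (z : 'rV[R]_d) : a != 0 ->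
  forall A, measurable A ->
  borel_lebesgue (affine_rV a z @^-1` A) = (((`|a| ^+ d)^-1)%:E * borel_lebesgue A)%E.
Proof.
move=> a0; elim: d z => [|d IH] z A mA.
  rewrite expr0 invr1 mul1e; congr borel_lebesgue; apply/seteqP; split => x /=;
  by rewrite (_ : affine_rV a z x = x)//; apply: rV_coord_inj => -[].
pose z' : 'rV[R]_d := \row_i z ord0 (lift ord0 i).
rewrite /= /pushforward.
have -> : rV_cons (d := d) @^-1` (affine_rV a z @^-1` A) =
    (fun w => (a * w.1 + z ord0 ord0, affine_rV a z' w.2)) @^-1` (rV_cons (d := d) @^-1` A).
  have E w : affine_rV a z (@rV_cons R d w) =
      rV_cons (a * w.1 + z ord0 ord0, affine_rV a z' w.2).
    apply: rV_coord_inj => i; rewrite rV_coord_affine; case: (unliftP ord0 i) => [j|] ->.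
      by rewrite !rV_consS/= rV_coord_affine mxE.
    by rewrite !rV_cons0.
  by apply/seteqP; split => w /=; rewrite E.
transitivity ((`|a|^-1 * (`|a| ^+ d)^-1)%:E *
    (@lebesgue_measure R \x @borel_lebesgue R d) (rV_cons (d := d) @^-1` A))%E; last first.
  by rewrite exprS invfM.
apply: (@product_measure_scaling R _ _ (measurableTypeR R) (borel_rV R d)
  (@lebesgue_measure R) (@borel_lebesgue R d) (fun t => a * t + z ord0 ord0)).
- by rewrite invr_ge0.
- by rewrite invr_ge0 exprn_ge0.
- by apply: measurable_funD => //; exact: measurable_funM.
- exact: lebesgue_measure_affine.
- by move=> B mB; exact: IH.
- by rewrite -[X in measurable X]setTI; apply: measurable_rV_cons.
Qed.

Lemma borel_lebesgue_box d (c : 'rV[R]_d) (r : R) : 0 < r ->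
  borel_lebesgue [set x : borel_rV R d | forall i, `|rV_coord i x - c ord0 i| < r]
    = ((r *+ 2) ^+ d)%:E.
Proof.
move=> r0; elim: d c => [|d IH] c.
  by rewrite expr0 /= diracE mem_set// => -[].
pose c' : 'rV[R]_d := \row_i c ord0 (lift ord0 i).
rewrite /= /pushforward.
have -> : rV_cons (d := d) @^-1` [set x | forall i, `|rV_coord i x - c ord0 i| < r] =
    ball (c ord0 ord0 : R) r `*` [set x | forall i, `|rV_coord i x - c' ord0 i| < r].
  apply/seteqP; split => [w /= h|w [/= h0 h] i].
    split; first by have := h ord0; rewrite rV_cons0 /ball/= distrC.
    by move=> i; have := h (lift ord0 i); rewrite rV_consS mxE.
  case: (unliftP ord0 i) => [j|] ->; last by rewrite rV_cons0 distrC.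
  by rewrite rV_consS; have := h j; rewrite mxE.
rewrite product_measure1E//; last 2 first.
- exact: measurable_realfun.measurable_ball.
- rewrite (_ : mkset _ = \big[setI/setT]_(i < d) (rV_coord i @^-1` ball (c' ord0 i : R) r)).
    apply: bigsetI_measurable => i _; rewrite -[X in measurable X]setTI.
    apply: measurable_rV_coord => //; exact: measurable_realfun.measurable_ball.
  apply/seteqP; split => y; rewrite -bigcap_seq.
    by move=> yc i _ /=; rewrite /ball/= distrC.
  by move=> yc i; have /= := yc i (mem_index_enum i); rewrite /ball/= distrC.
transitivity (lebesgue_measure (ball (c ord0 ord0 : R) r) * ((r *+ 2) ^+ d)%:E)%E.
  by congr (_ * _)%E; exact: IH.
by rewrite lebesgue_measure_ball ?ltW// exprS EFinM.
Qed.

End borel_affine.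

(** * Measurable hulls and measure-preserving maps *)

Section completion.
Context {R : realType} {d} {T : measurableType d}.
Variable mu : {sigma_finite_measure set T -> \bar R}.
Local Notation mus := (mu^*)%mu.

Lemma mu_ext_approx A (e : R) : (mus A < +oo)%E -> 0 < e ->
  exists B, [/\ measurable B, A `<=` B & (mus B <= mus A + e%:E)%E].
Proof.
move=> Aoo e0.
have Afin : mus A \is a fin_num by rewrite ge0_fin_numE// mu_ext_ge0.
have [_ [F [mF AF] <-] Fe] := lb_ereal_inf_adherent e0 Afin.
exists (\bigcup_k F k); split => //; first exact: bigcupT_measurable.
rewrite measurable_mu_extE//; last exact: bigcupT_measurable.
apply/ltW/(le_lt_trans _ Fe).
rewrite measure_sigma_subadditive//; exact: bigcupT_measurable.
Qed.

(** Each [B n] covers A with excess 1 / (n + 1). The Caratheodory condition for A, tested on [B n],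
    turns this into a bound on the measure of the difference, because the finite measure of A can be
    subtracted. *)
Lemma caratheodory_hull_finite A : (mus A < +oo)%E -> mus.-caratheodory A ->
  exists B, [/\ measurable B, A `<=` B & mus (B `\` A) = 0%E].
Proof.
move=> Aoo cA.
have /choice[B AB] n : exists B,
    [/\ measurable B, A `<=` B & (mus B <= mus A + (n.+1%:R^-1)%:E)%E].
  by apply: mu_ext_approx => //; rewrite invr_gt0.
have Afin : mus A \is a fin_num by rewrite ge0_fin_numE// mu_ext_ge0.
exists (\bigcap_n B n); split.
- by apply: bigcapT_measurable => n; have [] := AB n.
- by move=> x Ax n _; have [_ + _] := AB n; exact.
have le n : (mus (\bigcap_n B n `\` A) <= (n.+1%:R^-1)%:E)%E.
  have [mB sAB] := AB n; rewrite (cA (B n)) setIidr// leeD2lE// => h.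
  apply: le_trans h; apply: le_mu_ext.
  by move=> x [Bx nAx]; split => //; exact: Bx.
apply: le_anti; apply/andP; split; last exact: mu_ext_ge0.
apply/lee_addgt0Pr => e e0.
rewrite add0e; apply: (le_trans (le (Num.truncn e^-1))).
by rewrite lee_fin invf_ple ?posrE// ltW// truncnS_gt.
Qed.

(** Up to null sets a set of the completed sigma-algebra is measurable for the original one. This is
    how families that generate only the Borel sets reach all Lebesgue-measurable sets. *)
Lemma caratheodory_hull A : mus.-caratheodory A ->
  exists B, [/\ measurable B, A `<=` B & mus (B `\` A) = 0%E].
Proof.
move=> cA; have [E ET mE] := sigma_finiteT mu.
have /choice[B AB] n : exists B,
    [/\ measurable B, A `&` E n `<=` B & mus (B `\` (A `&` E n)) = 0%E].
  have [mEn Enoo] := mE n; apply: caratheodory_hull_finite.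
    apply: (@le_lt_trans _ _ (mus (E n))); first exact: le_mu_ext.
    by rewrite measurable_mu_extE.
  apply: caratheodory_measurable_setI => //; exact: caratheodory_measurable_mu_ext.
exists (\bigcup_n B n); split.
- by apply: bigcupT_measurable => n; have [] := AB n.
- move=> x Ax; have : [set: T] x by []; rewrite ET => -[n _ Ex].
  by exists n => //; have [_ + _] := AB n; apply.
apply: le_anti; apply/andP; split; last exact: mu_ext_ge0.
apply: (@le_trans _ _ (mus (\bigcup_n (B n `\` (A `&` E n))))).
  apply: le_mu_ext => x [[n _ Bx] nAx]; exists n => //; split => // -[].
  by move/nAx.
apply: (le_trans (outer_measure_sigma_subadditive mus _)).
by rewrite eseries0// => n _ _; have [_ _] := AB n.
Qed.

End completion.

Section measure_preserving.
Context {R : realType} {d1 d2} {T1 : measurableType d1} {T2 : measurableType d2}.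
Variables (m1 : {measure set T1 -> \bar R}) (m2 : {measure set T2 -> \bar R}).
Variable phi : T1 -> T2.
Hypothesis mphi : measurable_fun setT phi.
Hypothesis phiE : forall A, measurable A -> m1 (phi @^-1` A) = m2 A.

Lemma ge0_integral_preserving (f : T2 -> \bar R) :
  measurable_fun setT f -> (forall x, 0 <= f x)%E ->
  (\int[m1]_x f (phi x) = \int[m2]_x f x)%E.
Proof.
move=> mf f0; rewrite -[X in (\int[m1]_(x in X) _)%E](preimage_setT phi).
rewrite -(@ge0_integral_pushforward _ _ _ _ _ _ mphi)//.
by apply: eq_measure_integral => A mA _; rewrite /= /pushforward phiE.
Qed.

Lemma Rintegral_preserving (f : T2 -> R) : measurable_fun setT f ->
  \int[m1]_x f (phi x) = \int[m2]_x f x.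
Proof.
move=> mf; have mEf : measurable_fun setT (EFin \o f) by exact/measurable_EFinP.
rewrite /Rintegral integralE [in RHS]integralE; congr (fine (_ - _)).
  transitivity (\int[m1]_x ((EFin \o f)^\+ (phi x)))%E.
    by apply: eq_integral => x _; rewrite !(funeposE, funenegE).
  exact: (ge0_integral_preserving (measurable_funepos mEf) (funepos_ge0 _)).
transitivity (\int[m1]_x ((EFin \o f)^\- (phi x)))%E.
  by apply: eq_integral => x _; rewrite !(funeposE, funenegE).
exact: (ge0_integral_preserving (measurable_funeneg mEf) (funeneg_ge0 _)).
Qed.

Lemma powint_preserving p (f : T2 -> R) : measurable_fun setT f ->
  powint m1 p (f \o phi) = powint m2 p f.
Proof.
move=> mf; rewrite /powint -[RHS]ge0_integral_preserving//.
exact: measurable_powR_norm.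
Qed.

Lemma Lp_norm_preserving p (f : T2 -> R) : measurable_fun setT f ->
  Lp_norm m1 p (f \o phi) = Lp_norm m2 p f.
Proof. by move=> mf; rewrite !Lp_normE powint_preserving. Qed.

Lemma Lp_preserving p (f : T2 -> R) : 1 <= p -> Lp m2 p f -> Lp m1 p (f \o phi).
Proof.
move=> p1 /(Lp_powint _ p1)[mf foo]; apply/(Lp_powint _ p1); split.
  exact: measurableT_comp.
by rewrite powint_preserving.
Qed.

Lemma ae_preserving (Q : T2 -> Prop) : {ae m2, forall x, Q x} ->
  {ae m1, forall x, Q (phi x)}.
Proof.
move=> [N [mN N0 QN]]; exists (phi @^-1` N); split => [||x /= nQ].
- by rewrite -[X in measurable X]setTI; exact: mphi.
- by rewrite phiE.
- exact: QN.
Qed.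

Lemma preserving_operator p : 1 <= p ->
  bounded_operator (Lp m2 p) (Lp_norm m2 p) (Lp m1 p) (Lp_norm m1 p) (fun f => f \o phi).
Proof.
move=> p1; split => [f|a f g _ _|]; first exact: Lp_preserving.
  rewrite (_ : _ - _ = 0); last by apply/funext => x; rewrite !fctE subrr.
  exact: sn0 (seminormed_Lp _ p1).
by exists 1 => f Lf; rewrite mul1e Lp_norm_preserving//; exact: Lp_measurable Lf.
Qed.

End measure_preserving.

Section lebesgue_affine.
Variables (R : realType) (d : nat).
Local Notation mus := (mu_ext (@borel_lebesgue R d)).

Definition affine (a : R) (z x : euclid R d) : euclid R d := a *: x + z.

Lemma affineK (a : R) (z : euclid R d) : a != 0 ->
  cancel (affine a z) (affine a^-1 (- (a^-1 *: z))).
Proof.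
move=> a0 x; rewrite /affine scalerDr scalerA mulVf// scale1r.
by rewrite addrK.
Qed.

Lemma affineVK (a : R) (z : euclid R d) : a != 0 ->
  cancel (affine a^-1 (- (a^-1 *: z))) (affine a z).
Proof.
move=> a0 x; rewrite /affine scalerDr scalerN !scalerA mulfV// !scale1r.
by rewrite subrK.
Qed.

Lemma mu_ext_affine_le (a : R) (z : euclid R d) A : a != 0 ->
  (mus (affine a z @^-1` A) <= ((`|a| ^+ d)^-1)%:E * mus A)%E.
Proof.
move=> a0; have c0 : 0 < (`|a| ^+ d)^-1 by rewrite invr_gt0 exprn_gt0// normr_gt0.
rewrite -lee_pdivrMl//; apply: le_ereal_inf_tmp => _ [F [mF AF] <-].
rewrite lee_pdivrMl// -nneseriesZl//; apply: ereal_inf_lbound => /=.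
exists (fun k => affine a z @^-1` F k).
  split => [k|x /AF[k _ Fk]]; last by exists k.
  by rewrite -[X in measurable X]setTI; exact: (@measurable_affine_rV R d a z).
by apply: eq_eseriesr => k _; exact: borel_lebesgue_affine.
Qed.

Lemma mu_ext_affine (a : R) (z : euclid R d) A : a != 0 ->
  mus (affine a z @^-1` A) = (((`|a| ^+ d)^-1)%:E * mus A)%E.
Proof.
move=> a0; apply: le_anti; rewrite mu_ext_affine_le//=.
have c0 : 0 < (`|a| ^+ d)^-1 by rewrite invr_gt0 exprn_gt0// normr_gt0.
rewrite -lee_pdivlMl//.
rewrite [in leLHS](_ : A = affine a^-1 (- (a^-1 *: z)) @^-1` (affine a z @^-1` A)).
  by rewrite (le_trans (mu_ext_affine_le _ _ _)) ?invr_eq0// normfV exprVn.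
by apply/seteqP; split => x /=; rewrite affineVK.
Qed.

(** Both sides carry the completed sigma-algebra, for which Borel measurability is not enough. The
    Caratheodory condition is transported instead: every test set is the preimage of one, and outer
    measures scale by a constant. *)
Lemma measurable_affine (a : R) (z : euclid R d) : a != 0 ->
  measurable_fun setT (affine a z).
Proof.
move=> a0 _ A mA; rewrite setTI.
have cA : mus.-caratheodory A by exact: mA.
suff : mus.-caratheodory (affine a z @^-1` A) by [].
move=> X.
have XE : X = affine a z @^-1` (affine a^-1 (- (a^-1 *: z)) @^-1` X).
  by apply/seteqP; split => x /=; rewrite affineK.
set Y := _ @^-1` X in XE; rewrite XE.
transitivity (mus (affine a z @^-1` (Y `&` A)) + mus (affine a z @^-1` (Y `&` ~` A)))%E => //.
have E B : mus (affine a z @^-1` B) = (((`|a| ^+ d)^-1)%:E * mus B)%E.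
  exact: mu_ext_affine.
rewrite !E -[RHS]ge0_muleDr; [congr (_ * _)%E; exact: cA|exact: mu_ext_ge0|].
exact: mu_ext_ge0.
Qed.

Lemma lebesgue_rV_affine (a : R) (z : euclid R d) A : a != 0 ->
  lebesgue_rV (affine a z @^-1` A) = (((`|a| ^+ d)^-1)%:E * lebesgue_rV A)%E.
Proof. exact: mu_ext_affine. Qed.

Lemma lebesgue_rV_translation (z : euclid R d) A :
  lebesgue_rV (affine 1 z @^-1` A) = lebesgue_rV A.
Proof. by rewrite lebesgue_rV_affine ?oner_eq0// normr1 expr1n invr1 mul1e. Qed.

Lemma lebesgue_rV_borel (A : set (borel_rV R d)) : measurable A ->
  @lebesgue_rV R d A = borel_lebesgue A.
Proof. by move=> mA; exact: measurable_mu_extE. Qed.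

Lemma lebesgue_borel_hull (A : set (euclid R d)) : measurable A ->
  exists B : set (euclid R d), [/\ borel_rV_display.-measurable (B : set (borel_rV R d)),
    A `<=` B & lebesgue_rV (B `\` A) = 0%E].
Proof. exact: caratheodory_hull. Qed.

Lemma ball_euclidP (c x : euclid R d) (r : R) : 0 < r ->
  ball c r x <-> forall i, `|(x : 'rV[R]_d) ord0 i - (c : 'rV[R]_d) ord0 i| < r.
Proof.
move=> r0; split => [[_ cx] i|cx]; first by have := cx ord0 i; rewrite /ball/= distrC.
by split => // i j; rewrite (ord1 i) /ball/= distrC.
Qed.

Lemma lebesgue_ball (c : euclid R d) (r : R) : 0 < r ->
  lebesgue_rV (ball c r) = ((r *+ 2) ^+ d)%:E.
Proof.
move=> r0; rewrite -(borel_lebesgue_box (c : 'rV[R]_d) r0).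
rewrite (_ : ball c r = [set x | forall i, `|(x : 'rV[R]_d) ord0 i - (c : 'rV[R]_d) ord0 i| < r]).
  apply: lebesgue_rV_borel.
  rewrite (_ : [set x | _] = \big[setI/setT]_(i < d)
      (rV_coord i @^-1` ball ((c : 'rV[R]_d) ord0 i : R) r)).
    apply: bigsetI_measurable => i _; rewrite -[X in measurable X]setTI.
    apply: measurable_rV_coord => //; exact: measurable_realfun.measurable_ball.
  apply/seteqP; split => y; rewrite -bigcap_seq.
    by move=> yc i _ /=; rewrite /ball/= distrC; exact: yc.
  by move=> yc i; have /= := yc i (mem_index_enum i); rewrite /ball/= distrC.
by apply/seteqP; split => x /(ball_euclidP _ _ r0).
Qed.

Lemma continuous_coord (i : 'I_d) :
  continuous (fun x : euclid R d => (x : 'rV[R]_d) ord0 i : R).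
Proof. exact: (@coord_continuous R 1 d ord0 i). Qed.

Lemma borel_sub_sigma_algebra (S : set (set (euclid R d))) : sigma_algebra setT S ->
  (forall U : set (euclid R d), open U -> S U) ->
  forall A : set (borel_rV R d), measurable A -> S A.
Proof.
move=> sS oS A mA; pose T' := g_sigma_algebraType S.
suff mid : measurable_fun setT ((fun x => x) : T' -> borel_rV R d).
  have := mid measurableT _ mA; rewrite setTI => h.
  have : <<s S >> A by exact: h.
  by rewrite sigma_algebra_id.
apply: measurable_fun_rV => i.
apply: (measurability _ (RGenOInfty.measurableE R)) => _ [_ [x ->] <-].
rewrite setTI; apply: sub_sigma_algebra; apply: oS.
have := @continuous_coord i; move/continuousP; apply.
exact: interval_open.
Qed.

Lemma measurable_continuous (f : euclid R d -> R) : continuous f -> measurable_fun setT f.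
Proof.
move=> cf; apply: (measurability _ (RGenOInfty.measurableE R)) => _ [_ [x ->] <-].
rewrite setTI; apply: open_measurable_euclid.
by move/continuousP : cf; apply; exact: interval_open.
Qed.

Definition rational_ball (c : 'rV[rat]_d * nat) : set (euclid R d) :=
  ball (map_mx ratr c.1 : 'rV[R]_d) c.2.+1%:R^-1.

(** The closed cube is asked to lie in U, since it becomes the compact support of a [bump_ball]. *)
Lemma open_rational_ball (U : set (euclid R d)) x : open U -> U x ->
  exists c, rational_ball c x /\
    forall y : euclid R d, (forall i, `|(y : 'rV[R]_d) ord0 i - ratr (c.1 ord0 i)|
      <= c.2.+1%:R^-1) -> U y.
Proof.
move=> oU Ux; have /nbhs_ballP[e /= e0 xeU] : nbhs x U by exact: open_nbhs_nbhs.
have [n ne] : exists n, n.+1%:R^-1 < e / 2.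
  have e20 : 0 < e / 2 by rewrite divr_gt0.
  by have [n] := ltr_add_invr e20; rewrite add0r => ne; exists n.
have /choice[q qx] (i : 'I_d) : exists q : rat,
    `|(x : 'rV[R]_d) ord0 i - ratr q| < n.+1%:R^-1.
  have [||t [tx [r _ rt]]] := @dense_rat R (ball ((x : 'rV[R]_d) ord0 i : R) n.+1%:R^-1).
  - by exists ((x : 'rV[R]_d) ord0 i); apply: ballxx; rewrite invr_gt0.
  - exact: ball_open.
  - by exists r; rewrite rt.
exists (\row_i q i, n); split => [|y /= yq].
  by apply/ball_euclidP; rewrite ?invr_gt0// => i; rewrite !mxE.
apply: xeU; apply/ball_euclidP => // i.
rewrite (le_lt_trans (ler_distD (ratr (q i)) _ _))// [ltRHS]splitr ltrD//.
  by rewrite (le_lt_trans _ ne)//; have := yq i; rewrite mxE.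
by rewrite (lt_trans _ ne)// distrC.
Qed.

End lebesgue_affine.

(** * Test functions *)

Section bump.
Variable R : realType.
Implicit Types (p : {poly R}) (t : R).

Lemma poly_le_expR p : exists2 C : R, 0 <= C & forall s, 0 <= s -> `|p.[s]| <= C * expR s.
Proof.
have pow n s : 0 <= s -> s ^+ n <= n`!%:R * expR s.
  case: n => [s0|n s0]; first by rewrite expr0 fact0 mul1r -[leLHS]expR0 ler_expR.
  have := expR_ge1Dxn n s0; rewrite -lerBrDl => h.
  rewrite -ler_pdivrMl ?ltr0n ?fact_gt0// mulrC (le_trans h)// lerBlDl.
  by rewrite ler_wpDl.
exists (\sum_(i < size p) `|p`_i| * i`!%:R) => [|s s0].
  by apply: sumr_ge0 => i _; rewrite mulr_ge0.
rewrite horner_coef mulr_suml; apply: (le_trans (ler_norm_sum _ _ _)).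
apply: ler_sum => i _; rewrite normrM -mulrA ler_wpM2l//.
by rewrite ger0_norm ?exprn_ge0// pow.
Qed.

(** The polynomial factor closes the family under differentiation; the function of interest is
    [bump 1], that is, exp (- 1 / t) for t > 0. *)
Definition bump p t : R := if 0 < t then p.[t^-1] * expR (- t^-1) else 0.

(* d/dt of p(1/t) e^(-1/t) *)
Definition bump_deriv p : {poly R} := 'X^2 * (p - p^`()).

Let is_derive_bump_pos p t : 0 < t -> is_derive t 1 (bump p) (bump (bump_deriv p) t).
Proof.
move=> t0.
have nt0 : t != 0 by rewrite gt_eqF.
have dV : is_derive t 1 (fun s : R => s^-1) (- t ^- 2 *: 1).
  by apply: (@is_deriveV R id t 1 1) => //; exact: is_derive_id.
have dE : is_derive t 1 (fun s : R => expR (- s^-1)) (expR (- t^-1) * - (- t ^- 2 *: 1)).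
  by apply: (@is_derive1_comp R expR (fun s => - s^-1)).
have dP : is_derive t 1 (fun s : R => p.[s^-1]) (p^`().[t^-1] * (- t ^- 2 *: 1)).
  by apply: (@is_derive1_comp R (horner p) (fun s => s^-1)).
have h := is_deriveM dP dE.
rewrite (_ : bump (bump_deriv p) t = p.[t^-1] *: (expR (- t^-1) * - (- t ^- 2 *: 1))
    + expR (- t^-1) *: (p^`().[t^-1] * (- t ^- 2 *: 1))); last first.
  by rewrite /bump t0 /bump_deriv !hornerE /GRing.scale/=; field.
apply: near_eq_is_derive h.
near=> s; rewrite /bump ifT//; near: s; exact: lt_nbhsr.
Unshelve. all: by end_near. Qed.

Let is_derive_bump_neg p t : t < 0 -> is_derive t 1 (bump p) (bump (bump_deriv p) t).
Proof.
move=> t0; rewrite {2}/bump ifF; last by rewrite le_gtF// ltW.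
have h : is_derive t 1 (cst 0 : R -> R) (0 : R) by exact: is_derive_cst.
apply: near_eq_is_derive h.
near=> s; rewrite /bump ifF// le_gtF// ltW//; near: s; exact: lt_nbhsl.
Unshelve. all: by end_near. Qed.

(** For h > 0 the difference quotient is h times (1/h)^2 p(1/h) exp (- 1/h). The exponential
    dominates the polynomial X^2 p, so the quotient is O(h). *)
Let is_derive_bump0 p : is_derive (0 : R) 1 (bump p) (bump (bump_deriv p) 0).
Proof.
rewrite {2}/bump ltxx.
have [C C0 pC] := poly_le_expR ('X^2 * p).
have E : (fun h : R => h^-1 *: ((bump p \o shift 0) (h *: 1) - bump p 0)) @ 0^' --> (0 : R).
  have Cp : 0 < C + 1 by rewrite ltr_wpDl.
  apply/cvgrPdist_le => e e0; near=> h.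
  rewrite /= addr0 /GRing.scale/= mulr1 sub0r normrN {2}/bump ltxx subr0.
  apply: (@le_trans _ _ (C * `|h|)).
    rewrite /bump; case: ifPn => [h0|_]; last by rewrite mulr0 normr0 mulr_ge0.
    have hV0 : 0 <= h^-1 by rewrite invr_ge0 ltW.
    have := pC _ hV0; rewrite !hornerE => hC.
    rewrite !normrM (ger0_norm (expR_ge0 _)) (ger0_norm hV0) (gtr0_norm h0).
    rewrite expRN ler_pdivrMr ?expR_gt0//.
    rewrite (_ : h^-1 * _ = h * `|h^-1 ^+ 2 * p.[h^-1]|); last first.
      by rewrite normrM (ger0_norm (exprn_ge0 _ hV0)); field; rewrite gt_eqF.
    rewrite (_ : C * h * _ = h * (C * expR h^-1)); last by ring.
    by rewrite ler_wpM2l// ltW.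
  apply: (@le_trans _ _ ((C + 1) * `|h|)); first by rewrite ler_wpM2r// lerDl.
  rewrite -ler_pdivlMl//; near: h; apply: dnbhs0_le.
  by rewrite mulr_gt0 ?invr_gt0.
apply: DeriveDef; first by apply/cvg_ex; exists 0.
exact: (cvg_lim _ E).
Unshelve. all: by end_near. Qed.

Lemma is_derive_bump p t : is_derive t 1 (bump p) (bump (bump_deriv p) t).
Proof.
by case: (ltgtP 0 t) => [||<-]; [exact: is_derive_bump_pos|exact: is_derive_bump_neg|
  exact: is_derive_bump0].
Qed.

Lemma continuous_bump p : continuous (bump p).
Proof.
move=> t; apply: differentiable_continuous; apply/derivable1_diffP.
exact: (@ex_derive _ _ _ _ _ _ _ (is_derive_bump p t)).
Qed.

Lemma bump1_gt0 t : (0 < bump 1 t) = (0 < t).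
Proof. by rewrite /bump; case: ifP => [t0|]; rewrite ?ltxx// hornerE mul1r expR_gt0. Qed.

Lemma bump1_ge0 t : 0 <= bump 1 t.
Proof. by rewrite /bump; case: ifP => // _; rewrite hornerE mul1r expR_ge0. Qed.

Lemma bump1_le1 t : bump 1 t <= 1.
Proof.
rewrite /bump; case: ifP => // t0; rewrite hornerE mul1r -expR0 ler_expR.
by rewrite oppr_le0 invr_ge0 ltW.
Qed.

End bump.

Lemma is_derive_line {R : realType} (V : normedModType R) (f : V -> R) x v (t df : R) :
  is_derive t 1 (fun s : R => f (s *: v + x)) df <-> is_derive (t *: v + x) v f df.
Proof.
pose g s := f (s *: v + x).
have E : (fun h : R => h^-1 *: ((g \o shift t) (h *: 1) - g t)) =
    (fun h => h^-1 *: ((f \o shift (t *: v + x)) (h *: v) - f (t *: v + x))).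
  by apply/funext => h; rewrite /g -[h *: 1]/(h * 1) mulr1 /= scalerDl addrA.
split => -[d l]; split; rewrite ?/derivable ?/derive.
- by rewrite -E.
- by rewrite -E.
- by rewrite E.
- by rewrite E.
Qed.

Section smooth.
Context {R : realType} {d : nat}.
Local Notation E := (euclid R d).
Implicit Types f g : E -> R.

(** A coinduction principle: a class of continuous, partially differentiable functions that is
    stable under partial derivatives consists of smooth functions. *)
Lemma smooth_ind (C : set (E -> R)) :
  (forall f, C f -> [/\ continuous f, forall i x, derivable f x (basis_vec i) &
    forall i, C (partial i f)]) -> forall f, C f -> smooth f.
Proof.
move=> HC f Cf s /=; have : C (foldr partial f s).
  by elim: s => //= i s /HC[_ _]; apply.
by move=> /HC[].
Qed.

Lemma smooth_continuous f : smooth f -> continuous f.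
Proof. by move=> /(_ [::])[]. Qed.

Lemma smooth_derivable f i x : smooth f -> derivable f x (basis_vec i).
Proof. by move=> /(_ [::])[_]; apply. Qed.

Lemma smooth_partial f i : smooth f -> smooth (partial i f).
Proof. by move=> sf s; rewrite -foldr_rcons; exact: sf. Qed.

Lemma smooth_cst (c : R) : smooth (cst c : E -> R).
Proof.
apply: (@smooth_ind (range (fun c : R => cst c))) => [_ [a _ <-]|]; last by exists c.
split; [exact: cst_continuous|by move=> i x; exact: derivable_cst|].
by move=> i; exists 0 => //; apply/funext => x; rewrite /partial derive_cst.
Qed.

(** By the Leibniz rule a derivative of a product is a sum of products. [smooth_ind] needs a class
    stable under derivatives, and this algebra is one. *)
Inductive smooth_algebra : (E -> R) -> Prop :=
| smooth_base f : smooth f -> smooth_algebra f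
| smooth_add f g : smooth_algebra f -> smooth_algebra g -> smooth_algebra (f + g)
| smooth_mul f g : smooth_algebra f -> smooth_algebra g -> smooth_algebra (f * g).

Lemma smooth_algebra_smooth f : smooth_algebra f -> smooth f.
Proof.
apply: smooth_ind => {}f; elim=> {f} [f sf|f g _ [cf df pf] _ [cg dg pg]
    |f g af [cf df pf] ag [cg dg pg]].
- split=> [|i x|i]; [exact: smooth_continuous|exact: smooth_derivable|].
  by apply/smooth_base/smooth_partial.
- split=> [x|i x|i]; [apply: continuousD; [exact: cf|exact: cg]|exact: derivableD (df i x) (dg i x)|].
  rewrite (_ : partial i _ = partial i f + partial i g); first exact: smooth_add.
  by apply/funext => x; rewrite /partial deriveD.
- split=> [x|i x|i]; [apply: continuousM; [exact: cf|exact: cg]|exact: derivableM (df i x) (dg i x)|].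
  rewrite (_ : partial i _ = f * partial i g + g * partial i f).
    by apply: smooth_add; exact: smooth_mul.
  by apply/funext => x; rewrite /partial deriveM.
Qed.

Lemma smoothD f g : smooth f -> smooth g -> smooth (f + g).
Proof. by move=> sf sg; apply/smooth_algebra_smooth/smooth_add; exact: smooth_base. Qed.

Lemma smoothM f g : smooth f -> smooth g -> smooth (f * g).
Proof. by move=> sf sg; apply/smooth_algebra_smooth/smooth_mul; exact: smooth_base. Qed.

Lemma smoothZ (c : R) f : smooth f -> smooth (c *: f).
Proof. by move=> sf; apply: (smoothM (smooth_cst c) sf). Qed.

Lemma smoothN f : smooth f -> smooth (- f).
Proof. by rewrite -scaleN1r; exact: smoothZ. Qed.

Lemma smooth_prod I (r : seq I) (F : I -> E -> R) : (forall i, smooth (F i)) ->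
  smooth (\prod_(i <- r) F i).
Proof. by move=> sF; elim/big_ind: _ => //; [exact: smooth_cst|exact: smoothM]. Qed.

Lemma partialM f g i : smooth f -> smooth g ->
  partial i (f * g) = f * partial i g + g * partial i f.
Proof. by move=> sf sg; apply/funext => x; rewrite /partial deriveM//; exact: smooth_derivable. Qed.

Lemma is_derive_partial f i x : smooth f -> is_derive x (basis_vec i) f (partial i f x).
Proof. by move=> sf; apply: DeriveDef => //; exact: smooth_derivable. Qed.

Lemma is_derive_affine f i (a : R) (z x : E) : smooth f ->
  is_derive x (basis_vec i) (f \o affine a z) (a * partial i f (affine a z x)).
Proof.
move=> sf; have := (@is_derive_line R E (f \o affine a z) x (basis_vec i) 0
  (a * partial i f (affine a z x))).1.
rewrite scale0r add0r; apply.
rewrite (_ : (fun s => _) =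
    (fun s : R => f (s *: basis_vec i + affine a z x)) \o (fun s => a * s)); last first.
  by apply/funext => s /=; rewrite /affine scalerDr scalerA addrA.
rewrite mulrC; apply: is_derive1_comp.
  rewrite mulr0; apply/is_derive_line; rewrite scale0r add0r.
  exact: is_derive_partial.
rewrite -[X in is_derive _ _ _ X]mulr1.
exact: (@is_deriveZ R R R id a 0 1 1).
Qed.

Lemma partial_affine f i (a : R) (z : E) : smooth f ->
  partial i (f \o affine a z) = a *: (partial i f \o affine a z).
Proof.
by move=> sf; apply/funext => x; rewrite /partial (@derive_val _ _ _ _ _ _ _ (is_derive_affine i a z x sf)).
Qed.

Lemma continuous_affine (a : R) (z : E) : continuous (affine a z).
Proof.
move=> x; apply: (@continuousD R E E (fun x => a *: x) (cst z)); last exact: cst_continuous.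
exact: (@scaler_continuous R E a).
Qed.

Lemma smooth_affine f (a : R) (z : E) : smooth f -> smooth (f \o affine a z).
Proof.
move=> sf; apply: (@smooth_ind [set h | exists c g, smooth g /\ h = c *: (g \o affine a z)]);
  last by exists 1, f; rewrite scale1r.
move=> _ [c [g [sg ->]]]; split => [x|i x|i].
- apply: continuousZl_tmp => //.
  by apply: continuous_comp; [exact: continuous_affine|exact: smooth_continuous].
- apply: derivableZ; exact: (@ex_derive _ _ _ _ _ _ _ (is_derive_affine i a z x sg)).
- exists (c * a), (partial i g); split; first exact: smooth_partial.
  apply/funext => x; rewrite /partial deriveZ.
    rewrite -[X in _ *: X]/(partial i _ x) partial_affine// -scalerA.
    by [].
  exact: (@ex_derive _ _ _ _ _ _ _ (is_derive_affine i a z x sg)).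
Qed.

Lemma smooth_bump p i (a c : R) : smooth (fun x : E => bump p (a * (x : 'rV[R]_d) ord0 i + c)).
Proof.
pose B p (x : E) := bump p (a * (x : 'rV[R]_d) ord0 i + c).
have dB q j x : is_derive x (basis_vec j) (B q)
    ((a * (i == j)%:R) * B (bump_deriv q) x).
  have := (@is_derive_line R E (B q) x (basis_vec j) 0
    ((a * (i == j)%:R) * B (bump_deriv q) x)).1.
  rewrite scale0r add0r; apply.
  rewrite (_ : (fun s => _) = bump q \o
      ((fun s => (a * (i == j)%:R) * s) + cst (a * (x : 'rV[R]_d) ord0 i + c))); last first.
    apply/funext => s /=; rewrite /B !fctE /= !mxE eqxx /=; congr bump.
    by ring.
  rewrite (mulrC (a * (i == j)%:R) (B _ x)); apply: is_derive1_comp.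
    by rewrite !fctE mulr0 add0r; exact: is_derive_bump.
  have h1 : is_derive (0 : R) 1 (fun s : R => (a * (i == j)%:R) * s) (a * (i == j)%:R).
    rewrite -[X in is_derive _ _ _ X]mulr1; exact: (@is_deriveZ R R R id _ 0 1 1).
  have h2 : is_derive (0 : R) 1 (cst (a * (x : 'rV[R]_d) ord0 i + c) : R -> R) (0 : R).
    exact: is_derive_cst.
  by have := is_deriveD h1 h2; rewrite addr0.
apply: (@smooth_ind [set h | exists k q, h = k *: B q]); last by exists 1, p; rewrite scale1r.
move=> _ [k [q ->]]; split => [x|j x|j].
- apply: continuousZl_tmp => //.
  apply: continuous_comp; last exact: continuous_bump.
  apply: continuousD; last exact: cst_continuous.
  apply: continuousZl_tmp; exact: continuous_coord.
- apply: derivableZ; exact: (@ex_derive _ _ _ _ _ _ _ (dB q j x)).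
- exists (k * (a * (i == j)%:R)), (bump_deriv q); apply/funext => x.
  by rewrite /partial deriveZ ?(@derive_val _ _ _ _ _ _ _ (dB q j x)) ?/GRing.scale/= ?mulrA.
Qed.

End smooth.

(** * Countable total families *)

Section countable_total_family.
Context {R : realType} {d} {T : measurableType d}.
Variables (mu : {measure set T -> \bar R}) (p : R).
Hypothesis p1 : 1 <= p.

Definition generated_indic (I : Type) (B : I -> set T) (D : (set T)^nat)
    (c : nat * seq I) : T -> R :=
  \1_((\big[setI/setT]_(i <- c.2) B i) `&` D c.1).

Lemma countable_total_family (I : Type) (B : I -> set T) (D : (set T)^nat) :
  (forall i, measurable (B i)) ->
  (forall A, measurable A ->
    exists2 A', <<s range B >> A' & (\1_A : T -> R) = \1_A' %[ae mu]) ->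
  \bigcup_k D k = setT -> nondecreasing_seq D ->
  (forall k, measurable (D k) /\ (mu (D k) < +oo)%E) ->
  total_family mu p (generated_indic B D).
Proof.
move=> mB gB DT ndD mD.
have mI (s : seq I) : measurable (\big[setI/setT]_(i <- s) B i).
  by apply: bigsetI_measurable.
split => [[k s]|X Xc XI].
  have [mDk Dkoo] := mD k; apply: Lp_indic => //; first exact: measurableI.
  apply: (le_lt_trans _ Dkoo); apply: le_measure; rewrite ?inE//.
  exact: measurableI.
apply: (closed_subspace_generated p1 Xc
  (G := [set A | exists s : seq I, A = \big[setI/setT]_(i <- s) B i]) (D := D)) => //.
- by move=> _ _ [s ->] [s' ->]; exists (s ++ s'); rewrite big_cat.
- by move=> _ [s ->].
- move=> A /gB[A' sA' AA']; exists A' => //.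
  apply: smallest_sub sA'; first exact: smallest_sigma_algebra.
  move=> _ [i _ <-]; apply: sub_sigma_algebra; exists [:: i].
  by rewrite big_seq1.
- by move=> k; have := XI (k, [::]); rewrite /generated_indic/= big_nil setTI.
- by move=> _ k [s ->]; exact: XI (k, s).
Qed.

End countable_total_family.

Lemma total_family_countably_generated {R : realType} {d} {T : measurableType d}
    (P : probability T R) (p : R) : 1 <= p -> countably_generated T ->
  exists e : nat * seq nat -> T -> R, total_family P p e.
Proof.
move=> p1 [G cG mE]; have /countable_injP[f finj] := cG.
(* The inverse of the injection f of the generators into the integers. A number that codes no
   generator is sent to [setT], which is measurable and neutral in intersections. *)
pose B n := if pselect (exists A, G A /\ f A = n) is left h then projT1 (cid h) else setT.
have GB A : G A -> B (f A) = A.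
  rewrite /B; case: pselect => [h GA|h GA]; last by exfalso; apply: h; exists A.
  by case: cid => C /= [GC fC]; apply: finj => //; exact/mem_set.
exists (generated_indic B (fun=> setT)); apply: countable_total_family => //.
- move=> n; rewrite /B; case: pselect => // h; case: cid => C /= [GC _].
  by rewrite mE; exact: sub_sigma_algebra.
- move=> A; rewrite mE => sA; exists A; last exact: aeW.
  apply: smallest_sub sA; first exact: smallest_sigma_algebra.
  by move=> C GC; apply: sub_sigma_algebra; exists (f C) => //; exact: GB.
- by apply/seteqP; split => // x _; exists 0%N.
- by move=> k; split => //; exact: fin_num_fun_lty.
Qed.

Section lebesgue_generation.
Variables (R : realType) (d : nat).
Local Notation E := (euclid R d).

(** An open set is a countable union of rational balls whose closed hulls it contains. Only these
    are required to be in S, so that S may be generated by functions supported in U. *)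
Lemma sigma_algebra_open (S : set (set E)) (U : set E) : sigma_algebra setT S -> open U ->
  (forall c : 'rV[rat]_d * nat, (forall y : E, (forall i, `|(y : 'rV[R]_d) ord0 i - ratr (c.1 ord0 i)|
      <= c.2.+1%:R^-1) -> U y) -> S (@rational_ball R d c)) -> S U.
Proof.
move=> sS oU SU; pose T' := g_sigma_algebraType S.
pose inside (c : 'rV[rat]_d * nat) := forall y : E,
  (forall i, `|(y : 'rV[R]_d) ord0 i - ratr (c.1 ord0 i)| <= c.2.+1%:R^-1) -> U y.
have UE : U = \bigcup_c (if `[< inside c >] then @rational_ball R d c else set0).
  apply/seteqP; split => [x Ux|x [c _]].
    have [c [cx cU]] := open_rational_ball oU Ux; exists c => //.
    by case: asboolP.
  case: asboolP => // cU /(ball_euclidP _ _ _) cx; apply: cU => i.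
  have r0 : 0 < c.2.+1%:R^-1 :> R by rewrite invr_gt0.
  by have := cx r0 i; rewrite mxE => /ltW.
have : @measurable _ T' (\bigcup_c (if `[< inside c >] then @rational_ball R d c else set0) : set E).
  apply: countable_bigcupT_measurable => // c.
  case: asboolP => [cU|_]; last exact: (@measurable0 _ T').
  by apply: sub_sigma_algebra; exact: SU.
by rewrite -UE => h; have : <<s S >> U by []; rewrite sigma_algebra_id.
Qed.

Variables (Q : set E) (oQ : open Q).
Local Notation leb := (lebesgue_on oQ).

Lemma lebesgue_onE A : lebesgue_on oQ A = lebesgue_rV (A `&` Q).
Proof. by []. Qed.

Lemma lebesgue_on_le A : measurable A -> (lebesgue_on oQ A <= lebesgue_rV A)%E.
Proof.
move=> mA; rewrite lebesgue_onE; apply: le_measure; rewrite ?inE//.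
by apply: measurableI => //; exact: open_measurable_euclid.
Qed.

Lemma lebesgue_on_ae (Z : E -> Prop) : {ae @lebesgue_rV R d, forall x, Z x} ->
  {ae leb, forall x, Z x}.
Proof.
move=> [N [mN N0 ZN]]; exists N; split => //.
by apply: le_anti; rewrite measure_ge0 andbT -N0; exact: lebesgue_on_le.
Qed.

Lemma ae_lebesgue_on (Z : E -> Prop) : (forall x, Q x -> Z x) -> {ae leb, forall x, Z x}.
Proof.
move=> QZ; exists (~` Q); split.
- exact/measurableC/open_measurable_euclid.
- by rewrite lebesgue_onE setICl measure0.
- by move=> x /= nZ /QZ.
Qed.

Lemma measurable_ball_euclid (c : E) r : measurable (ball c r).
Proof. exact/open_measurable_euclid/ball_open. Qed.

Lemma lebesgue_on_ball (c : E) r : 0 < r -> (lebesgue_on oQ (ball c r) < +oo)%E.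
Proof.
move=> r0; apply: (le_lt_trans (lebesgue_on_le (measurable_ball_euclid _ _))).
by rewrite lebesgue_ball// ltry.
Qed.

Lemma bigcup_ball : \bigcup_k ball (0 : E) k.+1%:R = setT.
Proof.
apply/seteqP; split => // x _; exists (Num.bound `|x|) => //.
rewrite -ball_normE /ball_/= sub0r normrN.
by rewrite (lt_le_trans (archi_boundP _))// ler_nat.
Qed.

Lemma nondecreasing_ball : nondecreasing_seq (fun k => ball (0 : E) k.+1%:R : set E).
Proof. by move=> m n mn; apply/subsetPset; apply: le_ball; rewrite ler_nat. Qed.

Lemma hull_ae (A B : set E) : measurable A -> measurable B -> A `<=` B ->
  lebesgue_rV (B `\` A) = 0%E -> (\1_A : E -> R) = \1_B %[ae leb].
Proof.
move=> mA mB AB BA0; apply: lebesgue_on_ae; exists (B `\` A); split => //.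
  exact: measurableD.
move=> x /= nAB; apply: contra_notP nAB => nBA _; rewrite !indicE.
have [Ax|nAx] := pselect (A x); first by rewrite !mem_set//; exact: AB.
by rewrite !memNset// => Bx; exact: nBA.
Qed.

Lemma total_family_lebesgue_on (p : R) : 1 <= p ->
  total_family leb p (generated_indic (@rational_ball R d) (fun k => ball (0 : E) k.+1%:R)).
Proof.
move=> p1; apply: countable_total_family => //.
- by move=> c; exact: measurable_ball_euclid.
- move=> A mA; have [B [bB AB BA0]] := lebesgue_borel_hull mA.
  have mB : measurable B by exact: caratheodory_measurable_mu_ext.
  exists B; last exact: hull_ae.
  have sS : sigma_algebra setT <<s range (@rational_ball R d) >>.
    exact: smallest_sigma_algebra.
  apply: (borel_sub_sigma_algebra sS) bB => U oU.
  apply: (sigma_algebra_open sS oU) => c _; apply: sub_sigma_algebra.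
  by exists c.
- exact: bigcup_ball.
- exact: nondecreasing_ball.
- by move=> k; split; [exact: measurable_ball_euclid|exact: lebesgue_on_ball].
Qed.

End lebesgue_generation.

Section test_functions.
Context {R : realType} {d : nat}.
Local Notation E := (euclid R d).
Variables (Q : set E) (oQ : open Q).
Local Notation leb := (lebesgue_on oQ).
Implicit Types f g phi : E -> R.

Lemma test_smooth phi : test_function Q phi -> smooth phi.
Proof. by case. Qed.

Lemma test0 : test_function Q (0 : E -> R).
Proof.
split; first exact: smooth_cst.
by exists set0; split => //; exact: compact0.
Qed.

Lemma testD f g : test_function Q f -> test_function Q g -> test_function Q (f + g).
Proof.
move=> [sf [K [cK KQ fK]]] [sg [K' [cK' KQ' gK]]]; split; first exact: smoothD.
exists (K `|` K'); split; [exact: compactU|by move=> x []; [exact: KQ|exact: KQ']|].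
by move=> x /not_orP[nK nK']; rewrite fctE fK// gK// addr0.
Qed.

Lemma testM f g : test_function Q f -> smooth g -> test_function Q (f * g).
Proof.
move=> [sf [K [cK KQ fK]]] sg; split; first exact: smoothM.
by exists K; split => // x nK; rewrite fctE fK// mul0r.
Qed.

Lemma testN f : test_function Q f -> test_function Q (- f).
Proof.
move=> [sf [K [cK KQ fK]]]; split; first exact: smoothN.
by exists K; split => // x nK; rewrite fctE fK// oppr0.
Qed.

Lemma partial_eq0 (K : set E) i f : compact K -> (forall x, ~ K x -> f x = 0) ->
  forall x, ~ K x -> partial i f x = 0.
Proof.
move=> cK fK x nK.
have oK : open (~` K) by exact: closed_openC (compact_closed (@norm_hausdorff R E) cK).
have : \forall y \near x, ~ K y by apply: open_nbhs_nbhs.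
move=> nearK; rewrite /partial.
rewrite (@near_eq_derive _ _ _ f (cst 0)) ?derive_cst//.
by apply: filterS nearK => y /fK ->.
Qed.

Lemma test_partial i f : test_function Q f -> test_function Q (partial i f).
Proof.
move=> [sf [K [cK KQ fK]]]; split; first exact: smooth_partial.
by exists K; split => //; exact: partial_eq0.
Qed.

Lemma compact_ball (K : set E) : compact K -> exists2 n : nat, (0 < n)%N &
  K `<=` ball (0 : E) n%:R.
Proof.
move=> /compact_bounded[M [Mr MK]].
pose n := (Num.bound `|M + 1|).+1; exists n => // x Kx.
rewrite -ball_normE /ball_/= sub0r normrN.
have := MK (M + 1); rewrite ltrDl ltr01 => /(_ erefl x Kx) h.
apply: (le_lt_trans h); apply: (le_lt_trans (ler_norm _)).
by rewrite (lt_trans (archi_boundP _))// ltr_nat.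
Qed.

Lemma test_bounded phi : test_function Q phi ->
  exists2 M : R, 0 <= M & forall x, `|phi x| <= M.
Proof.
move=> [sphi [K [cK _ phiK]]].
have : compact (phi @` K).
  by apply: continuous_compact => //; apply: continuous_subspaceT; exact: smooth_continuous.
move=> /compact_bounded[M [Mr MK]]; exists `|M + 1| => // x.
have [Kx|nKx] := pselect (K x); last by rewrite phiK// normr0.
have := MK (M + 1); rewrite ltrDl ltr01 => /(_ erefl (phi x)) h.
by rewrite (le_trans (h _))// ?ler_norm//; exists x.
Qed.

Lemma measurable_smooth phi : smooth phi -> measurable_fun setT phi.
Proof. by move=> sphi; apply: measurable_continuous; exact: smooth_continuous. Qed.

Lemma Lp_test (p : R) phi : 1 <= p -> test_function Q phi -> Lp leb p phi.
Proof.
move=> p1 tphi; have [M M0 phiM] := test_bounded tphi.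
have [sphi [K [cK _ phiK]]] := tphi; have [n n0 Kn] := compact_ball cK.
have LB : Lp leb p (M *: \1_(ball (0 : E) n%:R)).
  apply: (subspaceZ _ (subspace_Lp _ p1)); apply: Lp_indic => //.
    exact: measurable_ball_euclid.
  by apply: lebesgue_on_ball; rewrite ltr0n.
apply: (Lp_le p1 (measurable_smooth sphi) LB); apply: aeW => x.
rewrite -[(M *: \1_(ball (0 : E) n%:R)) x]/(M * \1_(ball (0 : E) n%:R) x) indicE.
have [Bx|nBx] := pselect (ball (0 : E) n%:R x).
  by rewrite mem_set// mulr1 (ger0_norm M0).
by rewrite memNset// mulr0 normr0 phiK ?normr0// => /Kn.
Qed.

(** With N = c.2 + 1 and centre q the arguments are 1 + N (x_i - q_i) and 1 - N (x_i - q_i), both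
    positive exactly when |x_i - q_i| < 1 / N. *)
Definition bump_factor (c : 'rV[rat]_d * nat) i (x : E) : R :=
  bump 1 (c.2.+1%:R * (x : 'rV[R]_d) ord0 i + (1 - c.2.+1%:R * ratr (c.1 ord0 i))) *
  bump 1 (- c.2.+1%:R * (x : 'rV[R]_d) ord0 i + (1 + c.2.+1%:R * ratr (c.1 ord0 i))).

Definition bump_ball (c : 'rV[rat]_d * nat) : E -> R := \prod_(i < d) bump_factor c i.

Lemma bump_ballE c x : bump_ball c x = \prod_(i < d) bump_factor c i x.
Proof. by rewrite /bump_ball fct_prodE. Qed.

Lemma smooth_bump_ball c : smooth (bump_ball c).
Proof. by apply: smooth_prod => i; apply: smoothM; exact: smooth_bump. Qed.

Lemma bump_factor_ge0 c i x : 0 <= bump_factor c i x.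
Proof. by rewrite mulr_ge0// bump1_ge0. Qed.

Lemma bump_ball_ge0 c x : 0 <= bump_ball c x.
Proof. by rewrite bump_ballE; apply: prodr_ge0 => i _; exact: bump_factor_ge0. Qed.

Lemma bump_ball_le1 c x : bump_ball c x <= 1.
Proof.
rewrite bump_ballE; apply: prodr_ile1 => i _; rewrite bump_factor_ge0/=.
by rewrite mulr_ile1 ?bump1_ge0 ?bump1_le1.
Qed.

Lemma bump_factor_gt0 c i x : (0 < bump_factor c i x) =
  (`|(x : 'rV[R]_d) ord0 i - ratr (c.1 ord0 i)| < c.2.+1%:R^-1).
Proof.
have n0 : 0 < c.2.+1%:R :> R by [].
transitivity ((0 < c.2.+1%:R * (x : 'rV[R]_d) ord0 i + (1 - c.2.+1%:R * ratr (c.1 ord0 i))) &&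
   (0 < - c.2.+1%:R * (x : 'rV[R]_d) ord0 i + (1 + c.2.+1%:R * ratr (c.1 ord0 i)))).
  rewrite -[X in _ = X && _]bump1_gt0 -[X in _ = _ && X]bump1_gt0 /bump_factor; apply/idP/andP => [h|[? ?]]; last exact: mulr_gt0.
  split; rewrite lt_neqAle bump1_ge0 andbT eq_sym; apply: contraTneq h => ->;
  by rewrite ?mul0r ?mulr0 ltxx.
rewrite -[RHS](ltr_pM2l n0) mulfV ?gt_eqF// -[X in X * `|_|](gtr0_norm n0) -normrM.
rewrite ltr_norml mulrBr; set a := _ * (x : 'rV[R]_d) ord0 i; set b := _ * ratr _.
by rewrite mulNr -/a; apply/andP/andP => -[? ?]; split; lra.
Qed.

Lemma bump_ball_gt0 c x : 0 < bump_ball c x <-> @rational_ball R d c x.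
Proof.
rewrite /rational_ball ball_euclidP ?invr_gt0// bump_ballE; split => [h i|h].
  rewrite mxE -bump_factor_gt0 lt_neqAle bump_factor_ge0 andbT eq_sym.
  apply: contraTneq h => bi; rewrite (bigD1 i)//= bi mul0r.
  by rewrite ltxx.
by apply: prodr_gt0 => i _; rewrite bump_factor_gt0; have := h i; rewrite mxE.
Qed.

Lemma test_bump_ball (c : 'rV[rat]_d * nat) :
  (forall y : E, (forall i, `|(y : 'rV[R]_d) ord0 i - ratr (c.1 ord0 i)|
      <= c.2.+1%:R^-1) -> Q y) -> test_function Q (bump_ball c).
Proof.
move=> cQ; split; first exact: smooth_bump_ball.
pose r : R := c.2.+1%:R^-1.
exists [set y : E | forall i, (y : 'rV[R]_d) ord0 i \in
  `[ratr (c.1 ord0 i) - r, ratr (c.1 ord0 i) + r]]; split.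
- apply: (@rV_compact R d (fun i => `[ratr (c.1 ord0 i) - r, ratr (c.1 ord0 i) + r]%classic)).
  by move=> i; exact: segment_compact.
- by move=> y /= yc; apply: cQ => i; rewrite ler_distl; exact: yc.
- move=> x /= nx; apply/eqP; rewrite eq_le bump_ball_ge0 andbT leNgt.
  apply/negP => /bump_ball_gt0; rewrite /rational_ball ball_euclidP ?invr_gt0// => cx; apply: nx => i.
  by rewrite in_itv/= -ler_distl ltW//; have := cx i; rewrite mxE.
Qed.

End test_functions.

Section test_functions_dense.
Context {R : realType} {d : nat}.
Local Notation E := (euclid R d).
Variables (Q : set E) (oQ : open Q) (p : R).
Hypothesis p1 : 1 <= p.
Local Notation leb := (lebesgue_on oQ).
Implicit Types f g phi : E -> R.

Definition cutoff phi :=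
  [/\ test_function Q phi, forall x, 0 <= phi x & forall x, phi x <= 1].

Definition positivity_set phi : set E := [set x | 0 < phi x].

Lemma cutoffM f g : cutoff f -> cutoff g -> cutoff (f * g) /\
  positivity_set (f * g) = positivity_set f `&` positivity_set g.
Proof.
move=> [tf f0 f1] [tg g0 g1]; split.
  split; first exact: testM tf (test_smooth tg).
  - by move=> x; rewrite fctE mulr_ge0.
  - by move=> x; rewrite fctE mulr_ile1.
apply/seteqP; split => x; rewrite /positivity_set/= fctE; last first.
  by move=> [? ?]; rewrite mulr_gt0.
by move=> fg; split; rewrite lt_neqAle ?f0 ?g0 andbT; apply: contraTneq fg => <-;
  rewrite ?mul0r ?mulr0 ltxx.
Qed.

(** The function is 1 - (1 - f) (1 - g), the probabilistic or: a smooth substitute for the maximum.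
    It makes finite unions of positivity sets again positivity sets. *)
Lemma cutoff_join f g : cutoff f -> cutoff g -> cutoff (f + g - f * g) /\
  positivity_set (f + g - f * g) = positivity_set f `|` positivity_set g.
Proof.
move=> [tf f0 f1] [tg g0 g1].
have E x : (f + g - f * g) x = 1 - (1 - f x) * (1 - g x) by rewrite !fctE; ring.
split.
  split.
  - by apply: testD; [exact: testD|apply: testN; exact: testM tf (test_smooth tg)].
  - by move=> x; rewrite E subr_ge0 mulr_ile1 ?subr_ge0// gerBl.
  - by move=> x; rewrite E gerBl mulr_ge0 ?subr_ge0.
apply/seteqP; split => x; rewrite /positivity_set/= E.
  have [f00|fn0] := eqVneq (f x) 0; last by left; rewrite lt_neqAle f0 eq_sym fn0.
  by rewrite f00 subr0 mul1r opprB addrC subrK; right.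
move=> fg; rewrite subr_gt0; have f1x := f1 x; have g1x := g1 x.
have := f0 x; have := g0 x; case: fg => h ? ?.
  by apply: (@le_lt_trans _ _ (1 - f x)); [rewrite ler_piMr ?subr_ge0// gerBl|rewrite gtrBl].
by apply: (@le_lt_trans _ _ (1 - g x)); [rewrite ler_piMl ?subr_ge0// gerBl|rewrite gtrBl].
Qed.

Lemma cutoff0 : cutoff 0.
Proof. by split => //; exact: test0. Qed.

Lemma measurable_positivity_set phi : test_function Q phi ->
  measurable (positivity_set phi) /\ (leb (positivity_set phi) < +oo)%E.
Proof.
move=> tphi; have mA : measurable (positivity_set phi).
  apply: open_measurable_euclid.
  have /continuousP := smooth_continuous (test_smooth tphi).
  have o0 : open (`]0, +oo[%classic : set R) by exact: interval_open.
  move=> /(_ _ o0).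
  by congr open; apply/seteqP; split => x /=; rewrite in_itv/= andbT.
split => //; have [_ [K [cK _ phiK]]] := tphi; have [n n0 Kn] := compact_ball cK.
apply: (@le_lt_trans _ _ (leb (ball (0 : E) n%:R))).
  apply: le_measure; rewrite ?inE//; first exact: measurable_ball_euclid.
  move=> x; rewrite /positivity_set/= => phix; apply: Kn; apply: contrapT => /phiK phix0.
  by rewrite phix0 ltxx in phix.
by apply: lebesgue_on_ball; rewrite ltr0n.
Qed.

Section closed_subspace_tests.
Variable X : set (E -> R).
Hypothesis Xc : closed_subspace (Lp leb p) (Lp_norm leb p) X.
Hypothesis Xt : forall phi, test_function Q phi -> X phi.

(* 1 - (1 - phi)^k is a polynomial in phi without constant term, hence a test
   function, and it increases to the indicator function of {phi > 0}. *)
Lemma indic_positivity_set phi : cutoff phi -> X (\1_(positivity_set phi)).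
Proof.
move=> [tphi phi0 phi1].
pose f_ k := iter k (fun f => f + phi - f * phi) (0 : E -> R).
have fE k x : f_ k x = 1 - (1 - phi x) ^+ k.
  elim: k => [|k IH]; first by rewrite expr0 subrr.
  by rewrite /f_ iterS -/(f_ k) !fctE IH exprS; ring.
have tf k : test_function Q (f_ k).
  elim: k => [|k IH]; first exact: test0.
  rewrite /f_ iterS; apply: testD; first exact: testD.
  by apply: testN; exact: testM (test_smooth tphi).
have [mA Aoo] := measurable_positivity_set tphi.
apply: (closed_subspace_dominated p1 Xc (f_ := f_) (g := \1_(positivity_set phi))).
- by move=> k; exact: Xt.
- exact: Lp_indic.
- move=> k x; rewrite fE indicE.
  have [Ax|nAx] := pselect (positivity_set phi x).
    rewrite mem_set// normr1 ger0_norm ?gerBl ?exprn_ge0 ?subr_ge0//.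
    by rewrite exprn_ile1 ?subr_ge0// gerBl.
  have -> : phi x = 0 by apply/eqP; rewrite eq_le phi0 andbT leNgt; exact/negP.
  by rewrite subr0 expr1n subrr normr0.
- move=> x; rewrite indicE.
  have [Ax|nAx] := pselect (positivity_set phi x); last first.
    have phix : phi x = 0 by apply/eqP; rewrite eq_le phi0 andbT leNgt; exact/negP.
    rewrite memNset//; under eq_fun do rewrite fE phix subr0 expr1n subrr.
    exact: cvg_cst.
  rewrite mem_set//; under eq_fun do rewrite fE.
  have z1 : `|1 - phi x| < 1 by rewrite ger0_norm ?subr_ge0// gtrBl.
  have h : (fun k => 1 - (1 - phi x) ^+ k) @ \oo --> (1 - 0 : R).
    by apply: cvgB; [exact: cvg_cst|exact: cvg_expr].
  by rewrite subr0 in h; exact: h.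
Qed.

Let bump_seq n : E -> R :=
  if (unpickle n : option ('rV[rat]_d * nat)) is Some c then
    if `[< forall y : E, (forall i, `|(y : 'rV[R]_d) ord0 i - ratr (c.1 ord0 i)|
      <= c.2.+1%:R^-1) -> Q y >] then bump_ball c else 0
  else 0.

Let bump_seq_cutoff n : cutoff (bump_seq n).
Proof.
rewrite /bump_seq; case: unpickle => [c|]; last exact: cutoff0.
case: asboolP => [cQ|_]; last exact: cutoff0.
split; [exact: test_bump_ball|exact: bump_ball_ge0|exact: bump_ball_le1].
Qed.

Let partial_join n : E -> R := iteri n (fun k f => f + bump_seq k - f * bump_seq k) 0.

Let partial_join_cutoff n : cutoff (partial_join n).
Proof.
elim: n => [|n IH]; first exact: cutoff0.
by have [] := cutoff_join IH (bump_seq_cutoff n).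
Qed.

Let partial_joinS n : positivity_set (partial_join n.+1) =
  positivity_set (partial_join n) `|` positivity_set (bump_seq n).
Proof. by have [] := cutoff_join (partial_join_cutoff n) (bump_seq_cutoff n). Qed.

(** The complement of Q is null for the measure on Q; adding it makes the sets exhaust the whole
    space. *)
Let exhaustion n : set E := ~` Q `|` positivity_set (partial_join n).

Let bigcup_exhaustion : \bigcup_n exhaustion n = setT.
Proof.
apply/seteqP; split => // x _.
have [Qx|nQx] := pselect (Q x); last by exists 0%N => //; left.
have [c [cx cQ]] := open_rational_ball oQ Qx.
exists (pickle c).+1 => //; right; rewrite partial_joinS; right.
rewrite /bump_seq pickleK /positivity_set/= ifT; last exact/asboolP.
exact/bump_ball_gt0.
Qed.

Let nondecreasing_exhaustion : nondecreasing_seq exhaustion.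
Proof.
apply/nondecreasing_seqP => n; apply/subsetPset; apply: setUS.
by rewrite partial_joinS; exact: subsetUl.
Qed.

Let indic_exhaustion n A :
  (\1_(A `&` positivity_set (partial_join n)) : E -> R) = \1_(A `&` exhaustion n) %[ae leb].
Proof.
apply: ae_lebesgue_on => x Qx _; rewrite !indicE; congr (_%:R); congr nat_of_bool.
apply/idP/idP; rewrite !inE => -[Ax Dx]; split => //; first by right.
by case: Dx.
Qed.

(** Positivity sets of cutoffs are stable under intersection and generate the Borel subsets of Q,
    and every measurable set agrees almost everywhere on Q with such a subset. *)
Lemma closed_subspace_tests : X = Lp leb p.
Proof.
pose G := [set A | exists2 phi, cutoff phi & A = positivity_set phi].
have mQ : measurable Q by exact: open_measurable_euclid.
have sG : sigma_algebra setT <<s G >> by exact: smallest_sigma_algebra.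
have GQ : <<s G >> Q.
  apply: (sigma_algebra_open sG oQ) => c cQ; apply: sub_sigma_algebra.
  exists (bump_ball c).
    split; [exact: test_bump_ball|exact: bump_ball_ge0|exact: bump_ball_le1].
  by apply/seteqP; split => x /bump_ball_gt0.
have mD n : measurable (exhaustion n).
  apply: measurableU; first exact: measurableC.
  by have [/measurable_positivity_set[]] := partial_join_cutoff n.
apply: (closed_subspace_generated p1 Xc (G := G) (D := exhaustion)) => //.
- move=> _ _ [f cf ->] [g cg ->]; have [cfg fg] := cutoffM cf cg.
  by exists (f * g).
- by move=> _ [f [/measurable_positivity_set[mf _] _ _] ->].
- move=> A mA; have [B [bB AB BA0]] := lebesgue_borel_hull mA.
  have mB : measurable B by exact: caratheodory_measurable_mu_ext.
  exists (B `&` Q).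
    (* The sets whose trace on Q is generated form a sigma-algebra, because Q itself is
       generated. *)
    pose S := [set A | <<s G >> (A `&` Q)].
    have sS : sigma_algebra setT S.
      split.
      - by rewrite /S/= set0I; exact: sigma_algebra0.
      - move=> C SC; rewrite /S/= setTD.
        rewrite (_ : _ `&` Q = Q `\` (C `&` Q)); last first.
          by apply/seteqP; split => x /=; tauto.
        exact: (@measurableD _ (g_sigma_algebraType G) _ _ GQ SC).
      - move=> F SF; rewrite /S/= setI_bigcupl; exact: sigma_algebra_bigcup.
    apply: (borel_sub_sigma_algebra sS) bB => U oU.
    have oUQ : open (U `&` Q) by exact: openI.
    apply: (sigma_algebra_open sG oUQ) => c cUQ; apply: sub_sigma_algebra.
    have cQ y : (forall i, `|(y : 'rV[R]_d) ord0 i - ratr (c.1 ord0 i)|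
      <= c.2.+1%:R^-1) -> Q y by move=> /cUQ[].
    exists (bump_ball c).
      split; [exact: test_bump_ball|exact: bump_ball_ge0|exact: bump_ball_le1].
    by apply/seteqP; split => x /bump_ball_gt0.
  have AB1 := hull_ae oQ mA mB AB BA0.
  have BQ : (\1_B : E -> R) = \1_(B `&` Q) %[ae leb].
    apply: ae_lebesgue_on => x Qx _; rewrite !indicE; congr (_%:R); congr nat_of_bool.
    by apply/idP/idP; rewrite !inE; [split|case].
  by move: AB1; apply: filterS2 BQ => x h1 h2 xT; rewrite h2// h1.
- move=> k; split => //; have [tk _ _] := partial_join_cutoff k.
  have [mk koo] := measurable_positivity_set tk.
  apply: (le_lt_trans _ koo); rewrite [leLHS]lebesgue_onE.
  apply: (@le_trans _ _ (lebesgue_rV (positivity_set (partial_join k) `&` Q))) => //.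
  apply: le_measure; rewrite ?inE; [exact: measurableI|exact: measurableI|].
  by move=> x [[|]].
- move=> k; have := indic_exhaustion k setT; rewrite !setTI.
  apply: (closed_subspace_ae p1 Xc); last exact: measurable_indic.
  exact/indic_positivity_set/partial_join_cutoff.
- move=> _ k [phi cphi ->].
  have [cfg fg] := cutoffM cphi (partial_join_cutoff k).
  have := indic_exhaustion k (positivity_set phi); rewrite -fg.
  apply: (closed_subspace_ae p1 Xc); first exact: indic_positivity_set.
  apply: measurable_indic; apply: measurableI => //.
  by have [/measurable_positivity_set[]] := cphi.
Qed.

End closed_subspace_tests.

Lemma total_family_tests :
  total_family leb p (fun phi : {phi | test_function Q phi} => sval phi).
Proof.
split => [[phi tphi]|X Xc Xt]; first exact: Lp_test.
by apply: closed_subspace_tests => // phi tphi; exact: (Xt (exist _ phi tphi)).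
Qed.

End test_functions_dense.

(** The fundamental lemma of the calculus of variations: by totality f is orthogonal to all of L^q,
    whereas by Hahn-Banach and Riesz some g in L^q would detect a nonzero f. *)
Lemma total_family_eq0 {R : realType} {d} {T : measurableType d}
    (mu : {sigma_finite_measure set T -> \bar R}) (p q : R) (I : Type) (e : I -> T -> R)
    (f : T -> R) : 1 < p -> p^-1 + q^-1 = 1 -> total_family mu q e -> Lp mu p f ->
  (forall i, \int[mu]_x (f x * e i x) = 0) -> f = 0 %[ae mu].
Proof.
move=> p1 pq [Le te] Lf fe.
have q1 : 1 < q := conjugate_gt1 p1 pq.
have qp : q^-1 + p^-1 = 1 by rewrite addrC.
have p1' := ltW p1; have q1' := ltW q1.
have snp := seminormed_Lp mu p1'.
have Xq : [set g | Lp mu q g /\ \int[mu]_x (g x * f x) = 0] = Lp mu q.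
  apply: te; first exact: (bounded_functional_kernel (seminormed_Lp mu q1') (pairing_functional q1 qp Lf)).
  by move=> i; split => //; rewrite -(fe i); apply: eq_Rintegral => x _; rewrite mulrC.
suff : Lp_norm mu p (f - 0) = 0%E.
  by move/(Lp_normB_ae mu p1' (Lp_measurable Lf) (measurable_cst _)).
rewrite subr0; apply: contrapT => nf.
have [|l [lb _ lf]] := separating_functional snp (null_closed_subspace snp) Lf.
  by move=> [_].
have [g Lg lE] := riesz_representation p1 pq lb.
move: lf; rewrite lE// => /eqP; apply.
have : [set g | Lp mu q g /\ \int[mu]_x (g x * f x) = 0] g by rewrite Xq.
by move=> [_ <-]; apply: eq_Rintegral => x _; rewrite mulrC.
Qed.

Lemma ae_eq_Rintegral {R : realType} {d} {T : measurableType d}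
    (mu : {measure set T -> \bar R}) (f g : T -> R) :
  measurable_fun setT f -> measurable_fun setT g -> f = g %[ae mu] ->
  \int[mu]_x f x = \int[mu]_x g x.
Proof.
move=> mf mg fg; rewrite /Rintegral; congr fine; apply: ae_eq_integral => //.
- exact/measurable_EFinP.
- exact/measurable_EFinP.
- by move: fg; apply: filterS => x h xT; rewrite h.
Qed.

Section swap.
Context {R : realType} {d1 d2} {T1 : measurableType d1} {T2 : measurableType d2}.
Variables (m1 : {sigma_finite_measure set T1 -> \bar R}).
Variables (m2 : {sigma_finite_measure set T2 -> \bar R}).

Definition pair_swap (S T : Type) (z : S * T) : T * S := (z.2, z.1).

Lemma measurable_pair_swap : measurable_fun setT (@pair_swap T1 T2).
Proof. by apply/measurable_fun_pairP; split; [exact: measurable_snd|exact: measurable_fst]. Qed.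

Lemma product_measure_swap A : measurable A ->
  (m1 \x m2)%E (@pair_swap T1 T2 @^-1` A) = (m2 \x m1)%E A.
Proof.
move=> mA; pose nu : {measure set (T2 * T1) -> \bar R} :=
  measure_function_pushforward__canonical__measure_function_Measure
    (m1 \x m2)%E measurable_pair_swap.
have -> : (m2 \x m1)%E A = nu A; last by [].
apply: product_measure_unique => // B C mB mC.
rewrite /nu /= /pushforward (_ : _ @^-1` _ = C `*` B); last first.
  by apply/seteqP; split => -[x y] []/=.
by rewrite product_measure1E// muleC.
Qed.

Lemma Rintegral_fubini1 (g : T1 * T2 -> R) : (m1 \x m2)%E.-integrable setT (EFin \o g) ->
  \int[(m1 \x m2)%E]_z g z = \int[m1]_x \int[m2]_y g (x, y).
Proof.
move=> ig; rewrite /Rintegral -fubini1//; congr fine.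
have mg : measurable_fun setT g by apply/measurable_EFinP; case/integrableP: ig.
apply: ae_eq_integral => //.
- exact: measurable_int (integrable_fubini_F ig).
- exact/measurable_EFinP/measurable_Rintegral_section.
- have := ae_integrable1 ig; apply: filterS => x ix _.
  by rewrite /fubini_F/= fineK//; exact: integrable_fin_num.
Qed.

End swap.

Section pairing.
Context {R : realType} {d1 d2} {T1 : measurableType d1} {T2 : measurableType d2}.
Variables (m1 : {sigma_finite_measure set T1 -> \bar R}).
Variables (m2 : {sigma_finite_measure set T2 -> \bar R}).
Variables (p q : R).
Hypothesis p1 : 1 < p.
Hypothesis pq : p^-1 + q^-1 = 1.
Let q1 : 1 < q. Proof. exact: conjugate_gt1 pq. Qed.

Lemma Lp_swap (F : T1 * T2 -> R) : Lp (m1 \x m2)%E p F -> Lp (m2 \x m1)%E p (F \o @pair_swap T2 T1).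
Proof.
exact: (Lp_preserving (@measurable_pair_swap _ _ _ _) (product_measure_swap m2 m1) (ltW p1)).
Qed.

Lemma swap_operator : bounded_operator (Lp (m1 \x m2)%E p) (Lp_norm (m1 \x m2)%E p)
  (Lp (m2 \x m1)%E p) (Lp_norm (m2 \x m1)%E p) (fun F => F \o @pair_swap T2 T1).
Proof.
exact: (preserving_operator (@measurable_pair_swap _ _ _ _) (product_measure_swap m2 m1) (ltW p1)).
Qed.

Lemma Lp_norm_swap (F : T1 * T2 -> R) : Lp (m1 \x m2)%E p F ->
  Lp_norm (m2 \x m1)%E p (F \o @pair_swap T2 T1) = Lp_norm (m1 \x m2)%E p F.
Proof.
move=> LF; apply: (Lp_norm_preserving (@measurable_pair_swap _ _ _ _) (product_measure_swap m2 m1)).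
exact: Lp_measurable LF.
Qed.

Lemma pairing_fubini1 (F K : T1 * T2 -> R) : Lp (m1 \x m2)%E p F -> Lp (m1 \x m2)%E q K ->
  \int[(m1 \x m2)%E]_z (F z * K z) = \int[m1]_x \int[m2]_y (F (x, y) * K (x, y)).
Proof. by move=> LF LK; rewrite Rintegral_fubini1//; exact: (hoelder_integrable p1 pq LF LK). Qed.

Lemma slice_pairing (F : T1 * T2 -> R) a b : Lp (m1 \x m2)%E p F -> Lp m1 q a -> Lp m2 q b ->
  \int[m1]_x (slice m2 b F x * a x) = \int[(m1 \x m2)%E]_z (F z * tensor a b z).
Proof.
move=> LF La Lb; have LT := Lp_tensor La Lb.
have mF := Lp_measurable LF; have ma := Lp_measurable La; have mb := Lp_measurable Lb.
rewrite pairing_fubini1//; apply: ae_eq_Rintegral.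
- by apply: measurable_funM => //; exact: measurable_slice.
- apply: (@measurable_Rintegral_section _ _ _ _ _ m2 (fun z => F z * tensor a b z)).
  by apply: measurable_funM => //; exact: Lp_measurable LT.
have := Lp_section_ae p1 LF; apply: filterS => x LFx _.
rewrite /slice mulrC -RintegralZl//; last exact: (hoelder_integrable p1 pq LFx Lb).
by apply: eq_Rintegral => y _; rewrite /tensor/=; ring.
Qed.

End pairing.

Lemma slice_pairing_swap {R : realType} {d1 d2} {T1 : measurableType d1} {T2 : measurableType d2}
    (m1 : {sigma_finite_measure set T1 -> \bar R})
    (m2 : {sigma_finite_measure set T2 -> \bar R}) (p q : R) (F : T1 * T2 -> R) a b :
  1 < p -> p^-1 + q^-1 = 1 -> Lp (m1 \x m2)%E p F -> Lp m1 q a -> Lp m2 q b ->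
  \int[m1]_x (slice m2 b F x * a x) = \int[m2]_y (slice m1 a (F \o @pair_swap T2 T1) y * b y).
Proof.
move=> p1 pq LF La Lb; have LFs := Lp_swap p1 LF.
have q1 : 1 < q := conjugate_gt1 p1 pq.
rewrite (slice_pairing p1 pq LF La Lb) (slice_pairing p1 pq LFs Lb La).
have mG : measurable_fun setT (fun z => F z * tensor a b z).
  by apply: measurable_funM; [exact: Lp_measurable LF|exact: Lp_measurable (Lp_tensor La Lb)].
rewrite -(Rintegral_preserving (@measurable_pair_swap _ _ _ _) (product_measure_swap m2 m1) mG).
by apply: eq_Rintegral => z _; rewrite /tensor/= [_ z.2 * _]mulrC.
Qed.

Section vcons.
Variables (R : realType) (T : Type) (n : nat).
Implicit Types (f : T -> R) (G : 'I_n -> T -> R).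

(** Component 0 holds a function and component i + 1 its i-th derivative. Graphs of gradients thus
    become subsets of a power of L^p. *)
Definition vcons f G : 'I_n.+1 -> T -> R := fun k => oapp G f (unlift ord0 k).

Lemma vcons0 f G : vcons f G ord0 = f.
Proof. by rewrite /vcons unlift_none. Qed.

Lemma vconsS f G i : vcons f G (lift ord0 i) = G i.
Proof. by rewrite /vcons liftK. Qed.

Definition vtail (F : 'I_n.+1 -> T -> R) : 'I_n -> T -> R := fun i => F (lift ord0 i).

Lemma vconsK F : vcons (F ord0) (vtail F) = F.
Proof. by apply/funext => k; case: (unliftP ord0 k) => [i|] ->; rewrite ?vcons0// vconsS. Qed.

Lemma vconsB f G (F : 'I_n.+1 -> T -> R) :
  vcons f G - F = vcons (f - F ord0) (G - vtail F).
Proof.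
apply/funext => k; change (vcons f G k - F k = vcons (f - F ord0) (G - vtail F) k).
by case: (unliftP ord0 k) => [i|] ->; rewrite ?vconsS ?vcons0.
Qed.

End vcons.

Section LpV_vcons.
Context {R : realType} {d} {T : measurableType d}.
Variables (mu : {measure set T -> \bar R}) (p : R) (n : nat).

Lemma LpV_vcons (f : T -> R) (G : 'I_n -> T -> R) :
  LpV mu p (vcons f G) <-> Lp mu p f /\ LpV mu p G.
Proof.
split=> [L|[Lf LG] k].
  by split => [|i]; [have := L ord0; rewrite vcons0|have := L (lift ord0 i); rewrite vconsS].
by case: (unliftP ord0 k) => [i|] ->; rewrite ?vcons0// vconsS.
Qed.

Lemma LpV_norm_vcons (f : T -> R) (G : 'I_n -> T -> R) :
  LpV_norm mu p (vcons f G) = (Lp_norm mu p f + LpV_norm mu p G)%E.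
Proof.
rewrite /LpV_norm big_ord_recl vcons0; congr (_ + _)%E.
by apply: eq_bigr => i _; rewrite vconsS.
Qed.

End LpV_vcons.

Lemma closed_subspace_kernels {R : realType} (V : lmodType R) (E : set V) (N : V -> \bar R)
    (I : Type) (l : I -> V -> R) : seminormed E N ->
  (forall i, bounded_functional E N (l i)) ->
  closed_subspace E N [set f | E f /\ forall i, l i f = 0].
Proof.
move=> sn lb; have K i := bounded_functional_kernel sn (lb i); split => [f []//||f [Ef Kf]].
  split; first by split => [|i]; [exact: (sn_sub sn).1|have [_ [[]]] := K i].
  move=> a f g [Ef lf] [Eg lg]; split => [|i]; first exact: (sn_sub sn).2.
  have [_ [_ sK] _] := K i.
  by have [] : [set f | E f /\ l i f = 0] (a *: f + g) by apply: sK.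
split => // i; have [_ _ cK] := K i.
suff [] : [set f | E f /\ l i f = 0] f by [].
by apply: cK; split => // e /Kf[g [Eg lg] fg]; exists g.
Qed.

(** * Graphs of weak gradients *)

Section weak_gradient_facts.
Context {R : realType} {d : nat} (Q : set (euclid R d)) (oQ : open Q) (p q : R).
Hypothesis p1 : 1 < p.
Hypothesis pq : p^-1 + q^-1 = 1.
Local Notation E := (euclid R d).
Local Notation leb := (lebesgue_on oQ).
Let q1 : 1 < q. Proof. exact: conjugate_gt1 pq. Qed.
Let p1' : 1 <= p. Proof. exact: ltW. Qed.
Let q1' : 1 <= q. Proof. exact: ltW. Qed.

Lemma test_Lq phi : test_function Q phi -> Lp leb q phi.
Proof. exact: Lp_test. Qed.

(** A bounded functional of the pair (v, g). The graph of the weak gradient is the common kernel of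
    these functionals, and is therefore closed. *)
Definition weak_gradient_defect (c : {phi | test_function Q phi} * 'I_d)
    (F : 'I_d.+1 -> E -> R) : R :=
  \int[leb]_x (F ord0 x * partial c.2 (sval c.1) x) +
  \int[leb]_x (F (lift ord0 c.2) x * sval c.1 x).

Definition gradient_graph : set ('I_d.+1 -> E -> R) :=
  [set F | weak_gradient oQ p (F ord0) (vtail F)].

Lemma gradient_graphE : gradient_graph =
  [set F | LpV leb p F /\ forall c, weak_gradient_defect c F = 0].
Proof.
apply/seteqP; split => F.
  move=> [L0 LS wF]; split.
    by rewrite -(vconsK F); apply/LpV_vcons.
  by move=> [[phi tphi] i]; rewrite /weak_gradient_defect/= wF// addNr.
move=> [LF wF]; have [L0 LS] : Lp leb p (F ord0) /\ LpV leb p (vtail F).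
  by apply/LpV_vcons; rewrite vconsK.
split => // phi tphi i; have := wF (exist _ phi tphi, i).
by rewrite /weak_gradient_defect/= => /eqP; rewrite addr_eq0 => /eqP.
Qed.

Lemma pairing_component (i : 'I_d.+1) g : Lp leb q g ->
  bounded_functional (@LpV _ _ _ leb p d.+1) (@LpV_norm _ _ _ leb p d.+1)
    (fun F => \int[leb]_x (F i x * g x)).
Proof.
move=> Lg; exact: (bounded_functional_comp (seminormed_LpV leb p1' d.+1)
  (seminormed_Lp leb p1') (LpV_proj_operator leb p1' i) (pairing_functional p1 pq Lg)).
Qed.

Lemma closed_gradient_graph :
  closed_subspace (@LpV _ _ _ leb p d.+1) (@LpV_norm _ _ _ leb p d.+1) gradient_graph.
Proof.
rewrite gradient_graphE; apply: (closed_subspace_kernels (seminormed_LpV leb p1' d.+1)).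
move=> [[phi tphi] i]; have tp := test_partial i tphi.
have b0 := pairing_component ord0 (test_Lq tp).
have bS := pairing_component (lift ord0 i) (test_Lq tphi).
exact: (bounded_functionalD (seminormed_LpV leb p1' d.+1) b0 bS).
Qed.

(** The difference of the two gradients is orthogonal to the test functions, which are total in
    L^q. *)
Lemma weak_gradient_ae v g v' g' : weak_gradient oQ p v g -> weak_gradient oQ p v' g' ->
  v = v' %[ae leb] -> forall i, g i = g' i %[ae leb].
Proof.
move=> [Lv Lg wg] [Lv' Lg' wg'] vv' i.
have LB : Lp leb p (g i - g' i) by exact: (subspaceB (subspace_Lp leb p1')).
suff : g i - g' i = 0 %[ae leb].
  by apply: filterS => x /[apply] /eqP; rewrite !fctE subr_eq0 => /eqP.
apply: (total_family_eq0 p1 pq (total_family_tests oQ q1') LB) => -[phi tphi] /=.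
have Lphi := test_Lq tphi; have Lpart := test_Lq (test_partial i tphi).
have [lin _] := pairing_functional p1 pq Lphi.
rewrite (linear_onB (subspace_Lp leb p1') lin)//.
apply/eqP; rewrite subr_eq0; apply/eqP/oppr_inj; rewrite -wg// -wg'//.
apply: ae_eq_Rintegral.
- exact: measurable_funM (Lp_measurable Lv) (Lp_measurable Lpart).
- exact: measurable_funM (Lp_measurable Lv') (Lp_measurable Lpart).
- by move: vv'; apply: filterS => x /[apply] ->.
Qed.

Lemma gradP v : W1p oQ p v -> weak_gradient oQ p v (grad oQ p v).
Proof. by move=> [g wg]; exact: (@xgetPex _ (fun _ _ => 0) [set g | weak_gradient oQ p v g] (ex_intro _ g wg)). Qed.

Lemma gradient_graph_grad v : W1p oQ p v -> gradient_graph (vcons v (grad oQ p v)).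
Proof.
move=> /gradP; rewrite /gradient_graph/= vcons0; congr weak_gradient.
by apply/funext => i; rewrite /vtail vconsS.
Qed.

Lemma W1p_normE v g : weak_gradient oQ p v g ->
  W1p_norm oQ p v = LpV_norm leb p (vcons v g).
Proof.
move=> wg; rewrite LpV_norm_vcons /W1p_norm; congr (_ + _)%E.
have wG : weak_gradient oQ p v (grad oQ p v) by apply: gradP; exists g.
have [_ LG _] := wG; have [_ Lg _] := wg.
apply: eq_bigr => i _; apply: Lp_norm_ae; [exact: Lp_measurable (LG i)|exact: Lp_measurable (Lg i)|].
by apply: (weak_gradient_ae wG wg); exact: aeW.
Qed.

Section fields.
Context {dO : measure_display} {Omega : measurableType dO} (P : probability Omega R).
Local Notation mu := (P \x leb)%E.
Local Notation field := (Omega * E -> R).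
Let sL := seminormed_LpV mu p1' d.+1.

Lemma weak_gradient_QE u (G : 'I_d -> field) : weak_gradient_Q oQ p P u G <->
  LpV mu p (vcons u G) /\
  {ae P, forall w, gradient_graph (fun i x => vcons u G i (w, x))}.
Proof.
have E w : gradient_graph (fun i x => vcons u G i (w, x)) <->
    weak_gradient oQ p (fun x => u (w, x)) (fun i x => G i (w, x)).
  rewrite /gradient_graph/= vcons0 (_ : vtail _ = fun i x => G i (w, x))//.
  by apply/funext => i; rewrite /vtail vconsS.
split => [[Lu LG wG]|[/LpV_vcons[Lu LG] wG]].
  by split; [apply/LpV_vcons|move: wG; apply: filterS => w /E].
by split => //; move: wG; apply: filterS => w /E.
Qed.

Lemma weak_gradient_Q_ae u G u' G' : weak_gradient_Q oQ p P u G ->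
  weak_gradient_Q oQ p P u' G' -> u = u' %[ae mu] -> forall i, G i = G' i %[ae mu].
Proof.
move=> [Lu LG wG] [Lu' LG' wG'] uu' i.
apply: prod1_ae.
  have := measurable_eq_set (Lp_measurable (LG i)) (Lp_measurable (LG' i)).
  by congr measurable; apply/seteqP; split => z //= /(_ I).
have uu1 := ae_prod1 uu'.
move: wG; apply: filterS3 wG' uu1 => w wG' uu1 wG.
by apply: (weak_gradient_ae wG wG').
Qed.

Lemma nablaP u : LpW1p oQ p P u -> weak_gradient_Q oQ p P u (nabla oQ p P u).
Proof.
move=> [G wG].
exact: (@xgetPex _ (fun _ _ => 0) [set G | weak_gradient_Q oQ p P u G] (ex_intro _ G wG)).
Qed.

(** [nabla] is one choice among gradients that agree almost everywhere, and the norm does not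
    distinguish them. *)
Lemma LpW1p_normE u G : weak_gradient_Q oQ p P u G ->
  LpW1p_norm oQ p P u = LpV_norm mu p (vcons u G).
Proof.
move=> wG; rewrite LpV_norm_vcons /LpW1p_norm; congr (_ + _)%E.
have wN : weak_gradient_Q oQ p P u (nabla oQ p P u) by apply: nablaP; exists G.
have [_ LN _] := wN; have [_ LG _] := wG.
apply: eq_bigr => i _; apply: Lp_norm_ae; [exact: Lp_measurable (LN i)|exact: Lp_measurable (LG i)|].
by apply: (weak_gradient_Q_ae wN wG); exact: aeW.
Qed.

Definition sections_in_graph : set ('I_d.+1 -> field) :=
  [set F | LpV mu p F /\ {ae P, forall w, gradient_graph (fun i x => F i (w, x))}].

Lemma sections_in_graph_subspace : subspace sections_in_graph.
Proof.
have [_ sJ _] := closed_gradient_graph.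
split; first by split; [exact: (sn_sub sL).1|apply: aeW => w; exact: sJ.1].
move=> a F G [LF JF] [LG JG]; split; first exact: (sn_sub sL).2.
move: JG; apply: filterS2 JF => w JF JG.
exact: (sJ.2 a (fun i x => F i (w, x)) (fun i x => G i (w, x))).
Qed.

(* Along an approximating sequence the integrals over Omega of the distances
   of the sections tend to 0, hence their infimum vanishes almost everywhere. *)
Lemma closed_sections_in_graph :
  closed_subspace (@LpV _ _ _ mu p d.+1) (@LpV_norm _ _ _ mu p d.+1) sections_in_graph.
Proof.
split => [F []//||F [LF FA]]; first exact: sections_in_graph_subspace.
split => //.
have e0 (n : nat) : 0 < n.+1%:R^-1 :> R by rewrite invr_gt0.
have /choice[T TF] n : exists T, sections_in_graph T /\
    (LpV_norm mu p (F - T)%R < (n.+1%:R^-1)%:E)%E.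
  by have [T JT FT] := FA _ (e0 n); exists T.
have LB n i : Lp mu p (F i - T n i).
  have [[LT _] _] := TF n; exact: (subspaceB (subspace_Lp mu p1')).
pose D n w : \bar R := (\sum_(i < d.+1) powint leb p (fun x => (F i - T n i)%R (w, x)))%E.
have D0 n w : (0 <= D n w)%E by apply: sume_ge0 => i _; exact: powint_ge0.
have mD n : measurable_fun setT (D n).
  apply: emeasurable_sum => i; apply: measurable_powint_section.
  exact: Lp_measurable (LB n i).
have intD n : (\int[P]_w D n w <= (d.+1%:R * n.+1%:R^-1)%:E)%E.
  rewrite ge0_integral_sum//; last 2 first.
  - by move=> i; apply: measurable_powint_section; exact: Lp_measurable (LB n i).
  - by move=> i w _; exact: powint_ge0.
  apply: (@le_trans _ _ (\sum_(i < d.+1) (n.+1%:R^-1)%:E)%E); last first.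
    by rewrite sumEFin sumr_const card_ord mulr_natl.
  apply: lee_sum => i _; rewrite -powint_tonelli; last exact: Lp_measurable (LB n i).
  (* A number in ]0, 1] dominates its p-th power. *)
  apply: (@le_trans _ _ ((n.+1%:R^-1 `^ p)%:E)).
    apply/Lp_norm_pow; rewrite ?invr_ge0//.
    apply/ltW/(le_lt_trans _ (TF n).2); exact: (Lp_norm_le_LpV mu p (F - T n)).
  rewrite lee_fin -[leRHS]powRr1 ?invr_ge0//.
  apply: ger_powR => //.
  by rewrite invr_gt0 ltr0n/= invf_le1// ler1n.
pose h w := einfs (D ^~ w) 0%N.
have mh : measurable_fun setT h by exact: measurable_fun_einfs.
have h0 w : (0 <= h w)%E by apply: le_ereal_inf_tmp => _ [n _ <-]; exact: D0.
have hD n w : (h w <= D n w)%E by apply: ereal_inf_lbound; exists n.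
have inth : (\int[P]_w h w = 0)%E.
  apply: le_anti; rewrite integral_ge0 ?andbT//.
  apply/lee_addgt0Pr => e ep; rewrite add0e.
  have [n ne] : exists n : nat, d.+1%:R / e <= n.+1%:R.
    exists (Num.bound (d.+1%:R / e)); rewrite ltW// (lt_trans (archi_boundP _))//.
      by rewrite divr_ge0// ltW.
    by rewrite ltr_nat.
  apply: (@le_trans _ _ (\int[P]_w D n w)%E); first by apply: ge0_le_integral.
  apply: (le_trans (intD n)); rewrite lee_fin ler_pdivrMr//.
  by move: ne; rewrite ler_pdivrMr// mulrC.
have hae : {ae P, forall w, h w = 0%E} by apply/ge0_integral_eq0.
have secT : {ae P, forall w, forall n, gradient_graph (fun i x => T n i (w, x))}.
  by apply: ae_foralln => n; have [[_ +] _] := TF n.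
have secF : {ae P, forall w, forall i, Lp leb p (fun x => F i (w, x))}.
  have : {ae P, forall w, forall n, Lp leb p (fun x => F (inord n) (w, x))}.
    by apply: ae_foralln => n; exact: (Lp_section_ae p1 (LF _)).
  by apply: filterS => w Lw i; have := Lw i; rewrite inord_val.
move: secF; apply: filterS2 (filterI hae secT) => w [hw JT] LFw.
have [LJ _ cJ] := closed_gradient_graph; apply: cJ; split => // e ep.
(* The d + 1 components, each of norm at most e / (d + 2), add up to less than e. *)
pose c := (e / d.+2%:R) `^ p.
have c0 : 0 < c by apply: powR_gt0; rewrite divr_gt0.
have [_ [n _ <-] Dn] : exists2 y, [set D k w | k in [set k | (0 <= k)%N]] y & (y < c%:E)%E.
  by apply: ereal_inf_lt; rewrite -[X in (X < _)%E]/(h w) hw lte_fin.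
exists (fun i x => T n i (w, x)); first exact: JT.
apply: (@le_lt_trans _ _ (\sum_(i < d.+1) (e / d.+2%:R)%:E)%E).
  apply: lee_sum => i _; apply/Lp_norm_pow; rewrite ?divr_ge0 ?(ltW ep)//.
  apply/ltW/(le_lt_trans _ Dn); rewrite /D (bigD1 i)//=.
  by apply: leeDl; apply: sume_ge0 => j _; exact: powint_ge0.
rewrite sumEFin sumr_const card_ord lte_fin -(mulr_natr (e / _)) -mulrA gtr_pMr//.
by rewrite mulrC ltr_pdivrMr// mul1r ltr_nat.
Qed.

(** The algebraic tensor product of X with the graph of the weak gradient. Its closure in L^p
    replaces [tensor_W1p], whose norm involves the chosen [nabla]; the next two lemmas translate
    between them. *)
Definition tensor_graph (X : set (Omega -> R)) : set ('I_d.+1 -> field) :=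
  [set T | exists n (f : 'I_n -> Omega -> R) (F : 'I_n -> 'I_d.+1 -> E -> R),
    [/\ forall k, X (f k), forall k, gradient_graph (F k) &
        T = fun i z => \sum_(k < n) f k z.1 * F k i z.2]].

Lemma tensor_graph_sections X : X `<=` Lp P p -> tensor_graph X `<=` sections_in_graph.
Proof.
move=> XL _ [n [f [F [Xf JF ->]]]].
rewrite (_ : (fun i z => _) = \sum_(k < n) (fun i => tensor (f k) (F k i))); last first.
  by apply/funext => i; apply/funext => z; rewrite !fct_sumE.
have [LJ sJ _] := closed_gradient_graph.
apply: (subspace_sum _ sections_in_graph_subspace) => k _; split.
  by move=> i; apply: Lp_tensor; [exact: XL|exact: (LJ _ (JF k))].
apply: aeW => w; exact: (subspaceZ (f k w) sJ (JF k)).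
Qed.

Lemma tensor_W1p_graph X u : X `<=` Lp P p -> tensor_W1p oQ p P X u ->
  norm_closure (@LpV _ _ _ mu p d.+1) (@LpV_norm _ _ _ mu p d.+1) (tensor_graph X)
    (vcons u (nabla oQ p P u)).
Proof.
move=> XL [/nablaP wu uA]; have /weak_gradient_QE Su := wu.
split => [|e e0]; first by case: Su.
have [_ [n [f [g [Xf Wg ->]]]] ue] := uA _ e0.
pose T : 'I_d.+1 -> field := fun i z => \sum_(k < n) f k z.1 * vcons (g k) (grad oQ p (g k)) i z.2.
have TT : tensor_graph X T.
  by exists n, f, (fun k => vcons (g k) (grad oQ p (g k))); split => // k; exact: gradient_graph_grad.
have gE : (fun z => \sum_(k < n) f k z.1 * g k z.2) = T ord0.
  by apply/funext => z; apply: eq_bigr => k _; rewrite vcons0.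
have := subspaceB sections_in_graph_subspace Su (tensor_graph_sections XL TT).
rewrite vconsB => /weak_gradient_QE wB.
by exists T => //; rewrite vconsB -(LpW1p_normE wB) -gE.
Qed.

(** Since [sections_in_graph] is closed, the limit of the gradients is the gradient of the limit. *)
Lemma graph_tensor_W1p X u G : X `<=` Lp P p ->
  norm_closure (@LpV _ _ _ mu p d.+1) (@LpV_norm _ _ _ mu p d.+1) (tensor_graph X) (vcons u G) ->
  tensor_W1p oQ p P X u /\ weak_gradient_Q oQ p P u G.
Proof.
move=> XL cl; have Su : sections_in_graph (vcons u G).
  exact: (norm_closure_min (tensor_graph_sections XL) closed_sections_in_graph).
have wG : weak_gradient_Q oQ p P u G by apply/weak_gradient_QE.
split => //; split => [|e e0]; first by exists G.
have [_ /(_ _ e0)[T TT ue]] := cl.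
have ST := tensor_graph_sections XL TT.
have [n [f [F [Xf JF TE]]]] := TT.
exists (T ord0).
  exists n, f, (fun k => F k ord0); split => // [k|]; last by rewrite TE.
  by exists (vtail (F k)); exact: JF.
have := subspaceB sections_in_graph_subspace Su ST.
rewrite vconsB => /weak_gradient_QE wB.
by rewrite (LpW1p_normE wB) -vconsB.
Qed.

End fields.
End weak_gradient_facts.

(** * The dynamical system *)

Section flow.
Context {R : realType} {d : nat} {dO : measure_display} {Omega : measurableType dO}.
Variables (P : probability Omega R) (tau : euclid R d -> Omega -> Omega).
Hypothesis ds : dynamical_system P tau.
Local Notation E := (euclid R d).

Lemma tauD x y w : tau x (tau y w) = tau (x + y) w.
Proof. by rewrite (flowD ds). Qed.

Lemma tau0 w : tau 0 w = w.
Proof. by rewrite (flow0 ds). Qed.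

Lemma tau_preserving x A : measurable A -> P (tau x @^-1` A) = P A.
Proof.
move=> mA; rewrite -(flow_preserving ds (- x) mA); congr (P _).
apply/seteqP; split => [w Aw|_ [w Aw <-]] /=; last by rewrite tauD subrr tau0.
by exists (tau x w) => //; rewrite tauD addNr tau0.
Qed.

Definition theta (a : R) (z : Omega * E) : Omega * E := (tau (a *: z.2) z.1, z.2).

Lemma thetaK a : a != 0 -> cancel (theta (- a)) (theta a).
Proof.
by move=> _ [w x]; rewrite /theta/= tauD scaleNr subrr tau0.
Qed.

Lemma measurable_theta a : a != 0 -> measurable_fun setT (theta a).
Proof.
move=> a0; apply/measurable_fun_pairP; split; last exact: measurable_snd.
rewrite (_ : _ \o _ = (fun z : Omega * E => tau z.2 z.1) \o
  (fun z => (z.1, affine a 0 z.2))); last first.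
  by apply/funext => z /=; rewrite /affine addr0.
apply: measurableT_comp; first exact: flow_jointly_measurable ds.
apply/measurable_fun_pairP; split; first exact: measurable_fst.
exact: (measurableT_comp (measurable_affine (0 : E) a0) measurable_snd).
Qed.

Section shift.
Variables (leb : {sigma_finite_measure set E -> \bar R}).
Local Notation mu := (P \x leb)%E.

(** The product measure is the integral over x of the P-measures of the sections at x, and each of
    them is preserved by [g x]. *)
Lemma preserving_sections (f : Omega * E -> Omega * E) (g : E -> Omega -> Omega) :
  measurable_fun setT f -> (forall w x, f (w, x) = (g x w, x)) ->
  (forall x A, measurable A -> P (g x @^-1` A) = P A) ->
  forall A, measurable A -> mu (f @^-1` A) = mu A.
Proof.
move=> mf fE gP A mA.
have E B : measurable B -> mu B = (P \x^ leb)%E B.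
  move=> mB; have h C D (mC : measurable C) (mD : measurable D) := product_measure2E P leb mC mD.
  exact: (product_measure_unique h mB).
have mfA : measurable (f @^-1` A) by rewrite -[X in measurable X]setTI; exact: mf.
rewrite !E// /product_measure2; apply: eq_integral => x _ /=.
rewrite -[RHS](gP x); last exact: measurable_ysection.
by congr (P _); apply/seteqP; split => w; rewrite /ysection/= !inE/= fE.
Qed.

Lemma theta_preserving a A : a != 0 -> measurable A -> mu (theta a @^-1` A) = mu A.
Proof.
move=> a0; apply: (preserving_sections (g := fun x => tau (a *: x))) => //.
  exact: measurable_theta.
by move=> x B mB; exact: tau_preserving.
Qed.

Definition translate (x : E) (z : Omega * E) : Omega * E := (tau x z.1, z.2).

Lemma measurable_translate x : measurable_fun setT (translate x).
Proof.
apply/measurable_fun_pairP; split; last exact: measurable_snd.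
exact: (measurableT_comp (flow_measurable ds x) measurable_fst).
Qed.

Lemma translate_preserving x A : measurable A -> mu (translate x @^-1` A) = mu A.
Proof.
apply: (preserving_sections (g := fun _ => tau x)) => //.
  exact: measurable_translate.
by move=> _ B mB; exact: tau_preserving.
Qed.

Variables (p : R).
Hypothesis p1 : 1 <= p.

Lemma tau_operator x : bounded_operator (Lp P p) (Lp_norm P p) (Lp P p) (Lp_norm P p)
  (fun f => f \o tau x).
Proof. exact: (preserving_operator (flow_measurable ds x) (tau_preserving x) p1). Qed.

Lemma Lp_tau x f : Lp P p f -> Lp P p (f \o tau x).
Proof. by have [+ _ _] := tau_operator x; exact. Qed.

Lemma Lp_norm_tau x f : Lp P p f -> Lp_norm P p (f \o tau x) = Lp_norm P p f.
Proof.
move=> /Lp_measurable mf.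
exact: (Lp_norm_preserving (flow_measurable ds x) (tau_preserving x)).
Qed.

(** For a = - 1 / eps this is the pointwise formula of S_eps. The maps [theta a] preserve the
    product measure, so the formula makes sense on all of L^p and not only on tensors. *)
Definition shift a (F : Omega * E -> R) : Omega * E -> R := F \o theta a.

Lemma shift_operator a : a != 0 ->
  bounded_operator (Lp mu p) (Lp_norm mu p) (Lp mu p) (Lp_norm mu p) (shift a).
Proof.
move=> a0; apply: (preserving_operator _ _ p1); first exact: measurable_theta.
by move=> A; exact: theta_preserving.
Qed.

Lemma Lp_shift a F : a != 0 -> Lp mu p F -> Lp mu p (shift a F).
Proof. by move=> a0; have [+ _ _] := shift_operator a0; exact. Qed.

Lemma Lp_norm_shift a F : a != 0 -> Lp mu p F -> Lp_norm mu p (shift a F) = Lp_norm mu p F.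
Proof.
move=> a0 /Lp_measurable mF.
apply: (Lp_norm_preserving (measurable_theta a0)) => // A; exact: theta_preserving.
Qed.

Lemma translate_operator x :
  bounded_operator (Lp mu p) (Lp_norm mu p) (Lp mu p) (Lp_norm mu p)
    (fun F => F \o translate x).
Proof.
exact: (preserving_operator (measurable_translate x) (translate_preserving x) p1).
Qed.

Lemma Lp_norm_translate x F : Lp mu p F -> Lp_norm mu p (F \o translate x) = Lp_norm mu p F.
Proof.
move=> /Lp_measurable mF.
exact: (Lp_norm_preserving (measurable_translate x) (translate_preserving x)).
Qed.

End shift.

Section unfolding.
Variables (p : R) (Q : set E) (oQ : open Q).
Hypothesis p1 : 1 < p.
Let p1' : 1 <= p. Proof. exact: ltW. Qed.
Local Notation leb := (lebesgue_on oQ).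
Local Notation mu := (P \x leb)%E.

Lemma is_unfolding_shift eps : 0 < eps -> is_unfolding P tau p oQ eps (shift (- eps^-1)).
Proof.
move=> e0; have a0 : - eps^-1 != 0 by rewrite oppr_eq0 invr_eq0 gt_eqF.
have na0 : eps^-1 != 0 by rewrite invr_eq0 gt_eqF.
split; last first.
  move=> u _; apply: aeW => z _.
  by rewrite /shift/= /theta scaleNr.
split.
- by move=> u; exact: Lp_shift.
- by move=> a u v _ _; exact: aeW.
- by move=> u; exact: Lp_norm_shift.
- move=> v Lv; exists (shift eps^-1 v); first exact: Lp_shift.
  apply: aeW => z _; rewrite /shift/=; congr v.
  by have := thetaK na0 z.
Qed.

(** [unfolding] is some operator with the defining properties. It agrees with the shift on
    rectangles, both are bounded, and rectangles are total. *)
Lemma unfolding_shift eps u : 0 < eps -> Lp mu p u ->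
  unfolding P tau p oQ eps u = shift (- eps^-1) u %[ae mu].
Proof.
move=> e0 Lu; have iS := is_unfolding_shift e0.
have [[TL Tlin Tn _] TT] : is_unfolding P tau p oQ eps (unfolding P tau p oQ eps).
  have exU : exists T, [set T | is_unfolding P tau p oQ eps T] T.
    by exists (shift (- eps^-1)).
  exact: (xgetPex _ exU).
have a0 : - eps^-1 != 0 by rewrite oppr_eq0 invr_eq0 gt_eqF.
have sn := seminormed_Lp mu p1'.
have sb := shift_operator leb p1' a0; have [SL _ _] := sb.
have ub : bounded_operator (Lp mu p) (Lp_norm mu p) (Lp mu p) (Lp_norm mu p)
    (unfolding P tau p oQ eps).
  split => //; last by exists 1 => f Lf; rewrite mul1e Tn.
  move=> a f g Lf Lg; have Lc : Lp mu p (a *: f + g) by exact: (sn_sub sn).2.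
  apply/(Lp_normB_ae mu p1'); [exact: Lp_measurable (TL _ Lc)| |exact: Tlin].
  by apply: (@Lp_measurable _ _ _ mu p); apply: (sn_sub sn).2; exact: TL.
have Kc := closed_subspace_preimage sn sn
  (bounded_operatorD sn sn ub (bounded_operatorZ sn sn (- 1) sb)) (null_closed_subspace sn).
have := rectangles_dense p1 Kc; set K := [set f | _].
have KE f : Lp mu p f -> K f <-> unfolding P tau p oQ eps f = shift (- eps^-1) f %[ae mu].
  move=> Lf; rewrite -(Lp_normB_ae mu p1' (Lp_measurable (TL _ Lf)) (Lp_measurable (SL _ Lf))).
  rewrite /K/= scaleN1r; split => [[_ []]//|h]; split => //; split => //.
  by apply: (subspaceB (sn_sub sn)); [exact: TL|exact: SL].
move=> KL; apply/KE => //; rewrite KL// => A B mA Aoo mB Boo.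
have LA := Lp_indic p1' mA Aoo; have LB := Lp_indic p1' mB Boo.
apply/KE; first exact: Lp_tensor.
have tAB : tensor_alg (Lp P p) (Lp leb p) (tensor (\1_A) (\1_B)) by exact: tensor_alg1.
have := TT _ tAB; apply: filterS => z /[apply] ->.
by rewrite /shift/= /theta scaleNr.
Qed.

End unfolding.
End flow.

(** * Infinitesimal generators along the coordinate axes *)

Section generators.
Context {R : realType} {d : nat} {dO : measure_display} {Omega : measurableType dO}.
Variables (P : probability Omega R) (tau : euclid R d -> Omega -> Omega) (p : R).
Hypothesis ds : dynamical_system P tau.
Hypothesis p1 : 1 < p.
Let p1' : 1 <= p. Proof. exact: ltW. Qed.
Local Notation E := (euclid R d).
Let sn := seminormed_Lp P p1'.
Let sL := sn_sub sn.

Definition diff_quotient i (h : R) (f : Omega -> R) : Omega -> R :=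
  h^-1 *: (f \o tau (h *: basis_vec i) - f).

Lemma Lp_diff_quotient i h f : Lp P p f -> Lp P p (diff_quotient i h f).
Proof.
by move=> Lf; apply: (subspaceZ _ sL); apply: (subspaceB sL) => //; exact: Lp_tau.
Qed.

Lemma is_generatorP i f g : is_generator P tau p i f g <->
  [/\ Lp P p f, Lp P p g & forall e : R, 0 < e -> \forall h \near (0 : R)^',
    (Lp_norm P p (diff_quotient i h f - g)%R <= e%:E)%E].
Proof.
split => -[Lf Lg fg]; split => //.
  move=> e e0; move/fine_cvgP : fg => [_ /cvgrPdist_le/(_ _ e0)].
  apply: filterS => h; rewrite sub0r normrN /= => he.
  have LB : Lp P p (diff_quotient i h f - g).
    by apply: (subspaceB sL) => //; exact: Lp_diff_quotient.
  by rewrite -(fineK (sn_fin sn LB)) lee_fin (le_trans (ler_norm _)).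
apply/fine_cvgP; split.
  apply: nearW => h; apply: (sn_fin sn); apply: (subspaceB sL) => //.
  exact: Lp_diff_quotient.
apply/cvgrPdist_le => e e0; have := fg e e0; apply: filterS => h.
rewrite sub0r normrN /= => he.
have LB : Lp P p (diff_quotient i h f - g).
  by apply: (subspaceB sL) => //; exact: Lp_diff_quotient.
rewrite ger0_norm ?fine_ge0 ?(sn_ge0 sn)// -lee_fin fineK//.
exact: (sn_fin sn LB).
Qed.

Lemma is_generator_linear i a f g f' g' :
  is_generator P tau p i f g -> is_generator P tau p i f' g' ->
  is_generator P tau p i (a *: f + f') (a *: g + g').
Proof.
move=> /is_generatorP[Lf Lg fg] /is_generatorP[Lf' Lg' fg'].
apply/is_generatorP; split; [exact: sL.2|exact: sL.2|move=> e e0].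
have a1 : 0 < `|a| + 1 by rewrite ltr_wpDl.
have e1 : 0 < e / 2 / (`|a| + 1) by rewrite !divr_gt0.
have e2 : 0 < e / 2 by rewrite divr_gt0.
have := fg' _ e2; apply: filterS2 (fg _ e1) => h fh fh'.
have LB k l : Lp P p k -> Lp P p l -> Lp P p (diff_quotient i h k - l).
  by move=> Lk Ll; apply: (subspaceB sL) => //; exact: Lp_diff_quotient.
rewrite (_ : _ - _ = a *: (diff_quotient i h f - g) + (diff_quotient i h f' - g')); last first.
  apply/funext => w; rewrite /diff_quotient !fctE /GRing.scale/=; ring.
apply: (le_trans (snD sn (subspaceZ a sL (LB _ _ Lf Lg)) (LB _ _ Lf' Lg'))).
rewrite (snZ sn _ (LB _ _ Lf Lg)) [e]splitr EFinD leeD//.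
apply: (le_trans (lee_wpmul2l _ fh)); first by rewrite lee_fin.
rewrite -EFinM lee_fin mulrCA ger_pMr// ler_pdivrMr// mul1r.
by rewrite lerDl.
Qed.

Lemma is_generator0 i : is_generator P tau p i 0 0.
Proof.
apply/is_generatorP; split; [exact: sL.1|exact: sL.1|move=> e e0].
apply: nearW => h; rewrite (_ : _ - _ = 0) ?(sn0 sn) ?lee_fin ?ltW//.
by apply/funext => w; rewrite /diff_quotient !fctE subrr /GRing.scale/= mulr0 subrr.
Qed.

(** T f has the difference quotients T of those of f, though only almost everywhere, since T is
    linear only modulo null elements. *)
Lemma is_generator_operator i (T : (Omega -> R) -> Omega -> R) f g :
  bounded_operator (Lp P p) (Lp_norm P p) (Lp P p) (Lp_norm P p) T ->
  (forall f x, T (f \o tau x) = T f \o tau x) ->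
  is_generator P tau p i f g -> is_generator P tau p i (T f) (T g).
Proof.
move=> bT Tc /is_generatorP[Lf Lg fg]; have [TL _ _] := bT.
have [C C0 TC] := bounded_operator_ge0 sn bT.
apply/is_generatorP; split; [exact: TL|exact: TL|move=> e e0].
have C1 : 0 < C + 1 by rewrite ltr_wpDl.
have e1 : 0 < e / (C + 1) by rewrite divr_gt0.
have := fg _ e1; apply: filterS => h fh.
have LD := Lp_diff_quotient i h Lf; have LDT := Lp_diff_quotient i h (TL _ Lf).
have LB := subspaceB sL LD Lg.
have Lft := Lp_tau ds p1' (h *: basis_vec i) Lf.
have E1 : Lp_norm P p (T (diff_quotient i h f) - diff_quotient i h (T f)) = 0%E.
  have LfB := subspaceB sL Lft Lf.
  have [_ Tlin _] := bT.
  have := Tlin h^-1 (f \o tau (h *: basis_vec i) - f) 0 LfB sL.1; rewrite addr0 => h1.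
  have h2 := bounded_operatorB bT Lft Lf.
  have h3 := Tlin 0 0 0 sL.1 sL.1; rewrite scale0r add0r scale0r add0r subrr in h3.
  apply/(Lp_normB_ae P p1'); [exact: Lp_measurable (TL _ LD)|exact: Lp_measurable LDT|].
  have L0 := TL _ sL.1.
  have T0 : T 0 = 0 %[ae P].
    have Tlin1 := Tlin 1 0 0 sL.1 sL.1; rewrite scale1r addr0 in Tlin1.
    have L2 : Lp P p (1 *: T 0 + T 0) by exact: sL.2.
    move/(Lp_normB_ae P p1' (Lp_measurable L0) (Lp_measurable L2)) : Tlin1.
    apply: filterS => w /[apply]; rewrite !fctE /GRing.scale/= mul1r => /eqP.
    by rewrite -subr_eq0 opprD addrA subrr sub0r oppr_eq0 => /eqP.
  have L3 : Lp P p (h^-1 *: T (f \o tau (h *: basis_vec i) - f) + T 0).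
    by apply: sL.2 => //; exact: TL.
  have L4 : Lp P p (T (f \o tau (h *: basis_vec i)) - T f).
    by apply: (subspaceB sL); exact: TL.
  move/(Lp_normB_ae P p1' (Lp_measurable (TL _ LD)) (Lp_measurable L3)) : h1.
  move/(Lp_normB_ae P p1' (Lp_measurable (TL _ LfB)) (Lp_measurable L4)) : h2.
  move=> h2 h1; move: h1; apply: filterS2 (filterI h2 T0) => w [h2w T0w] h1w wT.
  by rewrite h1w// !fctE h2w// T0w// addr0 !fctE Tc.
have E2 := bounded_operatorB bT LD Lg.
rewrite (snBC sn LDT (TL _ Lg)).
apply: (le_trans (sn_triangle sn (TL _ Lg) (TL _ LD) LDT)).
rewrite E1 adde0 (snBC sn (TL _ Lg) (TL _ LD)).
rewrite -(sn_eqN sn (TL _ LB) (subspaceB sL (TL _ LD) (TL _ Lg)) E2).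
apply: (le_trans (TC _ LB)); apply: (le_trans (lee_wpmul2l _ fh)); first by rewrite lee_fin.
rewrite -EFinM lee_fin mulrCA ger_pMr// ler_pdivrMr// mul1r.
by rewrite lerDl.
Qed.

(* U_s f - f telescopes along the steps s / N *)
Lemma is_generator_translation i f g (s : R) : is_generator P tau p i f g ->
  (Lp_norm P p (f \o tau (s *: basis_vec i) - f)%R <= `|s|%:E * Lp_norm P p g)%E.
Proof.
move=> /is_generatorP[Lf Lg fg].
have [->|s0] := eqVneq s 0.
  rewrite scale0r normr0 mul0e (_ : _ - _ = 0) ?(sn0 sn)//.
  by apply/funext => w; rewrite !fctE (tau0 ds) subrr.
have Lft x := Lp_tau ds p1' x Lf.
apply/lee_addgt0Pr => e e0.
have e1 : 0 < e / `|s| by rewrite divr_gt0 ?normr_gt0.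
have [N Ns] : exists N : nat, (Lp_norm P p (diff_quotient i (s / N.+1%:R) f - g)%R
    <= (e / `|s|)%:E)%E.
  have /nbhs_ballP[r /= r0 rfg] := fg _ e1.
  exists (Num.bound (`|s| / r)); apply: rfg; last first.
    by rewrite mulf_neq0// invr_eq0 pnatr_eq0.
  rewrite -ball_normE /ball_/= sub0r normrN normrM normfV (ger0_norm (ler0n _ _)).
  rewrite ltr_pdivrMr// mulrC -ltr_pdivrMr//.
  by rewrite (lt_trans (archi_boundP _)) ?divr_ge0 ?(ltW r0)// ltr_nat.
set t := s / N.+1%:R in Ns.
have t0 : t != 0 by rewrite mulf_neq0// invr_eq0 pnatr_eq0.
pose step k := (f \o tau ((k.+1%:R * t) *: basis_vec i)) - (f \o tau ((k%:R * t) *: basis_vec i)).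
have sE : f \o tau (s *: basis_vec i) - f = \sum_(k < N.+1) step k.
  rewrite -(big_mkord xpredT step) (telescope_sumr (fun k => f \o tau ((k%:R * t) *: basis_vec i)))//.
  rewrite mul0r scale0r /t mulrCA mulfV ?pnatr_eq0// mulr1.
  by congr (_ - _); apply/funext => w; rewrite /= (tau0 ds).
have stepE k : step k = t *: (diff_quotient i t f \o tau ((k%:R * t) *: basis_vec i)).
  apply/funext => w; rewrite /step /diff_quotient !fctE /GRing.scale/= mulrA mulfV// mul1r.
  rewrite (tauD ds); congr (f (tau _ w) - _).
  by rewrite -scalerDl -natr1 mulrDl mul1r addrC.
have LD := Lp_diff_quotient i t Lf.
rewrite sE; apply: (le_trans (sn_sum sn _ _)).
  by move=> k _; rewrite stepE; apply: (subspaceZ _ sL); exact: Lp_tau.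
apply: (@le_trans _ _ (\sum_(k < N.+1) (`|t|%:E * (Lp_norm P p g + (e / `|s|)%:E)))%E).
  apply: lee_sum => k _; rewrite stepE (snZ sn); last exact: Lp_tau.
  rewrite (Lp_norm_tau ds)//; apply: lee_wpmul2l; first by rewrite lee_fin.
  have -> : diff_quotient i t f = (diff_quotient i t f - g) + g by rewrite subrK.
  apply: (le_trans (snD sn (subspaceB sL LD Lg) Lg)).
  by rewrite addeC leeD2l.
have gf := sn_fin sn Lg; rewrite -(fineK gf) -EFinD -!EFinM sumEFin sumr_const card_ord.
rewrite -EFinD lee_fin -mulr_natl mulrA /t normrM normfV [X in _ * (_ / X)]ger0_norm//.
rewrite mulrCA mulfV ?pnatr_eq0// mulr1 mulrDr.
by rewrite [X in _ + X]mulrCA mulfV ?mulr1// normr_eq0.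
Qed.

Definition generator_graph : set ('I_d.+1 -> Omega -> R) :=
  [set F | Lp P p (F ord0) /\ forall i, is_generator P tau p i (F ord0) (F (lift ord0 i))].

Lemma generator_graph_LpV : generator_graph `<=` @LpV _ _ _ P p d.+1.
Proof.
move=> F [L0 Fg] k; case: (unliftP ord0 k) => [i|] -> //.
by have [] := Fg i.
Qed.

Lemma generator_graph_subspace : subspace generator_graph.
Proof.
split; first by split => [|i]; [exact: sL.1|exact: is_generator0].
move=> a F G [LF gF] [LG gG]; split => [|i]; first exact: sL.2.
exact: is_generator_linear.
Qed.

(** The closure is built into the definition. The two facts drawn from it, [generator_graph_Lpot]
    and [generator_graph_Linv], pass from the graph to its closure. *)
Definition closed_generator_graph : set ('I_d.+1 -> Omega -> R) :=
  norm_closure (@LpV _ _ _ P p d.+1) (@LpV_norm _ _ _ P p d.+1) generator_graph.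

Let snV n := seminormed_LpV P p1' n.

Lemma closed_subspace_generator_graph :
  closed_subspace (@LpV _ _ _ P p d.+1) (@LpV_norm _ _ _ P p d.+1) closed_generator_graph.
Proof.
exact: (norm_closure_subspace (snV _) generator_graph_LpV generator_graph_subspace).
Qed.

Lemma horizontal_gradients_subspace : subspace (horizontal_gradients P tau p).
Proof.
split; first by exists 0 => i; exact: is_generator0.
move=> a F G [f fF] [g gG]; exists (a *: f + g) => i.
exact: is_generator_linear.
Qed.

Lemma horizontal_gradients_LpV : horizontal_gradients P tau p `<=` @LpV _ _ _ P p d.
Proof. by move=> F [f fF] i; have [] := fF i. Qed.

Lemma closed_Lpot :
  closed_subspace (@LpV _ _ _ P p d) (@LpV_norm _ _ _ P p d) (Lpot P tau p).
Proof.
exact: (norm_closure_subspace (snV _) horizontal_gradients_LpV horizontal_gradients_subspace).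
Qed.

Lemma generator_graph_Lpot F : closed_generator_graph F -> Lpot P tau p (vtail F).
Proof.
have bt : bounded_operator (@LpV _ _ _ P p d.+1) (@LpV_norm _ _ _ P p d.+1)
    (@LpV _ _ _ P p d) (@LpV_norm _ _ _ P p d) (fun F => vtail F).
  by apply: (LpV_operator (snV _)) => i; exact: LpV_proj_operator.
have Kc := closed_subspace_preimage (snV _) (snV _) bt closed_Lpot.
have GK : generator_graph `<=` [set F | LpV P p F /\ Lpot P tau p (vtail F)].
  move=> G GG; split; first exact: generator_graph_LpV.
  apply: (sub_norm_closure (snV _) horizontal_gradients_LpV).
  by exists (G ord0) => i; case: GG.
by move=> /(norm_closure_min GK Kc)[].
Qed.

Lemma generator_graph_Linv F : closed_generator_graph F ->
  (forall i, Lp_norm P p (F (lift ord0 i)) = 0%E) -> Linv P tau p (F ord0).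
Proof.
move=> FG F0; have [LF FA] := FG; have L0 := LF ord0.
have Lt f x (Lf : Lp P p f) := Lp_tau ds p1' x Lf.
have axis i s : (F ord0 \o tau (s *: basis_vec i)) = F ord0 %[ae P].
  apply/(Lp_normB_ae P p1'); [exact: Lp_measurable (Lt _ _ L0)|exact: Lp_measurable L0|].
  apply: le_anti; rewrite (sn_ge0 sn) andbT; apply/lee_addgt0Pr => e e0; rewrite add0e.
  (* Replacing F by G costs one share of the error before the translation and one after it, and
     translating G costs |s| shares by [is_generator_translation], as the i-th derivative of G is
     within one share of a null element. *)
  have s2 : 0 < `|s| + 2 by rewrite ltr_wpDl.
  have e1 : 0 < e / (`|s| + 2) by rewrite divr_gt0.
  have [G [LG0 GG] FGe] := FA _ e1.
  have comp k : (Lp_norm P p (F k - G k)%R <= (e / (`|s| + 2))%:E)%E.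
    by apply/ltW/(le_lt_trans _ FGe); exact: (Lp_norm_le_LpV P p (F - G)).
  have LGi : Lp P p (G (lift ord0 i)) by have [] := GG i.
  have h1 : (Lp_norm P p ((F ord0 \o tau (s *: basis_vec i)) - (G ord0 \o tau (s *: basis_vec i)))%R
      <= (e / (`|s| + 2))%:E)%E.
    have -> : (F ord0 \o tau (s *: basis_vec i)) - (G ord0 \o tau (s *: basis_vec i)) =
      (F ord0 - G ord0) \o tau (s *: basis_vec i) by [].
    by rewrite (Lp_norm_tau ds)//; exact: (subspaceB sL).
  have h2 := is_generator_translation s (GG i).
  have h3 : (Lp_norm P p (G (lift ord0 i)) <= (e / (`|s| + 2))%:E)%E.
    have := comp (lift ord0 i); apply: le_trans.
    have LFi := LF (lift ord0 i).
    apply: (le_trans (_ : _ <= Lp_norm P p (G (lift ord0 i) - F (lift ord0 i))%R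
       + Lp_norm P p (F (lift ord0 i)))%E).
      rewrite -[X in Lp_norm P p X](subrK (F (lift ord0 i))).
      by apply: (snD sn) => //; exact: (subspaceB sL).
    by rewrite F0 adde0 (snBC sn).
  apply: (le_trans (sn_triangle sn (Lt _ _ L0) (Lt _ _ LG0) L0)).
  apply: (le_trans (leeD h1 (sn_triangle sn (Lt _ _ LG0) LG0 L0))).
  have h4 := comp ord0; rewrite (snBC sn L0 LG0) in h4.
  apply: (le_trans (leeD2l _ (leeD (le_trans h2 (lee_wpmul2l _ h3)) h4))); rewrite ?lee_fin//.
  rewrite [leRHS](_ : e = (`|s| + 2) * (e / (`|s| + 2))); last first.
    by rewrite mulrCA mulfV ?mulr1// gt_eqF.
  by rewrite le_eqVlt; apply/orP; left; apply/eqP; ring.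
have comp x y : (F ord0 \o tau x) = F ord0 %[ae P] -> (F ord0 \o tau y) = F ord0 %[ae P] ->
    (F ord0 \o tau (x + y)) = F ord0 %[ae P].
  move=> hx hy.
  have hx' := ae_preserving (flow_measurable ds y) (tau_preserving ds y) hx.
  move: hy; apply: filterS2 hx' => w hx' hy wT.
  by rewrite -hy//= -hx'//= (tauD ds).
split => // x.
have -> : x = \sum_i ((x : 'rV[R]_d) ord0 i) *: (basis_vec i : E).
  exact: (matrix.row_sum_delta (x : 'rV[R]_d)).
elim/big_rec: _ => [|i y _ hy]; last exact: comp.
by apply: aeW => w _; rewrite /= (tau0 ds).
Qed.

End generators.

Lemma mean_value_le {R : realType} (g dg : R -> R) (C s : R) :
  (forall t : R, `|t| <= `|s| -> is_derive t 1 g (dg t) /\ `|dg t| <= C) ->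
  `|g s - g 0| <= C * `|s|.
Proof.
move=> gD.
have cont (a b : R) : (forall t, t \in `[a, b] -> `|t| <= `|s|) -> {within `[a, b], continuous g}.
  move=> ab; apply: derivable_within_continuous => t /ab /gD[dt _].
  exact: (@ex_derive _ _ _ _ _ _ _ dt).
have [s0|s0] := leP 0 s.
  have sub t : t \in `[0, s] -> `|t| <= `|s|.
    by rewrite in_itv/= => /andP[t0 ts]; rewrite !ger0_norm.
  have [t||c cs ->] := @MVT_segment R g dg 0 s s0.
  - by move=> /subset_itv_oo_cc/sub/gD[].
  - exact: cont.
  - by rewrite subr0 normrM ler_wpM2r//; have [] := gD c (sub c cs).
have sub t : t \in `[s, 0] -> `|t| <= `|s|.
  by rewrite in_itv/= => /andP[st t0]; rewrite !ler0_norm ?(ltW s0)// lerN2.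
have [t||c cs] := @MVT_segment R g dg s 0 (ltW s0).
- by move=> /subset_itv_oo_cc/sub/gD[].
- exact: cont.
- rewrite distrC => ->; rewrite sub0r normrM normrN ler_wpM2r//.
  by have [] := gD c (sub c cs).
Qed.

(** * Mollification along the orbits *)

Section mollification.
Context {R : realType} {d : nat} {dO : measure_display} {Omega : measurableType dO}.
Variables (P : probability Omega R) (tau : euclid R d -> Omega -> Omega) (p q : R).
Hypothesis ds : dynamical_system P tau.
Hypothesis p1 : 1 < p.
Hypothesis pq : p^-1 + q^-1 = 1.
Let q1 : 1 < q. Proof. exact: conjugate_gt1 pq. Qed.
Let p1' : 1 <= p. Proof. exact: ltW. Qed.
Let q1' : 1 <= q. Proof. exact: ltW. Qed.
Local Notation E := (euclid R d).
Local Notation leb := (lebesgue_on (@openT E)).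
Implicit Types (h : Omega -> R) (eta chi : E -> R).
Local Notation mu := (P \x leb)%E.
Let sn := seminormed_Lp P p1'.
Let sL := sn_sub sn.

Definition mollify (h : Omega -> R) (eta : E -> R) : Omega -> R :=
  slice leb eta (fun z => h (tau z.2 z.1)).

(* h (tau_y w) itself is not integrable over R^d in y *)
Definition window (chi : E -> R) (h : Omega -> R) : Omega * E -> R :=
  fun z => h (tau z.2 z.1) * chi z.2.

Lemma Lp_window chi h : Lp leb p chi -> Lp P p h -> Lp mu p (window chi h).
Proof.
move=> Lc Lh; rewrite (_ : window chi h = shift tau 1 (tensor h chi)).
  by apply: (Lp_shift ds) => //; exact: Lp_tensor.
by apply/funext => z; rewrite /window /shift/= /theta scale1r.
Qed.

Lemma slice_window chi eta h : slice leb eta (window chi h) = mollify h (chi * eta).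
Proof.
by apply/funext => w; apply: eq_Rintegral => y _; rewrite /window/= fctE mulrA.
Qed.

Lemma mollify_window (A : set E) eta h : (forall y, ~ A y -> eta y = 0) ->
  mollify h eta = slice leb eta (window (\1_A) h).
Proof.
move=> etaA; rewrite slice_window; congr (mollify h _); apply/funext => y.
rewrite fctE indicE; have [Ay|nAy] := pselect (A y); first by rewrite mem_set// mul1r.
by rewrite etaA ?mulr0.
Qed.

Lemma Lp_indic_ball (r : R) (n : nat) : 1 <= r -> (0 < n)%N ->
  Lp leb r (\1_(ball (0 : E) n%:R)).
Proof.
move=> r1 n0; apply: Lp_indic => //; first exact: measurable_ball_euclid.
by apply: lebesgue_on_ball; rewrite ltr0n.
Qed.

Lemma test_support (Q : set E) eta : test_function Q eta ->
  exists2 n : nat, (0 < n)%N & forall y : E, ~ ball (0 : E) n%:R y ->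
    eta y = 0 /\ forall i, partial i eta y = 0.
Proof.
move=> [_ [K [cK _ etaK]]]; have [n n0 Kn] := compact_ball cK.
exists n => // y nBy; have nKy : ~ K y by move=> /Kn.
by split => [|i]; [exact: etaK|exact: partial_eq0 cK etaK _ nKy].
Qed.

Lemma Lp_mollify h eta : Lp P p h -> test_function setT eta -> Lp P p (mollify h eta).
Proof.
move=> Lh teta; have [n n0 etan] := test_support teta.
rewrite (mollify_window _ (fun y nBy => (etan y nBy).1)); apply: (Lp_slice p1 pq).
  exact: Lp_test.
by apply: Lp_window => //; exact: Lp_indic_ball.
Qed.

Lemma lebesgue_onT_translation (z : E) (A : set E) : measurable A ->
  leb (affine 1 z @^-1` A) = leb A.
Proof. by move=> mA; rewrite !lebesgue_onE !setIT lebesgue_rV_translation. Qed.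

Lemma measurable_orbit h w : measurable_fun setT h ->
  measurable_fun setT (fun y : E => h (tau y w)).
Proof.
move=> mh; apply: (@measurable_section _ _ _ _ _ (fun z : Omega * E => h (tau z.2 z.1)) w).
exact: (measurableT_comp mh (flow_jointly_measurable ds)).
Qed.

(** Translation invariance of Lebesgue measure moves the flow from h, which is only measurable along
    orbits, onto the smooth kernel eta. *)
Lemma mollify_translation h eta z w : measurable_fun setT h -> test_function setT eta ->
  mollify h eta (tau z w) = mollify h (eta \o affine 1 (- z)) w.
Proof.
move=> mh teta.
have mf : measurable_fun setT (fun y : E => h (tau y w) * eta (affine 1 (- z) y)).
  apply: measurable_funM; first exact: measurable_orbit.
  exact: (measurableT_comp (measurable_smooth (test_smooth teta))
    (measurable_affine (- z) (oner_neq0 _))).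
rewrite /mollify /slice/= -(Rintegral_preserving (measurable_affine z (oner_neq0 R))
  (lebesgue_onT_translation z) mf).
apply: eq_Rintegral => y _; rewrite (tauD ds) /affine !scale1r addrK.
by [].
Qed.

Lemma test_affine eta (a : R) (z : E) : a != 0 -> test_function setT eta ->
  test_function setT (eta \o affine a z).
Proof.
move=> a0 [seta [K [cK _ etaK]]]; split; first exact: smooth_affine.
exists (affine a^-1 (- (a^-1 *: z)) @` K); split => //.
  apply: continuous_compact => //; apply: continuous_subspaceT; exact: continuous_affine.
move=> x nx; apply: etaK => Kx; apply: nx; exists (affine a z x) => //.
exact: affineK.
Qed.

(** Taylor's formula with a remainder uniform in y: the mean value inequality is applied to
    [partial i eta], and then to eta minus its linear part along the line. *)
Lemma test_second_order eta i : test_function setT eta -> exists2 M : R, 0 <= M &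
  forall (y : E) (s : R), `|eta (y - s *: basis_vec i) - eta y + s * partial i eta y| <= M * `|s| ^+ 2.
Proof.
move=> teta; have seta := test_smooth teta.
have [M M0 bM] := test_bounded (test_partial i (test_partial i teta)).
exists M => // y s.
have lin t : `|partial i eta y - partial i eta (t *: basis_vec i + y)| <= M * `|t|.
  have := @mean_value_le R (fun r => partial i eta (r *: basis_vec i + y))
    (fun r => partial i (partial i eta) (r *: basis_vec i + y)) M t.
  rewrite distrC scale0r add0r; apply => r _; split; last exact: bM.
  by apply/is_derive_line; apply: is_derive_partial; exact: smooth_partial.
have := @mean_value_le R (fun r => eta (r *: basis_vec i + y) - r * partial i eta y)
  (fun r => partial i eta (r *: basis_vec i + y) - partial i eta y) (M * `|s|) (- s).
rewrite scale0r add0r mul0r subr0 scaleNr normrN mulNr opprK => h.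
rewrite expr2 mulrA [y - _]addrC [X in `|X|]addrAC; apply: h => t ts; split.
  have d1 : is_derive t 1 (fun r : R => eta (r *: basis_vec i + y))
      (partial i eta (t *: basis_vec i + y)).
    by apply/is_derive_line; exact: is_derive_partial.
  have d2 : is_derive t 1 (fun r : R => r * partial i eta y) (partial i eta y).
    rewrite (_ : (fun r => _) = (partial i eta y) *: (id : R -> R)); last first.
      by apply/funext => r; rewrite fctE /GRing.scale/= mulrC.
    rewrite -[X in is_derive _ _ _ X]mulr1.
    exact: (@is_deriveZ R R R id _ t 1 1).
  exact: (is_deriveB d1 d2).
by rewrite distrC; apply: (le_trans (lin t)); rewrite ler_wpM2l.
Qed.

(** Translation by s along the i-th axis turns eta y into eta (y - s e_i), whence the minus sign.
    The error of the difference quotient is the slice against [rho s], whose L^q norm is O(|s|) by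
    [test_second_order]. *)
Lemma generator_mollify h eta i : Lp P p h -> test_function setT eta ->
  is_generator P tau p i (mollify h eta) (- mollify h (partial i eta)).
Proof.
move=> Lh teta; have tp := test_partial i teta.
have Lm := Lp_mollify Lh teta; have Lmp := Lp_mollify Lh tp.
apply/(is_generatorP ds p1); split => //; first exact: (subspaceN sL).
have [n n0 etan] := test_support teta.
have [M M0 bM] := test_second_order i teta.
(* Radius n + 1 leaves room for translates of the support by |s| < 1, so one window serves all these
   s. *)
pose B := ball (0 : E) n.+1%:R; pose F := window (\1_B) h.
have LF : Lp mu p F by apply: Lp_window => //; exact: Lp_indic_ball.
have sB := slice_kernel_operator p1 pq LF.
have snq := seminormed_Lp leb q1'.
pose rho (s : R) : E -> R := s^-1 *: (eta \o affine 1 (- (s *: basis_vec i)) - eta) + partial i eta.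
have ts s : test_function setT (eta \o affine 1 (- (s *: basis_vec i))).
  by apply: test_affine => //; exact: oner_neq0.
have Lrho s : Lp leb q (rho s).
  apply: (sn_sub snq).2; last exact: Lp_test.
  by apply: (subspaceB (sn_sub snq)); exact: Lp_test.
have eB s y : `|s| < 1 -> ~ B y -> eta (affine 1 (- (s *: basis_vec i)) y) = 0.
  move=> s1 nBy; apply: (etan _ _).1; rewrite /affine scale1r => By; apply: nBy.
  have n0' : 0 < n%:R :> R by rewrite ltr0n.
  apply/ball_euclidP => // j; move/(ball_euclidP _ _ n0')/(_ j) : By.
  rewrite !mxE /= !subr0 => By.
  rewrite -[X in `|X|](subrK (s * (j == i)%:R)) (le_lt_trans (ler_normD _ _))//.
  rewrite -natr1 ltr_leD// normrM (le_trans _ (ltW s1))// ler_piMr//.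
  by case: (_ == _); rewrite ?normr1 ?normr0.
have sub y : ~ B y -> ~ ball (0 : E) n%:R y.
  by move=> nBy By; apply: nBy; apply: le_ball By; rewrite ler_nat.
have e0B y : ~ B y -> eta y = 0 by move=> /sub/etan[].
have peB y : ~ B y -> partial i eta y = 0 by move=> /sub/etan[].
have LIB : Lp leb q (\1_B) by exact: Lp_indic_ball.
have rho_le s : s != 0 -> `|s| < 1 ->
    (Lp_norm leb q (rho s) <= (M * `|s|)%:E * Lp_norm leb q (\1_B))%E.
  move=> s0 s1; have Ms : 0 <= M * `|s| by rewrite mulr_ge0.
  rewrite -[X in (X%:E * _)%E](ger0_norm Ms) -(snZ snq _ LIB).
  apply: (Lp_norm_le q1'); [exact: Lp_measurable (Lrho s)| |].
    by apply: (@Lp_measurable _ _ _ leb q); exact: (subspaceZ _ (sn_sub snq)).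
  apply: aeW => y; rewrite -[((M * `|s|) *: \1_B) y]/((M * `|s|) * \1_B y) indicE.
  have [By|nBy] := pselect (B y); last first.
    rewrite memNset// mulr0 normr0 /rho !fctE /= eB// e0B// peB//.
    by rewrite subrr scaler0 addr0 normr0.
  rewrite mem_set// mulr1 (ger0_norm Ms) /rho !fctE /= /affine scale1r /GRing.scale/=.
  rewrite (_ : _ + _ = s^-1 * (eta (y - s *: basis_vec i) - eta y + s * partial i eta y)).
    rewrite normrM normfV ler_pdivrMl ?normr_gt0// mulrCA -expr2.
    exact: bM.
  by rewrite [RHS]mulrDr mulrA mulVf// mul1r.
have [C C0 sC] := bounded_operator_ge0 snq sB.
have [K KE K0] : exists2 K : R, Lp_norm leb q (\1_B) = K%:E & 0 <= K.
  exists (fine (Lp_norm leb q (\1_B))); first by rewrite fineK// (sn_fin snq LIB).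
  by rewrite fine_ge0// (sn_ge0 snq).
have LD s : Lp P p (diff_quotient tau i s (mollify h eta) - - mollify h (partial i eta)).
  by apply: (subspaceB sL); [exact: Lp_diff_quotient|exact: (subspaceN sL)].
have quotE s : `|s| < 1 ->
    (diff_quotient tau i s (mollify h eta) - - mollify h (partial i eta)) =
    slice leb (rho s) F %[ae P].
  move=> s1.
  have E1 : mollify h eta \o tau (s *: basis_vec i) =
      slice leb (eta \o affine 1 (- (s *: basis_vec i))) F.
    rewrite -mollify_window; last by move=> y nBy; exact: eB.
    by apply/funext => w; rewrite /= mollify_translation//; exact: Lp_measurable Lh.
  have E2 : mollify h eta = slice leb eta F by exact: mollify_window.
  have E3 : mollify h (partial i eta) = slice leb (partial i eta) F by exact: mollify_window.
  have Le1 := Lp_test (@openT E) q1' (ts s); have Le := Lp_test (@openT E) q1' teta.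
  have Lpe := Lp_test (@openT E) q1' tp.
  have h1 := slice_linear_kernel_ae p1 pq s^-1 (subspaceB (sn_sub snq) Le1 Le) Lpe LF.
  have [SL _ _] := sB; have LB1 := subspaceB (sn_sub snq) Le1 Le.
  have h2 : slice leb (eta \o affine 1 (- (s *: basis_vec i)) - eta) F =
      slice leb (eta \o affine 1 (- (s *: basis_vec i))) F - slice leb eta F %[ae P].
    apply/(Lp_normB_ae P p1'); [exact: Lp_measurable (SL _ LB1)| |exact: (bounded_operatorB sB)].
    by apply: (@Lp_measurable _ _ _ P p); apply: (subspaceB sL); exact: SL.
  move: h1; apply: filterS2 h2 => w h2 h1 wT; rewrite h1// /diff_quotient E1 E2 E3.
  rewrite !fctE opprK; congr (_ * _ + _).
  exact: (esym (h2 wT)).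
move=> e e0.
have D0 : 0 < C * (M * K) + 1 by rewrite ltr_wpDl// !mulr_ge0.
have e1 : 0 < e / (C * (M * K) + 1) by rewrite divr_gt0.
near=> s.
have s1 : `|s| < 1 by near: s; exact: dnbhs0_lt.
have s0 : s != 0 by near: s; exact: nbhs_dnbhs_neq.
have se : `|s| <= e / (C * (M * K) + 1) by near: s; exact: dnbhs0_le.
rewrite (Lp_norm_ae _ _ _ (quotE s s1)); last 2 first.
- exact: Lp_measurable (LD s).
- by apply: (@Lp_measurable _ _ _ P p); exact: (Lp_slice p1 pq (Lrho s) LF).
apply: (le_trans (sC _ (Lrho s))).
apply: (le_trans (lee_wpmul2l _ (rho_le s s0 s1))); first by rewrite lee_fin.
rewrite KE -!EFinM lee_fin.
rewrite (_ : C * _ = (C * (M * K)) * `|s|); last by ring.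
apply: (@le_trans _ _ ((C * (M * K) + 1) * `|s|)); first by rewrite ler_wpM2r// lerDl.
by rewrite mulrC -ler_pdivlMr.
Unshelve. all: by end_near. Qed.

(* If g annihilates every mollified function then, for almost every y near 0,
   g is orthogonal to e_k o tau_y for all k, hence to every function. *)
Lemma mollify_dense (X : set (Omega -> R)) : countably_generated Omega ->
  closed_subspace (Lp P p) (Lp_norm P p) X ->
  (forall h eta, Lp P p h -> test_function setT eta -> X (mollify h eta)) ->
  X = Lp P p.
Proof.
move=> cg Xc Xm; apply/seteqP; split => [f|f Lf]; first by have [+ _ _] := Xc; exact.
apply: contrapT => nXf.
have [l [lb lX lf]] := separating_functional sn Xc Lf nXf.
have [g Lg lE] := riesz_representation p1 pq lb.
have [e [Le te]] := total_family_countably_generated P p1' cg.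
pose c0 : 'rV[rat]_d * nat := (0, 0%N).
pose chi := @bump_ball R d c0.
have tchi : test_function setT chi by apply: test_bump_ball.
have Lchi := Lp_test (@openT E) p1' tchi.
(* [c k y] is chi y times the pairing of g with [e k \o tau y]. The cutoff chi makes this a function
   in L^p of y. *)
pose c k : E -> R := slice P g (window chi (e k) \o @pair_swap E Omega).
have LW k : Lp mu p (window chi (e k)) by exact: Lp_window.
have Lc k : Lp leb p (c k) by exact: (Lp_slice p1 pq Lg (Lp_swap p1 (LW k))).
have c_ae k : c k = 0 %[ae leb].
  apply: (total_family_eq0 p1 pq (total_family_tests (@openT E) q1') (Lc k)) => -[eta teta] /=.
  have Leta := Lp_test (@openT E) q1' teta.
  have tce := testM tchi (test_smooth teta).
  rewrite -(slice_pairing_swap p1 pq (LW k) Lg Leta) slice_window.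
  rewrite -lE; last exact: Lp_mollify.
  by apply: lX; exact: Xm.
have c_ae' : {ae leb, forall y, forall n, forall k, unpickle n = Some k -> c k y = 0}.
  apply: ae_foralln => n; case: unpickle => [k|]; last by apply: aeW => y k.
  by have := c_ae k; apply: filterS => y h k' [<-]; exact: h.
(* The exceptional sets of the countably many k form a null set, whereas the ball on which chi > 0
   has positive measure. *)
have [y [yB cy]] : exists y, @rational_ball R d c0 y /\ forall k, c k y = 0.
  apply: contrapT => nex; have [N [mN N0 cN]] := c_ae'.
  have : (leb (@rational_ball R d c0) <= leb N)%E.
    apply: le_measure; rewrite ?inE//; first exact: measurable_ball_euclid.
    move=> y yB; apply: cN => /= h; apply: nex; exists y; split => // k.
    by apply: (h (pickle k)); rewrite pickleK.
  rewrite N0 lebesgue_onE setIT /rational_ball lebesgue_ball ?invr_gt0//.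
  by rewrite lee_fin leNgt exprn_gt0// pmulrn_lgt0 ?invr_gt0.
have cy0 : chi y != 0 by rewrite gt_eqF//; exact/bump_ball_gt0.
have bK := bounded_functional_comp sn sn (tau_operator ds p1' y) (pairing_functional p1 pq Lg).
have := te _ (bounded_functional_kernel sn bK); set K := [set f | _] => KL.
(* The functions whose composition with [tau y] is orthogonal to g form a closed subspace containing
   all [e k], hence everything. Composing [f \o tau (- y)] with [tau y] gives back f. *)
have : K (f \o tau (- y)).
  rewrite KL => [|k]; first exact: (Lp_tau ds).
  split; first exact: Le.
  have := cy k; rewrite /c /slice /=.
  have -> : (fun x => window chi (e k) (@pair_swap E Omega (y, x)) * g x) =
      (fun x => chi y * ((e k \o tau y) x * g x)).
    by apply/funext => x; rewrite /window/=; ring.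
  rewrite RintegralZl//; last exact: (hoelder_integrable p1 pq (Lp_tau ds p1' y (Le k)) Lg).
  by move/eqP; rewrite mulf_eq0 (negbTE cy0)/= => /eqP.
move=> [_ /= lf0]; move: lf; rewrite lE// => /eqP; apply.
rewrite -[RHS]lf0; apply: eq_Rintegral => w _; rewrite /= (tauD ds).
by rewrite addNr (tau0 ds).
Qed.

End mollification.

(** For composition with (x, y) |-> y - a x, whose measurability is checked coordinatewise and so
    holds for Borel sets of the target only. *)
Lemma measurable_continuous_borel {R : realType} {d : nat} (f : euclid R d -> R) :
  continuous f -> measurable_fun setT (f : borel_rV R d -> R).
Proof.
move=> cf; apply: (measurability _ (RGenOInfty.measurableE R)) => _ [_ [x ->] <-].
rewrite setTI.
have oU : open (f @^-1` `]x, +oo[%classic : set (euclid R d)).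
  by move/continuousP : cf; apply; exact: interval_open.
apply: (@sigma_algebra_open R d (@measurable _ (borel_rV R d)) _ _ oU).
  split; [exact: measurable0|by move=> A mA; rewrite setTD; exact: measurableC|].
  by move=> F mF; exact: bigcupT_measurable.
move=> c _; rewrite (_ : rational_ball c = \big[setI/setT]_(i < d)
    (rV_coord i @^-1` ball (ratr (c.1 ord0 i) : R) c.2.+1%:R^-1)).
  apply: bigsetI_measurable => i _; rewrite -[X in measurable X]setTI.
  apply: measurable_rV_coord => //; exact: measurable_realfun.measurable_ball.
have r0 : 0 < c.2.+1%:R^-1 :> R by rewrite invr_gt0.
apply/seteqP; split => y; rewrite -bigcap_seq /rational_ball.
  by move=> /(ball_euclidP _ _ r0) yc i _ /=; rewrite /ball/= distrC; have := yc i; rewrite mxE.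
move=> yc; apply/(ball_euclidP _ _ r0) => i; rewrite mxE.
by have /= := yc i (mem_index_enum i); rewrite /ball/= distrC.
Qed.

Lemma RintegralN {R : realType} d (T : measurableType d) (m : {measure set T -> \bar R})
    (f : T -> R) : m.-integrable setT (EFin \o f) ->
  \int[m]_x (- f x) = - \int[m]_x f x.
Proof.
by move=> If; rewrite -[RHS]mulN1r -RintegralZl//; apply: eq_Rintegral => x _; rewrite mulN1r.
Qed.

(** * Horizontal derivatives of unfolded functions *)

Section transport.
Context {R : realType} {d : nat} {dO : measure_display} {Omega : measurableType dO}.
Variables (P : probability Omega R) (tau : euclid R d -> Omega -> Omega) (p q : R).
Hypothesis ds : dynamical_system P tau.
Hypothesis p1 : 1 < p.
Hypothesis pq : p^-1 + q^-1 = 1.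
Let q1 : 1 < q. Proof. exact: conjugate_gt1 pq. Qed.
Let p1' : 1 <= p. Proof. exact: ltW. Qed.
Let q1' : 1 <= q. Proof. exact: ltW. Qed.
Local Notation E := (euclid R d).
Variables (Q : set E) (oQ : open Q) (a : R).
Hypothesis a0 : a != 0.
Local Notation lebT := (lebesgue_on (@openT E)).
Local Notation leb := (lebesgue_on oQ).
Local Notation mu := (P \x leb)%E.
Local Notation mollify := (@mollify R d dO Omega tau).
Implicit Types (h : Omega -> R) (eta phi psi : E -> R).

(** The function psi x * eta (y - a x) of (x, y). Integrating h (tau_y w) eta (y - a x) over y gives
    [mollify h eta] at tau_(a x) w, by [mollify_orbit]. *)
Definition kernel psi eta (z : E * E) : R := psi z.1 * eta (affine (- a) z.2 z.1).

Let measurable_kernel_factor eta : smooth eta ->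
  measurable_fun setT (fun z : E * E => eta (affine (- a) z.2 z.1)).
Proof.
move=> seta.
have mg : measurable_fun setT ((fun z => affine (- a) z.2 z.1) : E * E -> borel_rV R d).
  apply: measurable_fun_rV => i.
  rewrite (_ : _ \o _ = fun z : E * E => - a * (z.1 : 'rV[R]_d) ord0 i + (z.2 : 'rV[R]_d) ord0 i).
    have mc := measurable_continuous (@continuous_coord R d i).
    apply: measurable_funD; last exact: (measurableT_comp mc measurable_snd).
    by apply: measurable_funM => //; exact: (measurableT_comp mc measurable_fst).
  by apply/funext => z; rewrite /rV_coord /affine /= !mxE.
exact: (measurableT_comp (measurable_continuous_borel (smooth_continuous seta)) mg).
Qed.

Section window_size.
Variables (phi eta : E -> R) (m n : nat).
Hypotheses (m0 : (0 < m)%N) (n0 : (0 < n)%N).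

Definition window_size := (n + Num.bound `|a| * m)%N.

Lemma window_sizeP (x y : E) : ball (0 : E) m%:R x ->
  ball (0 : E) n%:R (affine (- a) y x) -> ball (0 : E) window_size%:R y.
Proof.
rewrite -!ball_normE /ball_/= !sub0r !normrN => xm yn.
have -> : y = affine (- a) y x + a *: x by rewrite /affine scaleNr addrAC addNr add0r.
rewrite (le_lt_trans (ler_normD _ _))// /window_size natrD ltr_leD//.
rewrite normrZ natrM; apply: ler_pM => //; last exact: ltW.
exact/ltW/archi_boundP.
Qed.

End window_size.

Lemma Lq_kernel psi eta : test_function Q psi -> test_function setT eta ->
  Lp (leb \x lebT)%E q (kernel psi eta).
Proof.
move=> tpsi teta; have [M M0 bM] := test_bounded tpsi; have [M' M0' bM'] := test_bounded teta.
have [m m0 psim] := test_support tpsi; have [n n0 etan] := test_support teta.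
pose B := ball (0 : E) m%:R; pose B' := ball (0 : E) (window_size m n)%:R.
have w0 : (0 < window_size m n)%N by rewrite ltn_addr.
have LB : Lp leb q (\1_B).
  apply: Lp_indic => //; first exact: measurable_ball_euclid.
  by apply: lebesgue_on_ball; rewrite ltr0n.
have LB' : Lp lebT q (\1_B') by exact: Lp_indic_ball.
have LM : Lp (leb \x lebT)%E q ((M * M') *: tensor (\1_B) (\1_B')).
  by apply: (subspaceZ _ (subspace_Lp _ q1')); exact: Lp_tensor.
apply: (Lp_le q1' _ LM).
  apply: measurable_funM; last exact: measurable_kernel_factor (test_smooth teta).
  exact: (measurableT_comp (measurable_smooth (test_smooth tpsi)) measurable_fst).
apply: aeW => -[x y].
rewrite -[((M * M') *: _) _]/((M * M') * (\1_B x * \1_B' y)) /kernel/= !indicE.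
have [Bx|nBx] := pselect (B x); last first.
  by rewrite (psim _ nBx).1 mul0r normr0.
have [By|nBy] := pselect (ball (0 : E) n%:R (affine (- a) y x)); last first.
  by rewrite (etan _ nBy).1 mulr0 normr0.
rewrite !mem_set//; last exact: window_sizeP Bx By.
rewrite !mulr1 normrM (ger0_norm (mulr_ge0 M0 M0')).
by apply: ler_pM.
Qed.

Lemma mollify_orbit h eta x w : measurable_fun setT h -> test_function setT eta ->
  mollify h eta (tau (a *: x) w) = \int[lebT]_y (h (tau y w) * eta (affine (- a) y x)).
Proof.
move=> mh teta; rewrite (mollify_translation ds)//.
apply: eq_Rintegral => y _; congr (_ * eta _).
by rewrite /affine scale1r scaleNr addrC.
Qed.

(* F and phi are integrated against eta (y - a x), whose x_i-derivative is - a times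
   d_i eta: the weak gradient of F, tested against x |-> phi x * eta (y - a x), yields
   the identity for each y, and it is then weighted by h (tau_y w). *)
Lemma transport_identity h eta phi F i : Lp P p h -> test_function setT eta ->
  test_function Q phi -> gradient_graph oQ p F ->
  slice leb phi (shift tau a (tensor (mollify h eta) (F (lift ord0 i)))) +
  slice leb (partial i phi) (shift tau a (tensor (mollify h eta) (F ord0))) =
  a *: slice leb phi (shift tau a (tensor (mollify h (partial i eta)) (F ord0))) %[ae P].
Proof.
move=> Lh teta tphi JF; have tpe := test_partial i teta; have tpp := test_partial i tphi.
have mh := Lp_measurable Lh.
have [LJ _ _] := closed_gradient_graph oQ p1 pq; have LF := LJ _ JF.
have [m m0 phim] := test_support tphi; have [n n0 etan] := test_support teta.
pose N := window_size m n; pose B := ball (0 : E) N%:R.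
have N0 : (0 < N)%N by rewrite ltn_addr.
have LW : Lp (P \x lebT)%E p (window tau (\1_B) h).
  by apply: (Lp_window ds) => //; exact: Lp_indic_ball.
have LS e k : test_function setT e -> Lp mu p (shift tau a (tensor (mollify h e) (F k))).
  move=> te; apply: (Lp_shift ds) => //; apply: Lp_tensor => //.
  exact: (Lp_mollify ds p1 pq).
have s0 := Lp_section_ae p1 LW.
have s1 := Lp_section_ae p1 (LS _ (lift ord0 i) teta).
have s2 := Lp_section_ae p1 (LS _ ord0 teta).
have s3 := Lp_section_ae p1 (LS _ ord0 tpe).
move: s0; apply: filterS2 (filterI s1 (filterI s2 s3)) => w [{}s1 [{}s2 {}s3]] s0 _.
pose beta y : R := window tau (\1_B) h (w, y).
pose c1 x := F (lift ord0 i) x * phi x + F ord0 x * partial i phi x.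
pose c2 x := - a * (F ord0 x * phi x).
(* G is integrated in both orders: over y first it yields the mollified functions ([Gx]), over x
   first it vanishes by the weak gradient identity ([Gy]). The window inside [beta] provides
   integrability. *)
pose G (z : E * E) := beta z.2 * (c1 z.1 * eta (affine (- a) z.2 z.1) +
  c2 z.1 * partial i eta (affine (- a) z.2 z.1)).
have Lphi := Lp_test oQ q1' tphi; have Lpp := Lp_test oQ q1' tpp.
have LT k : Lp (leb \x lebT)%E p (tensor (F k) beta) by apply: Lp_tensor.
have I1 := hoelder_integrable p1 pq (LT (lift ord0 i)) (Lq_kernel tphi teta).
have I2 := hoelder_integrable p1 pq (LT ord0) (Lq_kernel tpp teta).
have I3 := hoelder_integrable p1 pq (LT ord0) (Lq_kernel tphi tpe).
have IG : (leb \x lebT)%E.-integrable setT (EFin \o G).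
  have := integrableD measurableT (integrableD measurableT I1 I2) (integrableZl measurableT (- a) I3).
  apply: eq_integrable => // -[x y] _ /=; rewrite -EFinM -!EFinD; congr EFin.
  by rewrite /G /kernel /tensor /c1 /c2 /=; ring.
have Gx : \int[leb]_x \int[lebT]_y G (x, y) =
    \int[leb]_x (c1 x * mollify h eta (tau (a *: x) w) +
      c2 x * mollify h (partial i eta) (tau (a *: x) w)).
  apply: eq_Rintegral => x _; rewrite !mollify_orbit//.
  have [Bx|nBx] := pselect (ball (0 : E) m%:R x); last first.
    have [phi0 pphi0] := phim _ nBx.
    rewrite /G /c1 /c2 /= phi0 pphi0 !mulr0 addr0 !mul0r addr0.
    transitivity (\int[lebT]_y (0 : R)); last by rewrite Rintegral_cst// mul0r.
    by apply: eq_Rintegral => y _; rewrite !mul0r addr0 mulr0.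
  have conv e : test_function setT e -> (forall y, ~ ball (0 : E) n%:R y -> e y = 0) ->
      \int[lebT]_y (h (tau y w) * e (affine (- a) y x)) =
        \int[lebT]_y (beta y * e (affine (- a) y x)) /\
      lebT.-integrable setT (EFin \o (fun y => beta y * e (affine (- a) y x))).
    move=> te en; split.
      apply: eq_Rintegral => y _; rewrite /beta /window/= indicE.
      have [By|nBy] := pselect (B y); first by rewrite mem_set// mulr1.
      by rewrite memNset// mulr0 mul0r en ?mulr0// => /(window_sizeP Bx).
    have ta : test_function setT (fun y => e (affine (- a) y x)).
      have := test_affine (- (a *: x)) (oner_neq0 R) te; congr test_function.
      by apply/funext => y; rewrite /= /affine scale1r scaleNr addrC.
    exact: (hoelder_integrable p1 pq s0 (Lp_test (@openT E) q1' ta)).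
  have [-> ie] := conv _ teta (fun y ny => (etan y ny).1).
  have [-> ip] := conv _ tpe (fun y ny => (etan y ny).2 i).
  rewrite -!RintegralZl// -RintegralD//; last 2 first.
  - by have := integrableZl measurableT (c1 x) ie; apply: eq_integrable.
  - by have := integrableZl measurableT (c2 x) ip; apply: eq_integrable.
  by apply: eq_Rintegral => y _; rewrite /G/=; ring.
have Gy : \int[lebT]_y \int[leb]_x G (x, y) = 0.
  transitivity (\int[lebT]_y (0 : R)); last by rewrite Rintegral_cst// mul0r.
  apply: eq_Rintegral => y _.
  have seta := smooth_affine (- a) y (test_smooth teta).
  have tpsi := testM tphi seta.
  have [_ _ /(_ _ tpsi i) wF] := JF.
  have Lpsi := Lp_test oQ q1' tpsi; have Ldpsi := Lp_test oQ q1' (test_partial i tpsi).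
  have J1 := hoelder_integrable p1 pq (LF (lift ord0 i)) Lpsi.
  have J2 := hoelder_integrable p1 pq (LF ord0) Ldpsi.
  transitivity (beta y * (\int[leb]_x (F ord0 x * partial i (phi * (eta \o affine (- a) y)) x) +
      \int[leb]_x (F (lift ord0 i) x * (phi * (eta \o affine (- a) y)) x))); last first.
    by rewrite wF addNr mulr0.
  rewrite -RintegralD// -RintegralZl//; last exact: (integrableD measurableT J2 J1).
  apply: eq_Rintegral => x _; rewrite partialM//; last exact: test_smooth tphi.
  rewrite partial_affine; last exact: test_smooth teta.
  rewrite /G /c1 /c2 !fctE /= /GRing.scale/=; ring.
have tot : \int[leb]_x (c1 x * mollify h eta (tau (a *: x) w) +
      c2 x * mollify h (partial i eta) (tau (a *: x) w)) = 0.
  rewrite -Gx -(Rintegral_fubini1 IG).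
  have mG : measurable_fun setT G by apply/measurable_EFinP; case/integrableP: IG.
  rewrite -(Rintegral_preserving (@measurable_pair_swap _ _ _ _) (product_measure_swap lebT leb) mG).
  rewrite Rintegral_fubini1 ?Gy//.
  apply/integrableP; split.
    apply/measurable_EFinP; exact: (measurableT_comp mG (@measurable_pair_swap _ _ _ _)).
  have := (integrableP _ _ _ IG).2.
  rewrite -(ge0_integral_preserving (@measurable_pair_swap _ _ _ _) (product_measure_swap lebT leb)
    (f := fun z => `|(EFin \o G) z|%E))//.
  by apply: measurableT_comp => //; exact/measurable_EFinP.
have K1 := hoelder_integrable p1 pq s1 Lphi.
have K2 := hoelder_integrable p1 pq s2 Lpp.
have K3 := hoelder_integrable p1 pq s3 Lphi.
apply/eqP; rewrite -subr_eq0 !fctE -[a *: _]/(a * _) /slice -RintegralD// -RintegralZl//.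
rewrite -RintegralB//; last 2 first.
- exact: (integrableD measurableT K1 K2).
- by have := integrableZl measurableT a K3; apply: eq_integrable.
apply/eqP; rewrite -[RHS]tot; apply: eq_Rintegral => x _.
by rewrite /shift /tensor /theta /c1 /c2 /=; ring.
Qed.

Let snV := seminormed_LpV mu p1' d.+1.
Let snVP := seminormed_LpV P p1' d.+1.
Let snmu := seminormed_Lp mu p1'.
Let snP := seminormed_Lp P p1'.

(* For T = (u, nabla u), this is f = I_phi S u together with D_1 f, ..., D_d f. *)
Definition horizontal phi (T : 'I_d.+1 -> Omega * E -> R) : 'I_d.+1 -> Omega -> R :=
  vcons (slice leb phi (shift tau a (T ord0)))
    (fun i => (- a)^-1 *: (slice leb phi (shift tau a (T (lift ord0 i))) +
       slice leb (partial i phi) (shift tau a (T ord0)))).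

Lemma slice_shift_operator j psi : test_function Q psi ->
  bounded_operator (@LpV _ _ _ mu p d.+1) (@LpV_norm _ _ _ mu p d.+1) (Lp P p) (Lp_norm P p)
    (fun T => slice leb psi (shift tau a (T j))).
Proof.
move=> tpsi; have Lpsi := Lp_test oQ q1' tpsi.
have b1 := bounded_operator_comp snV snmu snmu (LpV_proj_operator mu p1' j)
  (shift_operator ds leb p1' a0).
exact: (bounded_operator_comp snV snmu snP b1 (slice_operator P p1 pq Lpsi)).
Qed.

Lemma horizontal_operator phi : test_function Q phi ->
  bounded_operator (@LpV _ _ _ mu p d.+1) (@LpV_norm _ _ _ mu p d.+1)
    (@LpV _ _ _ P p d.+1) (@LpV_norm _ _ _ P p d.+1) (horizontal phi).
Proof.
move=> tphi; apply: (LpV_operator (A := fun k T => horizontal phi T k) snV) => k.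
case: (unliftP ord0 k) => [i|] ->.
  under eq_fun do rewrite /horizontal vconsS.
  apply: (bounded_operatorZ snV snP); apply: (bounded_operatorD snV snP).
    exact: slice_shift_operator.
  by apply: slice_shift_operator; exact: test_partial.
under eq_fun do rewrite /horizontal vcons0.
exact: slice_shift_operator.
Qed.

Lemma slice_shift_commute F phi (f : Omega -> R) x :
  slice leb phi (shift tau a (tensor (f \o tau x) F)) =
  slice leb phi (shift tau a (tensor f F)) \o tau x.
Proof.
apply/funext => w; apply: eq_Rintegral => y _.
by rewrite /shift /tensor /theta /= !(tauD ds) addrC.
Qed.

(** By closedness T may be a tensor of f with a pair F in the gradient graph, and by [mollify_dense]
    f may be [mollify h eta]. The map A : f |-> I_phi S (f F_0) commutes with the flow, so it
    carries the generator of the mollified function to that of its image. [transport_identity]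
    recognizes the result as component i of [horizontal]. *)
Lemma horizontal_graph phi T : countably_generated Omega -> test_function Q phi ->
  norm_closure (@LpV _ _ _ mu p d.+1) (@LpV_norm _ _ _ mu p d.+1)
    (tensor_graph oQ p (Lp P p)) T ->
  closed_generator_graph P tau p (horizontal phi T).
Proof.
move=> cg tphi; have bH := horizontal_operator tphi.
have Gc := closed_subspace_generator_graph ds p1.
have Kc := closed_subspace_preimage snV snVP bH Gc; set K := [set f | _] in Kc.
have [_ sK _] := Kc; have [LJ _ _] := closed_gradient_graph oQ p1 pq.
suff TK : tensor_graph oQ p (Lp P p) `<=` K by move=> /(norm_closure_min TK Kc)[].
move=> _ [n [f [F [Lf JF ->]]]].
rewrite (_ : (fun i z => _) = \sum_(k < n) (fun i => tensor (f k) (F k i))); last first.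
  by apply/funext => i; apply/funext => z; rewrite !fct_sumE.
apply: subspace_sum => // k _.
have LF := LJ _ (JF k).
have bT : bounded_operator (Lp P p) (Lp_norm P p)
    (@LpV _ _ _ mu p d.+1) (@LpV_norm _ _ _ mu p d.+1) (fun f i => tensor f (F k i)).
  by apply: (LpV_operator snP) => i; exact: tensor_operator1.
have KTc := closed_subspace_preimage snP snV bT Kc; set KT := [set f | _] in KTc.
suff : KT (f k) by case.
rewrite (mollify_dense ds p1 pq cg KTc)// => h eta Lh teta.
have Lm := Lp_mollify ds p1 pq Lh teta; split => //.
have LT : LpV mu p (fun i => tensor (mollify h eta) (F k i)) by have [+ _ _] := bT; exact.
have LH : LpV P p (horizontal phi (fun i => tensor (mollify h eta) (F k i))).
  by have [+ _ _] := bH; exact.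
split => //.
pose A f := slice leb phi (shift tau a (tensor f (F k ord0))).
have bA : bounded_operator (Lp P p) (Lp_norm P p) (Lp P p) (Lp_norm P p) A.
  exact: (bounded_operator_comp snP snV snP bT (slice_shift_operator ord0 tphi)).
have gA i : is_generator P tau p i (A (mollify h eta)) (A (- mollify h (partial i eta))).
  apply: (is_generator_operator ds p1 bA); last exact: (generator_mollify ds p1 pq i Lh teta).
  by move=> g x; exact: slice_shift_commute.
have GG : generator_graph P tau p
    (vcons (A (mollify h eta)) (fun i => A (- mollify h (partial i eta)))).
  split; first by rewrite vcons0; have [+ _ _] := bA; exact.
  by move=> i; rewrite vcons0 vconsS.
apply: (closed_subspace_eq Gc LH (sub_norm_closure snVP (@generator_graph_LpV _ _ _ _ P tau p) GG)).
apply/LpV_norm0P => j; rewrite -[(_ - _) j]/(_ j - _ j).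
case: (unliftP ord0 j) => [i|] ->; last first.
  by rewrite /horizontal !vcons0 subrr; exact: sn0 snP.
rewrite /horizontal !vconsS.
have tpe := test_partial i teta; have Lmp := Lp_mollify ds p1 pq Lh tpe.
have LAN : Lp P p (A (- mollify h (partial i eta))).
  by have [+ _ _] := bA; apply; exact: (subspaceN (sn_sub snP)).
have LHi := LH (lift ord0 i); rewrite /horizontal vconsS in LHi.
apply/(Lp_normB_ae P p1' (Lp_measurable LHi) (Lp_measurable LAN)).
have tid := transport_identity i Lh teta tphi (JF k).
have LSp : Lp mu p (shift tau a (tensor (mollify h (partial i eta)) (F k ord0))).
  by apply: (Lp_shift ds) => //; exact: Lp_tensor.
have sect := Lp_section_ae p1 LSp.
move: tid; apply: filterS2 sect => w sect tid wT.
have AN : A (- mollify h (partial i eta)) w = - A (mollify h (partial i eta)) w.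
  have I := hoelder_integrable p1 pq sect (Lp_test oQ q1' tphi).
  rewrite /A /slice -RintegralN//; apply: eq_Rintegral => x _.
  by rewrite /shift /tensor /theta /= fctE; ring.
rewrite AN -[LHS]/((- a)^-1 * (_ + _) w) tid// -[(a *: _) w]/(a * A _ w).
by rewrite mulrA invrN mulNr mulVf// mulN1r.
Qed.

End transport.

Lemma closed_subspace_forall {R : realType} (V : lmodType R) (E : set V) (N : V -> \bar R)
    (I : Type) (X : I -> set V) : seminormed E N ->
  (forall i, closed_subspace E N (X i)) ->
  closed_subspace E N [set f | E f /\ forall i, X i f].
Proof.
move=> sn Xc; split => [f []//||f [Ef Kf]].
  split; first by split => [|i]; [exact: (sn_sub sn).1|have [_ [+ _] _] := Xc i].
  move=> a f g [Ef Xf] [Eg Xg]; split => [|i]; first exact: (sn_sub sn).2.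
  by have [_ sX _] := Xc i; exact: sX.2.
split => // i; have [_ _ cX] := Xc i.
by apply: cX; split => // e /Kf[g [Eg Xg] fg]; exists g.
Qed.

Lemma weak_cvg_scale0 {R : realType} (V : lmodType R) (E : set V) (N : V -> \bar R)
    (c_ : nat -> R) (u_ : nat -> V) u : seminormed E N -> c_ n @[n --> \oo] --> 0 ->
  weak_cvg E N u_ u -> weak_cvg E N (fun n => c_ n *: u_ n) 0.
Proof.
move=> sn c0 [Eu_ Eu ucvg]; split => [n||l lE lC].
- exact: subspaceZ (sn_sub sn) (Eu_ n).
- exact: (sn_sub sn).1.
have lu := ucvg l lE lC; rewrite (linear_on0 (sn_sub sn) lE).
rewrite (_ : l \o _ = fun n => c_ n * (l \o u_) n).
  by rewrite -[X in _ --> X](mul0r (l u)); exact: cvgM.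
by apply/funext => n; rewrite /= (linear_onZ _ (sn_sub sn) lE (Eu_ n)).
Qed.

Lemma weak_cvg_subr {R : realType} (V : lmodType R) (E : set V) (N : V -> \bar R)
    (u_ : nat -> V) u y : seminormed E N -> E y ->
  weak_cvg E N u_ u -> weak_cvg E N (fun n => u_ n - y) (u - y).
Proof.
move=> sn Ey [Eu_ Eu ucvg]; have sE := sn_sub sn; split => [n||l lE lC].
- exact: subspaceB.
- exact: subspaceB.
rewrite (linear_onB sE lE)//.
rewrite (_ : l \o _ = fun n => (l \o u_) n - l y).
  by apply: cvgB; [exact: ucvg|exact: cvg_cst].
by apply/funext => n; rewrite /= (linear_onB sE lE).
Qed.

(** For averages: an operator that is linear modulo null elements commutes with finite sums only
    modulo null elements. *)
Lemma bounded_operator_scaled_sum {R : realType} (V W : lmodType R) (E : set V) (N : V -> \bar R)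
    (F : set W) (M : W -> \bar R) (A : V -> W) (c : R) n (f : nat -> V) :
  seminormed E N -> seminormed F M -> bounded_operator E N F M A -> (forall k, E (f k)) ->
  M (A (c *: \sum_(k < n) f k) - c *: \sum_(k < n) A (f k)) = 0%E.
Proof.
move=> sn sm bA Ef; have [AF Alin _] := bA; have sE := sn_sub sn; have sF := sn_sub sm.
have LF k : F (A (f k)) by exact: AF.
have Sf m : E (\sum_(k < m) f k) by apply: subspace_sum.
have SF m : F (\sum_(k < m) A (f k)) by apply: subspace_sum.
have M0 g g' : F g -> F g' -> M (g - g') = 0%E -> M (g' - g) = 0%E.
  by move=> Fg Fg' h; rewrite (snBC sm).
have Mtr g g' g'' : F g -> F g' -> F g'' -> M (g - g') = 0%E -> M (g' - g'') = 0%E ->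
    M (g - g'') = 0%E.
  move=> Fg Fg' Fg'' h h'; apply: le_anti; rewrite (sn_ge0 sm) andbT.
  by rewrite (le_trans (sn_triangle sm Fg Fg' Fg''))// h h' adde0.
have A0 : M (A 0) = 0%E.
  have := Alin (-1) 0 0 sE.1 sE.1; rewrite scaler0 addr0 scaleN1r addNr subr0.
  by [].
elim: n => [|n IH].
  by rewrite !big_ord0 !scaler0 subr0.
rewrite !big_ord_recr /= [c *: (_ + f n)]scalerDr [_ + c *: f n]addrC.
apply: (Mtr _ (c *: A (f n) + A (c *: \sum_(k < n) f k))).
- by apply: AF; apply: sE.2 => //; exact: (subspaceZ _ sE (Sf n)).
- by apply: sF.2 => //; apply: AF; exact: (subspaceZ _ sE (Sf n)).
- by apply: (subspaceZ _ sF); exact: (subspaceD sF (SF n) (LF n)).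
- by apply: Alin => //; exact: (subspaceZ _ sE (Sf n)).
by rewrite scalerDr [c *: _ + c *: A (f n)]addrC opprD addrACA subrr add0r.
Qed.

(** * Ergodic averages *)

Section averages.
Context {R : realType} {d : nat} {dO : measure_display} {Omega : measurableType dO}.
Variables (P : probability Omega R) (tau : euclid R d -> Omega -> Omega) (p q : R).
Hypothesis ds : dynamical_system P tau.
Hypothesis p1 : 1 < p.
Hypothesis pq : p^-1 + q^-1 = 1.
Let p1' : 1 <= p. Proof. exact: ltW. Qed.
Local Notation E := (euclid R d).
Let sn := seminormed_Lp P p1'.
Let sL := sn_sub sn.

(* The steps 1/(j+1) tend to 0 while the range j+1 tends to infinity, so that the
   average of a difference quotient telescopes to O(1/(j+1)). *)
Definition cesaro (S : Type) (phi : E -> S -> S) i j (f : S -> R) : S -> R :=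
  ((j.+1 ^ 2)%N%:R)^-1 *:
    \sum_(k < j.+1 ^ 2) (f \o phi ((k%:R / j.+1%:R) *: basis_vec i)).

Lemma cesaro_norm (S : Type) (B : set (S -> R)) (M : (S -> R) -> \bar R)
    (phi : E -> S -> S) i j f : seminormed B M ->
  (forall x g, B g -> B (g \o phi x) /\ M (g \o phi x) = M g) -> B f ->
  B (cesaro phi i j f) /\ (M (cesaro phi i j f) <= M f)%E.
Proof.
move=> sm phiM Bf; have sB := sn_sub sm.
have Bt x : B (f \o phi x) by have [] := phiM x f Bf.
have BS : B (\sum_(k < j.+1 ^ 2) (f \o phi ((k%:R / j.+1%:R) *: basis_vec i))).
  by apply: subspace_sum.
split; first exact: subspaceZ.
have N0 : 0 < ((j.+1 ^ 2)%N%:R : R) by rewrite ltr0n expn_gt0.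
rewrite /cesaro (snZ sm)// gtr0_norm ?invr_gt0//.
apply: (le_trans (lee_wpmul2l _ (sn_sum sm _ _))); rewrite ?lee_fin ?invr_ge0 ?(ltW N0)//.
rewrite (eq_bigr (fun=> M f)); last by move=> k _; have [] := phiM ((k%:R / j.+1%:R) *: basis_vec i) f Bf.
rewrite -(fineK (sn_fin sm Bf)) sumEFin sumr_const card_ord -EFinM lee_fin.
by rewrite -[X in _ * X]mulr_natl mulrA mulVf ?mul1r// gt_eqF.
Qed.

Lemma cesaro_diff_quotient i j f :
  cesaro tau i j (diff_quotient tau i j.+1%:R^-1 f) =
  j.+1%:R^-1 *: ((f \o tau (j.+1%:R *: basis_vec i)) - f).
Proof.
have j0 : j.+1%:R != 0 :> R by rewrite pnatr_eq0.
rewrite /cesaro.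
pose g (k : nat) := f \o tau ((k%:R / j.+1%:R) *: basis_vec i).
rewrite (eq_bigr (fun k : 'I_(j.+1 ^ 2) => j.+1%:R *: (g k.+1 - g k))) => [|k _].
  rewrite -scaler_sumr scalerA -(big_mkord xpredT (fun k => g k.+1 - g k)) telescope_sumr//.
  rewrite /g mul0r scale0r natrX expr2 mulfK// invfM mulfVK//.
  by congr (_ *: (_ - _)); apply/funext => w; rewrite /= (tau0 ds).
apply/funext => w; rewrite /diff_quotient /g !fctE invrK; congr (_ * (f _ - _)).
by rewrite (tauD ds) -scalerDl -[k.+1%:R]natr1 mulrDl mul1r addrC.
Qed.

Lemma cesaroB (S : Type) (phi : E -> S -> S) i j (f g : S -> R) :
  cesaro phi i j (f - g) = cesaro phi i j f - cesaro phi i j g.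
Proof. by rewrite /cesaro -scalerBr -sumrB. Qed.

Lemma cesaroD (S : Type) (phi : E -> S -> S) i j (f g : S -> R) :
  cesaro phi i j (f + g) = cesaro phi i j f + cesaro phi i j g.
Proof. by rewrite /cesaro -scalerDr -big_split. Qed.

Lemma cesaro_contraction i j f : Lp P p f ->
  Lp P p (cesaro tau i j f) /\ (Lp_norm P p (cesaro tau i j f) <= Lp_norm P p f)%E.
Proof.
apply: (cesaro_norm _ _ sn) => x g Lg.
by split; [exact: (Lp_tau ds)|exact: (Lp_norm_tau ds)].
Qed.

(** Write g = D - (D - g) with D the difference quotient of f for the step 1 / (j + 1). The average
    of D telescopes and is at most 2 |f| / (j + 1) in norm; that of D - g is no larger than D - g,
    which tends to 0. *)
Lemma cesaro_generator i f g : is_generator P tau p i f g ->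
  forall e : R, 0 < e -> \forall j \near \oo, (Lp_norm P p (cesaro tau i j g) <= e%:E)%E.
Proof.
move=> /(is_generatorP ds p1)[Lf Lg fg] e e0.
have e2 : 0 < e / 2 by rewrite divr_gt0.
pose K := fine (Lp_norm P p f).
have KE : Lp_norm P p f = K%:E by rewrite (sn_fineE sn).
have K0 : 0 <= K by rewrite fine_ge0 ?(sn_ge0 sn).
have [r /= r0 rfg] := fg _ e2.
have s0 : 0 < e / 2 / (K + K + 1) by rewrite divr_gt0// ltr_wpDl// addr_ge0.
near=> j.
have jr : j.+1%:R^-1 < r by near: j; exact: (near_infty_natSinv_lt (PosNum r0)).
have js : j.+1%:R^-1 < e / 2 / (K + K + 1) by near: j; exact: (near_infty_natSinv_lt (PosNum s0)).
have j0 : 0 < j.+1%:R^-1 :> R by rewrite invr_gt0.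
pose D := diff_quotient tau i j.+1%:R^-1 f.
have LD : Lp P p D by exact: (Lp_diff_quotient ds p1).
have [LcD _] := cesaro_contraction i j LD; have [Lcg _] := cesaro_contraction i j Lg.
have LB := subspaceB sL LD Lg; have [LcB cB] := cesaro_contraction i j LB.
have -> : cesaro tau i j g = cesaro tau i j D - cesaro tau i j (D - g).
  by rewrite cesaroB opprB addrCA subrr addr0.
apply: (le_trans (snB sn LcD LcB)); rewrite (splitr e) EFinD leeD//; last first.
  apply: (le_trans cB); apply: rfg; last by rewrite gt_eqF.
  by rewrite /ball_/= sub0r normrN gtr0_norm.
rewrite cesaro_diff_quotient (snZ sn); last first.
  by apply: (subspaceB sL) => //; exact: (Lp_tau ds).
have := snB sn (Lp_tau ds p1' (j.+1%:R *: basis_vec i) Lf) Lf.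
rewrite (Lp_norm_tau ds)// KE => /(lee_wpmul2l (x := `|j.+1%:R^-1|%:E)) h.
apply: (le_trans (h _)); rewrite ?lee_fin//.
rewrite gtr0_norm//; apply/ltW.
have KK : 0 <= K + K by rewrite addr_ge0.
have KK1 : 0 < K + K + 1 by rewrite ltr_wpDl.
move: js; rewrite ltr_pdivlMr//; apply: le_lt_trans.
by rewrite ler_pM2l// lerDl.
Unshelve. all: by end_near. Qed.

Lemma cesaro_Lpot i F : Lpot P tau p F ->
  forall e : R, 0 < e -> \forall j \near \oo, (Lp_norm P p (cesaro tau i j (F i)) <= e%:E)%E.
Proof.
move=> [LF FG] e e0; have e2 : 0 < e / 2 by rewrite divr_gt0.
have [G [f Gf] FGe] := FG _ e2.
have [/(_ _)LG _] : LpV P p G /\ True by split => // k; have [] := Gf k.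
have := cesaro_generator (Gf i) e2; apply: filterS => j jG.
have LB := subspaceB sL (LF i) (LG i).
have [LcB cB] := cesaro_contraction i j LB; have [LcG _] := cesaro_contraction i j (LG i).
have -> : cesaro tau i j (F i) = cesaro tau i j (F i - G i) + cesaro tau i j (G i).
  by rewrite cesaroB subrK.
apply: (le_trans (snD sn LcB LcG)); rewrite (splitr e) EFinD leeD//.
apply: (le_trans cB); apply/ltW; apply: le_lt_trans FGe.
exact: (Lp_norm_le_LpV P p (F - G) i).
Qed.

Lemma cesaro_Linv i j f : Linv P tau p f -> Lp_norm P p (cesaro tau i j f - f) = 0%E.
Proof.
move=> [Lf fi].
suff : [set g | Lp P p g /\ Lp_norm P p g = 0%E] (cesaro tau i j f - f) by case.
have [_ sN _] := null_closed_subspace sn.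
have N0 : (j.+1 ^ 2)%N%:R != 0 :> R by rewrite pnatr_eq0 -lt0n expn_gt0.
have -> : cesaro tau i j f - f = ((j.+1 ^ 2)%N%:R)^-1 *:
    \sum_(k < j.+1 ^ 2) (f \o tau ((k%:R / j.+1%:R) *: basis_vec i) - f).
  rewrite sumrB sumr_const card_ord scalerBr -[f *+ _]scaler_nat scalerA mulVf// scale1r.
  by [].
apply: (subspaceZ _ sN); apply: subspace_sum => // k _.
have Lt := Lp_tau ds p1' ((k%:R / j.+1%:R) *: basis_vec i) Lf.
split; first exact: subspaceB.
exact/(Lp_normB_ae P p1' (Lp_measurable Lt) (Lp_measurable Lf)).
Qed.

Section fields.
Variables (leb : {sigma_finite_measure set E -> \bar R}).
Local Notation mu := (P \x leb)%E.
Let snmu := seminormed_Lp mu p1'.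

Lemma cesaro_translate_norm i j F : Lp mu p F ->
  Lp mu p (cesaro (translate tau) i j F) /\
  (Lp_norm mu p (cesaro (translate tau) i j F) <= Lp_norm mu p F)%E.
Proof.
apply: (cesaro_norm _ _ snmu) => x g Lg; split; last exact: (Lp_norm_translate ds).
by have [+ _ _] := translate_operator ds leb p1' x; exact.
Qed.

Lemma slice_cesaro i j b F : Lp leb q b -> Lp mu p F ->
  Lp_norm P p (slice leb b (cesaro (translate tau) i j F) - cesaro tau i j (slice leb b F)) = 0%E.
Proof.
move=> Lb LF.
apply: (@bounded_operator_scaled_sum R _ _ _ _ _ _ (slice leb b) _ _
  (fun k => F \o translate tau ((k%:R / j.+1%:R) *: basis_vec i)) snmu sn
  (slice_operator P p1 pq Lb)) => k.
by have [+ _ _] := translate_operator ds leb p1' ((k%:R / j.+1%:R) *: basis_vec i); exact.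
Qed.

End fields.
End averages.

Section weak_compactness_product.
Context {R : realType} {d1 d2} {T1 : measurableType d1} {T2 : measurableType d2}.
Variables (m1 : {sigma_finite_measure set T1 -> \bar R}).
Variables (m2 : {sigma_finite_measure set T2 -> \bar R}).

Let product_sigma_finite : sigma_finite setT (m1 \x m2)%E.
Proof.
have /sigma_finiteP[F [TF ndF Foo]] := sigma_finiteT m1.
have /sigma_finiteP[G [TG ndG Goo]] := sigma_finiteT m2.
exists (fun n => F n `*` G n) => [|k].
  rewrite -setXTT TF TG predeqE => -[x y]; split => [[/= [n _ Fn] [k _ Gk]]|].
    exists (maxn n k) => //; split.
    - by move: x Fn; exact/subsetPset/ndF/leq_maxl.
    - by move: y Gk; exact/subsetPset/ndG/leq_maxr.
  by move=> [n _ []/= ? ?]; split; exists n.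
have [? ?] := Foo k; have [? ?] := Goo k.
split; first exact: measurableX.
by rewrite product_measure1E// lte_mul_pinfty// ge0_fin_numE.
Qed.

Lemma weak_compactness_product (p q : R) (I1 I2 : countType)
    (e1 : I1 -> T1 -> R) (e2 : I2 -> T2 -> R) m (f : 'I_m -> nat -> T1 * T2 -> R) (C : R) :
  1 < p -> p^-1 + q^-1 = 1 -> total_family m1 q e1 -> total_family m2 q e2 ->
  (forall i n, Lp (m1 \x m2)%E p (f i n)) ->
  (forall i n, (Lp_norm (m1 \x m2)%E p (f i n) <= C%:E)%E) ->
  exists (k : nat -> nat) (u : 'I_m -> T1 * T2 -> R), {homo k : m n / (m < n)%N} /\
    forall i, weak_cvg (Lp (m1 \x m2)%E p) (Lp_norm (m1 \x m2)%E p) (f i \o k) (u i).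
Proof.
move=> p1 pq te1 te2; have q1 := conjugate_gt1 p1 pq.
have te := total_family_product q1 te1 te2.
pose mu : {measure set (T1 * T2)%type -> \bar R} := (m1 \x m2)%E.
pose B := @Measure_isSigmaFinite.Build _ _ _ mu product_sigma_finite.
pose nu : {sigma_finite_measure set (T1 * T2)%type -> \bar R} :=
  HB.pack (mu : set _ -> \bar R) (Measure.class mu) B.
exact: (@weak_compactness _ _ _ nu p q p1 pq _ _ m f C te).
Qed.

End weak_compactness_product.

(** * Two-scale limits *)

Section two_scale_limit.
Context {R : realType} {d : nat} {dO : measure_display} {Omega : measurableType dO}.
Variables (P : probability Omega R) (tau : euclid R d -> Omega -> Omega) (p q : R).
Hypothesis ds : dynamical_system P tau.
Hypothesis p1 : 1 < p.
Hypothesis pq : p^-1 + q^-1 = 1.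
Hypothesis cg : countably_generated Omega.
Let q1 : 1 < q. Proof. exact: conjugate_gt1 pq. Qed.
Let p1' : 1 <= p. Proof. exact: ltW. Qed.
Let q1' : 1 <= q. Proof. exact: ltW. Qed.
Local Notation E := (euclid R d).
Variables (Q : set E) (oQ : open Q).
Local Notation leb := (lebesgue_on oQ).
Local Notation mu := (P \x leb)%E.
Local Notation field := (Omega * E -> R).
Let snV n := seminormed_LpV mu p1' n.
Let snVP n := seminormed_LpV P p1' n.
Let snmu := seminormed_Lp mu p1'.
Let snP := seminormed_Lp P p1'.

(** For W = (v, U) this is I_phi (U - nabla v) in distributional form, which does not presuppose
    that v has a weak gradient. *)
Definition corrector phi (W : 'I_d.+1 -> field) : 'I_d -> Omega -> R :=
  fun i => slice leb phi (W (lift ord0 i)) + slice leb (partial i phi) (W ord0).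

Let slice_component_operator j psi : test_function Q psi ->
  bounded_operator (@LpV _ _ _ mu p d.+1) (@LpV_norm _ _ _ mu p d.+1) (Lp P p) (Lp_norm P p)
    (fun W => slice leb psi (W j)).
Proof.
move=> tpsi; have Lpsi := Lp_test oQ q1' tpsi.
exact: (bounded_operator_comp (snV _) snmu snP (LpV_proj_operator mu p1' j)
  (slice_operator P p1 pq Lpsi)).
Qed.

Let corrector_component_operator i phi : test_function Q phi ->
  bounded_operator (@LpV _ _ _ mu p d.+1) (@LpV_norm _ _ _ mu p d.+1) (Lp P p) (Lp_norm P p)
    (fun W => corrector phi W i).
Proof.
move=> tphi; apply: (bounded_operatorD (snV _) snP); first exact: slice_component_operator.
by apply: slice_component_operator; exact: test_partial.
Qed.

(** The vector (I_phi S u, eps * corrector) lies in the closed generator graph and converges weakly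
    to (I_phi v, 0), which is therefore in the graph. Its tail divided by eps shows that the
    correctors lie in [Lpot], which is weakly closed as well. *)
Lemma two_scale_limit_identities (eps_ : nat -> R) (T : nat -> 'I_d.+1 -> field)
    (W : 'I_d.+1 -> field) :
  (forall n, 0 < eps_ n) -> eps_ n @[n --> \oo] --> 0 ->
  (forall n, norm_closure (@LpV _ _ _ mu p d.+1) (@LpV_norm _ _ _ mu p d.+1)
    (tensor_graph oQ p (Lp P p)) (T n)) ->
  weak_cvg (@LpV _ _ _ mu p d.+1) (@LpV_norm _ _ _ mu p d.+1)
    (fun n i => shift tau (- (eps_ n)^-1) (T n i)) W ->
  forall phi, test_function Q phi ->
    Linv P tau p (slice leb phi (W ord0)) /\ Lpot P tau p (corrector phi W).
Proof.
move=> e0 ecvg TT SW phi tphi.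
pose S n i := shift tau (- (eps_ n)^-1) (T n i).
have bS := slice_component_operator ord0 tphi.
have bC i := corrector_component_operator i tphi.
have a0 n : - (eps_ n)^-1 != 0 by rewrite oppr_eq0 invr_eq0 gt_eqF.
have GG n : closed_generator_graph P tau p
    (vcons (slice leb phi (S n ord0)) (fun i => eps_ n *: corrector phi (S n) i)).
  have := horizontal_graph ds p1 pq (a0 n) cg tphi (TT n).
  by rewrite /horizontal opprK invrK.
have CW i := weak_cvg_operator (snV _) snP (bC i) SW.
split.
  have := closed_subspace_weak (snVP _) (u_ := fun n => vcons (slice leb phi (S n ord0))
    (fun i => eps_ n *: corrector phi (S n) i)) (u := vcons (slice leb phi (W ord0)) (fun=> 0))
    (closed_subspace_generator_graph ds p1) GG.
  move=> h; have {}h : closed_generator_graph P tau p (vcons (slice leb phi (W ord0)) (fun=> 0)).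
    apply: h; apply: (weak_cvgV p1') => j; case: (unliftP ord0 j) => [i|] ->.
      under eq_fun do rewrite vconsS.
      by rewrite vconsS; exact: (weak_cvg_scale0 snP ecvg (CW i)).
    under eq_fun do rewrite vcons0.
    by rewrite vcons0; exact: (weak_cvg_operator (snV _) snP bS SW).
  have := generator_graph_Linv ds p1 h; rewrite vcons0; apply => i.
  by rewrite vconsS; exact: sn0 snP.
apply: (closed_subspace_weak (snVP _) (u_ := fun n => corrector phi (S n)) (closed_Lpot ds p1)).
  move=> n; have := generator_graph_Lpot ds p1 (GG n).
  have [_ sLpot _] := closed_Lpot (tau := tau) ds p1.
  move=> /(subspaceZ (eps_ n)^-1 sLpot).
  congr (Lpot P tau p _); apply/funext => i; apply/funext => w.
  rewrite /vtail -[LHS]/((eps_ n)^-1 * vcons _ _ (lift ord0 i) w) vconsS.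
  by rewrite -[(eps_ n *: _) w]/(eps_ n * _) mulKf// gt_eqF.
exact: (weak_cvgV p1').
Qed.

(** The corrector is I_phi U_i + y with y = I_{d_i phi} v, and y is invariant by the hypothesis for
    d_i phi. Averages in direction i send the corrector to 0 and fix y, so I_phi of the averages of
    U_i tends to - y in norm. The subsequence and G come from compactness on Omega x Q and are the
    same for all phi. *)
Lemma averaged_gradient (W : 'I_d.+1 -> field) : LpV mu p W ->
  (forall phi, test_function Q phi ->
    Linv P tau p (slice leb phi (W ord0)) /\ Lpot P tau p (corrector phi W)) ->
  exists2 G, LpV mu p G & forall phi, test_function Q phi -> forall i,
    slice leb phi (G i) = - slice leb (partial i phi) (W ord0) %[ae P].
Proof.
move=> LW HW; pose A i n := cesaro (translate tau) i n (W (lift ord0 i)).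
have LA i n := cesaro_translate_norm ds p1 i n (LW (lift ord0 i)).
have [e1 te1] := total_family_countably_generated P q1' cg.
have [||k [G [kinc AG]]] := weak_compactness_product (f := A)
    (C := fine (LpV_norm mu p W)) p1 pq te1 (total_family_lebesgue_on oQ q1').
- by move=> i n; have [] := LA i n.
- move=> i n; have [_ h] := LA i n; apply: (le_trans h).
  by rewrite -(sn_fineE (snV _) LW); exact: Lp_norm_le_LpV.
exists G => [i|phi tphi i]; first by have [_ + _] := AG i.
have tp := test_partial i tphi.
have Lphi := Lp_test oQ q1' tphi; have Lp' := Lp_test oQ q1' tp.
have [_ Cpot] := HW _ tphi; have [[Ly yinv] _] := HW _ tp.
set y := slice leb (partial i phi) (W ord0) in Ly yinv *.
have LG : Lp mu p (G i) by have [_ + _] := AG i.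
have LsG := Lp_slice p1 pq Lphi LG.
have Lny : Lp P p (- y) by exact: (subspaceN (sn_sub snP)).
apply/(Lp_normB_ae P p1' (Lp_measurable LsG) (Lp_measurable Lny)).
have := weak_cvg_operator snmu snP (slice_operator P p1 pq Lphi) (AG i).
move=> /(weak_cvg_subr snP Lny) wc; apply: (weak_cvg_norm0 snP wc).
have LS n : Lp P p (slice leb phi (A i n) - (- y)).
  by apply: (subspaceB (sn_sub snP)) => //; apply: (Lp_slice p1 pq) => //; have [] := LA i n.
suff cv e : 0 < e -> \forall n \near \oo, (Lp_norm P p (slice leb phi (A i n) - (- y))%R <= e%:E)%E.
  apply/fine_cvgP; split.
    by apply: nearW => n; exact: (sn_fin snP (LS (k n))).
  apply/cvgrPdist_le => e e0; have [N _ cvN] := cv _ e0.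
  exists N => // n /= Nn; rewrite sub0r normrN ger0_norm ?fine_ge0 ?(sn_ge0 snP)//.
  rewrite -lee_fin -(sn_fineE snP (LS (k n))).
  by apply: cvN; exact: (leq_trans Nn (leq_homo_lt kinc n)).
move=> e0.
have := cesaro_Lpot ds p1 i Cpot e0; apply: filterS => n; apply: le_trans.
have LWi := LW (lift ord0 i).
have LsW := Lp_slice p1 pq Lphi LWi; have LC : Lp P p (corrector phi W i) by have [+ _] := Cpot; exact.
have [Lc1 _] := cesaro_contraction ds p1 i n LsW.
have [Lc2 _] := cesaro_contraction ds p1 i n Ly.
have [LcC _] := cesaro_contraction ds p1 i n LC.
rewrite (sn_eqN snP (LS n) LcC)//.
have sP := sn_sub snP.
have -> : cesaro tau i n (corrector phi W i) =
    cesaro tau i n (slice leb phi (W (lift ord0 i))) + cesaro tau i n y.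
  by rewrite -cesaroD.
set s1 := slice leb phi (A i n); set s2 := cesaro tau i n (slice _ _ _); set s3 := cesaro tau i n y.
(* The first difference is null because averaging commutes with I_phi, the second because y is
   invariant. *)
have -> : s1 - (- y) - (s2 + s3) = (s1 - s2) - (s3 - y).
  by rewrite opprK opprD opprB addrACA [y - s3]addrC [- s3 + y]addrC.
have Ls1 : Lp P p s1 by apply: (Lp_slice p1 pq) => //; have [] := LA i n.
apply: le_anti; rewrite (sn_ge0 snP) andbT.
apply: (le_trans (snB snP (subspaceB sP Ls1 Lc1) (subspaceB sP Lc2 Ly))).
by rewrite (slice_cesaro ds p1 pq)// (cesaro_Linv ds p1)// adde0.
Qed.

(** As v has a weak gradient, the corrector is almost everywhere I_phi (U - nabla v). All these
    slices lie in [Lpot], and test functions are total. *)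
Lemma corrector_Lpot v U : LpV mu p (vcons v U) -> LpW1p oQ p P v ->
  (forall phi, test_function Q phi -> Lpot P tau p (corrector phi (vcons v U))) ->
  tensor_LpV oQ p P (Lpot P tau p) (U - nabla oQ p P v).
Proof.
move=> /LpV_vcons[Lv LU] /nablaP[_ LN wN] HW.
have LB : LpV mu p (U - nabla oQ p P v) by exact: (subspaceB (sn_sub (snV _))).
apply: (tensor_closure_slices p1 pq (closed_Lpot ds p1) (total_family_tests oQ q1') LB).
move=> [phi tphi]/=; have Lphi := Lp_test oQ q1' tphi.
have LSB : LpV P p (fun i => slice leb phi ((U - nabla oQ p P v) i)).
  by move=> i; apply: (Lp_slice p1 pq Lphi); exact: LB.
have C := HW _ tphi; have [LC _] := C.
apply: (closed_subspace_eq (closed_Lpot ds p1) LSB C).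
apply/(LpV_normB_ae P p1') => [i|i|i]; [exact: Lp_measurable (LSB i)|exact: Lp_measurable (LC i)|].
have lin := slice_linear_ae p1 pq (-1) Lphi (LN i) (LU i).
move: wN; apply: filterS2 lin => w lin [_ _ /(_ _ tphi i) wN] wT.
rewrite /corrector vcons0 vconsS -[RHS]/(_ w + _ w).
have -> : slice leb (partial i phi) v w = - slice leb phi (nabla oQ p P v i) w by exact: wN.
have := lin wT; rewrite scaleN1r [- _ + U i]addrC => ->.
by rewrite -[LHS]/((-1) * _ w + _ w) mulN1r addrC.
Qed.

End two_scale_limit.

(** * Closures of tensors of invariant functions *)

Section invariant_tensors.
Context {R : realType} {d : nat} {dO : measure_display} {Omega : measurableType dO}.
Variables (P : probability Omega R) (tau : euclid R d -> Omega -> Omega) (p q : R).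
Hypothesis ds : dynamical_system P tau.
Hypothesis p1 : 1 < p.
Hypothesis pq : p^-1 + q^-1 = 1.
Let q1 : 1 < q. Proof. exact: conjugate_gt1 pq. Qed.
Let p1' : 1 <= p. Proof. exact: ltW. Qed.
Let q1' : 1 <= q. Proof. exact: ltW. Qed.
Local Notation E := (euclid R d).
Let snP := seminormed_Lp P p1'.
Let sP := sn_sub snP.

Let Plty A : measurable A -> (P A < +oo)%E.
Proof. by move=> mA; apply: (le_lt_trans (probability_le1 P mA)); exact: ltry. Qed.

Lemma Linv_Lp : Linv P tau p `<=` Lp P p.
Proof. by move=> f []. Qed.

Lemma closed_Linv : closed_subspace (Lp P p) (Lp_norm P p) (Linv P tau p).
Proof.
have Kc x := closed_subspace_preimage snP snP
  (bounded_operatorBid snP (tau_operator ds p1' x))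
  (null_closed_subspace snP).
have := closed_subspace_forall snP Kc; congr closed_subspace.
apply/seteqP; split => f [Lf h]; split => // x; have Lt := Lp_tau ds p1' x Lf.
  have [_ [_ fx]] := h x.
  exact/(Lp_normB_ae P p1' (Lp_measurable Lt) (Lp_measurable Lf)).
split => //; split; first exact: subspaceB.
by apply/(Lp_normB_ae P p1' (Lp_measurable Lt) (Lp_measurable Lf)); exact: h.
Qed.

(** Functions in [Linv] are invariant almost everywhere only, with a null set that may depend on x;
    their level sets are of this kind. These sets form an algebra, as partitions into atoms
    require. *)
Definition ae_invariant_set : set (set Omega) :=
  [set A | measurable A /\ forall x, (\1_A : Omega -> R) \o tau x = \1_A %[ae P]].

Lemma ae_invariant_Linv A : ae_invariant_set A -> Linv P tau p (\1_A).
Proof.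
by move=> [mA hA]; split => //; apply: Lp_indic => //; exact: Plty.
Qed.

Lemma ae_invariant_level f (a : R) : Linv P tau p f ->
  ae_invariant_set [set w | a <= f w].
Proof.
move=> [Lf hf]; split; first exact/measurable_level/(Lp_measurable Lf).
move=> x; move: (hf x); apply: filterS => w /[apply] /= fw.
by rewrite !indicE; congr (nat_of_bool _)%:R; apply/idP/idP; rewrite !inE /= fw.
Qed.

Lemma ae_invariant_set0 : ae_invariant_set set0.
Proof. by split => // x; apply: aeW => w _; rewrite /= !indicE !in_set0. Qed.

Lemma ae_invariant_setC A : ae_invariant_set A -> ae_invariant_set (~` A).
Proof.
move=> [mA hA]; split => [|x]; first exact: measurableC.
move: (hA x); apply: filterS => w /[apply] /=; rewrite !indicE !in_setC.
by case: (_ \in A); case: (_ \in A) => //= /eqP; rewrite ?oner_eq0 // eq_sym oner_eq0.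
Qed.

Lemma ae_invariant_setI : setI_closed ae_invariant_set.
Proof.
move=> A B [mA hA] [mB hB]; split => [|x]; first exact: measurableI.
move: (hA x); apply: filterS2 (hB x) => w hBw hAw wT.
by have := hAw wT; have := hBw wT; rewrite /= !indicI /= => -> ->.
Qed.

Variables (Q : set E) (oQ : open Q).
Local Notation leb := (lebesgue_on oQ).
Local Notation mu := (P \x leb)%E.
Local Notation field := (Omega * E -> R).
Let snmu := seminormed_Lp mu p1'.
Let snV := seminormed_LpV mu p1' d.+1.

Let snsw := seminormed_Lp (leb \x P)%E p1'.

Let invariant_indic : set (Omega -> R) :=
  [set b | exists2 B, ae_invariant_set B /\ (P B < +oo)%E & b = \1_B].

(** [averaging] acts in the second variable, and here it is to act on Omega, whence the swap. The
    invariant factors are approximated through their level sets. *)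
Lemma swap_invariant_tensor F : norm_closure (Lp mu p) (Lp_norm mu p)
    (tensor_alg (Linv P tau p) (Lp leb p)) F ->
  norm_closure (Lp (leb \x P)%E p) (Lp_norm (leb \x P)%E p)
    (tensor_alg (Lp leb p) invariant_indic) (F \o @pair_swap E Omega).
Proof.
have sub : tensor_alg (Lp leb p) invariant_indic `<=` Lp (leb \x P)%E p.
  move=> _ [n [f [g [Lf gB ->]]]].
  rewrite (_ : (fun z => _) = \sum_(k < n) tensor (f k) (g k)); last first.
    by apply/funext => z; rewrite fct_sumE.
  apply: (subspace_sum _ (sn_sub snsw)) => k _; apply: Lp_tensor => //.
  by have [B [[mB _] Boo] ->] := gB k; exact: Lp_indic.
have sT : subspace (tensor_alg (Lp leb p) invariant_indic).
  by apply: subspace_tensor_alg => a f; exact: (subspaceZ _ (subspace_Lp leb p1')).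
have Kc := norm_closure_subspace snsw sub sT; set K := norm_closure _ _ _ in Kc *.
have swc := closed_subspace_preimage snmu snsw (swap_operator P leb p1) Kc.
set K' := [set f | _] in swc; suff TK : tensor_alg (Linv P tau p) (Lp leb p) `<=` K'.
  by move=> /(norm_closure_min TK swc)[].
move=> _ [n [f [g [Lf Lg ->]]]]; have [_ sK' _] := swc.
rewrite (_ : (fun z => _) = \sum_(k < n) tensor (f k) (g k)); last first.
  by apply/funext => z; rewrite fct_sumE.
apply: (subspace_sum _ sK') => k _; have Lk := Linv_Lp (Lf k).
split; first exact: Lp_tensor.
have -> : tensor (f k) (g k) \o @pair_swap E Omega = tensor (g k) (f k).
  by apply/funext => z; rewrite /tensor /= mulrC.
have gc := closed_subspace_preimage snP snsw (tensor_operator2 P p1 (Lg k)) Kc.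
set Kg := [set f | _] in gc; suff : Kg (f k) by case.
apply: (closed_subspace_level_sets p1' gc Lk) => a a0.
have key B : ae_invariant_set B -> Kg (\1_B).
  move=> iB; have LB := Linv_Lp (ae_invariant_Linv iB); split => //.
  apply: (sub_norm_closure snsw sub); apply: tensor_alg1 => //.
  by exists B => //; split => //; case: iB => mB _; exact: Plty.
split; apply/key/ae_invariant_level => //.
by have [_ sL _] := closed_Linv; exact: (subspaceN sL).
Qed.

(** The identity between slices, paired with the indicator function of B and with the integrals
    exchanged, is the weak gradient identity for the averages over B. *)
Lemma average_gradient_graph B (W : 'I_d.+1 -> field) : measurable B -> LpV mu p W ->
  (forall phi, test_function Q phi -> forall i,
    slice leb phi (W (lift ord0 i)) = - slice leb (partial i phi) (W ord0) %[ae P]) ->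
  gradient_graph oQ p (fun j => average P B (W j \o @pair_swap E Omega)).
Proof.
move=> mB LW HW; have [_ sJ _] := closed_gradient_graph oQ p1 pq.
have Boo : (P B < +oo)%E by exact: Plty.
have LBq : Lp P q (\1_B) by exact: Lp_indic.
apply: (subspaceZ (fine (P B))^-1 (f := fun j => slice P (\1_B) (W j \o @pair_swap E Omega)) sJ).
have Lsw j := Lp_swap p1 (LW j).
have LS j : Lp leb p (slice P (\1_B) (W j \o @pair_swap E Omega)).
  exact: (Lp_slice p1 pq LBq (Lsw j)).
split => [//|i|phi tphi i]; first exact: LS.
have Lphi := Lp_test oQ q1' tphi; have Lp' := Lp_test oQ q1' (test_partial i tphi).
have swE j : (W j \o @pair_swap E Omega) \o @pair_swap Omega E = W j.
  by apply/funext => -[].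
rewrite /vtail (slice_pairing_swap p1 pq (Lsw _) Lp' LBq).
rewrite (slice_pairing_swap p1 pq (Lsw _) Lphi LBq) !swE.
have L1 := Lp_slice p1 pq Lphi (LW (lift ord0 i)); have L2 := Lp_slice p1 pq Lp' (LW ord0).
rewrite -RintegralN; last exact: (hoelder_integrable p1 pq L1 LBq).
apply: ae_eq_Rintegral.
- by apply: measurable_funM; [exact: Lp_measurable L2|exact: Lp_measurable LBq].
- apply: measurableT_comp => //.
  by apply: measurable_funM; [exact: Lp_measurable L1|exact: Lp_measurable LBq].
move: (HW _ tphi i); apply: filterS => w /[apply] ->.
by rewrite fctE mulNr opprK.
Qed.

(** Every component has invariant slices, the gradient ones because they equal - I_{d_i phi} W_0,
    and so lies in the closure of invariant tensors. Averaging over sets of a partition of Omega,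
    rather than of Q, approximates all components at once without destroying the gradient relation:
    each average over a set is a pair in the gradient graph. *)
Lemma invariant_tensor_graph (W : 'I_d.+1 -> field) : LpV mu p W ->
  (forall phi, test_function Q phi -> Linv P tau p (slice leb phi (W ord0))) ->
  (forall phi, test_function Q phi -> forall i,
    slice leb phi (W (lift ord0 i)) = - slice leb (partial i phi) (W ord0) %[ae P]) ->
  norm_closure (@LpV _ _ _ mu p d.+1) (@LpV_norm _ _ _ mu p d.+1)
    (tensor_graph oQ p (Linv P tau p)) W.
Proof.
move=> LW H0 HW; split => // e e0; have [_ sinv _] := closed_Linv.
have Hinv j phi : test_function Q phi -> Linv P tau p (slice leb phi (W j)).
  move=> tphi; case: (unliftP ord0 j) => [i|] ->; last exact: H0.
  have LS := Lp_slice p1 pq (Lp_test oQ q1' tphi) (LW (lift ord0 i)).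
  have tp := test_partial i tphi; have Ly := subspaceN sinv (H0 _ tp).
  apply: (closed_subspace_eq closed_Linv LS Ly).
  apply/(Lp_normB_ae P p1'); [exact: Lp_measurable LS|exact: Lp_measurable (Linv_Lp Ly)|].
  exact: HW.
have WT j : norm_closure (Lp (leb \x P)%E p) (Lp_norm (leb \x P)%E p)
    (tensor_alg (Lp leb p) invariant_indic) (W j \o @pair_swap E Omega).
  apply: swap_invariant_tensor.
  have Xc : closed_subspace (@LpV _ _ _ P p d.+1) (@LpV_norm _ _ _ P p d.+1)
      [set F | LpV P p F /\ forall i, LpV P p F /\ Linv P tau p (F i)].
    apply: (closed_subspace_forall (seminormed_LpV P p1' d.+1)) => i.
    exact: (closed_subspace_preimage (seminormed_LpV P p1' d.+1) snP (LpV_proj_operator P p1' i) closed_Linv).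
  have [|_ h] := tensor_closure_slices p1 pq Xc (total_family_tests oQ q1') LW.
    move=> [phi tphi]/=; have LS : LpV P p (fun i => slice leb phi (W i)).
      by move=> i; exact: (Lp_slice p1 pq (Lp_test oQ q1' tphi) (LW i)).
    by split => // i; split => //; exact: Hinv.
  split => // e' e'0; have [_ [n [F [g [XF Lg ->]]]] lt] := h _ e'0.
  exists (fun z => \sum_(k < n) F k j z.1 * g k z.2).
    by exists n, (fun k => F k j), g; split => // k; have [_ /(_ j)[]] := XF k.
  by apply: le_lt_trans lt; exact: (Lp_norm_le_LpV mu p (W - _)).
have e2 : 0 < e / d.+2%:R by rewrite divr_gt0.
have [K [C [SC Ce]]] := averaging_approximation p1 pq ae_invariant_setI
  ae_invariant_setC ae_invariant_set0 (fun A => @proj1 _ _) WT e2.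
pose T : 'I_d.+1 -> field := fun j z =>
  \sum_(k < #|K|) \1_(C (enum_val k)) z.1 * average P (C (enum_val k)) (W j \o @pair_swap E Omega) z.2.
exists T.
  exists #|K|, (fun k => \1_(C (enum_val k))),
    (fun k j => average P (C (enum_val k)) (W j \o @pair_swap E Omega)); split => // k.
    by apply: ae_invariant_Linv; have [] := SC (enum_val k).
  by apply: average_gradient_graph => //; have [[]] := SC (enum_val k).
have TE j : W j - T j =
    (W j \o @pair_swap E Omega - \sum_s averaging P (C s) (W j \o @pair_swap E Omega))
      \o @pair_swap Omega E.
  apply/funext => -[w x]; rewrite !fctE fct_sumE /T /pair_swap/=; congr (_ - _).
  rewrite [RHS](reindex _ (onW_bij _ (@enum_val_bij K))).
  by apply: eq_bigr => k _; rewrite /averaging /tensor/= mulrC.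
have LA j : Lp (leb \x P)%E p
    (W j \o @pair_swap E Omega - \sum_s averaging P (C s) (W j \o @pair_swap E Omega)).
  have Lsw := Lp_swap p1 (LW j).
  apply: (subspaceB (sn_sub snsw)) => //; apply: (subspace_sum _ (sn_sub snsw)) => s _.
  by have [_ fC] := SC s; have [+ _ _] := averaging_operator leb p1 pq fC; exact.
have le j : (Lp_norm mu p ((W - T)%R j) <= (e / d.+2%:R)%:E)%E.
  by rewrite -[(W - T)%R j]/(W j - T j) TE (Lp_norm_swap (LA j)); exact/ltW/Ce.
apply: (@le_lt_trans _ _ (\sum_(j < d.+1) (e / d.+2%:R)%:E)%E); first exact: lee_sum.
rewrite sumEFin lte_fin sumr_const card_ord -[_ *+ _]mulr_natl mulrCA.
by rewrite gtr_pMr// ltr_pdivrMr// mul1r ltr_nat.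
Qed.

End invariant_tensors.

Section two_scale_compactness.
Context {R : realType} {d : nat} {dO : measure_display} {Omega : measurableType dO}.
Variables (P : probability Omega R) (tau : euclid R d -> Omega -> Omega) (p q : R).
Hypothesis ds : dynamical_system P tau.
Hypothesis p1 : 1 < p.
Hypothesis pq : p^-1 + q^-1 = 1.
Hypothesis cg : countably_generated Omega.
Let q1 : 1 < q. Proof. exact: conjugate_gt1 pq. Qed.
Let p1' : 1 <= p. Proof. exact: ltW. Qed.
Let q1' : 1 <= q. Proof. exact: ltW. Qed.
Local Notation E := (euclid R d).
Variables (Q : set E) (oQ : open Q).
Local Notation leb := (lebesgue_on oQ).
Local Notation mu := (P \x leb)%E.
Local Notation field := (Omega * E -> R).

Lemma unfolding_operator eps : 0 < eps ->
  is_unfolding P tau p oQ eps (unfolding P tau p oQ eps).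
Proof.
move=> e0; have exU : exists T, [set T | is_unfolding P tau p oQ eps T] T.
  by exists (shift tau (- eps^-1)); exact: is_unfolding_shift.
exact: (xgetPex _ exU).
Qed.

(** Weak convergence does not see the null set on which [unfolding] and the shift may differ. *)
Lemma two_scale_cvg_shift (eps_ : nat -> R) (u_ : nat -> field) u :
  (forall n, 0 < eps_ n) -> (forall n, Lp mu p (u_ n)) ->
  weak_cvg (Lp mu p) (Lp_norm mu p) (fun n => shift tau (- (eps_ n)^-1) (u_ n)) u ->
  two_scale_cvg P tau p oQ eps_ u_ u.
Proof.
move=> e0 Lu wu; have snmu := seminormed_Lp mu p1'.
have [LS Lu' _] := wu.
have LT n : Lp mu p (unfolding P tau p oQ (eps_ n) (u_ n)).
  by have [[+ _ _ _] _] := unfolding_operator (e0 n); exact.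
apply: (weak_cvg_eq snmu wu) => // [n|]; last by rewrite subrr; exact: sn0 snmu.
apply/(Lp_normB_ae mu p1' (Lp_measurable (LS n)) (Lp_measurable (LT n))).
by have := unfolding_shift ds p1 (e0 n) (Lu n); apply: filterS => z /[apply] ->.
Qed.

Lemma two_scale_compactness (eps_ : nat -> R) (u_ : nat -> field) :
  (forall n, 0 < eps_ n) -> eps_ n @[n --> \oo] --> 0 ->
  (forall n, tensor_W1p oQ p P (Lp P p) (u_ n)) ->
  (exists C : R, forall n, (LpW1p_norm oQ p P (u_ n) <= C%:E)%E) ->
  exists (W : 'I_d.+1 -> field) (k : nat -> nat),
    [/\ {homo k : m n / (m < n)%N},
      weak_cvg (@LpV _ _ _ mu p d.+1) (@LpV_norm _ _ _ mu p d.+1)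
        (fun n i => shift tau (- (eps_ (k n))^-1)
          (vcons (u_ (k n)) (nabla oQ p P (u_ (k n))) i)) W,
      tensor_W1p oQ p P (Linv P tau p) (W ord0) &
      tensor_LpV oQ p P (Lpot P tau p) (vtail W - nabla oQ p P (W ord0))].
Proof.
move=> e0 ecvg Tu [C uC]; pose T n := vcons (u_ n) (nabla oQ p P (u_ n)).
have TT n := tensor_W1p_graph p1 pq (@subset_refl _ (Lp P p)) (Tu n).
have LT n : LpV mu p (T n) by case: (TT n).
have a0 n : - (eps_ n)^-1 != 0 by rewrite oppr_eq0 invr_eq0 gt_eqF.
have [e1 te1] := total_family_countably_generated P q1' cg.
have [||k [W [kinc SW]]] := weak_compactness_product
    (f := fun i n => shift tau (- (eps_ n)^-1) (T n i)) (C := C)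
    p1 pq te1 (total_family_lebesgue_on oQ q1').
- by move=> i n; apply: (Lp_shift ds) => //; exact: LT.
- move=> i n; rewrite (Lp_norm_shift ds)//; last exact: LT.
  apply: le_trans (uC n).
  by rewrite -[leRHS]LpV_norm_vcons; exact: Lp_norm_le_LpV.
have {}SW := weak_cvgV p1' SW.
have ecvg' : (eps_ \o k) n @[n --> \oo] --> 0.
  move/cvgrPdist_le : ecvg => ecvg; apply/cvgrPdist_le => e /ecvg[N _ eN].
  by exists N => // n /= Nn; apply: eN; exact: (leq_trans Nn (leq_homo_lt kinc n)).
have ids := two_scale_limit_identities ds p1 pq cg (fun n => e0 (k n)) ecvg' (fun n => TT (k n)) SW.
have [_ LW _] := SW.
have [G LG Gphi] := averaged_gradient ds p1 pq cg LW ids.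
have LWG : LpV mu p (vcons (W ord0) G) by apply/LpV_vcons; split.
have := invariant_tensor_graph ds p1 pq (W := vcons (W ord0) G) LWG.
rewrite vcons0 => /(_ (fun phi tphi => (ids phi tphi).1)) cl.
have {}cl : norm_closure (LpV mu p (n:=d.+1)) (LpV_norm mu p (n:=d.+1))
    (tensor_graph oQ p (Linv P tau p)) (vcons (W ord0) G).
  by apply: cl => phi tphi i; rewrite vconsS; exact: Gphi.
have [tW wG] := graph_tensor_W1p p1 pq (@Linv_Lp _ _ _ _ P tau p) cl.
exists W, k; split => //.
have ids' phi : test_function Q phi -> Lpot P tau p (corrector oQ phi W) by move=> /ids[].
apply: (corrector_Lpot ds p1 pq); first by rewrite vconsK.
  by exists G.
by rewrite vconsK.
Qed.

End two_scale_compactness.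

Lemma rank_one_operator {R : realType} (V W : lmodType R) (E : set V) (N : V -> \bar R)
    (F : set W) (M : W -> \bar R) (l : V -> R) (y : W) :
  seminormed E N -> seminormed F M -> bounded_functional E N l -> F y ->
  bounded_operator E N F M (fun f => l f *: y).
Proof.
move=> sn sm [lE [C lC]] Fy; split.
- by move=> f _; exact: (subspaceZ _ (sn_sub sm)).
- by move=> a f g Ef Eg; rewrite lE// scalerDl scalerA subrr; exact: sn0 sm.
exists (C * fine (M y)) => f Ef; rewrite (snZ sm)// (sn_fineE sm Fy) EFinM.
rewrite [(C%:E * _)%E]muleC -muleA muleC; apply: lee_wpmul2l; last exact: lC.
by rewrite lee_fin fine_ge0 ?(sn_ge0 sm).
Qed.

(** * The ergodic case *)

Section probability_space.
Context {R : realType} {d} {T : measurableType d}.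
Variable P : probability T R.

Lemma Lp_cst1 (p : R) : 1 <= p -> Lp P p (cst 1).
Proof.
move=> p1; have -> : cst 1 = \1_[set: T] :> (T -> R) by rewrite indicT.
by apply: Lp_indic => //; apply: (le_lt_trans (probability_le1 P measurableT)); exact: ltry.
Qed.

Lemma Lp_integrable (p q : R) f : 1 < p -> p^-1 + q^-1 = 1 -> Lp P p f ->
  P.-integrable setT (EFin \o f).
Proof.
move=> p1 pq Lf.
have := hoelder_integrable p1 pq Lf (Lp_cst1 (ltW (conjugate_gt1 p1 pq))).
by apply: eq_integrable => // w _ /=; rewrite mulr1.
Qed.

Lemma Rintegral_probability_cst (c : R) : \int[P]_w c = c.
Proof. by rewrite Rintegral_cst//= probability_setT mulr1. Qed.

End probability_space.

Section ergodicity.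
Context {R : realType} {d : nat} {dO : measure_display} {Omega : measurableType dO}.
Variables (P : probability Omega R) (tau : euclid R d -> Omega -> Omega) (p q : R).
Hypothesis ds : dynamical_system P tau.
Hypothesis p1 : 1 < p.
Hypothesis pq : p^-1 + q^-1 = 1.
Let q1 : 1 < q. Proof. exact: conjugate_gt1 pq. Qed.
Let p1' : 1 <= p. Proof. exact: ltW. Qed.
Let q1' : 1 <= q. Proof. exact: ltW. Qed.
Local Notation E := (euclid R d).
Let snP := seminormed_Lp P p1'.

Lemma ae_const (Z : Prop) : {ae @lebesgue_rV R d, forall x : E, Z} -> Z.
Proof.
move=> [N [mN N0 ZN]]; apply: contrapT => nZ.
have N1 : N = setT by apply/seteqP; split => // x _; exact: ZN.
have : lebesgue_rV (ball (0 : E) 1) = 0%E.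
  apply: le_anti; rewrite measure_ge0 andbT -N0 N1; apply: le_measure => //; rewrite inE //.
  exact: measurable_ball_euclid.
rewrite lebesgue_ball// => -[]/eqP.
by rewrite expf_eq0 pnatr_eq0 andbF.
Qed.

(* B is the set of the w such that tau_x w is in A for almost every x *)
Lemma ae_invariant_strict A : ae_invariant_set P tau A ->
  exists2 B, invariant_set tau B & (\1_A : Omega -> R) = \1_B %[ae P].
Proof.
move=> [mA hA].
pose lebT : {sigma_finite_measure set E -> \bar R} := @lebesgue_rV R d.
have mtau := flow_jointly_measurable ds.
have mN : measurable [set z : Omega * E | A (tau z.2 z.1)].
  by rewrite -[X in measurable X]setTI; exact: mtau.
set N := [set z | _] in mN; have mNC := measurableC mN.
pose B := [set w | {ae lebT, forall x, A (tau x w)}].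
have BE : B = (fun w => lebT (xsection (~` N) w)) @^-1` [set 0%E].
  apply/seteqP; split => w /=.
    move=> Bw; have := (negligibleP lebT (measurable_xsection w mNC)).1; apply.
    by move: Bw; congr (lebT.-negligible _); apply/seteqP; split => x /=; rewrite xsectionE.
  move=> h; exists (xsection (~` N) w); split => // [|x nA].
    exact: measurable_xsection.
  by rewrite xsectionE.
have mB : measurable B.
  have mx : measurable_fun setT (fun w => lebT (xsection (~` N) w)).
    exact: measurable_fun_xsection.
  by rewrite BE -[X in measurable X]setTI; apply: mx.
have Btau y w : B w -> B (tau y w).
  have ht := ae_preserving (measurable_affine y (oner_neq0 R)) (fun C _ => @lebesgue_rV_translation R d y C).
  move=> /(ht _); apply: filterS => x; rewrite /affine scale1r.
  by rewrite (tauD ds).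
exists B.
  split => // x; apply/seteqP; split => [_ [w Bw <-]|w Bw]; first exact: Btau.
  by exists (tau (- x) w); [exact: Btau|rewrite (tauD ds) subrr (tau0 ds)].
have mI : measurable [set z : Omega * E | (\1_A (tau z.2 z.1) : R) = \1_A z.1].
  apply: measurable_eq_set; first exact: (measurableT_comp (measurable_indic mA) mtau).
  exact: (measurableT_comp (measurable_indic mA) measurable_fst).
(* Fubini exchanges the quantifiers: the identity holds for each x and almost every w, hence for
   almost every w it holds at almost every x. *)
have aeI : {ae (P \x lebT)%E, forall z : Omega * E, (\1_A (tau z.2 z.1) : R) = \1_A z.1}.
  apply: prod2_ae => //; apply: aeW => x; move: (hA x).
  by apply: filterS => w; exact.
have := ae_prod1 aeI; apply: filterS => w hw _; rewrite !indicE; congr (nat_of_bool _)%:R.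
apply/idP/idP => /set_mem.
  move=> Aw; apply/mem_set; rewrite /B /=; move: hw; apply: filterS => x /=.
  rewrite !indicE (mem_set Aw) => h; apply/set_mem; move: h.
  by case: (_ \in A) => // /eqP; rewrite eq_sym oner_eq0.
move=> Bw; apply/mem_set; apply: ae_const; move: hw; apply: filterS2 Bw => x /= Ax.
rewrite !indicE (mem_set Ax) => h; apply/set_mem; move: h.
by case: (_ \in A) => // /eqP; rewrite oner_eq0.
Qed.

Let expectation_functional : bounded_functional (Lp P p) (Lp_norm P p) (fun f => \int[P]_w f w).
Proof.
have := pairing_functional p1 pq (Lp_cst1 P q1'); congr bounded_functional.
by apply/funext => f; apply: eq_Rintegral => w _; rewrite mulr1.
Qed.

Let ae_cst_closed : closed_subspace (Lp P p) (Lp_norm P p)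
  [set f | Lp P p f /\ f = cst (\int[P]_w f w) %[ae P]].
Proof.
have cst1p := Lp_cst1 P p1'.
have b1 := rank_one_operator snP snP expectation_functional cst1p.
have := closed_subspace_preimage snP snP (bounded_operatorD snP snP (bounded_operator_id snP)
  (bounded_operatorZ snP snP (-1) b1)) (null_closed_subspace snP).
congr closed_subspace; have sP := sn_sub snP.
have AE f : id f + -1 *: (\int[P]_w f w *: cst 1) = f - cst (\int[P]_w f w).
  rewrite scaleN1r; congr (_ - _); apply/funext => w; by rewrite -[LHS]/(_ * 1) mulr1.
have Lc c : Lp P p (cst c).
  by have := subspaceZ c sP cst1p; congr Lp; apply/funext => w; rewrite -[LHS]/(c * 1) mulr1.
apply/seteqP; split => f /=; rewrite AE => -[Lf h]; split => //.
  case: h => _; exact: (Lp_normB_ae P p1' (Lp_measurable Lf) (Lp_measurable (Lc _))).1.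
split; first exact: subspaceB.
exact: (Lp_normB_ae P p1' (Lp_measurable Lf) (Lp_measurable (Lc _))).2.
Qed.

Hypothesis erg : ergodic P tau.

(** Being almost everywhere equal to one's mean is a closed condition, so level sets suffice. They
    agree almost everywhere with strictly invariant sets, which have measure 0 or 1. *)
Lemma ergodic_Linv f : Linv P tau p f -> f = cst (\int[P]_w f w) %[ae P].
Proof.
move=> If; have Lf := Linv_Lp If.
suff : [set f | Lp P p f /\ f = cst (\int[P]_w f w) %[ae P]] f by case.
have key B : ae_invariant_set P tau B ->
    [set f | Lp P p f /\ f = cst (\int[P]_w f w) %[ae P]] (\1_B).
  move=> iB; split; first exact: (Linv_Lp (ae_invariant_Linv p1 iB)).
  have [C iC BC] := ae_invariant_strict iB.
  have [mB _] := iB; have [mC _] := iC.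
  have [c Cc] : exists c : R, \1_C = cst c %[ae P].
    have [C0|C1] := erg iC.
      exists 0; exists C; split => // w /=; rewrite indicE => h.
      by apply: contrapT => nC; apply: h => _; rewrite memNset.
    exists 1; exists (~` C); split; first exact: measurableC.
      by rewrite probability_setC// C1 subee.
    by move=> w /= h Cw; apply: h => _; rewrite indicE mem_set.
  have Bc : \1_B = cst c %[ae P].
    by move: Cc; apply: filterS2 BC => w BC Cc wT; rewrite BC// Cc.
  have -> : \int[P]_w (\1_B w : R) = c.
    rewrite -[RHS](Rintegral_probability_cst P); apply: ae_eq_Rintegral => //.
  exact: Bc.
apply: (closed_subspace_level_sets p1' ae_cst_closed Lf) => a a0.
have [_ sL _] := closed_Linv ds p1; have InF := subspaceN sL If.
by split; apply: key; [exact: ae_invariant_level a If|exact: ae_invariant_level a InF].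
Qed.

End ergodicity.

(** * Means over Omega *)

Section mean.
Context {R : realType} {d : nat} {dO : measure_display} {Omega : measurableType dO}.
Variables (P : probability Omega R) (tau : euclid R d -> Omega -> Omega) (p q : R).
Hypothesis ds : dynamical_system P tau.
Hypothesis p1 : 1 < p.
Hypothesis pq : p^-1 + q^-1 = 1.
Let q1 : 1 < q. Proof. exact: conjugate_gt1 pq. Qed.
Let p1' : 1 <= p. Proof. exact: ltW. Qed.
Let q1' : 1 <= q. Proof. exact: ltW. Qed.
Local Notation E := (euclid R d).
Variables (Q : set E) (oQ : open Q).
Local Notation leb := (lebesgue_on oQ).
Local Notation mu := (P \x leb)%E.
Local Notation field := (Omega * E -> R).
Let snP := seminormed_Lp P p1'.
Let snL := seminormed_Lp leb p1'.
Let snsw := seminormed_Lp (leb \x P)%E p1'.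
Let snmu := seminormed_Lp mu p1'.
Let snVL := seminormed_LpV leb p1' d.+1.
Let snV := seminormed_LpV mu p1' d.+1.

Lemma mean_operator : bounded_operator (Lp mu p) (Lp_norm mu p) (Lp leb p) (Lp_norm leb p)
  (mean P).
Proof.
have := bounded_operator_comp snmu snsw snL (swap_operator P leb p1)
  (slice_operator leb p1 pq (Lp_cst1 P q1')).
congr bounded_operator; apply/funext => F; apply/funext => x.
by apply: eq_Rintegral => w _; rewrite mulr1.
Qed.

Lemma mean_LpV_operator : bounded_operator (@LpV _ _ _ mu p d.+1) (@LpV_norm _ _ _ mu p d.+1)
  (@LpV _ _ _ leb p d.+1) (@LpV_norm _ _ _ leb p d.+1) (fun W i => mean P (W i)).
Proof.
apply: (LpV_operator snV) => i.
exact: (bounded_operator_comp snV snmu snL (LpV_proj_operator mu p1' i) mean_operator).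
Qed.

Lemma mean_shift a F : measurable_fun setT F -> mean P (shift tau a F) = mean P F.
Proof.
move=> mF; apply/funext => x.
exact: (Rintegral_preserving (flow_measurable ds (a *: x))
  (fun A mA => tau_preserving ds (a *: x) mA) (measurable_section2 x mF)).
Qed.

Lemma mean_gradient_graph W : norm_closure (@LpV _ _ _ mu p d.+1) (@LpV_norm _ _ _ mu p d.+1)
    (tensor_graph oQ p (Lp P p)) W ->
  gradient_graph oQ p (fun i => mean P (W i)).
Proof.
have Jc := closed_gradient_graph oQ p1 pq; have [LJ sJ _] := Jc.
have Kc := closed_subspace_preimage snV snVL mean_LpV_operator Jc.
set K := [set f | _] in Kc; suff TK : tensor_graph oQ p (Lp P p) `<=` K.
  by move=> /(norm_closure_min TK Kc)[].
move=> _ [n [f [F [Lf JF ->]]]]; have [_ sK _] := Kc.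
rewrite (_ : (fun i z => _) = \sum_(k < n) (fun i => tensor (f k) (F k i))); last first.
  by apply/funext => i; apply/funext => z; rewrite !fct_sumE.
apply: (subspace_sum _ sK) => k _; split.
  by move=> i; apply: Lp_tensor => //; exact: LJ.
have := subspaceZ (\int[P]_w f k w) sJ (JF k); congr gradient_graph.
apply/funext => i; apply/funext => x.
rewrite -[LHS]/((\int[P]_w f k w) * F k i x) -RintegralZr//.
exact: (Lp_integrable p1 pq (Lf k)).
Qed.

Lemma weak_cvg_W1p (V_ : nat -> 'I_d.+1 -> E -> R) V : (forall n, gradient_graph oQ p (V_ n)) ->
  weak_cvg (@LpV _ _ _ leb p d.+1) (@LpV_norm _ _ _ leb p d.+1) V_ V ->
  weak_cvg (W1p oQ p) (W1p_norm oQ p) (fun n => V_ n ord0) (V ord0).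
Proof.
move=> JV_ wV; have [LJ sJ _] := closed_gradient_graph oQ p1 pq.
have JV := closed_subspace_weak snVL (closed_gradient_graph oQ p1 pq) JV_ wV.
have JW F : gradient_graph oQ p F -> W1p oQ p (F ord0) by exists (vtail F).
split => [n||l lE [C lC]]; [exact/JW|exact: JW|].
have JN F : gradient_graph oQ p F -> W1p_norm oQ p (F ord0) = LpV_norm leb p F.
  by move=> JF; rewrite (W1p_normE p1 pq JF) vconsK.
pose K := `|C|.
have [L [LE Ll Lb]] : exists L, [/\ linear_on (LpV leb p (n:=d.+1)) L,
    forall F, gradient_graph oQ p F -> L F = l (F ord0) &
    forall F, LpV leb p F -> `|L F| <= K * fine (LpV_norm leb p F)].
  apply: (@hahn_banach _ _ _ _ (fun F => K * fine (LpV_norm leb p F)) (fun F => l (F ord0))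
    (sn_sub snVL) sJ LJ).
  - have [h1 h2] := sn_seminorm_on snVL; split.
      by move=> f g Lf Lg; rewrite -mulrDr; apply: ler_wpM2l; [exact: normr_ge0|exact: h1].
    by move=> a f Lf; rewrite h2// mulrCA.
  - by move=> a F G JF JG; exact: lE (JW _ JF) (JW _ JG).
  - move=> F JF; have := lC _ (JW _ JF); rewrite JN// (sn_fineE snVL (LJ _ JF)) lee_fin.
    move=> /le_trans; apply; apply: ler_wpM2r; last exact: ler_norm.
    by rewrite fine_ge0 ?(sn_ge0 snVL).
have [LV_ LV wcv] := wV; have := wcv L LE; rewrite -(Ll _ JV).
rewrite (_ : L \o V_ = l \o (fun n => V_ n ord0)); last first.
  by apply/funext => n; exact: Ll.
apply; exists K => F LF; rewrite (sn_fineE snVL LF) lee_fin; exact: Lb.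
Qed.

Lemma mean_weak_cvg (a_ : nat -> R) (T_ : nat -> 'I_d.+1 -> field) (W : 'I_d.+1 -> field) :
  (forall n, norm_closure (@LpV _ _ _ mu p d.+1) (@LpV_norm _ _ _ mu p d.+1)
    (tensor_graph oQ p (Lp P p)) (T_ n)) ->
  weak_cvg (@LpV _ _ _ mu p d.+1) (@LpV_norm _ _ _ mu p d.+1)
    (fun n i => shift tau (a_ n) (T_ n i)) W ->
  weak_cvg (W1p oQ p) (W1p_norm oQ p) (fun n => mean P (T_ n ord0)) (mean P (W ord0)).
Proof.
move=> TT wW; apply: (weak_cvg_W1p (V_ := fun n i => mean P (T_ n i)) (V := fun i => mean P (W i))).
  by move=> n; exact: mean_gradient_graph.
have := weak_cvg_operator snV snVL mean_LpV_operator wW; congr weak_cvg.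
apply/funext => n; apply/funext => i /=; apply: mean_shift.
by have [LT _] := TT n; exact: Lp_measurable (LT i).
Qed.

Section ergodic_mean.
Hypothesis erg : ergodic P tau.

(** By closedness it suffices to treat a tensor with an invariant first factor, which is almost
    everywhere constant. *)
Lemma Linv_tensor_mean u : tensor_W1p oQ p P (Linv P tau p) u ->
  u = (fun z => mean P u z.2) %[ae mu].
Proof.
have cst1p := Lp_cst1 P p1'.
have mb := bounded_operator_comp snmu snL snmu mean_operator (tensor_operator2 leb p1 cst1p).
have Nc := closed_subspace_preimage snmu snmu (bounded_operatorBid snmu mb) (null_closed_subspace snmu).
set N := [set f | _] in Nc.
have Kc := closed_subspace_preimage snV snmu (LpV_proj_operator mu p1' ord0) Nc.
set K := [set f | _] in Kc; have [_ sK _] := Kc.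
have [LJ _ _] := closed_gradient_graph oQ p1 pq.
have ME F : tensor (cst 1) (mean P F) = fun z : Omega * E => mean P F z.2.
  by apply/funext => z; rewrite /tensor mul1r.
have LM F : Lp mu p F -> Lp mu p (fun z => mean P F z.2).
  by move=> LF; rewrite -ME; have [+ _ _] := mb; exact.
have NE F : Lp mu p F -> N F <-> (fun z => mean P F z.2) = F %[ae mu].
  move=> LF; rewrite -(Lp_normB_ae mu p1' (Lp_measurable (LM _ LF)) (Lp_measurable LF)).
  rewrite /N /= ME; split => [[_ []]//|h]; split => //; split => //.
  exact: (subspaceB (sn_sub snmu) (LM _ LF) LF).
move=> /(tensor_W1p_graph p1 pq (@Linv_Lp _ _ _ _ P tau p)) cl.
suff TK : tensor_graph oQ p (Linv P tau p) `<=` K.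
  have [Lu /=] := norm_closure_min TK Kc cl; rewrite vcons0 => Nu.
  have L0 := Lu ord0; rewrite vcons0 in L0.
  by have := (NE _ L0).1 Nu; apply: filterS => z /[apply] ->.
move=> _ [n [f [F [If JF ->]]]].
rewrite (_ : (fun i z => _) = \sum_(k < n) (fun i => tensor (f k) (F k i))); last first.
  by apply/funext => i; apply/funext => z; rewrite !fct_sumE.
apply: (subspace_sum _ sK) => k _; have Lf := Linv_Lp (If k); have LF := LJ _ (JF k).
have LT i : Lp mu p (tensor (f k) (F k i)) by exact: Lp_tensor.
split => //; apply/(NE _ (LT ord0)).
have fc := ergodic_Linv ds p1 pq erg (If k).
apply: prod2_ae.
  have := measurable_eq_set (Lp_measurable (LM _ (LT ord0))) (Lp_measurable (LT ord0)).
  by congr measurable; apply/seteqP; split => z //= /(_ I).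
apply: aeW => x; move: fc; apply: filterS => w fw _.
rewrite /mean /tensor/= RintegralZr//; last exact: (Lp_integrable p1 pq Lf).
by rewrite fw.
Qed.

(** The mean satisfies the specification of [Pinv], so the chosen function satisfies it too. For
    almost every x its section has a version measurable for the invariant sets; this version is
    constant by ergodicity, and testing with the whole space identifies the constant. *)
Lemma Pinv_mean u : Lp mu p u -> u = (fun z => mean P u z.2) %[ae mu] ->
  Pinv P tau p oQ u = (fun z => mean P u z.2) %[ae mu].
Proof.
move=> Lu um; pose m := fun z : Omega * E => mean P u z.2.
have cst1p := Lp_cst1 P p1'.
have Lcst c : Lp P p (cst c).
  have := subspaceZ c (sn_sub snP) cst1p.
  by congr Lp; apply/funext => w; rewrite -[LHS]/(c * 1) mulr1.
have invT : invariant_set tau setT.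
  split => // x; apply/seteqP; split => // w _.
  by exists (tau (- x) w) => //; rewrite (tauD ds) subrr (tau0 ds).
have Lm : Lp mu p m.
  have -> : m = tensor (cst 1) (mean P u) by apply/funext => z; rewrite /tensor mul1r.
  by apply: Lp_tensor => //; have [+ _ _] := mean_operator; exact.
have Pm : is_Pinv P tau p oQ u m.
  split => //; have := ae_prod2 um; apply: filterS => x hx; split.
  - exact: (Lcst (mean P u x)).
  - exists (cst (mean P u x)) => [B mB|]; last exact: aeW.
    rewrite preimage_cst; case: ifP => _ //.
    by split => // y; exact: image_set0.
  - move=> A [mA _]; rewrite /Rintegral; congr fine; apply: ae_eq_integral => //.
    + apply: measurable_funTS; apply/measurable_EFinP.
      exact: measurable_section2 (Lp_measurable Lm).
    + apply: measurable_funTS; apply/measurable_EFinP.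
      exact: measurable_section2 (Lp_measurable Lu).
    + by move: hx; apply: filterS => w h _ /=; rewrite h.
have PP : is_Pinv P tau p oQ u (Pinv P tau p oQ u).
  have exV : exists v, [set v | is_Pinv P tau p oQ u v] v by exists m.
  exact: (xgetPex _ exV).
case: PP => LP' ceP; apply: prod2_ae.
  have := measurable_eq_set (Lp_measurable LP') (Lp_measurable Lm).
  by congr measurable; apply/seteqP; split => z //= /(_ I).
move: ceP; apply: filterS => x [Lg [g' ig' gg'] hg].
have mg' : measurable_fun setT g' by move=> _ B mB; rewrite setTI; have [] := ig' B mB.
have Lg' : Lp P p g' by exact: (Lp_ae p1' Lg mg' gg').
have Ig' : Linv P tau p g'.
  split => // y; apply: aeW => w _ /=.
  (* The fibre of g' through w is an invariant set and so contains [tau y w]: g' is invariant at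
     every point. *)
  have [mB hB] := ig' [set g' w] (measurable_set1 _).
  have : (tau y @` (g' @^-1` [set g' w])) (tau y w) by exists w.
  by rewrite hB.
have cg' := ergodic_Linv ds p1 pq erg Ig'.
have e1 : \int[P]_w g' w = mean P u x.
  rewrite -[RHS](hg _ invT); apply: ae_eq_Rintegral => //; first exact: Lp_measurable Lg.
  by move: gg'; apply: filterS => w /[apply] ->.
by move: cg'; apply: filterS2 gg' => w h1 h2 _; rewrite h1// h2// e1.
Qed.

End ergodic_mean.
End mean.

Theorem proposition2p13 (R : realType) (d : nat)
    (dO : measure_display) (Omega : measurableType dO) (P : probability Omega R)
    (tau : euclid R d -> Omega -> Omega)
    (Omega_countably_generated : countably_generated Omega)
    (tau_dynamical_system : dynamical_system P tau)
    (p : R) (p_gt1 : 1 < p)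
    (Q : set (euclid R d)) (oQ : open Q)
    (eps_ : nat -> R) (eps_gt0 : forall n, 0 < eps_ n)
    (eps_cvg0 : eps_ n @[n --> \oo] --> 0)
    (u_ : nat -> Omega * euclid R d -> R)
    (u_in : forall n, tensor_W1p oQ p P (Lp P p) (u_ n))
    (u_bounded : exists C : R,
      forall n, (LpW1p_norm oQ p P (u_ n) <= C%:E)%E) :
  exists (u : Omega * euclid R d -> R) (chi : 'I_d -> Omega * euclid R d -> R)
      (k : nat -> nat),
    [/\ {homo k : m n / (m < n)%N},
        tensor_W1p oQ p P (Linv P tau p) u,
        tensor_LpV oQ p P (Lpot P tau p) chi,
        two_scale_cvg P tau p oQ (eps_ \o k) (u_ \o k) u
        /\
        two_scale_cvgV P tau p oQ (eps_ \o k) (fun n => nabla oQ p P (u_ (k n)))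
          (nabla oQ p P u + chi) &
        ergodic P tau ->
        [/\ u = Pinv P tau p oQ u %[ae (P \x lebesgue_on oQ)%E],
            Pinv P tau p oQ u = (fun z => mean P u z.2)
              %[ae (P \x lebesgue_on oQ)%E],
            W1p oQ p (mean P u) &
            weak_cvg (W1p oQ p) (W1p_norm oQ p)
              (fun n => mean P (u_ (k n))) (mean P u)]].

Proof.
have [q pq] : exists q : R, p^-1 + q^-1 = 1.
  by exists (1 - p^-1)^-1; rewrite invrK addrC subrK.
have p1' := ltW p_gt1.
have [W [k [kinc SW tW cW]]] := two_scale_compactness tau_dynamical_system p_gt1 pq
  Omega_countably_generated eps_gt0 eps_cvg0 u_in u_bounded.
have TT n := tensor_W1p_graph p_gt1 pq (@subset_refl _ (Lp P p)) (u_in (k n)).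
have LT n i : Lp (P \x lebesgue_on oQ)%E p
    (vcons (u_ (k n)) (nabla oQ p P (u_ (k n))) i) by have [+ _] := TT n; exact.
have cvg_component i := two_scale_cvg_shift tau_dynamical_system p_gt1 (eps_ := eps_ \o k)
  (fun n => eps_gt0 (k n)) (fun n => LT n i) (weak_cvgV_proj p1' i SW).
exists (W ord0), (vtail W - nabla oQ p P (W ord0)), k; split => //.
  split.
    have := cvg_component ord0.
    by under eq_fun do rewrite vcons0.
  rewrite addrC subrK; apply: (weak_cvgV p1') => i.
  have := cvg_component (lift ord0 i).
  by under eq_fun do rewrite vconsS.
move=> erg; have Lu : Lp (P \x lebesgue_on oQ)%E p (W ord0) by have [_ + _] := SW; exact.
have um := Linv_tensor_mean tau_dynamical_system p_gt1 pq erg tW.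
have Pm := Pinv_mean tau_dynamical_system p_gt1 pq erg Lu um.
have mW := mean_weak_cvg tau_dynamical_system p_gt1 pq TT SW.
split => //; last 2 first.
- by case: mW.
- by move: mW; under eq_fun do rewrite vcons0.
by move: Pm; apply: filterS2 um => z uz Pz zT; rewrite uz// Pz.
Qed.
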